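(* Let $b,\sigma,r$ satisfy the conditions (i)--(v) listed in the context. Let $G:\,]0,\infty[\,\to\mathbb R$ be absolutely continuous (on compact subintervals of $]0,\infty[$) and such that, for every $x>0$, $$\mathbb E\left[\int_0^\infty e^{-\Lambda^{r(X^0)}_t}|G(X^0_t)|\,dt\right]<\infty\quad\text{and}\quad\int_0^x\frac{|G(s)|\psi(s)}{\sigma^2(s)p_{X^0}'(s)}\,ds+\int_x^\infty\frac{|G(s)|\phi(s)}{\sigma^2(s)p_{X^0}'(s)}\,ds<\infty$$ (these two conditions are equivalent). Suppose also that there exists a constant $\varepsilon>0$ such that $$\text{either }\mathcal D_rG(s)\le0\text{ for all }s\le\varepsilon,\ \text{ or }\mathcal D_rG(s)\ge0\text{ for all }s\le\varepsilon,$$ and $$\text{either }\mathcal D_rG(s)\le0\text{ for all }s\ge1/\varepsilon,\ \text{ or }\mathcal D_rG(s)\ge0\text{ for all }s\ge1/\varepsilon .$$ Then, for every $x>0$, $$\int_0^x\frac{|\mathcal D_rG(s)|\,\psi'(s)}{r(s)p_{X^0}'(s)}\,ds+\int_x^\infty\frac{|\mathcal D_rG(s)|\,[-\phi'(s)]}{r(s)p_{X^0}'(s)}\,ds<\infty ,$$ the function $R_{Y^0,\mathcal D_rG}$ is well-defined and real-valued, and $$R_{X^0,G}'(x)=R_{Y^0,\mathcal D_rG}(x),\quad\text{for all }x>0 .$$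
   Context: Let $W$ be a standard one-dimensional Brownian motion on a filtered probability space satisfying the usual conditions, and let $b,\sigma:\,]0,\infty[\,\to\mathbb R$, $r:\,]0,\infty[\,\to\mathbb R_+$. Notation. $$\mu(x)=b(x)+\sigma(x)\sigma'(x)-\tfrac12\sigma^2(x)\frac{r'(x)}{r(x)},\qquad \rho(x)=\frac{r^2(x)-r(x)b'(x)+r'(x)b(x)}{r(x)} .$$ Conditions. (i) $b,\sigma$ are $C^1$, $\sigma'$ is locally Lipschitz, and $\sigma^2(x)>0$ for all $x>0$. (ii) The solution $X^0$ of $dX^0_t=b(X^0_t)\,dt+\sigma(X^0_t)\,dW_t$, $X^0_0=x>0$, is non-explosive (it stays in $]0,\infty[$ for all $t\ge0$, a.s.). (iii) $r$ is $C^1$, $r'$ is locally Lipschitz, and there is a constant $r_0>0$ with $r(x)\ge r_0$ for all $x>0$. (iv) The solution $Y^0$ of $dY^0_t=\mu(Y^0_t)\,dt+\sigma(Y^0_t)\,dW_t$, $Y^0_0=x>0$, is non-explosive (it stays in $]0,\infty[$ for all $t\ge0$, a.s.). (v) $\rho(x)\ge r_0$ for all $x>0$. Further notation. $\Lambda^{r(X^0)}_t=\int_0^tr(X^0_u)\,du$, $\Lambda^{\rho(Y^0)}_t=\int_0^t\rho(Y^0_u)\,du$. Fix $c>0$; $p_{X^0}'(x)=\exp\left(-2\int_c^x\frac{b(s)}{\sigma^2(s)}\,ds\right)$. The functions $\phi,\psi$ are the (unique) $C^2$ functions spanning the solution space of $\frac12\sigma^2(x)w''(x)+b(x)w'(x)-r(x)w(x)=0$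 on $]0,\infty[$ such that $\phi>0$, $\phi'<0$, $\psi>0$, $\psi'>0$, $\lim_{x\downarrow0}\phi(x)=\lim_{x\to\infty}\psi(x)=\infty$ and $\phi(c)=\psi(c)=1$. For $G$ absolutely continuous, $$\mathcal D_rG(x)=\frac{r(x)G'(x)-r'(x)G(x)}{r(x)}=r(x)\frac{d}{dx}\left(\frac{G(x)}{r(x)}\right).$$ Finally, with $X^0_0=x$ and $Y^0_0=x$ respectively, $$R_{X^0,G}(x)=\mathbb E\left[\int_0^\infty e^{-\Lambda^{r(X^0)}_t}G(X^0_t)\,dt\right],\qquad R_{Y^0,\mathcal D_rG}(x)=\mathbb E\left[\int_0^\infty e^{-\Lambda^{\rho(Y^0)}_t}\mathcal D_rG(Y^0_t)\,dt\right].$$ *)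

(* Defs.v *)
From HB Require Import structures.
From mathcomp Require Import all_boot all_order all_algebra.
From mathcomp Require Import all_classical all_reals all_analysis.

Set Implicit Arguments.
Unset Strict Implicit.
Unset Printing Implicit Defensive.

Import Order.TTheory GRing.Theory Num.Theory.
Import numFieldNormedType.Exports.

Local Open Scope classical_set_scope.
Local Open Scope ring_scope.

(* Functions on ]0, +oo[ are represented by functions R -> R whose values
   outside ]0, +oo[ are irrelevant. *)
Section functions_on_half_line.
Context {R : realType}.
Implicit Types f g : R -> R.

Definition C1_pos f :=
  forall x : R, 0 < x -> derivable f x 1 /\ {for x, continuous (derive1 f)}.

Definition C2_pos f := C1_pos f /\ C1_pos (derive1 f).

Definition locally_lipschitz_pos f :=
  forall x : R, 0 < x -> exists A : set R, nbhs x A /\ [lipschitz f y | y in A].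

Definition abs_continuous_on (a b : R) f :=
  forall e : R, 0 < e -> exists2 d : R, 0 < d &
    forall (n : nat) (u v : 'I_n -> R),
      (forall i, a <= u i /\ u i <= v i /\ v i <= b) ->
      trivIset setT (fun i => `]u i, v i[%classic) ->
      \sum_(i < n) (v i - u i) < d ->
      \sum_(i < n) `|f (v i) - f (u i)| < e.

Definition abs_continuous_pos f :=
  forall a b : R, 0 < a -> a <= b -> abs_continuous_on a b f.

(* The integral from a to b with its orientation: the sign changes when
   b < a. *)
Definition oriented_integral f (a b : R) : R :=
  if a <= b then \int[lebesgue_measure]_(s in `[a, b]) f s
  else - \int[lebesgue_measure]_(s in `[b, a]) f s.

Definition scale_density (b sigma : R -> R) (c x : R) : R :=
  expR (- 2 * oriented_integral (fun s => b s / sigma s ^+ 2) c x).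

Definition drift_mu (b sigma r : R -> R) (x : R) : R :=
  b x + sigma x * derive1 sigma x - 2^-1 * sigma x ^+ 2 * (derive1 r x / r x).

Definition rate_rho (b r : R -> R) (x : R) : R :=
  (r x ^+ 2 - r x * derive1 b x + derive1 r x * b x) / r x.

(* derive1 G is total. Where G is not derivable, a Lebesgue-null set when G is
   absolutely continuous, its value is conventional. *)
Definition D_op (r G : R -> R) (x : R) : R :=
  (r x * derive1 G x - derive1 r x * G x) / r x.

Definition ode_solution (b sigma r w : R -> R) :=
  C2_pos w /\
  forall x : R, 0 < x ->
    2^-1 * sigma x ^+ 2 * derive1 (derive1 w) x + b x * derive1 w x - r x * w x = 0.

Definition fundamental_pair (b sigma r : R -> R) (c : R) (phi psi : R -> R) :=
  [/\ ode_solution b sigma r phi, ode_solution b sigma r psi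
    & forall w, ode_solution b sigma r w ->
        exists A B : R, forall x : R, 0 < x -> w x = A * phi x + B * psi x] /\
  [/\ forall x : R, 0 < x -> 0 < phi x /\ derive1 phi x < 0,
      forall x : R, 0 < x -> 0 < psi x /\ 0 < derive1 psi x,
      phi x @[x --> 0^'+] --> +oo,
      psi x @[x --> +oo] --> +oo
    & phi c = 1 /\ psi c = 1].

End functions_on_half_line.

Section stochastic_integration.
Context {R : realType} {d : measure_display} {Omega : measurableType d}.
Variable P : probability Omega R.
(* Time is the half-line [0, +oo[; the values of filtrations and processes at
   negative times are irrelevant. *)
Implicit Types (F : R -> set (set Omega)) (W X H I : R -> Omega -> R).

Definition usual_filtration F :=
  [/\ forall t, 0 <= t -> sigma_algebra setT (F t) /\ F t `<=` measurable,
      forall s t, 0 <= s -> s <= t -> F s `<=` F t,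
      forall t, 0 <= t -> \bigcap_(s in [set s | t < s]) F s `<=` F t
    & forall A : set Omega, P.-negligible A -> F 0 A].

Definition measurable_wrt (S : set (set Omega)) (xi : Omega -> R) :=
  forall B : set R, measurable B -> S (xi @^-1` B).

Definition adapted F X := forall t, 0 <= t -> measurable_wrt (F t) (X t).

Definition brownian_motion F W :=
  [/\ adapted F W,
      {ae P, forall w, W 0 w = 0 /\
        {within `[0, +oo[, continuous (fun t => W t w)}},
      forall s t (A : set Omega) (B : set R), 0 <= s -> s < t ->
        F s A -> measurable B ->
        (P (A `&` (W t \- W s)%R @^-1` B) =
         P A * P ((W t \- W s)%R @^-1` B))%E
    & forall s t (B : set R), 0 <= s -> s < t -> measurable B ->
        P ((W t \- W s)%R @^-1` B) = normal_prob 0 (Num.sqrt (t - s)) B].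

Record simple_process F := SimpleProcess {
  sp_size : nat ;
  sp_time : nat -> R ;
  sp_coef : nat -> Omega -> R ;
  sp_time_ge0 : 0 <= sp_time 0 ;
  sp_time_nd : forall i, sp_time i <= sp_time i.+1 ;
  sp_coef_meas : forall i, measurable_wrt (F (sp_time i)) (sp_coef i) ;
  sp_coef_bounded : forall i, exists M : R, forall w, `|sp_coef i w| <= M }.

Definition sp_value F (S : simple_process F) (s : R) (w : Omega) : R :=
  \sum_(i < sp_size S)
    sp_coef S i w * \1_(`]sp_time S i, sp_time S i.+1]%classic) s.

Definition sp_integral F (S : simple_process F) W (t : R) (w : Omega) : R :=
  \sum_(i < sp_size S)
    sp_coef S i w *
    (W (Num.min (sp_time S i.+1) t) w - W (Num.min (sp_time S i) t) w).

Definition to0_in_probability (U : nat -> Omega -> \bar R) :=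
  forall e : R, 0 < e ->
    P [set w | (e%:E <= U n w)%E] @[n --> \oo] --> (0 : \bar R).

(* I is (a continuous version of) the Ito integral of H with respect to W: the
   limit in probability of the integrals of simple processes S n such that the
   integral of (S n - H)^2 over [0, t] tends to 0 in probability for all t. *)
Definition ito_integral F W H I :=
  {ae P, forall w, {within `[0, +oo[, continuous (fun t => I t w)}} /\
  exists S : nat -> simple_process F, forall t : R, 0 <= t ->
    to0_in_probability (fun n w =>
      \int[lebesgue_measure]_(s in `[0%R, t])
        ((sp_value (S n) s w - H s w) ^+ 2)%:E)%E /\
    to0_in_probability (fun n w => (`|sp_integral (S n) W t w - I t w|)%:E).

(* X solves dX = b(X) dt + sigma(X) dW, X_0 = x, on the whole of [0, +oo[
   without leaving ]0, +oo[. *)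
Definition nonexplosive_sde_solution F W (b sigma : R -> R) (x : R) X :=
  [/\ adapted F X,
      {ae P, forall w, [/\ X 0 w = x,
        {within `[0, +oo[, continuous (fun t => X t w)}
        & forall t, 0 <= t -> 0 < X t w]}
    & exists2 I, ito_integral F W (fun t w => sigma (X t w)) I
        & {ae P, forall w, forall t, 0 <= t ->
            X t w = x + \int[lebesgue_measure]_(u in `[0, t]) b (X u w)
                    + I t w}].

Definition Lambda (k : R -> R) X (t : R) (w : Omega) : R :=
  \int[lebesgue_measure]_(u in `[0, t]) k (X u w).

Definition discounted_integral (k f : R -> R) X (w : Omega) : \bar R :=
  (\int[lebesgue_measure]_(t in `[0%R, +oo[)
     (expR (- Lambda k X t w) * f (X t w))%:E)%E.

Definition resolvent (k f : R -> R) X : \bar R :=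
  (\int[P]_w discounted_integral k f X w)%E.

Definition resolvent_well_defined (k f : R -> R) X :=
  [/\ (resolvent k (fun y => `|f y|%R) X < +oo)%E,
      {ae P, forall w, lebesgue_measure.-integrable `[0, +oo[
        (fun t => (expR (- Lambda k X t w) * f (X t w))%:E)}
    & P.-integrable setT (discounted_integral k f X)].

End stochastic_integration.

(* Main.v *)
(** Let [p] be the scale density, [C = (phi psi' - phi' psi) / p] the (constant)
    Wronskian, [A x] the integral of [G psi / (sigma^2 p)] over ]0, x] and [B x]
    that of [G phi / (sigma^2 p)] over ]x, +oo[. The Green representation of
    the resolvent of X^0 is [R = (2 / C) (phi A + psi B)], so that
    [R' = (2 / C) (phi' A + psi' B)].

    The functions [psi'] and [- phi'] are nonnegative, respectively
    nondecreasing and nonincreasing, solutions of the equation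
    [1/2 sigma^2 w'' + mu w' - rho w = 0] attached to Y^0: this follows by
    differentiating the equation of [phi] and [psi] once. Hence the resolvent
    of Y^0 has a Green representation too, with kernels [psi' / (r p)] and
    [- phi' / (r p)]. Integrating by parts against these kernels, whose
    product with [G] has derivative [(D_r G) psi' / (r p) + 2 G psi / (sigma^2 p)],
    turns R_{Y, D_r G} into [R'], provided the boundary terms
    [G psi' / (r p)] at 0 and [G phi' / (r p)] at +oo vanish. They do because
    the sign condition makes [G / r] monotone near the ends, and monotone
    convergence then also yields integrability of [D_r G] against the kernels.

    The Green representation itself is Dynkin's formula for bounded C^2
    functions, proved from the definition of the Ito integral by simple
    processes: for simple integrands the formula in expectation is exact, and
    it passes to the limit after stopping [X] on a finite time grid and
    cutting the approximating integrand off when the integral of its square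
    exceeds a constant, which makes all functionals uniformly bounded. *)
Require Import Defs.
From HB Require Import structures.
From mathcomp Require Import all_boot all_order all_algebra.
From mathcomp Require Import all_classical all_reals all_analysis.
From mathcomp Require Import measurable_realfun.
From mathcomp Require Import ring lra.

Set Implicit Arguments.
Unset Strict Implicit.
Unset Printing Implicit Defensive.

Import Order.TTheory GRing.Theory Num.Theory.
Import numFieldNormedType.Exports.

Local Open Scope classical_set_scope.
Local Open Scope ring_scope.


(** * Absolutely continuous functions *)

(** Two obstacles shape the passage to the limit. Convergence in probability says nothing about
    expectations, which is why every functional must be bounded by a constant independent of the
    approximating integrand. A true exit time need not fit any finite partition, whence the grid;
    its price, that the path may stray between grid points, is an event whose probability vanishes
    with the mesh. Dynkin's formula is applied only to Green potentials of continuous functions with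
    compact support, which are bounded by construction. They determine the discounted occupation
    measure of the process, hence the resolvent of every measurable function, so that the possibly
    discontinuous [D_op r G] needs no separate treatment. For the pair [- phi'], [psi'] the equation
    alone does not give monotonicity, that is [phi'' >= 0] and [psi'' >= 0]. It rests on (v) and on
    the positivity of [phi], and for [psi] also on [phi] being infinite at 0. *)

Section absolute_continuity.
Context {R : realType}.
Implicit Types (a b : R) (f : R -> R).
Local Notation mu := (@lebesgue_measure R).

(** Intervals indexed by dependent pairs occur below, where each interval of a family is itself
    partitioned; hence an arbitrary [finType] of indices. *)
Lemma abs_continuous_on_finType a b f : abs_continuous_on a b f ->
  forall e : R, 0 < e -> exists2 d : R, 0 < d &
    forall (I : finType) (u v : I -> R),
      (forall i, a <= u i /\ u i <= v i /\ v i <= b) ->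
      trivIset setT (fun i => `]u i, v i[%classic) ->
      \sum_i (v i - u i) < d ->
      \sum_i `|f (v i) - f (u i)| < e.
Proof.
move=> acf e e0; have [d d0 h] := acf _ e0; exists d => // I u v uv tuv.
have reI (F : I -> R) : \sum_i F i = \sum_(k < #|I|) F (enum_val k).
  by rewrite (reindex (@enum_val I predT))//; exact: onW_bij (@enum_val_bij _).
rewrite (reI (fun i => v i - u i)) (reI (fun i => `|f (v i) - f (u i)|)) => sd.
apply: (h _ (fun k => u (enum_val k)) (fun k => v (enum_val k))) sd.
  by move=> i; exact: uv.
by move=> i j _ _ ij; apply: enum_val_inj; exact: tuv.
Qed.

(** Total variations are suprema over partitions. Partitions of all the intervals chosen together
    have pieces that form one disjoint family of the same total length, to which absolute continuity
    applies at once. *)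
Lemma abs_continuous_total_variation a b f : abs_continuous_on a b f ->
  forall e : R, 0 < e -> exists2 d : R, 0 < d &
    forall (n : nat) (u v : 'I_n -> R),
      (forall i, a <= u i /\ u i <= v i /\ v i <= b) ->
      trivIset setT (fun i => `]u i, v i[%classic) ->
      \sum_(i < n) (v i - u i) < d ->
      (\sum_(i < n) total_variation (u i) (v i) f <= e%:E)%E.
Proof.
move=> acf e e0; have [d d0 h] := abs_continuous_on_finType acf e0.
exists d => // n u v uv tuv sd.
have key (s : 'I_n -> seq R) : (forall i, itv_partition (u i) (v i) (s i)) ->
    \sum_(i < n) variation (u i) (v i) f (s i) < e.
  move=> ps.
  pose T : finType := {i : 'I_n & 'I_(size (s i))}.
  pose p i k := nth (v i) (u i :: s i) k.
  have pu i k : (k < (size (s i)).+1)%N -> u i <= p i k.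
    by move=> ks; exact: itv_partition_nth_ge.
  have pv i k : (k < (size (s i)).+1)%N -> p i k <= v i.
    by move=> ks; exact: itv_partition_nth_le.
  have pS i (k : 'I_(size (s i))) : p i k < p i k.+1.
    by have /pathP := (ps i).1; apply.
  have pnd i k l : (k <= l)%N -> (l <= size (s i))%N -> p i k <= p i l.
    move=> kl ls; elim: l kl ls => [|l ih]; first by rewrite leqn0 => /eqP ->.
    rewrite leq_eqVlt => /orP[/eqP ->//|kl] ls.
    by rewrite (le_trans (ih kl (ltnW ls)))// ltW// (pS i (Ordinal ls)).
  have -> : \sum_(i < n) variation (u i) (v i) f (s i) =
      \sum_(i : T) `|f (p (tag i) (tagged i).+1) - f (p (tag i) (tagged i))|.
    rewrite -(@sig_big_dep _ _ _ _ (fun i => 'I_(size (s i))) xpredT (fun=> xpredT)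
        (fun i k => `|f (p i k.+1) - f (p i k)|))/=.
    by apply: eq_bigr => i _; rewrite /variation big_mkord.
  apply: h.
  - move=> [i k]/=; split; first by rewrite (le_trans _ (pu i k (ltnW (ltn_ord k))))//= (uv i).1.
    by split; [exact/ltW/pS|rewrite (le_trans (pv i k.+1 (ltn_ord k)))// (uv i).2.2].
  - move=> [i k] [j l] _ _ /= [z [/=]]; rewrite !in_itv/= => /andP[kz zk] /andP[lz zl].
    have ij : i = j.
      apply: tuv => //; exists z; split; rewrite /= in_itv/=.
        by rewrite (le_lt_trans (pu i k (ltnW (ltn_ord k))) kz) (lt_le_trans zk (pv i k.+1 (ltn_ord k))).
      by rewrite (le_lt_trans (pu j l (ltnW (ltn_ord l))) lz) (lt_le_trans zl (pv j l.+1 (ltn_ord l))).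
    subst j; congr existT; apply/val_inj => /=.
    have [kl|lk|//] := ltngtP k l.
    + have := lt_trans lz zk; rewrite ltNge pnd//; exact: ltnW.
    + have := lt_trans kz zl; rewrite ltNge pnd//; exact: ltnW.
  - rewrite (le_lt_trans _ sd)//.
    rewrite -(@sig_big_dep _ _ _ _ (fun i => 'I_(size (s i))) xpredT (fun=> xpredT)
        (fun i k => p i k.+1 - p i k))/=.
    apply: ler_sum => i _.
    rewrite -(big_mkord xpredT (fun k => p i k.+1 - p i k)) telescope_sumr//.
    by apply: lerB; [exact: pv|exact: pu].
have bvf i : bounded_variation (u i) (v i) f.
  exists e => _ [l pl <-]; apply/ltW.
  (* A partition of a single interval is completed by the coarsest partition of each of the others;
     [key] then bounds its variation by [e]. *)
  pose s j := if j == i then l else if u j == v j then [::] else [:: v j].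
  have ps j : itv_partition (u j) (v j) (s j).
    rewrite /s; case: eqP => [->//|_]; case: eqP => [->|/eqP uvj].
      by split => //=.
    by apply: itv_partition1; rewrite lt_neqAle uvj (uv j).2.1.
  apply: le_lt_trans (key s ps); rewrite (bigD1 i)//= {1}/s eqxx lerDl.
  by apply: sumr_ge0 => j _; rewrite /variation sumr_ge0.
have fin i : total_variation (u i) (v i) f \is a fin_num.
  by apply/bounded_variationP => //; exact: (uv i).2.1.
apply/lee_addgt0Pr => t t0.
have tn : 0 < t / n.+1%:R by rewrite divr_gt0.
have /choice[s pts] i : exists s, itv_partition (u i) (v i) s /\
    (total_variation (u i) (v i) f <= (variation (u i) (v i) f s)%:E + (t / n.+1%:R)%:E)%E.
  have [] := ub_ereal_sup_adherent tn (fin i).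
  move=> _ [_ [s ps <-] <-]; rewrite lteBlDr// => ?.
  by exists s; split => //; exact: ltW.
have ps i := (pts i).1; have ts i := (pts i).2.
apply: (@le_trans _ _ (\sum_(i < n) ((variation (u i) (v i) f (s i))%:E + (t / n.+1%:R)%:E)%E)).
  exact: lee_sum.
rewrite big_split/= leeD//.
  by rewrite sumEFin lee_fin ltW// key.
rewrite sumEFin lee_fin sumr_const card_ord -[leLHS]mulr_natr mulrAC ler_pdivrMr//.
by rewrite ler_pM2l// ler_nat.
Qed.

Lemma abs_continuous_on_continuous a b f : abs_continuous_on a b f ->
  forall e : R, 0 < e -> exists2 d : R, 0 < d &
    forall x y, a <= x -> x <= y -> y <= b -> y - x < d -> `|f y - f x| < e.
Proof.
move=> acf e e0; have [d d0 h] := acf _ e0; exists d => // x y ax xy yb yxd.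
have := h 1%N (fun=> x) (fun=> y); rewrite !big_ord1; apply => //.
by move=> i j _ _ _; rewrite !ord1.
Qed.

(** An interval shorter than [d] has variation at most 1, and finitely many steps of length [d / 2]
    cover [a, b]. *)
Lemma abs_continuous_bounded_variation a b f : a <= b ->
  abs_continuous_on a b f -> bounded_variation a b f.
Proof.
move=> ab acf; have [d d0 h] := abs_continuous_total_variation acf ltr01.
have step x y : a <= x -> x <= y -> y <= b -> y - x < d ->
    bounded_variation x y f.
  move=> ax xy yb yxd; apply/bounded_variationP => //.
  rewrite ge0_fin_numE ?total_variation_ge0// (le_lt_trans _ (ltry 1))//.
  have := h 1%N (fun=> x) (fun=> y); rewrite !big_ord1; apply => //.
  by move=> i j _ _ _; rewrite !ord1.
have key n x : a <= x -> x <= b -> x - a < d / 2 * n%:R -> bounded_variation a x f.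
  elim: n x => [x ax _|n ih x ax xb xn].
    by rewrite mulr0 subr_lt0 ltNge ax.
  have [xs|xs] := ltP (x - a) (d / 2); first by apply: step => //; lra.
  have ha : a <= x - d / 2 by lra.
  have hx : x - d / 2 <= x by lra.
  apply/bounded_variationP => //.
  rewrite (total_variationD f ha hx) fin_numD; apply/andP; split.
    apply/bounded_variationP => //; apply: ih => //; first lra.
    by move: xn; rewrite -[n.+1%:R]natr1 mulrDr mulr1; lra.
  by apply/bounded_variationP => //; apply: step => //; lra.
apply: (key (Num.bound ((b - a) / (d / 2)))) => //.
rewrite -ltr_pdivrMl ?divr_gt0// mulrC.
by rewrite archi_boundP// divr_ge0 ?subr_ge0// ltW// divr_gt0.
Qed.



Lemma lebesgue_stieltjes_measure_itvoc (F : cumulative R R) x y : x <= y ->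
  lebesgue_stieltjes_measure F `]x, y]%classic = (F y - F x)%:E.
Proof.
move=> xy; rewrite /lebesgue_stieltjes_measure /measure_extension/=.
by rewrite measurable_mu_extE/= ?wlength_itv_bnd//; exact: is_ocitv.
Qed.

(** Radon-Nikodym for the Stieltjes measure of [F] restricted to ]a, b]. A Lebesgue null set is
    enclosed in an open set of small measure, whose components meet ]a, b] in intervals where
    absolute continuity controls the increments of [F]. *)
Lemma nondecreasing_abs_continuous_integral a b (F : R -> R) : a < b ->
  {homo F : x y / x <= y} -> continuous F -> abs_continuous_on a b F ->
  exists2 g : R -> R, mu.-integrable [set: R] (EFin \o g) &
    forall x, a <= x -> x <= b -> F x - F a = \int[mu]_(t in `]a, x]) g t.
Proof.
move=> ab ndF cF acF.
pose cuF : cumulative R R :=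
  HB.pack F (isCumulative.Build R _ R F ndF (right_continuousW cF)).
pose nu0 : {measure set (measurableTypeR R) -> \bar R} :=
  lebesgue_stieltjes_measure cuF.
have mab : measurable (`]a, b]%classic : set (measurableTypeR R)) by exact: measurable_itv.
have nu0E x y : x <= y -> nu0 `]x, y]%classic = (F y - F x)%:E.
  by move=> xy; exact: (lebesgue_stieltjes_measure_itvoc cuF xy).
have nuoo : (nu0 `]a, b]%classic < +oo)%E by rewrite nu0E ?ltry// ltW.
pose nu : {finite_measure set (measurableTypeR R) -> \bar R} := mfrestr mab nuoo.
(* The Stieltjes measure of [F] is absolutely continuous, and its density is
   the derivative of [F]. *)
have numu : nu `<< mu.
  apply/null_content_dominatesP => A mA A0.
  apply/eqP; rewrite eq_le measure_ge0 andbT.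
  apply/lee_addgt0Pr => e e0; rewrite add0e.
  have [d d0 h] := acF _ e0.
  have [|U [oU AU Ud]] := lebesgue_regularity_outer mA _ d0; first by rewrite A0 ltry.
  have mU : measurable U by exact: open_measurable.
  have muU : (mu U < d%:E)%E.
    rewrite (le_lt_trans _ Ud)//.
    have {1}-> : U = (U `\` A) `|` A by rewrite setDKU.
    by rewrite (le_trans (measureU2 _ _ _))//= ?A0 ?adde0//; exact: measurableD.
  rewrite (@le_trans _ _ (nu U))//; first by rewrite le_measure// ?inE.
  pose I := open_disjoint_itv oU.
  have mI k : measurable (I k) by apply: open_measurable; exact: open_disjoint_itv_open.
  have tI : trivIset setT I by exact: open_disjoint_itv_trivIset.
  have UI : U = \bigcup_k I k by exact: open_disjoint_itv_bigcup.
  (* A component [I k] may stick out of ]a, b] or miss it. The infimum and the supremum of its trace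
     serve as end points; the infimum is not attained because [I k] is open. *)
  have /choice[uv uvP] k : exists uv : R * R, [/\ a <= uv.1, uv.1 <= uv.2, uv.2 <= b,
      I k `&` `]a, b] `<=` `]uv.1, uv.2] & `]uv.1, uv.2[ `<=` I k].
    pose J := I k `&` `]a, b].
    have [J0|/set0P J0] := eqVneq J set0.
      exists (a, a) => /=; split => //; first exact: ltW.
        by rewrite -/J J0.
      by rewrite set_itv_ge// bnd_simp ltxx.
    have Ja x : J x -> a < x /\ x <= b by move=> [_]; rewrite /= in_itv/= => /andP[].
    have hl : has_lbound J by exists a => x /Ja[/ltW].
    have hu : has_ubound J by exists b => x /Ja[].
    have [z Jz] := J0.
    exists (inf J, sup J) => /=; split.
    - by apply: lb_le_inf => // x /Ja[/ltW].
    - by rewrite (@le_trans _ _ z)//; [apply: ge_inf|apply: ub_le_sup].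
    - by apply: ge_sup => // x /Ja[].
    - move=> x Jx; rewrite /= in_itv/=; apply/andP; split; last exact: ub_le_sup.
      rewrite lt_neqAle ge_inf// andbT; apply/negP => /eqP infx.
      have [Ikx xab] := Jx.
      have [ax xb] := Ja _ Jx.
      have [e1 e10 be] : exists2 e1 : R, 0 < e1 & ball x e1 `<=` I k.
        apply/nbhs_ballP; apply: open_nbhs_nbhs; split => //.
        exact: open_disjoint_itv_open.
      pose y := Num.max ((a + x) / 2) (x - e1 / 2).
      have yx : y < x by rewrite gt_max; lra.
      have ay : a < y by rewrite lt_max; apply/orP; left; lra.
      have xy : x - e1 / 2 <= y by rewrite le_max lexx orbT.
      have Jy : J y.
        split; last by rewrite /= in_itv/= ay/= (le_trans (ltW yx)).
        by apply: be; rewrite /ball/= ltr_distlC; lra.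
      by have := ge_inf hl Jy; rewrite infx leNgt yx.
    - move=> x; rewrite /= in_itv/= => /andP[ix xs].
      have [y Jy yx] := inf_lt J0 ix.
      have [w Jw xw] := sup_gt J0 xs.
      have iI : is_interval (I k) by exact: open_disjoint_itv_is_interval.
      by apply: (iI y w Jy.1 Jw.1); rewrite (ltW yx) (ltW xw).
  have nuI k : (nu (I k) <= (F (uv k).2 - F (uv k).1)%:E)%E.
    have [au u_v vb Iuv _] := uvP k.
    rewrite -nu0E//; apply: le_measure => //; rewrite inE.
      by apply: measurableI; [exact: mI|exact: mab].
    exact: measurable_itv.
  have := @measure_semi_sigma_additive _ _ R nu I mI tI.
  rewrite -UI => /(_ mU) /(cvg_lim (@ereal_hausdorff R)) <-.
  apply: lime_le; first by apply: is_cvg_nneseries => n _ _; exact: measure_ge0.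
  apply: nearW => n; rewrite big_mkord.
  apply: (@le_trans _ _ (\sum_(k < n) (F (uv k).2 - F (uv k).1)%:E)%E).
    by apply: lee_sum => k _; exact: nuI.
  rewrite sumEFin lee_fin.
  have Fge (k : 'I_n) : F (uv k).2 - F (uv k).1 <= `|F (uv k).2 - F (uv k).1| by exact: ler_norm.
  apply: (le_trans (ler_sum _ (fun k _ => Fge k))); apply/ltW.
  apply: (h n (fun k : 'I_n => (uv k).1) (fun k : 'I_n => (uv k).2)).
  - by move=> k; have [? ? ? _ _] := uvP k.
  - move=> i j _ _ [z [zi zj]]; apply/val_inj; apply: tI => //.
    by exists z; have [_ _ _ _ Ii] := uvP i; have [_ _ _ _ Ij] := uvP j; split; [exact: Ii|exact: Ij].
  - rewrite -lte_fin (le_lt_trans _ muU)// -sumEFin.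
    apply: (@le_trans _ _ (\sum_(0 <= k < n) mu (I k))%E).
      rewrite big_mkord; apply: lee_sum => k _.
      have [_ u_v _ _ Ik] := uvP k.
      apply: (@le_trans _ _ (mu `](uv k).1, (uv k).2[%classic)); last first.
        by apply: le_measure => //; rewrite inE; [exact: measurable_itv|exact: mI].
      rewrite lebesgue_measure_itv/= lte_fin.
      by case: ltP => [//|vu]; rewrite lee_fin; lra.
    have := @measure_semi_sigma_additive _ _ R mu I mI tI.
    rewrite -UI => /(_ mU) /(cvg_lim (@ereal_hausdorff R)) <-.
    by apply: nneseries_lim_ge => k _ _; exact: measure_ge0.
have [g [g0 gfin ig gE]] := @radon_nikodym_sigma_finite _ _ _ (@lebesgue_measure R) nu numu.
exists (fine \o g).
  by rewrite (_ : _ \o _ = g)//; apply/funext => x /=; rewrite fineK.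
move=> x ax xb; rewrite /Rintegral (_ : (fun t => _) = g); last first.
  by apply/funext => t /=; rewrite fineK.
rewrite -gE//= /mfrestr /mrestr/= setIidl ?nu0E//.
by apply: subset_itvl; rewrite bnd_simp.
Unshelve. all: by end_near. Qed.


(** Jordan decomposition: with [V] the variation from [a], both [V] and [V - f] are nondecreasing,
    and their increments are at most twice those of [V], which make them absolutely continuous. The
    clamp [cl] extends everything to the line by constants. *)
Lemma total_variation_abs_continuous_integral a b f : a < b ->
  abs_continuous_on a b f ->
  exists2 g : R -> R, mu.-integrable [set: R] (EFin \o g) &
    forall x, a <= x -> x <= b -> f x - f a = \int[mu]_(t in `]a, x]) g t.
Proof.
move=> ab acf.
pose cl x := Num.min b (Num.max a x).
have acl x : a <= cl x by rewrite le_min (ltW ab) le_max lexx.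
have clb x : cl x <= b by rewrite ge_min lexx.
have ndcl x y : x <= y -> cl x <= cl y.
  move=> xy; rewrite /cl le_min ge_min lexx/= ge_min ge_max !le_max lexx/= xy.
  by rewrite !orbT.
have clid x : a <= x -> x <= b -> cl x = x.
  by move=> ax xb; rewrite /cl (max_idPr ax) (min_idPr xb).
have cl1 x y : x <= y -> cl y - cl x <= y - x.
  by move=> xy; rewrite /cl /Num.min /Num.max; do !case: ifPn; rewrite -?leNgt; lra.
have bvf := abs_continuous_bounded_variation (ltW ab) acf.
have fin x : a <= x -> x <= b -> total_variation a x f \is a fin_num.
  by move=> ax xb; apply/bounded_variationP => //; apply: bounded_variationl bvf.
pose V x := fine (total_variation a (cl x) f).
pose f' x := f (cl x).
have VD x y : x <= y -> ((V y - V x)%:E = total_variation (cl x) (cl y) f)%E.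
  move=> xy; rewrite EFinB /V !fineK ?fin//.
  rewrite (total_variationD f (acl x) (ndcl _ _ xy)) addeAC subee ?add0e//.
  exact: fin.
have ndV : {homo V : x y / x <= y}.
  move=> x y xy; rewrite -subr_ge0 -lee_fin VD// total_variation_ge0//.
  exact: ndcl.
have fV x y : x <= y -> `|f' y - f' x| <= V y - V x.
  by move=> xy; rewrite -lee_fin VD//; apply: total_variation_ge; exact: ndcl.
have ndVf : {homo (fun x => V x - f' x) : x y / x <= y}.
  by move=> x y xy; have := fV _ _ xy; have := ler_norm (f' y - f' x); lra.
have cont (h : R -> R) : (forall e : R, 0 < e -> exists2 d : R, 0 < d &
    forall x y, x <= y -> y - x < d -> `|h y - h x| <= e) -> continuous h.
  move=> H x; apply/cvgrPdist_le => e e0; have [d d0 Hd] := H e e0.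
  near=> y; have [xy|yx] := leP x y.
    by rewrite distrC Hd// -(ger0_norm (_ : 0 <= y - x)) ?subr_ge0// distrC; near: y; exact: cvgr_dist_lt.
  by rewrite Hd// ?ltW// -(gtr0_norm (_ : 0 < x - y)) ?subr_gt0//; near: y; exact: cvgr_dist_lt.
have acV := abs_continuous_total_variation acf.
have VE e : 0 < e -> exists2 d : R, 0 < d &
    forall x y, x <= y -> y - x < d -> V y - V x <= e.
  move=> e0; have [d d0 H] := acV _ e0; exists d => // x y xy xyd.
  rewrite -lee_fin VD//.
  have := H 1%N (fun=> cl x) (fun=> cl y); rewrite !big_ord1; apply.
  - by move=> _; split=> //; split => //; exact: ndcl.
  - by move=> i j _ _ _; rewrite !ord1.
  - by rewrite (le_lt_trans (cl1 _ _ xy)).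
have cV : continuous V.
  apply: cont => e /VE[d d0 H]; exists d => // x y xy xyd.
  by rewrite ger0_norm ?H// subr_ge0 ndV.
have cVf : continuous (fun x => V x - f' x).
  apply: cont => e e0; have [d d0 H] : exists2 d : R, 0 < d &
    forall x y, x <= y -> y - x < d -> V y - V x <= e / 2 by apply: VE; lra.
  exists d => // x y xy xyd; rewrite ger0_norm ?subr_ge0 ?ndVf//.
  have := H _ _ xy xyd; have := fV _ _ xy; have := ler_norm (f' x - f' y).
  by rewrite distrC; lra.
have ac1 (h : R -> R) (k : R) : 0 < k -> (forall x y, x <= y -> `|h y - h x| <= k * (V y - V x)) ->
    abs_continuous_on a b h.
  move=> k0 H e e0; have [|d d0 Hd] := acV (e / (2 * k)); first by rewrite divr_gt0// mulr_gt0.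
  exists d => // n u v uv tuv suv.
  apply: (@le_lt_trans _ _ (\sum_(i < n) k * (V (v i) - V (u i)))).
    by apply: ler_sum => i _; apply: H; exact: (uv i).2.1.
  rewrite -mulr_sumr; apply: (@le_lt_trans _ _ (k * (e / (2 * k)))).
    rewrite ler_pM2l// -lee_fin -sumEFin (le_trans _ (Hd n u v uv tuv suv))//.
    apply: lee_sum => i _; have [ui [uvi vi]] := uv i.
    by rewrite VD// !clid//; [exact: le_trans ui _|exact: le_trans vi].
  have -> : k * (e / (2 * k)) = e / 2 by field; rewrite gt_eqF.
  lra.
have [g1 ig1 g1E] := nondecreasing_abs_continuous_integral ab ndV cV
  (ac1 V 1 ltr01 (fun x y xy => ltac:(by rewrite mul1r ger0_norm ?subr_ge0 ?ndV))).
have ac2 : abs_continuous_on a b (fun x => V x - f' x).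
  apply: (ac1 _ 2) => // x y xy.
  have := fV _ _ xy; rewrite [X in _ -> X <= _]ger0_norm ?subr_ge0 ?ndVf//.
  by have := ler_norm (f' x - f' y); rewrite distrC; lra.
have [g2 ig2 g2E] := nondecreasing_abs_continuous_integral ab ndVf cVf ac2.
exists (fun t => g1 t - g2 t).
  by apply: (@eq_integrable _ _ _ mu _ measurableT ((EFin \o g1) \- (EFin \o g2))%E) => //; exact: integrableB.
move=> x ax xb.
have mx : measurable `]a, x] by exact: measurable_itv.
rewrite RintegralB//; [|exact: integrableS ig1|exact: integrableS ig2].
by rewrite -g1E// -g2E// /f' !clid// ?(ltW ab)//; lra.
Unshelve. all: by end_near. Qed.

End absolute_continuity.

(** * Almost everywhere derivatives and the fundamental theorem of calculus *)

Section absolute_continuity_derivative.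
Context {R : realType}.
Implicit Types (a b : R) (f : R -> R).
Local Notation mu := (@lebesgue_measure R).

Lemma countable_bigcapT_measurable d (T : measurableType d) (I : countType)
  (F : I -> set T) : (forall i, measurable (F i)) -> measurable (\bigcap_i F i).
Proof.
move=> mF; rewrite -[X in measurable X]setCK setC_bigcap; apply: measurableC.
by apply: countable_bigcupT_measurable => // i; exact: measurableC.
Qed.

(** Derivability at [x] is a Cauchy condition on difference quotients, for which rational increments
    suffice because [f] is continuous; so the set [D] of points of derivability is Borel. On it the
    derivative is the limit along the increments [1 / (n + 1)]. *)
Lemma continuous_measurable_derive1 f : continuous f ->
  measurable_fun [set: R] (fun x => (derive1 f x : R)).
Proof.
move=> cf; pose q (h x : R) := h^-1 * (f (h + x) - f x).
have mq h : measurable_fun [set: R] (q h).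
  apply: measurable_funM => //; apply: continuous_measurable_fun => x.
  apply: continuousB; last exact: cf.
  apply: (@continuous_comp _ _ _ (fun x => h + x) f); last exact: cf.
  by apply: continuousD => //; exact: cst_continuous.
have cq x h : h != 0 -> {for h, continuous (q ^~ x)}.
  move=> h0; apply: continuousM; first exact: continuousV.
  apply: continuousB; last exact: cst_continuous.
  apply: (@continuous_comp _ _ _ (fun h => h + x) f); last exact: cf.
  by apply: continuousD => //; exact: cst_continuous.
pose small n (r : R) := 0 < `|r| < n.+1%:R^-1.
pose C k n (r s : rat) : set R := if small n (ratr r) && small n (ratr s) then
  [set x | `|q (ratr r) x - q (ratr s) x| <= k.+1%:R^-1] else setT.
pose D := \bigcap_k \bigcup_n \bigcap_r \bigcap_s C k n r s.
have mC k n r s : measurable (C k n r s).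
  rewrite /C; case: ifP => // _.
  have mqq : measurable_fun [set: R] (fun x => `|q (ratr r) x - q (ratr s) x|).
    by apply: measurableT_comp => //; exact: measurable_funB.
  rewrite (_ : [set x | _] = (fun x => `|q (ratr r) x - q (ratr s) x|) @^-1` `]-oo, k.+1%:R^-1]).
    by rewrite -[X in measurable X]setTI; exact: mqq.
  by apply/seteqP; split => x /=; rewrite in_itv/=.
have mD : measurable D.
  apply: bigcapT_measurable => k; apply: bigcupT_measurable => n.
  apply: countable_bigcapT_measurable => r; apply: countable_bigcapT_measurable => s.
  exact: mC.
have qE x : (fun h : R => h^-1 *: ((f \o shift x) (h *: (1 : R)) - f x)) = q ^~ x.
  by apply/funext => h; rewrite /q /= /GRing.scale/= mulr1.
have dE x : derivable f x 1 <-> cvg (q h x @[h --> 0^']) by rewrite /derivable qE.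
have deE x : derive1 f x = lim (q h x @[h --> 0^']) by rewrite derive1E /derive qE.
have DP x : D x <-> cvg (q h x @[h --> 0^']).
  split=> [Dx|/cvg_ex[/= l /cvgrPdist_le ql]].
    apply/cauchy_cvgP; apply: cauchy_exP => e e0.
    have [k _ ke] : \forall k \near \oo, k.+1%:R^-1 < e / 4.
      by apply: near_infty_natSinv_lt (PosNum _); lra.
    have {}ke := ke k (leqnn k).
    have [n _ Cx] := Dx k I.
    have approx h : small n h -> exists2 r : rat, small n (ratr r) &
        `|q h x - q (ratr r) x| <= k.+1%:R^-1.
      move=> hn; have h0 : h != 0 by rewrite -normr_gt0; case/andP: hn.
      have [h0' hn'] := andP hn.
      pose dl := Num.min `|h| (n.+1%:R^-1 - `|h|).
      have dl0 : 0 < dl by rewrite lt_min h0' subr_gt0.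
      have [e1 /= e10 He1] : \forall z \near h, `|q h x - q z x| <= k.+1%:R^-1 /\ small n z.
        near=> z; split.
          by near: z; move: (cq x h h0) => /cvgrPdist_le; apply.
        have : ball h dl z by near: z; exact: (nbhsx_ballx h dl dl0).
        rewrite /ball/= lt_min => /andP[h1 h2]; apply/andP; split.
          by have := le_lt_trans (lerB_dist h z) h1; rewrite ltrBlDr ltrDl.
        have := le_lt_trans (lerB_dist z h); rewrite distrC => /(_ _ h2).
        by rewrite ltrBlDr subrK.
      have /rat_in_itvoo[r] : h - e1 < h + e1 by lra.
      rewrite in_itv/= => hr; exists r; have [] // := He1 (ratr r).
        by rewrite /= ltr_distlC.
      by rewrite /= ltr_distlC.
    pose h0 : R := n.+2%:R^-1.
    have sh0 : small n h0.
      have h00 : 0 < h0 by rewrite invr_gt0.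
      by rewrite /small gtr0_norm// h00/= ltf_pV2 ?posrE// ltr_nat.
    exists (q h0 x); change (\forall h \near 0^', ball (q h0 x) e (q h x)); near=> h.
    have sh : small n h.
      apply/andP; split; first by rewrite normr_gt0; near: h; exact: nbhs_dnbhs_neq.
      by near: h; apply: dnbhs0_lt.
    have [r sr qr] := approx _ sh0; have [s ss qs] := approx _ sh.
    have := Cx r I s I; rewrite /C sr ss/= => qrs.
    rewrite /ball/= (_ : q h0 x - q h x = (q h0 x - q (ratr r) x) + (q (ratr r) x - q (ratr s) x) + (q (ratr s) x - q h x)); last by ring.
    rewrite (le_lt_trans (ler_normD _ _))//.
    apply: (@le_lt_trans _ _ (k.+1%:R^-1 + k.+1%:R^-1 + k.+1%:R^-1)); last first.
      by move: ke; set K := k.+1%:R^-1 => ?; lra.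
    apply: lerD; last by rewrite distrC.
    by rewrite (le_trans (ler_normD _ _))// lerD.
  move=> k _; have k0 : (0 : R) < k.+1%:R^-1 / 2 by rewrite divr_gt0.
  have [e /= e0 He] := ql _ k0.
  have [n _ ne] : \forall n \near \oo, n.+1%:R^-1 < e.
    by apply: near_infty_natSinv_lt (PosNum _).
  exists n => // r _ s _; rewrite /C; case: ifP => //= /andP[/andP[r0 rn] /andP[s0 sn]].
  have lt z : 0 < `|z : R| -> `|z| < n.+1%:R^-1 -> `|l - q z x| <= k.+1%:R^-1 / 2.
    move=> z0 zn; apply: He; last by rewrite -normr_gt0.
    by rewrite /ball/= sub0r normrN (lt_trans zn)// ne/=.
  have := lt _ r0 rn; have := lt _ s0 sn.
  rewrite (_ : q (ratr r) x - q (ratr s) x = (l - q (ratr s) x) - (l - q (ratr r) x)); last by ring.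
  move=> hs hr; rewrite (le_trans (ler_normB _ _))//.
  by rewrite [leRHS]splitr lerD.
apply: (@measurable_fun_cvg _ _ _ _ (fun n x => q n.+1%:R^-1 x * \1_D x)) => //.
  by move=> n; apply: measurable_funM => //; exact: measurable_indic.
move=> x _; rewrite deE indicE; have [xD|xD] := boolP (x \in D).
  under eq_cvg do rewrite mulr1.
  have /(cvgr_dnbhsP _ _ _).1 : q h x @[h --> 0^'] --> lim (q h x @[h --> 0^']).
    by apply/DP; exact: set_mem.
  apply; split; first by move=> n; rewrite gt_eqF// invr_gt0.
  exact: cvg_harmonic.
under eq_cvg do rewrite mulr0.
(* Off [D] the difference quotients have no limit, and [lim] takes its default value, 0. *)
rewrite dvgP; first exact: cvg_cst.
by move=> /DP Dx; move: xD; rewrite notin_setE.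
Unshelve. all: by end_near. Qed.

Lemma near_eq_addr_derive1 (h f : R -> R) k x :
  {near x, (fun y => h y + k) =1 f} -> derivable h x 1 ->
  derivable f x 1 /\ derive1 f x = derive1 h x.
Proof.
move=> hf dh.
have qE : (fun t : R => t^-1 *: ((h \o shift x) (t *: (1 : R)) - h x)) =
    (fun t => t^-1 *: (((fun y => h y + k) \o shift x) (t *: (1 : R)) - (h x + k))).
  by apply/funext => t /=; rewrite opprD addrACA subrr addr0.
have dhk : derivable (fun y => h y + k) x 1 by rewrite /derivable -qE.
split; first exact: near_eq_derivable dhk.
by rewrite !derive1E -(near_eq_derive _ hf) /derive -qE.
Qed.

Lemma abs_continuous_clamp_continuous a b f : a <= b -> abs_continuous_on a b f ->
  continuous (fun x => f (Num.min b (Num.max a x))).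
Proof.
move=> ab acf; pose cl x := Num.min b (Num.max a x).
have acl x : a <= cl x by rewrite le_min ab le_max lexx.
have clb x : cl x <= b by rewrite ge_min lexx.
have cl1 x y : x <= y -> cl x <= cl y /\ cl y - cl x <= y - x.
  by move=> xy; rewrite /cl /Num.min /Num.max; do !case: ifPn; rewrite -?leNgt; lra.
move=> x; apply/cvgrPdist_lt => e e0.
have [d d0 Hd] := abs_continuous_on_continuous acf e0; near=> y.
have xyd : `|x - y| < d by near: y; exact: cvgr_dist_lt.
have [xy|yx] := leP x y.
  rewrite distrC; have [cxy dxy] := cl1 _ _ xy.
  apply: (Hd (cl x) (cl y)) => //; apply: (le_lt_trans dxy).
  by move: xyd; rewrite distrC ger0_norm ?subr_ge0.
have [cxy dxy] := cl1 _ _ (ltW yx).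
apply: (Hd (cl y) (cl x)) => //; apply: (le_lt_trans dxy).
by move: xyd; rewrite gtr0_norm ?subr_gt0.
Unshelve. all: by end_near. Qed.

Lemma abs_continuous_measurable_derive1 a b f : a < b -> abs_continuous_on a b f ->
  measurable_fun `[a, b]%classic (fun t : R => (derive1 f t : R)).
Proof.
move=> ab acf; pose cl x := Num.min b (Num.max a x).
have ccl : continuous (f \o cl) by exact: abs_continuous_clamp_continuous (ltW ab) acf.
(* The clamped function agrees with [f] around interior points only, so the end points are removed
   first. *)
apply: (@measurable_fun_itv_cc _ _ _ false true).
apply: (@eq_measurable_fun _ _ _ _ _ (fun t : R => (derive1 (f \o cl) t : R))).
  move=> x; rewrite inE/= in_itv/= => /andP[ax xb].
  rewrite !derive1E; apply: near_eq_derive; near=> y.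
  have ay : a <= y by apply/ltW; near: y; exact: lt_nbhsr.
  have yb : y <= b by apply/ltW; near: y; exact: lt_nbhsl.
  by rewrite /= /cl (max_idPr ay) (min_idPr yb).
by apply: measurable_funTS; exact: continuous_measurable_derive1.
Unshelve. all: by end_near. Qed.

(** [f] is the indefinite integral of some [g], and Lebesgue's differentiation theorem identifies
    [g] with the derivative almost everywhere. *)
Lemma abs_continuous_FTC a b f : a < b -> abs_continuous_on a b f ->
  [/\ {ae mu, forall x, a < x < b -> derivable f x 1},
      mu.-integrable `[a, b] (fun t => (derive1 f t : R)%:E) &
      \int[mu]_(t in `[a, b]) derive1 f t = f b - f a].
Proof.
move=> ab acf; have [g ig gE] := total_variation_abs_continuous_integral ab acf.
pose H x := \int[mu]_(t in `]a, x]) g t.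
have locg : locally_integrable setT g.
  by apply: open_integrable_locally => //; exact: openT.
have aeD : {ae mu, forall x, a < x < b -> derivable f x 1 /\ derive1 f x = g x}.
  have := @FTC1 R g (BRight a) (fun y => ltac:(apply: integrableS ig => //)) locg.
  apply: filterS; first exact: (ae_filter_ringOfSetsType mu).
  move=> x Hx /andP[ax xb].
  have [dH Hg] := Hx ax.
  have fH : {near x, (fun y => H y + f a) =1 f}.
    near=> y; rewrite /H -gE ?subrK//; apply/ltW; near: y.
      exact: lt_nbhsr.
    exact: lt_nbhsl.
  by have [df ->] := near_eq_addr_derive1 fH dH.
have aeE : ae_eq mu `[a, b]%classic (fun t => (derive1 f t : R)%:E) (EFin \o g).
  have na : mu.-negligible [set a] by apply/negligibleP => //; exact: lebesgue_measure_set1.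
  have nb : mu.-negligible [set b] by apply/negligibleP => //; exact: lebesgue_measure_set1.
  have := negligibleU (negligibleU na nb) aeD.
  apply: negligibleS => x /= /not_implyP[]; rewrite in_itv/= => /andP[ax xb] fg.
  have [->|xa] := eqVneq x a; first by left; left.
  have [->|xb'] := eqVneq x b; first by left; right.
  right => /(_ _)[].
    by rewrite !lt_neqAle eq_sym xa ax xb' xb.
  by move=> _ E; apply: fg; rewrite /= E.
have mf : measurable_fun `[a, b]%classic (fun t : R => (derive1 f t : R)%:E).
  apply/measurable_EFinP; exact: abs_continuous_measurable_derive1.
have mg : measurable_fun `[a, b]%classic (EFin \o g).
  by apply: measurable_funTS; exact: measurable_int ig.
split.
- move: aeD; apply: filterS; first exact: (ae_filter_ringOfSetsType mu).
  by move=> x /[apply] -[].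
- apply/integrableP; split => //.
  have igab : mu.-integrable `[a, b] (EFin \o g) by apply: integrableS ig.
  have /integrableP[_ igoo] := igab.
  have -> : (\int[mu]_(x in `[a, b]) `|(derive1 f x : R)%:E| = \int[mu]_(x in `[a, b]) `|(EFin \o g) x|)%E.
    apply: (@ge0_ae_eq_integral _ _ _ mu `[a, b]%classic (fun x => `|(derive1 f x : R)%:E|)%E (fun x => `|(EFin \o g) x|)%E) => //.
    - by apply: measurableT_comp.
    - by apply: measurableT_comp.
    - exact: ae_eq_abse aeE.
  exact: igoo.
- rewrite /Rintegral (@ae_eq_integral _ _ _ mu `[a, b]%classic (EFin \o g) _ _ _ _ aeE)//.
  rewrite -integral_itv_obnd_cbnd//; last by apply: measurable_funS mg => // z; rewrite /= !in_itv/= => /andP[/ltW -> ->].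
  by symmetry; apply: gE => //; exact: ltW.
Unshelve. all: by end_near. Qed.

End absolute_continuity_derivative.

(** * Gaussian increments and integration tools *)

Section integration_tools.
Context {R : realType}.
Implicit Types (a b : R) (f F : R -> R).
Local Notation mu := (@lebesgue_measure R).

Lemma continuous_FTC2_derive1 a b F f : a < b ->
  (forall x, a <= x -> x <= b -> is_derive x (1 : R) F (f x)) ->
  {within `[a, b], continuous f} ->
  \int[mu]_(x in `[a, b]) f x = F b - F a.
Proof.
move=> ab dF cf.
have cF x : a <= x -> x <= b -> {for x, continuous F}.
  move=> ax xb; apply/differentiable_continuous/derivable1_diffP.
  by have [] := dF x ax xb.
rewrite /Rintegral (@continuous_FTC2 R f F a b ab cf)//.
  split.
  - move=> x; rewrite in_itv/= => /andP[/ltW ax /ltW xb].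
    by have [] := dF x ax xb.
  - apply: cvg_at_right_filter; exact: (cF a (lexx _) (ltW ab)).
  - apply: cvg_at_left_filter; exact: (cF b (ltW ab) (lexx _)).
move=> x; rewrite in_itv/= => /andP[/ltW ax /ltW xb].
by rewrite derive1E; have [_ ->] := dF x ax xb.
Qed.


Lemma cvg_ge0_integral_itv f : measurable_fun [set: R] f -> (forall x, 0 <= f x) ->
  (\int[mu]_(x in `[(- n%:R)%R, n%:R]) (f x)%:E)%E @[n --> \oo] --> (\int[mu]_x (f x)%:E)%E.
Proof.
move=> mf f0.
rewrite (_ : (fun n => _) = (fun n => \int[mu]_x ((EFin \o f) \_ `[(- n%:R)%R, n%:R]) x)%E); last first.
  by apply/funext => n; rewrite integral_mkcond.
have fE x : (f x)%:E = limn (fun n => ((EFin \o f) \_ `[(- n%:R)%R, n%:R]) x).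
  apply/esym/cvg_lim => //; apply: cvg_near_cst; near=> n.
  rewrite patchE ifT// inE/= in_itv/=.
  by rewrite -ler_norml; near: n; exact: nbhs_infty_ger.
under [X in _ --> X]eq_integral do rewrite fE.
apply: cvg_monotone_convergence => //.
- move=> n; apply/(measurable_restrictT _ _).1 => //.
  by apply: measurable_funTS; exact/measurable_EFinP.
- by move=> n x _; rewrite patchE; case: ifP => //; rewrite lee_fin.
- move=> x _ m n mn; rewrite !patchE; case: ifPn; case: ifPn => //.
    rewrite notin_setE /= !inE/= !in_itv/= => + /andP[h1 h2]; case; apply/andP; split.
      by rewrite bnd_simp (le_trans _ h1)// lerN2 ler_nat.
    by rewrite bnd_simp (le_trans h2)// ler_nat.
  by rewrite lee_fin.
Unshelve. all: by end_near. Qed.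

Lemma cvg_integrable_integral_itv f : mu.-integrable [set: R] (EFin \o f) ->
  (\int[mu]_(x in `[(- n%:R)%R, n%:R]) (f x)%:E)%E @[n --> \oo] --> (\int[mu]_x (f x)%:E)%E.
Proof.
move=> intf; have mf := measurable_int _ intf.
under eq_cvg do rewrite integral_mkcond.
apply: (@dominated_cvg _ _ _ mu setT measurableT _ _ (fun x => `|(f x)%:E|)%E) => //.
- move=> n; apply/(measurable_restrictT _ _).1 => //.
  exact: measurable_funTS.
- move=> x _; apply: cvg_near_cst; near=> n; rewrite patchE ifT// inE/= in_itv/=.
  by rewrite -ler_norml; near: n; exact: nbhs_infty_ger.
- exact: integrable_abse.
- by move=> n x _; rewrite patchE; case: ifP => // _; rewrite abse0.
Unshelve. all: by end_near. Qed.

End integration_tools.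

Section density.
Context d (T : measurableType d) {R : realType}.
Variables (mu : {sigma_finite_measure set T -> \bar R}) (N : {finite_measure set T -> \bar R}).
Variable p : T -> R.
Hypotheses (mp : measurable_fun setT p) (p0 : forall x, 0 <= p x).
Hypothesis NE : forall A, measurable A -> N A = (\int[mu]_(x in A) (p x)%:E)%E.
Local Open Scope ereal_scope.

(** By uniqueness, [p] agrees almost everywhere with the Radon-Nikodym derivative, for which the
    change of variables is known. *)
Lemma ge0_integral_density (f : T -> R) : measurable_fun setT f ->
  (forall x, 0 <= f x)%R ->
  \int[N]_x (f x)%:E = \int[mu]_x (f x * p x)%:E.
Proof.
move=> mf f0.
have Nmu : N `<< mu.
  apply/null_content_dominatesP => A mA A0; rewrite NE//.
  apply: null_set_integral => //; apply: measurable_funTS; exact/measurable_EFinP.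
rewrite -(Radon_Nikodym_SigmaFinite.change_of_variables Nmu (fun x => _ : 0 <= (f x)%:E))//; last exact/measurable_EFinP.
pose g := Radon_Nikodym_SigmaFinite.f N mu.
have ig : mu.-integrable setT g by exact: Radon_Nikodym_SigmaFinite.f_integrable.
have gp : ae_eq mu setT g (EFin \o p).
  apply: integral_ae_eq => //; first exact/measurable_EFinP.
  by move=> E _ mE; rewrite -Radon_Nikodym_SigmaFinite.f_integral// NE.
apply: ae_eq_integral => //.
- by apply: emeasurable_funM; [exact/measurable_EFinP|exact: measurable_int ig].
- by apply/measurable_EFinP; exact: measurable_funM.
- exact: (@ae_eqe_mul2l _ _ _ _ _ _ _ (EFin \o f) gp).
Qed.

Lemma integrable_density (f : T -> R) : measurable_fun setT f ->
  mu.-integrable setT (fun x => (f x * p x)%:E) -> N.-integrable setT (EFin \o f).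
Proof.
move=> mf /integrableP[_ fp]; apply/integrableP; split; first exact/measurable_EFinP.
under eq_integral do rewrite /= .
rewrite (ge0_integral_density (f := fun x => `|f x|%R))//; last exact: measurableT_comp.
apply: le_lt_trans fp; apply: ge0_le_integral => //.
- by move=> x _; rewrite lee_fin mulr_ge0.
- by apply/measurable_EFinP/measurable_funM => //; exact: measurableT_comp.
- by apply: measurableT_comp => //; exact/measurable_EFinP/measurable_funM.
- by move=> x _; rewrite /= lee_fin normrM (ger0_norm (p0 x)).
Qed.

Lemma integral_density (f : T -> R) : measurable_fun setT f ->
  mu.-integrable setT (fun x => (f x * p x)%:E) ->
  \int[N]_x (f x)%:E = \int[mu]_x (f x * p x)%:E.
Proof.
move=> mf fp; have fpos : (fun x => (f x)%:E)^\+ = (fun x => (f^\+%R x)%:E) by exact: funerpos.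
have fneg : (fun x => (f x)%:E)^\- = (fun x => (f^\-%R x)%:E) by exact: funerneg.
have fppos : (fun x => (f x * p x)%:E)^\+ = (fun x => (f^\+%R x * p x)%:E).
  rewrite (_ : (fun x => _) = EFin \o (fun x => f x * p x)%R)// funerpos.
  by apply/funext => x; rewrite /= /funrpos maxr_pMl// mul0r.
have fpneg : (fun x => (f x * p x)%:E)^\- = (fun x => (f^\-%R x * p x)%:E).
  rewrite (_ : (fun x => _) = EFin \o (fun x => f x * p x)%R)// funerneg.
  by apply/funext => x; rewrite /= /funrneg maxr_pMl// mul0r mulNr.
rewrite integralE [RHS]integralE fpos fneg fppos fpneg.
rewrite (ge0_integral_density (f := f^\+%R)) ?(ge0_integral_density (f := f^\-%R))//.
- exact: measurable_funrneg.
- exact: measurable_funrpos.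
Qed.

End density.

(** * Moments of the centred normal law *)

Section normal_moments.
Context {R : realType}.
Variable s : R.
Hypothesis s0 : 0 < s.
Local Notation mu := (@lebesgue_measure R).
Local Notation p := (normal_pdf 0 s).
Local Notation N := (normal_prob 0 s : probability (measurableTypeR R) R).

Let s_neq0 : s != 0. Proof. by rewrite gt_eqF. Qed.

Lemma normal_pdf0E x : p x = normal_peak s * expR (- (x ^+ 2 / (s ^+ 2 *+ 2))).
Proof. by rewrite normal_pdfE// /normal_fun subr0 mulNr. Qed.

Let pN x : p (- x) = p x. Proof. by rewrite !normal_pdf0E sqrrN. Qed.

Let dp (x : R) : is_derive x (1 : R) p (- (x / s ^+ 2) * p x).
Proof.
have -> : p = (fun x => normal_peak s * expR (- (x ^+ 2 / (s ^+ 2 *+ 2)))).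
  by apply/funext => y; rewrite normal_pdf0E.
apply: is_derive_eq.
by rewrite /GRing.scale/= mulr0 add0r !mulr1 -mulr2n; field.
Qed.

Let cp : continuous p. Proof. exact: continuous_normal_pdf. Qed.
Let mp : measurable_fun [set: R] p. Proof. exact: measurable_normal_pdf. Qed.
Let p0 x : 0 <= p x. Proof. exact: normal_pdf_ge0. Qed.

Let cX k : continuous (fun x : R => x ^+ k * p x).
Proof. by move=> x; apply: cvgM; [exact: exprn_continuous|exact: cp]. Qed.

Let mX k : measurable_fun [set: R] (fun x : R => x ^+ k * p x).
Proof. by apply: continuous_measurable_fun; exact: cX. Qed.

Let J k n := \int[mu]_(x in `[- n%:R, n%:R]) (x ^+ k * p x).

Let intJ k n : mu.-integrable `[- n%:R, n%:R] (fun x => (x ^+ k * p x)%:E).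
Proof.
apply: continuous_compact_integrable; first exact: segment_compact.
by apply: continuous_subspaceT; exact: cX.
Qed.

(** Integration by parts on [-n, n], from [p' = - (x / s^2) p]: a truncated moment follows from the
    one two orders below, up to a nonnegative boundary term. *)
Let JS k n : (0 < n)%N ->
  J k.+2 n = s ^+ 2 * (k.+1%:R * J k n - (n%:R ^+ k.+1 - (- n%:R) ^+ k.+1) * p n%:R).
Proof.
move=> n0; have nn : - n%:R < n%:R :> R by rewrite (@lt_trans _ _ 0)// ?oppr_lt0 ltr0n.
have H : \int[mu]_(x in `[- n%:R, n%:R])
    (k.+1%:R * (x ^+ k * p x) - (s ^+ 2)^-1 * (x ^+ k.+2 * p x)) =
    (n%:R ^+ k.+1 - (- n%:R) ^+ k.+1) * p n%:R.
  rewrite (_ : _ * p n%:R = n%:R ^+ k.+1 * p n%:R - (- n%:R) ^+ k.+1 * p (- n%:R)); last by rewrite pN mulrBl.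
  apply: (@continuous_FTC2_derive1 R _ _ (fun x => x ^+ k.+1 * p x) (fun x => k.+1%:R * (x ^+ k * p x) - (s ^+ 2)^-1 * (x ^+ k.+2 * p x))) => //.
    move=> x _ _.
    have dX : is_derive x (1 : R) (fun x => x ^+ k.+1) (k.+1%:R * x ^+ k).
      apply: DeriveDef; first exact: exprn_derivable.
      by rewrite exp_derive /GRing.scale/= mulr1.
    apply: (is_derive_eq (is_deriveM dX (dp x))).
    by rewrite /GRing.scale/= !exprS; field; exact: s_neq0.
  apply: continuous_subspaceT => x.
  by apply: cvgB; apply: cvgM; [exact: cvg_cst|exact: cX|exact: cvg_cst|exact: cX].
move: H; rewrite RintegralB//; last 2 first.
  have -> : (EFin \o (fun x => k.+1%:R * (x ^+ k * p x))) = (fun x => k.+1%:R%:E * (x ^+ k * p x)%:E)%E by [].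
  exact: integrableZl.
  have -> : (EFin \o (fun x => (s ^+ 2)^-1 * (x ^+ k.+2 * p x))) = (fun x => (s ^+ 2)^-1%:E * (x ^+ k.+2 * p x)%:E)%E by [].
  exact: integrableZl.
rewrite (RintegralZl _ _ (intJ k n))// (RintegralZl _ _ (intJ k.+2 n))// -/(J k n) -/(J k.+2 n) => <-.
by field.
Qed.

Let J1 n : (0 < n)%N -> J 1 n = 0.
Proof.
move=> n0; have nn : - n%:R < n%:R :> R by rewrite (@lt_trans _ _ 0)// ?oppr_lt0 ltr0n.
rewrite (_ : 0 = - s ^+ 2 * p n%:R - - s ^+ 2 * p (- n%:R)); last by rewrite pN subrr.
apply: (@continuous_FTC2_derive1 R _ _ (fun x => - s ^+ 2 * p x) (fun x => x ^+ 1 * p x) nn).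
- move=> x _ _; apply: (is_derive_eq (is_deriveZ (- s ^+ 2) (dp x))).
  by rewrite /GRing.scale/= expr1; field.
- by apply: continuous_subspaceT; exact: cX.
Qed.

Let ge0_even k (x : R) : ~~ odd k -> 0 <= x ^+ k * p x.
Proof. by move=> ok; rewrite mulr_ge0// exprn_even_ge0. Qed.

Let bound_int k M : ~~ odd k -> (forall n, (0 < n)%N -> J k n <= M) ->
  (\int[mu]_x (x ^+ k * p x)%:E <= M%:E)%E.
Proof.
move=> ok JM.
have := cvg_ge0_integral_itv (mX k) (fun x => ge0_even x ok).
move=> /(cvg_lim (@ereal_hausdorff R)) <-; apply: lime_le.
  apply: ereal_nondecreasing_is_cvgn => m n mn; apply: ge0_subset_integral => //.
  - by apply: measurable_funTS; apply/measurable_EFinP; exact: mX.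
  - by move=> x _; rewrite lee_fin ge0_even.
  - by apply: subset_itv; rewrite bnd_simp ?lerN2 ler_nat.
near=> n; rewrite -(fineK (integrable_fin_num _ (intJ k n)))// lee_fin; apply: JM.
by near: n; exists 1%N.
Unshelve. all: by end_near. Qed.

Let integrable_even k M : ~~ odd k -> (forall n, (0 < n)%N -> J k n <= M) ->
  mu.-integrable [set: R] (fun x => (x ^+ k * p x)%:E).
Proof.
move=> ok JM; apply/integrableP; split; first by apply/measurable_EFinP; exact: mX.
under eq_integral => x _ do rewrite gee0_abs ?lee_fin ?ge0_even//.
by apply: (le_lt_trans (bound_int ok JM)); exact: ltry.
Qed.

Let i0 : mu.-integrable [set: R] (fun x => (x ^+ 0 * p x)%:E).
Proof. by under eq_fun do rewrite expr0 mul1r; exact: integrable_normal_pdf. Qed.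

Let J0 n : J 0 n <= 1.
Proof.
rewrite -lee_fin /J /Rintegral fineK ?(integrable_fin_num _ (intJ 0 n))//.
rewrite -(integral_normal_pdf 0 s).
rewrite (_ : \int[mu]_x (p x)%:E = \int[mu]_x (x ^+ 0 * p x)%:E)%E; last first.
  by apply: eq_integral => x _; rewrite expr0 mul1r.
apply: ge0_subset_integral => //; first by apply/measurable_EFinP; exact: mX.
by move=> x _; rewrite lee_fin ge0_even.
Qed.

Let bnd k n : 0 <= (n%:R ^+ k.+1 - (- n%:R) ^+ k.+1) * p n%:R.
Proof.
rewrite mulr_ge0// exprNn; rewrite -signr_odd; case: (odd _).
  by rewrite expr1 mulN1r opprK addr_ge0 ?exprn_ge0.
by rewrite expr0 mul1r subrr.
Qed.

Let J2 n : (0 < n)%N -> J 2 n <= s ^+ 2.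
Proof.
move=> n0; rewrite JS// ler_piMr ?sqr_ge0// mul1r.
have := bnd 0 n; have := J0 n; set u := J 0 n; set v := _ * p _; lra.
Qed.

Let i2 : mu.-integrable [set: R] (fun x => (x ^+ 2 * p x)%:E).
Proof. exact: (integrable_even (M := s ^+ 2)). Qed.

Let J4 n : (0 < n)%N -> J 4 n <= 3 * s ^+ 4.
Proof.
move=> n0; rewrite JS//; have := bnd 2 n; have := J2 n0; have := sqr_ge0 s.
set u := J 2 n; set v := _ * p _; rewrite (exprM s 2 2) -/(s ^+ 2).
set t := s ^+ 2 => t0 ut v0; nra.
Qed.

Let i4 : mu.-integrable [set: R] (fun x => (x ^+ 4 * p x)%:E).
Proof. exact: (integrable_even (M := 3 * s ^+ 4)). Qed.

Let i1 : mu.-integrable [set: R] (fun x => (x ^+ 1 * p x)%:E).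
Proof.
apply: (@le_integrable _ _ _ mu _ measurableT _ (fun x => (x ^+ 0 * p x)%:E + (x ^+ 2 * p x)%:E)%E).
- by apply/measurable_EFinP; exact: mX.
- move=> x _; rewrite /= lee_fin !normrM (ger0_norm (p0 x)) -mulrDl [leRHS]normrM (ger0_norm (p0 x)).
  rewrite ler_wpM2r// expr0 expr1 [leRHS]ger0_norm ?addr_ge0 ?sqr_ge0//.
  have := sqr_ge0 (`|x| - 1); rewrite -[x ^+ 2]real_normK ?num_real//; nra.
- exact: integrableD.
Qed.

Lemma normal_integrable_exprn k : (k <= 2)%N || (k == 4)%N ->
  N.-integrable setT (fun x => (x ^+ k)%:E).
Proof.
move=> k4; apply: (@integrable_density _ _ R mu N p) => //.
by move: k k4 => [|[|[|[|[|]]]]].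
Qed.

Lemma normal_mean : \int[N]_x x = 0.
Proof.
rewrite /Rintegral (@integral_density _ _ R mu N p)//.
have := @cvg_integrable_integral_itv R (fun x => x * p x) i1.
move=> H; suff -> : (\int[mu]_x (x * p x)%:E = 0)%E by [].
apply: (cvg_unique (@ereal_hausdorff R) H); apply: cvg_near_cst; near=> n.
rewrite -(fineK (integrable_fin_num _ (intJ 1 n)))//; congr EFin; apply: J1.
by near: n; exists 1%N.
Unshelve. all: by end_near. Qed.

(** From [1 + y <= exp y] at [y = n^2 / (2 s^2)] and [n (n + 1) <= 2 n^2], the boundary term is at
    most [8 * normal_peak s * s^2 / (n + 1)]. *)
Let bnd0 : (n%:R ^+ 1 - (- n%:R) ^+ 1) * p n%:R @[n --> \oo] --> (0 : R).
Proof.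
apply: (@squeeze_cvgr _ _ _ _ (cst 0) (fun n => (8 * normal_peak s * s ^+ 2) * n.+1%:R^-1)).
- near=> n; rewrite (bnd 0 n)/=.
  have n0 : (0 < n)%N by near: n; exists 1%N.
  rewrite normal_pdf0E expRN.
  have np : 0 < normal_peak s by exact: normal_peak_gt0.
  have E : 1 + n%:R ^+ 2 / (s ^+ 2 *+ 2) <= expR (n%:R ^+ 2 / (s ^+ 2 *+ 2)).
    by exact: expR_ge1Dx.
  set e := expR _ in E *; set k := normal_peak s in np *.
  have e0 : 0 < e by exact: expR_gt0.
  have nR : 1 <= n%:R :> R by rewrite ler1n.
  have en : n%:R ^+ 2 / (2 * s ^+ 2) <= e.
    by rewrite (le_trans _ E)// mulr_natl lerDr.
  rewrite !expr1 opprK ler_pdivlMr// -natr1.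
  have -> : (n%:R + n%:R) * (k / e) * (n%:R + 1) = 2 * k * (n%:R * (n%:R + 1)) / e by ring.
  rewrite ler_pdivrMr//.
  have s20 : 0 < 2 * s ^+ 2 by rewrite mulr_gt0// exprn_gt0.
  move: en; rewrite ler_pdivrMr// => en.
  have kk : k * (n%:R * (n%:R + 1)) <= k * (4 * s ^+ 2 * e).
    rewrite ler_pM2l//; move: en nR; rewrite expr2; set v := n%:R; nra.
  by move: kk; lra.
- exact: cvg_cst.
- rewrite -[X in _ --> X](mulr0 (8 * normal_peak s * s ^+ 2)).
  by apply: cvgM; [exact: cvg_cst|exact: cvg_harmonic].
Unshelve. all: by end_near. Qed.

Lemma normal_second_moment : \int[N]_x (x ^+ 2) = s ^+ 2.
Proof.
rewrite /Rintegral (@integral_density _ _ R mu N p)//.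
suff -> : (\int[mu]_x (x ^+ 2 * p x)%:E)%E = (s ^+ 2)%:E by [].
apply: (cvg_unique (@ereal_hausdorff R) (cvg_integrable_integral_itv i2)).
suff : (J 2 n)%:E @[n --> \oo] --> (s ^+ 2)%:E.
  apply: cvg_trans; apply: near_eq_cvg; near=> n.
  by rewrite /J /Rintegral fineK ?(integrable_fin_num _ (intJ 2 n)).
suff J2s : J 2 n @[n --> \oo] --> s ^+ 2 by apply: cvg_EFin; [exact: nearW|exact: J2s].
have cJ0 : J 0 n @[n --> \oo] --> (1 : R).
  have := cvg_integrable_integral_itv i0.
  under [X in _ --> X -> _]eq_integral do rewrite expr0 mul1r.
  by rewrite integral_normal_pdf => /fine_cvg.
have : s ^+ 2 * (1%:R * J 0 n - (n%:R ^+ 1 - (- n%:R) ^+ 1) * p n%:R) @[n --> \oo] --> s ^+ 2 * (1 * 1 - 0).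
  apply: cvgM; first exact: cvg_cst.
  by apply: cvgB; [apply: cvgM; [exact: cvg_cst|exact: cJ0]|exact: bnd0].
rewrite mul1r subr0 mulr1; apply: cvg_trans; apply: near_eq_cvg; near=> n.
by rewrite JS//; near: n; exists 1%N.
Unshelve. all: by end_near. Qed.

Lemma normal_fourth_moment : \int[N]_x (x ^+ 4) <= 3 * s ^+ 4.
Proof.
rewrite /Rintegral (@integral_density _ _ R mu N p)//.
rewrite -lee_fin fineK; first exact: bound_int J4.
exact: integrable_fin_num.
Qed.

End normal_moments.

Section sub_sigma_algebra.
Context {d : measure_display} {Omega : measurableType d} {R : realType}.
Variable (S : set (set Omega)).
Hypothesis sS : sigma_algebra setT S.
Let T := g_sigma_algebraType S.

Lemma measurable_wrtP (X : Omega -> R) :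
  measurable_wrt S X <-> measurable_fun setT (X : T -> R).
Proof.
have SE : <<s S >> = S by exact: sigma_algebra_id.
split=> [mX _ B mB|mX B mB].
  by rewrite setTI; change (<<s S >> (X @^-1` B)); rewrite SE; exact: mX.
have := mX measurableT B mB.
by rewrite setTI; change (<<s S >> (X @^-1` B) -> S (X @^-1` B)); rewrite SE.
Qed.

Lemma measurable_wrt_measurable (X : Omega -> R) : S `<=` measurable ->
  measurable_wrt S X -> measurable_fun setT X.
Proof. by move=> Sm mX _ B mB; rewrite setTI; apply: Sm; exact: mX. Qed.

End sub_sigma_algebra.

Section independence.
Context {d : measure_display} {Omega : measurableType d} {R : realType}.
Variables (P : probability Omega R) (N : probability (measurableTypeR R) R).
Variables (X Z : Omega -> R).
Hypotheses (mX : measurable_fun setT X) (mZ : measurable_fun setT Z).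
Hypothesis indep : forall A B : set R, measurable A -> measurable B ->
  (P (X @^-1` A `&` Z @^-1` B) = P (X @^-1` A) * N B)%E.

(** By hypothesis the joint law of [X] and [Z] is the product of the law of [X] and [N] on
    rectangles, hence everywhere, and Fubini factors the integral. *)
Lemma independent_integral (g : R -> R) : measurable_fun setT g ->
  P.-integrable setT (EFin \o X) -> N.-integrable setT (EFin \o g) ->
  P.-integrable setT (fun w => (X w * g (Z w))%:E) /\
  \int[P]_w (X w * g (Z w)) = \int[P]_w X w * \int[N]_z g z.
Proof.
move=> mg iX ig.
have mX' : measurable_fun setT (X : Omega -> measurableTypeR R) by exact: mX.
have mZ' : measurable_fun setT (Z : Omega -> measurableTypeR R) by exact: mZ.
pose XRV : {RV P >-> measurableTypeR R} := HB.pack (X : Omega -> measurableTypeR R)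
  (isMeasurableFun.Build _ _ _ _ (X : Omega -> measurableTypeR R) mX').
pose T2 := measurableTypeR R.
pose XZ w : T2 * T2 := (X w, Z w).
have mXZ : measurable_fun setT XZ by exact: measurable_fun_pair.
pose XZRV : {RV P >-> (T2 * T2)%type} :=
  HB.pack XZ (isMeasurableFun.Build _ _ _ _ XZ mXZ).
pose PX : probability T2 R := distribution P XRV.
pose m' : probability (T2 * T2)%type R := distribution P XZRV.
have m'E A : measurable A -> (PX \x N)%E A = m' A.
  move=> mA; apply: product_measure_unique; last exact: mA.
  by move=> B C mB mC; have H := indep mB mC; exact: H.
pose f (z : T2 * T2) := (z.1 * g z.2)%:E : \bar R.
have mf : measurable_fun setT f.
  apply/measurable_EFinP; apply: measurable_funM; first exact: measurable_fst.
  by apply: measurableT_comp => //; exact: measurable_snd.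
have mid : measurable_fun [set: T2] (fun x : T2 => (x : R)%:E) by apply/measurable_EFinP; exact: measurable_id.
have PXge (h : T2 -> \bar R) : measurable_fun setT h -> (forall y, 0 <= h y)%E -> (\int[PX]_x h x = \int[P]_w h (X w))%E.
  by move=> mh h0; rewrite (ge0_integral_distribution XRV).
have iidX : PX.-integrable setT (fun x : T2 => (x : R)%:E).
  apply/integrableP; split => //.
  by rewrite PXge//; [have /integrableP[] := iX|exact: measurableT_comp].
have If : (PX \x N)%E.-integrable setT f.
  apply/integrable12ltyP => //.
  under eq_integral => x _.
    under eq_integral do rewrite /f/= normrM EFinM.
    rewrite ge0_integralZl//; last by apply/measurable_EFinP; exact: measurableT_comp.
    over.
  rewrite ge0_integralZr//; last 2 first.
  - by apply/measurable_EFinP; exact: normr_measurable.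
  - exact: integral_ge0.
  have /integrableP[_ g1] := ig; have /integrableP[_ x1] := iidX.
  apply: lte_mul_pinfty; [exact: integral_ge0| |exact: g1].
  by rewrite ge0_fin_numE//; exact: integral_ge0.
have Im : P.-integrable setT (f \o XZ).
  apply/integrableP; split; first exact: measurableT_comp.
  have /integrableP[_] := If.
  rewrite (eq_measure_integral m'); last by move=> A mA _; exact: m'E.
  by rewrite (ge0_integral_distribution XZRV)//; exact: measurableT_comp.
split => //.
rewrite /Rintegral -fineM; [|exact: integrable_fin_num..].
congr fine.
transitivity (\int[m']_z f z)%E.
  by rewrite (integral_distribution (X := XZRV)).
transitivity (\int[PX \x N]_z f z)%E.
  by apply/esym/eq_measure_integral => A mA _; exact: m'E.
rewrite -integral12_prod_meas1//.
transitivity (\int[PX]_x ((x : R)%:E * \int[N]_z (g z)%:E))%E.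
  apply: eq_integral => x _.
  rewrite /fubini_F; under eq_integral do rewrite /f/= EFinM.
  by rewrite integralZl.
have gE : (\int[N]_z (g z)%:E)%E \is a fin_num by exact: integrable_fin_num.
rewrite -(fineK gE) integralZr//.
by congr (_ * _)%E; rewrite (integral_distribution (X := XRV)).
Qed.

End independence.

Section parametric_integrals.
Context {R : realType} {d : measure_display} {T : measurableType d}.
Local Notation mu := (@lebesgue_measure R).
Implicit Types (f : R -> T -> R).

(** [q n] rounds time down to a multiple of [1 / (n + 1)]. The rounded process is a countable
    patchwork of measurable pieces, and continuity of the paths gives the limit. *)
Lemma caratheodory_measurable f :
  (forall t, measurable_fun setT (f t)) -> (forall w, continuous (f ^~ w)) ->
  measurable_fun [set: R * T] (fun z => f z.1 z.2).
Proof.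
move=> mf cf.
pose q n (t : R) : R := (Num.floor (t * n.+1%:R))%:~R / n.+1%:R.
apply: (@measurable_fun_cvg _ _ _ _ (fun n z => f (q n z.1) z.2)).
  move=> n _ B mB; rewrite setTI.
  have -> : (fun z => f (q n z.1) z.2) @^-1` B =
     \bigcup_(k in [set: int]) ((fun t : R => (Num.floor (t * n.+1%:R) : int)) @^-1` [set k] `*` (f (k%:~R / n.+1%:R) @^-1` B)).
    apply/seteqP; split => [[t w]/= h|[t w]/= [k _ /= [<-//]]].
    by exists (Num.floor (t * n.+1%:R)).
  apply: countable_bigcupT_measurable; first exact: countableP.
  move=> k; apply: measurableX; last by rewrite -[X in measurable X]setTI; exact: mf.
  rewrite (_ : _ @^-1` _ = `[k%:~R / n.+1%:R, (k + 1)%:~R / n.+1%:R[%classic)//.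
  apply/seteqP; split => t /=; rewrite in_itv/= ler_pdivrMr ?ltr0n// ltr_pdivlMr ?ltr0n//.
    by move=> <-; rewrite floor_le_tmp floorD1_gt.
  by move=> ?; apply/eqP; rewrite floor_eq.
move=> z _.
have qz : q n z.1 @[n --> \oo] --> z.1.
  apply: (@squeeze_cvgr _ _ _ _ (fun n => z.1 - n.+1%:R^-1) (fun n => z.1)).
  - near=> n; rewrite /q; have n0 : 0 < n.+1%:R :> R by rewrite ltr0n.
    rewrite ler_pdivlMr// ler_pdivrMr// mulrBl mulVf ?gt_eqF// floor_le_tmp andbT.
    rewrite lerBlDr; apply/ltW; have := floorD1_gt (z.1 * n.+1%:R).
    by rewrite intrD.
  - rewrite -[X in _ --> X]subr0; apply: cvgB; first exact: cvg_cst.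
    exact: cvg_harmonic.
  - exact: cvg_cst.
exact: (cvg_comp _ _ qz (cf z.2 z.1)).
Unshelve. all: by end_near. Qed.

Lemma Rintegral0_eq d' (T' : measurableType d') (nu : {measure set T' -> \bar R}) (D : set T') (f : T' -> R) :
  (forall x, D x -> f x = 0) -> \int[nu]_(x in D) f x = 0.
Proof. by move=> f0; rewrite /Rintegral integral0_eq// => x Dx; rewrite f0. Qed.

Lemma bounded_integrable_itv (a b M : R) (f : R -> R) :
  measurable_fun `[a, b] f -> (forall t, a <= t <= b -> `|f t| <= M) ->
  mu.-integrable `[a, b] (EFin \o f).
Proof.
move=> mf fM; apply: (@le_integrable _ _ _ mu _ _ _ (EFin \o cst M)) => //.
- exact/measurable_EFinP.
- by move=> t /=; rewrite in_itv/= => tab; rewrite lee_fin (le_trans (fM _ tab))// ler_norm.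
- apply: continuous_compact_integrable; first exact: segment_compact.
  by apply: continuous_subspaceT => t; exact: cvg_cst.
Qed.

Lemma Rintegral_itv_split (a b c : R) (f : R -> R) : a <= b -> b <= c ->
  mu.-integrable `[a, c] (EFin \o f) ->
  \int[mu]_(x in `[a, c]) f x = \int[mu]_(x in `[a, b]) f x + \int[mu]_(x in `[b, c]) f x.
Proof.
move=> ab bc fi; apply/eqP; rewrite addrC -subr_eq; apply/eqP.
rewrite Rintegral_itvB ?bnd_simp//.
by apply: Rintegral_itv_obnd_cbnd; apply: integrableS fi => //; apply: subset_itvr; rewrite bnd_simp.
Qed.

End parametric_integrals.

(** Integrability is not assumed: an integral is by definition the difference of the integrals of
    the positive and negative parts, each measurable by Tonelli, and [fine] is measurable. *)
Lemma measurable_Rintegral_param {R : realType} {d1 d2 : measure_display}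
  {T1 : measurableType d1} {T2 : measurableType d2}
  (m1 : {sigma_finite_measure set T1 -> \bar R}) (g : T1 * T2 -> R) (D : set T1) :
  measurable D -> measurable_fun setT g ->
  measurable_fun setT (fun w => \int[m1]_(t in D) g (t, w)).
Proof.
move=> mD mg; apply: measurableT_comp; first exact: fine_measurable.
pose h z := (g z * \1_D z.1)%R.
have mh : measurable_fun setT h.
  by apply: measurable_funM => //; apply: measurableT_comp => //; exact: measurable_fst.
have gh w : (\int[m1]_(t in D) (g (t, w))%:E = \int[m1]_t (h (t, w))%:E)%E.
  rewrite integral_mkcond; apply: eq_integral => t _.
  by rewrite /h/= patchE indicE; case: (t \in D); rewrite ?mulr1 ?mulr0.
apply: (eq_measurable_fun (fun w => fubini_G m1 (fun z => ((EFin \o h)^\+ z)) w - fubini_G m1 (fun z => ((EFin \o h)^\- z)) w)%E).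
  move=> w _; rewrite gh [RHS]integralE /fubini_G.
  by congr (_ - _)%E; congr (integral _ _ _); apply/funext => t; rewrite ?funeposE ?funenegE.
apply: emeasurable_funB.
  apply: measurable_fun_fubini_tonelli_G => //.
  by apply: measurable_funepos; exact/measurable_EFinP.
apply: measurable_fun_fubini_tonelli_G => //.
by apply: measurable_funeneg; exact/measurable_EFinP.
Qed.


Section integrable_EFin.
Context {d : measure_display} {T : measurableType d} {R : realType}.
Variables (mu : {measure set T -> \bar R}) (D : set T).
Hypothesis mD : measurable D.

Lemma integrable_EFinD (f g : T -> R) : mu.-integrable D (EFin \o f) ->
  mu.-integrable D (EFin \o g) -> mu.-integrable D (EFin \o (fun x => f x + g x)).
Proof. exact: integrableD. Qed.

Lemma integrable_EFinB (f g : T -> R) : mu.-integrable D (EFin \o f) ->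
  mu.-integrable D (EFin \o g) -> mu.-integrable D (EFin \o (fun x => f x - g x)).
Proof. exact: integrableB. Qed.

Lemma integrable_EFinZl (k : R) (f : T -> R) : mu.-integrable D (EFin \o f) ->
  mu.-integrable D (EFin \o (fun x => k * f x)).
Proof. exact: integrableZl. Qed.

End integrable_EFin.

Section bounded_expectation.
Context {R : realType} {d : measure_display} {Omega : measurableType d}.
Variable P : probability Omega R.
Local Notation mu := (@lebesgue_measure R).
Implicit Types (f g : Omega -> R).

Definition bounded_measurable f :=
  measurable_fun setT f /\ exists M : R, forall w, `|f w| <= M.

Lemma expectation_cst (c : R) : \int[P]_w c = c.
Proof. by rewrite /Rintegral integral_cst//= probability_setT mule1. Qed.

Lemma integrable_EFin_cst (c : R) : P.-integrable setT (EFin \o (fun=> c)).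
Proof. exact: finite_measure_integrable_cst. Qed.

Lemma bounded_measurable_integrable f : bounded_measurable f ->
  P.-integrable setT (EFin \o f).
Proof.
move=> [mf [M fM]]; apply: (@le_integrable _ _ _ P _ measurableT _ (fun _ => M%:E)).
- exact/measurable_EFinP.
- by move=> w _; rewrite /= lee_fin (le_trans (fM w))// ler_norm.
- exact: finite_measure_integrable_cst.
Qed.

Lemma bounded_measurableD f g : bounded_measurable f -> bounded_measurable g ->
  bounded_measurable (fun w => f w + g w).
Proof.
move=> [mf [M fM]] [mg [K gK]]; split; first exact: measurable_funD.
by exists (M + K) => w; rewrite (le_trans (ler_normD _ _))// lerD.
Qed.

Lemma bounded_measurableM f g : bounded_measurable f -> bounded_measurable g ->
  bounded_measurable (fun w => f w * g w).
Proof.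
move=> [mf [M fM]] [mg [K gK]]; split; first exact: measurable_funM.
by exists (M * K) => w; rewrite normrM ler_pM.
Qed.

Lemma bounded_measurable_cst c : bounded_measurable (fun=> c).
Proof. by split => //; exists `|c|. Qed.

Lemma bounded_measurableN f : bounded_measurable f -> bounded_measurable (fun w => - f w).
Proof.
move=> [mf [M fM]]; split; first exact: measurableT_comp.
by exists M => w; rewrite normrN.
Qed.

Lemma bounded_measurableB f g : bounded_measurable f -> bounded_measurable g ->
  bounded_measurable (fun w => f w - g w).
Proof. by move=> bf bg; apply: bounded_measurableD => //; exact: bounded_measurableN. Qed.

Lemma fubini_itv (a b : R) (g : R * Omega -> R) (M : R) :
  measurable_fun setT g -> (forall t w, a <= t <= b -> `|g (t, w)| <= M) ->
  \int[P]_w (\int[mu]_(t in `[a, b]) g (t, w)) =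
  \int[mu]_(t in `[a, b]) (\int[P]_w g (t, w)).
Proof.
move=> mg gM.
pose h z := (g z * \1_(`[a, b]%classic) z.1)%R.
have mh : measurable_fun setT h.
  by apply: measurable_funM => //; apply: measurableT_comp => //; exact: measurable_fst.
have hM t w : (`|h (t, w)|%:E <= (`|M| * \1_(`[a, b]%classic) t)%:E)%E.
  rewrite lee_fin /h normrM indicE/= mem_setE; case: (boolP (t \in `[a, b])) => tab; last by rewrite !mulr0 normr0 mulr0.
  by rewrite normr1 !mulr1 (le_trans (gM t w _))// ler_norm.
have ih : (mu \x P)%E.-integrable setT (EFin \o h).
  apply/integrable12ltyP; first exact/measurable_EFinP.
  apply: (@le_lt_trans _ _ (\int[mu]_t (`|M| * \1_(`[a, b]%classic) t)%:E)%E).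
    apply: ge0_le_integral => //.
    - by move=> t _; exact: integral_ge0.
    - apply: (@measurable_fun_fubini_tonelli_F _ _ _ _ _ P (fun z => `|(EFin \o h) z|)%E) => //.
      by apply: measurableT_comp => //; exact/measurable_EFinP.
    - by apply/measurable_EFinP; exact: measurable_funM.
    - move=> t _.
      apply: (@le_trans _ _ (\int[P]_w (`|M| * \1_(`[a, b]%classic) t)%:E)%E).
        apply: ge0_le_integral => //.
        + apply: measurableT_comp => //; apply/measurable_EFinP.
          exact: measurableT_comp.
        + by move=> w _; exact: hM.
      by rewrite integral_cst//= probability_setT mule1.
  under eq_integral do rewrite EFinM.
  rewrite ge0_integralZl//; last by apply/measurable_EFinP.
  rewrite integral_indic// setIT.
  have mab : (lebesgue_measure `[a, b]%classic < +oo)%E by rewrite lebesgue_measure_itv/=; case: ifP => _; rewrite ltry.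
  by apply: lte_mul_pinfty.
have E := @Fubini _ _ _ _ _ mu P _ ih.
have gh w : (\int[mu]_(t in `[a, b]) (g (t, w))%:E = \int[mu]_t (h (t, w))%:E)%E.
  rewrite integral_mkcond; apply: eq_integral => t _.
  by rewrite /h/= patchE indicE; case: (t \in _); rewrite ?mulr1 ?mulr0.
rewrite [LHS]/Rintegral [RHS]/Rintegral; congr fine.
transitivity (\int[P]_w fubini_G mu (EFin \o h) w)%E.
  apply: eq_integral => w _; rewrite /fubini_G/= -gh /Rintegral fineK//.
  apply: integrable_fin_num => //.
  apply: (bounded_integrable_itv (M := M)); last by move=> t; exact: gM.
  by apply: measurable_funTS; exact: measurableT_comp.
rewrite [RHS]integral_mkcond; transitivity (\int[mu]_x fubini_F P (EFin \o h) x)%E; first by rewrite /fubini_F/= E.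
apply: eq_integral => t _.
rewrite patchE /fubini_F/= mem_setE; case: ifPn => tab.
  rewrite /Rintegral fineK; first by apply: eq_integral => w _; rewrite /h/= indicE mem_setE tab mulr1.
  apply: integrable_fin_num => //; apply: (bounded_measurable_integrable (f := fun w => g (t, w))); split; first exact: measurableT_comp.
  by exists M => w; exact: gM.
by rewrite integral0_eq// => w _; rewrite /h/= indicE mem_setE (negbTE tab) mulr0.
Qed.

End bounded_expectation.

Section real_analysis_tools.
Context {R : realType}.

Lemma mean_value (f f' : R -> R) (a b : R) :
  (forall x, is_derive x (1 : R) f (f' x)) ->
  exists2 z, `|z - a| <= `|b - a| & f b - f a = f' z * (b - a).
Proof.
move=> df.
have cf : continuous f.
  by move=> x; apply/differentiable_continuous/derivable1_diffP; have [] := df x.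
have [ab|ba|<-] := ltgtP a b.
- have [z] := MVT ab (fun x _ => df x) (continuous_subspaceT cf).
  rewrite in_itv/= => /andP[az zb] E; exists z => //.
  by rewrite !ger0_norm ?subr_ge0 ?(ltW az) ?(ltW ab)// lerD2r ltW.
- have [z] := MVT ba (fun x _ => df x) (continuous_subspaceT cf).
  rewrite in_itv/= => /andP[az zb] E; exists z.
    by rewrite !ler0_norm ?subr_le0 ?(ltW zb) ?(ltW ba)// lerN2 lerD2r ltW.
  by rewrite -opprB E -mulrN opprB.
- by exists a => //; rewrite !subrr mulr0.
Qed.

(** The modulus [e + L (z - x)^2] is available for bounded uniformly continuous functions and, being
    polynomial, can be integrated against Gaussian increments. The estimate comes from two mean
    value steps, one for [g] and one for its derivative. *)
Lemma taylor2_le (h h1 h2 : R -> R) (e L x y : R) :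
  (forall x, is_derive x (1 : R) h (h1 x)) ->
  (forall x, is_derive x (1 : R) h1 (h2 x)) ->
  0 <= L ->
  (forall z, `|h2 z - h2 x| <= e + L * (z - x) ^+ 2) ->
  `|h y - h x - h1 x * (y - x) - 2^-1 * h2 x * (y - x) ^+ 2|
  <= (e + L * (y - x) ^+ 2) * (y - x) ^+ 2.
Proof.
move=> dh dh1 L0 h2e.
have e0 : 0 <= e by have := h2e x; rewrite !subrr expr0n/= mulr0 addr0 normr0.
pose g z := h z - h1 x * z - 2^-1 * h2 x * (z - x) ^+ 2.
pose g' z := h1 z - h1 x - h2 x * (z - x).
have dg z : is_derive z (1 : R) g (g' z).
  have dq : is_derive z (1 : R) (fun z => (z - x) ^+ 2) (2 * (z - x)).
    by apply: is_derive_eq; rewrite /GRing.scale/=; ring.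
  have dl : is_derive z (1 : R) (fun z => h1 x * z) (h1 x).
    by apply: is_derive_eq; rewrite /GRing.scale/= mulr1.
  have dq' := is_deriveZ (2^-1 * h2 x) dq.
  apply: (is_derive_eq (is_deriveB (is_deriveB (dh z) dl) dq')).
  by rewrite /GRing.scale/= /g'; field.
pose k z := h1 z - h2 x * z.
have dk z : is_derive z (1 : R) k (h2 z - h2 x).
  have dl : is_derive z (1 : R) (fun z => h2 x * z) (h2 x).
    by apply: is_derive_eq; rewrite /GRing.scale/= mulr1.
  exact: (is_derive_eq (is_deriveB (dh1 z) dl)).
have [z zx E] := @mean_value g g' x y dg.
have [u ux E2] := @mean_value k _ x z dk.
have -> : h y - h x - h1 x * (y - x) - 2^-1 * h2 x * (y - x) ^+ 2 = g y - g x.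
  by rewrite /g subrr expr0n/= mulr0; ring.
rewrite E (_ : g' z = k z - k x); last by rewrite /g' /k; ring.
rewrite E2 !normrM.
have s2 (p q : R) : `|p| <= `|q| -> p ^+ 2 <= q ^+ 2.
  by move=> pq; rewrite -[p ^+ 2]real_normK ?num_real// -[q ^+ 2]real_normK ?num_real// lerXn2r ?nnegrE.
have A : `|h2 u - h2 x| <= e + L * (y - x) ^+ 2.
  rewrite (le_trans (h2e u))// lerD2l ler_wpM2l// s2//.
  exact: (le_trans ux).
have a2 : (y - x) ^+ 2 = `|y - x| * `|y - x|.
  by rewrite -normrM -expr2 ger0_norm ?sqr_ge0.
by rewrite [X in _ <= _ * X]a2 mulrA ler_wpM2r// ler_pM.
Qed.

(** Does the work of a vanishing derivative where only uniform estimates of increments are at hand: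
    they are summed over an equal subdivision of mesh at most [dl]. The summand 1 in [t - s + 1]
    covers the case [s = t]. *)
Lemma eq_of_little_increments (f : R -> R) (s t : R) : s <= t ->
  (forall e, 0 < e -> exists2 dl, 0 < dl & forall u v, s <= u -> u <= v -> v <= t ->
     v - u <= dl -> `|f v - f u| <= e * (v - u)) ->
  f t = f s.
Proof.
move=> st H; apply/eqP; rewrite -subr_eq0 -normr_le0; apply/ler_addgt0Pl => e e0.
rewrite addr0.
have ts1 : 0 < t - s + 1 by rewrite ltr_wpDl// subr_ge0.
have [dl dl0 Hd] := H (e / (t - s + 1)) (divr_gt0 e0 ts1).
pose n := (Num.truncn ((t - s) / dl)).+1.
have nd : (t - s) / n%:R <= dl.
  rewrite ler_pdivrMr ?ltr0n// mulrC -ler_pdivrMr//.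
  by apply/ltW/truncnS_gt.
pose g k := s + k%:R * ((t - s) / n%:R).
have step0 : 0 <= (t - s) / n%:R by rewrite divr_ge0// subr_ge0.
have gn : g n = t by rewrite /g mulrC divfK ?pnatr_eq0// addrC subrK.
have gS k : g k.+1 - g k = (t - s) / n%:R by rewrite /g -(natr1 k); ring.
have g0 : g 0 = s by rewrite /g mul0r addr0.
have -> : f t - f s = \sum_(0 <= k < n) (f (g k.+1) - f (g k)).
  by rewrite telescope_sumr// gn g0.
apply: (le_trans (ler_norm_sum _ _ _)).
apply: (@le_trans _ _ (\sum_(0 <= k < n) (e / (t - s + 1) * ((t - s) / n%:R)))).
  rewrite big_nat_cond [leRHS]big_nat_cond; apply: ler_sum => k; rewrite andbT => /andP[_ kn].
  rewrite -(gS k); apply: Hd.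
  - by rewrite /g lerDl mulr_ge0.
  - by rewrite -subr_ge0 gS.
  - by rewrite -gn /g lerD2l ler_wpM2r// ler_nat.
  - by rewrite gS.
rewrite sumr_const_nat subn0 -[X in X <= _]mulr_natr.
rewrite (_ : _ * _ = e * ((t - s) / (t - s + 1))); last first.
  by field; rewrite gt_eqF// pnatr_eq0.
by rewrite ler_piMr ?(ltW e0)// ler_pdivrMr// mul1r lerDl.
Qed.

End real_analysis_tools.

(** * Moments of Brownian increments *)

Section brownian_increments.
Context {R : realType} {d : measure_display} {Omega : measurableType d}.
Variables (P : probability Omega R) (F : R -> set (set Omega)) (W : R -> Omega -> R).

(* A Brownian motion all of whose paths are continuous on the whole line. *)
Definition continuous_brownian :=
  [/\ adapted F W, forall w, continuous (W ^~ w)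
    & forall s t (A : set Omega) (B : set R), 0 <= s -> s < t ->
        F s A -> measurable B ->
        (P (A `&` (W t \- W s)%R @^-1` B) =
         P A * normal_prob 0 (Num.sqrt (t - s)) B)%E].

Hypotheses (hF : usual_filtration P F) (hW : continuous_brownian).

Lemma adapted_measurable X t : adapted F X -> 0 <= t -> measurable_fun setT (X t).
Proof.
move=> aX t0; have [sF _ _ _] := hF; have [_ Fm] := sF t t0.
by apply: (measurable_wrt_measurable Fm); exact: aX.
Qed.

Let mW t : 0 <= t -> measurable_fun setT (W t).
Proof. by apply: adapted_measurable; case: hW. Qed.

Let incr s t w := W t w - W s w.

Let mincr s t : 0 <= s -> s <= t -> measurable_fun setT (incr s t).
Proof. by move=> s0 st; apply: measurable_funB; apply: mW => //; exact: le_trans st. Qed.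

(** The exponents are those of a second-order expansion: 1 and 2 in its main terms, 4 in the
    quadratic part of the modulus of continuity of the second derivative. *)
Lemma brownian_increment_exprn s t k (xi : Omega -> R) : 0 <= s -> s < t ->
  measurable_wrt (F s) xi -> (exists M : R, forall w, `|xi w| <= M) ->
  (k <= 2)%N || (k == 4)%N ->
  P.-integrable setT (fun w => (xi w * incr s t w ^+ k)%:E) /\
  \int[P]_w (xi w * incr s t w ^+ k) =
  \int[P]_w xi w * \int[normal_prob 0 (Num.sqrt (t - s))]_z (z ^+ k).
Proof.
move=> s0 st mxi bxi k4; have [sF _ _ _] := hF; have [_ Fm] := sF s s0.
have mxi' : measurable_fun setT xi by exact: measurable_wrt_measurable Fm mxi.
have ts : 0 < Num.sqrt (t - s) by rewrite sqrtr_gt0 subr_gt0.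
apply: (@independent_integral _ _ _ P (normal_prob 0 (Num.sqrt (t - s))) xi (incr s t) mxi' (mincr s0 (ltW st)) _ (fun z => z ^+ k)).
- move=> A B mA mB; have [_ _ ind] := hW.
  by rewrite -(ind s t (xi @^-1` A) B) //; exact: mxi.
- exact: exprn_measurable.
- exact: bounded_measurable_integrable.
- exact: normal_integrable_exprn.
Qed.

Lemma brownian_increment_mean s t (xi : Omega -> R) : 0 <= s -> s <= t ->
  measurable_wrt (F s) xi -> (exists M : R, forall w, `|xi w| <= M) ->
  P.-integrable setT (fun w => (xi w * incr s t w)%:E) /\
  \int[P]_w (xi w * incr s t w) = 0.
Proof.
move=> s0; rewrite le_eqVlt => /orP[/eqP<-|st] mxi bxi.
  rewrite /incr; split.
    by apply: eq_integrable (integrable0 _ _) => // w _; rewrite subrr mulr0.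
  by rewrite Rintegral0_eq// => w _; rewrite subrr mulr0.
have [I E] := brownian_increment_exprn (k := 1) s0 st mxi bxi isT.
split; first exact: I.
rewrite E (_ : \int[normal_prob 0 (Num.sqrt (t - s))]_z (z ^+ 1) = 0) ?mulr0//.
by rewrite -[RHS](normal_mean (s := Num.sqrt (t - s))) ?sqrtr_gt0 ?subr_gt0.
Qed.

Lemma brownian_increment_sqr s t (xi : Omega -> R) : 0 <= s -> s <= t ->
  measurable_wrt (F s) xi -> (exists M : R, forall w, `|xi w| <= M) ->
  P.-integrable setT (fun w => (xi w * incr s t w ^+ 2)%:E) /\
  \int[P]_w (xi w * incr s t w ^+ 2) = \int[P]_w xi w * (t - s).
Proof.
move=> s0; rewrite le_eqVlt => /orP[/eqP<-|st] mxi bxi.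
  rewrite /incr; split.
    by apply: eq_integrable (integrable0 _ _) => // w _; rewrite subrr expr0n mulr0.
  by rewrite subrr mulr0 Rintegral0_eq// => w _; rewrite subrr expr0n mulr0.
have [I E] := brownian_increment_exprn (k := 2) s0 st mxi bxi isT.
split => //; rewrite E normal_second_moment ?sqrtr_gt0 ?subr_gt0//.
by rewrite sqr_sqrtr// subr_ge0 ltW.
Qed.

Lemma measurable_wrt_cst u (a : R) : 0 <= u -> measurable_wrt (F u) (fun=> a).
Proof.
move=> u0; have [sF _ _ _] := hF; have [sFu _] := sF u u0.
by apply/(measurable_wrtP sFu); exact: measurable_cst.
Qed.

Let one_bounded : exists M : R, forall w : Omega, `|1 : R| <= M.
Proof. by exists 1 => _; rewrite normr1. Qed.

Lemma brownian_increment_pow4 s t : 0 <= s -> s <= t ->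
  P.-integrable setT (fun w => (incr s t w ^+ 4)%:E) /\
  \int[P]_w (incr s t w ^+ 4) <= 3 * (t - s) ^+ 2.
Proof.
move=> s0; rewrite le_eqVlt => /orP[/eqP<-|st].
  rewrite /incr; split.
    by apply: eq_integrable (integrable0 _ _) => // w _; rewrite subrr expr0n.
  by rewrite subrr expr0n mulr0 Rintegral0_eq// => w _; rewrite subrr expr0n.
have [I E] := brownian_increment_exprn (xi := fun=> 1) (k := 4) s0 st (measurable_wrt_cst 1 s0) one_bounded isT.
split; first by apply: eq_integrable I => // w _; rewrite mul1r.
have <- : \int[P]_w (1 * incr s t w ^+ 4) = \int[P]_w (incr s t w ^+ 4).
  by apply: eq_Rintegral => w _; rewrite mul1r.
rewrite E expectation_cst mul1r.
apply: (le_trans (normal_fourth_moment _)); first by rewrite sqrtr_gt0 subr_gt0.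
by rewrite (exprM _ 2 2) sqr_sqrtr// subr_ge0 ltW.
Qed.

Lemma brownian_increment_norm s t : 0 <= s -> s <= t ->
  P.-integrable setT (fun w => `|incr s t w|%:E) /\
  \int[P]_w `|incr s t w| <= Num.sqrt (t - s).
Proof.
move=> s0 st.
have [I1 E1] := brownian_increment_mean (xi := fun=> 1) s0 st (measurable_wrt_cst 1 s0) one_bounded.
have [I2 E2] := brownian_increment_sqr (xi := fun=> 1) s0 st (measurable_wrt_cst 1 s0) one_bounded.
have I : P.-integrable setT (fun w => `|incr s t w|%:E).
  by apply: eq_integrable (integrable_abse I1) => // w _; rewrite /= mul1r.
split => //; move: st; rewrite le_eqVlt => /orP[/eqP st|st].
  rewrite -st subrr sqrtr0 Rintegral0_eq// => w _.
  by rewrite /incr subrr normr0.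
set q := Num.sqrt (t - s).
have q0 : 0 < q by rewrite sqrtr_gt0 subr_gt0.
have qq : q ^+ 2 = t - s by rewrite sqr_sqrtr// subr_ge0 ltW.
(* The inequality [|a| <= q / 2 + a^2 / (2 q)], with [q] the standard deviation, reduces the first
   absolute moment to the second moment. *)
apply: (@le_trans _ _ (\int[P]_w (2^-1 * q + (2 * q)^-1 * (1 * incr s t w ^+ 2)))).
  apply: le_Rintegral => //.
  - have -> : (EFin \o (fun w => 2^-1 * q + (2 * q)^-1 * (1 * incr s t w ^+ 2))) =
        ((fun=> (2^-1 * q)%:E) \+ (fun w => (2 * q)^-1%:E * (1 * incr s t w ^+ 2)%:E))%E by [].
    apply: integrableD => //; first exact: finite_measure_integrable_cst.
    exact: integrableZl.
  - move=> w _; rewrite mul1r -[incr s t w ^+ 2]real_normK ?num_real//.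
    set a := `|_|; rewrite -(ler_pM2l q0).
    have -> : q * (2^-1 * q + (2 * q)^-1 * a ^+ 2) = 2^-1 * (q ^+ 2 + a ^+ 2) by field; rewrite gt_eqF.
    by have := sqr_ge0 (q - a); rewrite sqrrB -mulr_natl; lra.
rewrite RintegralD//; [|exact: finite_measure_integrable_cst|].
  rewrite expectation_cst RintegralZl// E2 expectation_cst.
  by rewrite mul1r -qq le_eqVlt; apply/orP; left; apply/eqP; field; rewrite gt_eqF.
have -> : (EFin \o (fun w => (2 * q)^-1 * (1 * incr s t w ^+ 2))) =
        (fun w => (2 * q)^-1%:E * (1 * incr s t w ^+ 2)%:E)%E by [].
exact: integrableZl.
Qed.

End brownian_increments.

(** * The Ito formula in expectation for simple integrands *)

Section measurable_wrt_theory.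
Context {R : realType} {d : measure_display} {Omega : measurableType d}.
Implicit Types (S : set (set Omega)) (X Y : Omega -> R).

Lemma measurable_wrt_mono S S' X : S `<=` S' -> measurable_wrt S X -> measurable_wrt S' X.
Proof. by move=> SS mX B mB; apply: SS; exact: mX. Qed.

Lemma measurable_wrt_comp S (g : R -> R) X : measurable_fun setT g ->
  measurable_wrt S X -> measurable_wrt S (g \o X).
Proof.
move=> mg mX B mB; rewrite comp_preimage; apply: mX.
by rewrite -[X in measurable X]setTI; exact: mg.
Qed.

Lemma measurable_wrtM S X Y : sigma_algebra setT S ->
  measurable_wrt S X -> measurable_wrt S Y -> measurable_wrt S (fun w => X w * Y w).
Proof.
move=> sS /(measurable_wrtP sS) mX /(measurable_wrtP sS) mY.
by apply/(measurable_wrtP sS); exact: measurable_funM.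
Qed.

Lemma measurable_wrtD S X Y : sigma_algebra setT S ->
  measurable_wrt S X -> measurable_wrt S Y -> measurable_wrt S (fun w => X w + Y w).
Proof.
move=> sS /(measurable_wrtP sS) mX /(measurable_wrtP sS) mY.
by apply/(measurable_wrtP sS); exact: measurable_funD.
Qed.

End measurable_wrt_theory.

(* First-order exponential and second-order Taylor expansion of
   [e^{-k} h (x + B + c w) - h x] in the time step [dl] and the increment [w]. *)
Lemma ito_step_bound {R : realType} (h h1 h2 : R -> R) (A e L D0 k B c w dl x : R) :
  (forall x, is_derive x (1 : R) h (h1 x)) ->
  (forall x, is_derive x (1 : R) h1 (h2 x)) ->
  (forall y, `|h y| <= A) -> (forall y, `|h2 y| <= A) ->
  (forall z, `|h2 z - h2 x| <= e + L * (z - x) ^+ 2) ->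
  1 <= A -> 0 <= e -> 0 <= L -> 0 <= D0 <= 1 -> 0 <= k <= A * dl -> `|B| <= A * dl ->
  `|c| <= A -> 0 <= dl <= 1 ->
  `|D0 * expR (- k) * h (x + B + c * w) - D0 * h x
    - (D0 * h1 x * B + D0 * (2^-1 * h2 x * c ^+ 2) * dl - D0 * h (x + B + c * w) * k)
    - D0 * h1 x * c * w - D0 * (2^-1 * h2 x * c ^+ 2) * (w ^+ 2 - dl)|
  <= A ^+ 4 * (2 * dl ^+ 2 + dl * `|w| + 2 * e * (dl ^+ 2 + w ^+ 2)
               + 8 * L * (dl ^+ 2 + w ^+ 4)).
Proof.
move=> dh dh1 hA h2A h2e A1 e0 L0 /andP[D00 D01] /andP[k0 kA] BA cA /andP[dl0 dl1].
set y := x + B + c * w.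
have T := taylor2_le y dh dh1 L0 h2e.
set rho := h y - _ - _ - _ in T.
have A0 : 0 <= A by lra.
(* The error is the sum of the second-order remainder of the exponential, the Taylor remainder
   [rho], and the part of [(B + c w)^2] other than [c^2 w^2]. *)
have -> : D0 * expR (- k) * h y - D0 * h x
    - (D0 * h1 x * B + D0 * (2^-1 * h2 x * c ^+ 2) * dl - D0 * h y * k)
    - D0 * h1 x * c * w - D0 * (2^-1 * h2 x * c ^+ 2) * (w ^+ 2 - dl) =
    D0 * ((expR (- k) - 1 + k) * h y) + D0 * rho + D0 * (2^-1 * h2 x * (B ^+ 2 + 2 * (B * (c * w)))).
  rewrite /rho (_ : y - x = B + c * w); last by rewrite /y; ring.
  by ring.
have D0le z : `|D0 * z| <= `|z| by rewrite normrM ger0_norm// ler_piMl.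
have A2 : A ^+ 2 = A * A by rewrite expr2.
have A3 : 1 <= A ^+ 3 by rewrite exprn_ege1.
have A24 : A ^+ 2 <= A ^+ 4 by rewrite ler_weXn2l.
have A34 : A ^+ 3 <= A ^+ 4 by rewrite ler_weXn2l.
have ek : `|expR (- k) - 1 + k| <= k ^+ 2.
  have E1 := expR_ge1Dx (- k); have E2 := expR_ge1Dx k.
  have E3 : expR (- k) * expR k = 1 by rewrite -expRD addNr expR0.
  have E4 := expR_gt0 (- k).
  rewrite ger0_norm; last by lra.
  by nra.
have s2 (p q : R) : `|p| <= q -> p ^+ 2 <= q ^+ 2.
  move=> pq; have q0 : 0 <= q by apply: le_trans pq.
  by rewrite -[p ^+ 2]real_normK ?num_real// lerXn2r ?nnegrE.
have k2 : k ^+ 2 <= (A * dl) ^+ 2 by apply: s2; rewrite ger0_norm.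
have t1 : `|D0 * ((expR (- k) - 1 + k) * h y)| <= A ^+ 4 * dl ^+ 2.
  rewrite (le_trans (D0le _))// normrM (@le_trans _ _ ((A * dl) ^+ 2 * A))//.
    by apply: ler_pM => //; exact: le_trans k2.
  have -> : (A * dl) ^+ 2 * A = A ^+ 3 * dl ^+ 2 by ring.
  by rewrite ler_wpM2r// sqr_ge0.
have B2 : B ^+ 2 <= (A * dl) ^+ 2 by apply: s2.
have c2 : c ^+ 2 <= A ^+ 2 by apply: s2.
have yx2 : (y - x) ^+ 2 <= 2 * A ^+ 2 * (dl ^+ 2 + w ^+ 2).
  have -> : (y - x) ^+ 2 = (B + c * w) ^+ 2 by rewrite /y; ring.
  apply: (@le_trans _ _ (2 * B ^+ 2 + 2 * (c ^+ 2 * w ^+ 2))).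
    by have := sqr_ge0 (B - c * w); rewrite sqrrB sqrrD exprMn; lra.
  have : c ^+ 2 * w ^+ 2 <= A ^+ 2 * w ^+ 2 by rewrite ler_wpM2r// sqr_ge0.
  by move: B2; rewrite exprMn; lra.
have yx4 : (y - x) ^+ 2 * (y - x) ^+ 2 <= 8 * A ^+ 4 * (dl ^+ 2 + w ^+ 4).
  apply: (@le_trans _ _ ((2 * A ^+ 2 * (dl ^+ 2 + w ^+ 2)) ^+ 2)).
    by rewrite -expr2 lerXn2r// nnegrE ?sqr_ge0// !mulr_ge0// ?addr_ge0 ?sqr_ge0.
  have -> : (2 * A ^+ 2 * (dl ^+ 2 + w ^+ 2)) ^+ 2 = 4 * A ^+ 4 * (dl ^+ 2 + w ^+ 2) ^+ 2 by ring.
  have -> : 8 * A ^+ 4 * (dl ^+ 2 + w ^+ 4) = 4 * A ^+ 4 * (2 * (dl ^+ 2 + w ^+ 4)) by ring.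
  rewrite ler_wpM2l// ?mulr_ge0 ?exprn_ge0//.
  have d4 : dl ^+ 4 <= dl ^+ 2 by rewrite ler_wiXn2l.
  have := sqr_ge0 (dl ^+ 2 - w ^+ 2); rewrite sqrrB sqrrD -!exprM; move: d4; lra.
have t2 : `|D0 * rho| <= A ^+ 4 * (2 * e * (dl ^+ 2 + w ^+ 2) + 8 * L * (dl ^+ 2 + w ^+ 4)).
  rewrite (le_trans (D0le _))// (le_trans T)// mulrDl mulrDr lerD//.
    apply: (@le_trans _ _ (e * (2 * A ^+ 2 * (dl ^+ 2 + w ^+ 2)))); first by rewrite ler_wpM2l.
    have -> : e * (2 * A ^+ 2 * (dl ^+ 2 + w ^+ 2)) = A ^+ 2 * (2 * e * (dl ^+ 2 + w ^+ 2)) by ring.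
    by rewrite ler_wpM2r// !mulr_ge0// addr_ge0 ?sqr_ge0.
  rewrite -mulrA.
  have -> : A ^+ 4 * (8 * L * (dl ^+ 2 + w ^+ 4)) = L * (8 * A ^+ 4 * (dl ^+ 2 + w ^+ 4)) by ring.
  by rewrite ler_wpM2l.
have t3 : `|D0 * (2^-1 * h2 x * (B ^+ 2 + 2 * (B * (c * w))))| <= A ^+ 4 * (dl ^+ 2 + dl * `|w|).
  rewrite (le_trans (D0le _))// -mulrA normrM ger0_norm//.
  have Bcw : `|B * (c * w)| <= A ^+ 2 * (dl * `|w|).
    rewrite !normrM; have -> : A ^+ 2 * (dl * `|w|) = A * dl * (A * `|w|) by ring.
    by rewrite ler_pM// ler_wpM2r.
  have S : `|B ^+ 2 + 2 * (B * (c * w))| <= A ^+ 2 * (dl ^+ 2 + 2 * (dl * `|w|)).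
    rewrite (le_trans (ler_normD _ _))// (ger0_norm (sqr_ge0 _)) [`|2 * _|]normrM (ger0_norm (ler0n _ 2)).
    by move: B2 Bcw; rewrite exprMn; lra.
  rewrite normrM (@le_trans _ _ (2^-1 * (A * (A ^+ 2 * (dl ^+ 2 + 2 * (dl * `|w|))))))//.
    by rewrite ler_wpM2l// ler_pM.
  have q0 : 0 <= dl ^+ 2 + dl * `|w| by rewrite addr_ge0 ?sqr_ge0// mulr_ge0.
  apply: (@le_trans _ _ (A ^+ 3 * (dl ^+ 2 + dl * `|w|))); last by rewrite ler_wpM2r.
  have -> : 2^-1 * (A * (A ^+ 2 * (dl ^+ 2 + 2 * (dl * `|w|)))) = A ^+ 3 * (2^-1 * dl ^+ 2 + dl * `|w|) by field.
  rewrite ler_wpM2l//; first lra.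
  by have := sqr_ge0 dl; lra.
rewrite (le_trans (ler_normD _ _))// (le_trans (lerD (ler_normD _ _) (lexx _)))//.
by move: t1 t2 t3; lra.
Qed.

(* Time regularity of the generator integrand, frozen at the left end point
   except in the discount factor term. *)
Lemma ito_freeze_bound {R : realType} (h h1 h2 : R -> R)
   (A e L Du Dr bt kp c x y z dl w w' : R) :
  (forall x, is_derive x (1 : R) h (h1 x)) ->
  (forall x, is_derive x (1 : R) h1 (h2 x)) ->
  (forall y, `|h y| <= A) -> (forall y, `|h1 y| <= A) -> (forall y, `|h2 y| <= A) ->
  (forall z, `|h2 z - h2 x| <= e + L * (z - x) ^+ 2) ->
  1 <= A -> 0 <= e -> 0 <= L -> 0 <= Du <= 1 -> 0 <= Dr <= 1 -> `|Dr - Du| <= A * dl ->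
  `|bt| <= A -> `|kp| <= A -> `|c| <= A -> 0 <= dl ->
  `|y - x| <= A * dl + A * `|w| -> `|z - y| <= A * dl + A * `|w'| ->
  `|Dr * (h1 y * bt + 2^-1 * h2 y * c ^+ 2 - kp * h y) -
    (Du * h1 x * bt + Du * (2^-1 * h2 x * c ^+ 2) - Du * h z * kp)|
  <= A ^+ 4 * (5 * dl + `|w| + `|w'| + e + 2 * L * (dl ^+ 2 + w ^+ 2)).
Proof.
move=> dh dh1 hA h1A h2A h2e A1 e0 L0 /andP[Du0 Du1] /andP[Dr0 Dr1] DD bA kA cA dl0 yx zy.
have A0 : 0 <= A by lra.
have lip (f f' : R -> R) p q : (forall x, is_derive x (1 : R) f (f' x)) ->
    (forall x, `|f' x| <= A) -> `|f q - f p| <= A * `|q - p|.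
  move=> df fA; have [u _ ->] := @mean_value _ f f' p q df.
  by rewrite normrM ler_wpM2r.
have A24 : A ^+ 2 <= A ^+ 4 by rewrite ler_weXn2l.
have A34 : A ^+ 3 <= A ^+ 4 by rewrite ler_weXn2l.
have Du' : `|Du| <= 1 by rewrite ger0_norm.
have prod (f f' p q : R) : `|f| <= A -> `|f - f'| <= q ->
    `|Dr * f - Du * f'| <= A * (A * dl) + q.
  move=> fA ff; have -> : Dr * f - Du * f' = (Dr - Du) * f + Du * (f - f') by ring.
  rewrite (le_trans (ler_normD _ _))// !normrM lerD//.
    by rewrite mulrC ler_pM.
  by rewrite (le_trans _ ff)// ler_piMl.
set U := A * dl + A * `|w| in yx; set U' := A * dl + A * `|w'| in zy.
have p1 : `|Dr * h1 y - Du * h1 x| <= A * (A * dl) + A * U.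
  apply: prod => //; apply: (le_trans (lip h1 h2 _ _ dh1 h2A)).
  by rewrite ler_wpM2l.
have p3 : `|Dr * h y - Du * h z| <= A * (A * dl) + A * U'.
  apply: prod => //; apply: (le_trans (lip h h1 _ _ dh h1A)).
  by rewrite distrC ler_wpM2l.
have yx2 : (y - x) ^+ 2 <= 2 * A ^+ 2 * (dl ^+ 2 + w ^+ 2).
  have U0 : 0 <= U by apply: le_trans yx.
  apply: (@le_trans _ _ (U ^+ 2)).
    by rewrite -[(y - x) ^+ 2]real_normK ?num_real// lerXn2r ?nnegrE.
  rewrite -[w ^+ 2]real_normK ?num_real// /U.
  have -> : (A * dl + A * `|w|) ^+ 2 = A ^+ 2 * (dl + `|w|) ^+ 2 by ring.
  have -> : 2 * A ^+ 2 * (dl ^+ 2 + `|w| ^+ 2) = A ^+ 2 * (2 * (dl ^+ 2 + `|w| ^+ 2)) by ring.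
  rewrite ler_wpM2l ?sqr_ge0//.
  by have := sqr_ge0 (dl - `|w|); rewrite sqrrB sqrrD; lra.
have p2 : `|Dr * h2 y - Du * h2 x| <= A * (A * dl) + (e + L * (2 * A ^+ 2 * (dl ^+ 2 + w ^+ 2))).
  apply: prod => //; apply: (le_trans (h2e y)).
  by rewrite lerD2l ler_wpM2l.
have -> : Dr * (h1 y * bt + 2^-1 * h2 y * c ^+ 2 - kp * h y) -
    (Du * h1 x * bt + Du * (2^-1 * h2 x * c ^+ 2) - Du * h z * kp) =
    (Dr * h1 y - Du * h1 x) * bt + (Dr * h2 y - Du * h2 x) * (2^-1 * c ^+ 2) - (Dr * h y - Du * h z) * kp by ring.
have c2 : `|2^-1 * c ^+ 2| <= 2^-1 * A ^+ 2.
  rewrite normrM ger0_norm// ler_wpM2l// ger0_norm ?sqr_ge0//.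
  by rewrite -[c ^+ 2]real_normK ?num_real// lerXn2r ?nnegrE.
rewrite (le_trans (ler_normB _ _))// (le_trans (lerD (ler_normD _ _) (lexx _)))//.
rewrite !(normrM (_ - _)).
apply: (le_trans (lerD (lerD (ler_pM _ _ p1 bA) (ler_pM _ _ p2 c2)) (ler_pM _ _ p3 kA))) => //.
rewrite /U /U'.
have q1 : 0 <= dl + `|w| + `|w'| by rewrite !addr_ge0.
have q2 : 0 <= dl ^+ 2 + w ^+ 2 by rewrite addr_ge0 ?sqr_ge0.
have r1 : A ^+ 3 * (4 * dl + `|w| + `|w'|) <= A ^+ 4 * (4 * dl + `|w| + `|w'|).
  by rewrite ler_wpM2r// !addr_ge0// mulr_ge0.
have r2 : A ^+ 2 * e <= A ^+ 4 * e by rewrite ler_wpM2r.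
have r3 : 0 <= A ^+ 4 * dl by rewrite mulr_ge0// exprn_ge0.
have r4 : 0 <= A ^+ 4 * e by rewrite mulr_ge0// exprn_ge0.
have r5 : 0 <= A ^+ 4 * (L * (dl ^+ 2 + w ^+ 2)) by rewrite !mulr_ge0// exprn_ge0.
have -> : (A * (A * dl) + A * (A * dl + A * `|w|)) * A +
  (A * (A * dl) + (e + L * (2 * A ^+ 2 * (dl ^+ 2 + w ^+ 2)))) * (2^-1 * A ^+ 2) +
  (A * (A * dl) + A * (A * dl + A * `|w'|)) * A =
  A ^+ 3 * (4 * dl + `|w| + `|w'|) + 2^-1 * (A ^+ 4 * dl) + 2^-1 * (A ^+ 2 * e) + A ^+ 4 * (L * (dl ^+ 2 + w ^+ 2)) by field.
by lra.
Qed.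

Lemma adapted_joint_measurable_pair {R : realType} {d} {Omega : measurableType d}
  (f : R -> Omega -> R) (u : R) :
  measurable_fun [set: R * Omega] (fun z => f z.1 z.2) -> measurable_fun setT (f u).
Proof.
move=> mf; have := measurableT_comp mf (measurable_pair1 u : measurable_fun setT (pair u : Omega -> _)).
exact.
Qed.

(** Expectation of the bound of [ito_step_bound], with [E1] and [E4] standing for the first absolute
    and the fourth moment of the increment. As [dl <= 1], all terms without [e] are of order
    [dl * sqrt dl]. *)
Lemma ito_moment_arith1 {R : realType} (A4 e L dl E1 E4 : R) : 0 <= A4 -> 0 <= e -> 0 <= L ->
  0 <= dl -> dl <= 1 -> E1 <= Num.sqrt dl -> E4 <= 3 * dl ^+ 2 ->
  A4 * (2 * dl ^+ 2 + 2 * e * dl ^+ 2 + 8 * L * dl ^+ 2) + A4 * dl * E1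
    + A4 * (2 * e) * dl + A4 * (8 * L) * E4
  <= A4 * (4 * e + (3 + 32 * L) * Num.sqrt dl) * dl.
Proof.
move=> A40 e0 L0 dl0 dl1; set s := Num.sqrt dl => E1s E4s.
have s0 : 0 <= s by exact: sqrtr_ge0.
have s1 : s <= 1 by rewrite -[leRHS]sqrtr1 ler_wsqrtr.
have dls : dl <= s.
  by rewrite -[leLHS]sqr_sqrtr// expr2 ler_piMl.
have dd : dl ^+ 2 <= dl * s by rewrite expr2 ler_wpM2l.
have dd1 : dl ^+ 2 <= dl by rewrite expr2 ler_piMl.
have E4s' : E4 <= 3 * (dl * s) by rewrite (le_trans E4s)// ler_pM2l.
have x1 : e * dl ^+ 2 <= e * dl by rewrite ler_wpM2l.
have x2 : L * dl ^+ 2 <= L * (dl * s) by rewrite ler_wpM2l.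
have x3 : L * E4 <= L * (3 * (dl * s)) by rewrite ler_wpM2l.
have x4 : dl * E1 <= dl * s by rewrite ler_wpM2l.
have -> : A4 * (2 * dl ^+ 2 + 2 * e * dl ^+ 2 + 8 * L * dl ^+ 2) + A4 * dl * E1
    + A4 * (2 * e) * dl + A4 * (8 * L) * E4 =
  A4 * (2 * dl ^+ 2 + 2 * (e * dl ^+ 2) + 8 * (L * dl ^+ 2) + dl * E1 + 2 * (e * dl) + 8 * (L * E4)) by ring.
rewrite -mulrA ler_wpM2l//; move: x1 x2 x3 x4 dd; lra.
Qed.

(** The counterpart for [ito_freeze_bound], whose two increments run from [u] to [r] and from [r] to
    [v]. *)
Lemma ito_moment_arith2 {R : realType} (A4 e L u r v E1 E2 : R) : 0 <= A4 -> 0 <= L ->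
  v - u <= 1 -> u <= r -> r <= v -> E1 <= Num.sqrt (r - u) -> E2 <= Num.sqrt (v - r) ->
  A4 * (5 * (v - u) + e + 2 * L * (v - u) ^+ 2) + A4 * E1 + A4 * E2 + A4 * (2 * L) * (r - u)
  <= A4 * (e + (7 + 4 * L) * Num.sqrt (v - u)).
Proof.
move=> A40 L0 dl1 ur rv E1s E2s.
have dl0 : 0 <= v - u by rewrite subr_ge0 (le_trans ur).
have ru : r - u <= v - u by rewrite lerD2r.
have vr : v - r <= v - u by rewrite lerD2l lerN2.
have {}E1s : E1 <= Num.sqrt (v - u) by rewrite (le_trans E1s)// ler_wsqrtr.
have {}E2s : E2 <= Num.sqrt (v - u) by rewrite (le_trans E2s)// ler_wsqrtr.
move: E1s E2s; set s := Num.sqrt _ => E1s E2s.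
have s0 : 0 <= s by exact: sqrtr_ge0.
have s1 : s <= 1 by rewrite -[leRHS]sqrtr1 ler_wsqrtr.
have dls : v - u <= s by rewrite -[leLHS]sqr_sqrtr// expr2 ler_piMl.
have dd : (v - u) ^+ 2 <= s by rewrite (le_trans _ dls)// expr2 ler_piMl.
have x1 : L * (v - u) ^+ 2 <= L * s by rewrite ler_wpM2l.
have x2 : L * (r - u) <= L * s by rewrite ler_wpM2l// (le_trans ru).
have -> : A4 * (5 * (v - u) + e + 2 * L * (v - u) ^+ 2) + A4 * E1 + A4 * E2 + A4 * (2 * L) * (r - u) =
  A4 * (5 * (v - u) + e + 2 * (L * (v - u) ^+ 2) + E1 + E2 + 2 * (L * (r - u))) by ring.
rewrite ler_wpM2l//; move: x1 x2 dls E1s E2s; lra.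
Qed.

(** * Ito's formula in expectation on one time cell *)

Section ito_cell.
Context {R : realType} {d : measure_display} {Omega : measurableType d}.
Variables (P : probability Omega R) (F : R -> set (set Omega)) (W : R -> Omega -> R).
Hypotheses (hF : usual_filtration P F) (hW : continuous_brownian P F W).
Variables (h h1 h2 : R -> R) (A : R).
Hypotheses (A1 : 1 <= A)
  (dh : forall x, is_derive x (1 : R) h (h1 x))
  (dh1 : forall x, is_derive x (1 : R) h1 (h2 x))
  (ch2 : continuous h2)
  (hA : forall x, `|h x| <= A) (h1A : forall x, `|h1 x| <= A) (h2A : forall x, `|h2 x| <= A)
  (h2mod : forall e, 0 < e -> exists2 L, 0 <= L &
     forall y z, `|h2 z - h2 y| <= e + L * (z - y) ^+ 2).
Variables V D bt kp : R -> Omega -> R.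
Hypotheses (mV : measurable_fun [set: R * Omega] (fun z => V z.1 z.2))
  (mD : measurable_fun [set: R * Omega] (fun z => D z.1 z.2))
  (mb : measurable_fun [set: R * Omega] (fun z => bt z.1 z.2))
  (mk : measurable_fun [set: R * Omega] (fun z => kp z.1 z.2))
  (aV : adapted F V) (aD : adapted F D)
  (D01 : forall u w, 0 <= D u w <= 1)
  (btA : forall u w, `|bt u w| <= A) (kpA : forall u w, 0 <= kp u w <= A)
  (DE : forall u v w, 0 <= u -> u <= v ->
     D v w = D u w * expR (- \int[lebesgue_measure]_(r in `[u, v]) kp r w)).
Variables (s t : R) (c : Omega -> R).
Hypotheses (s0 : 0 <= s) (st : s <= t) (mc : measurable_wrt (F s) c)
  (cA : forall w, `|c w| <= A)
  (VE : forall u v w, s <= u -> u <= v -> v <= t ->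
     V v w = V u w + \int[lebesgue_measure]_(r in `[u, v]) bt r w + c w * (W v w - W u w)).
Local Notation mu := (@lebesgue_measure R).
Local Notation "''E' f" := (\int[P]_w f w) (at level 10, f at level 8).

Let J r w := D r w * (h1 (V r w) * bt r w + 2^-1 * h2 (V r w) * c w ^+ 2 - kp r w * h (V r w)).

Let ch : continuous h.
Proof. by move=> x; apply/differentiable_continuous/derivable1_diffP; have [] := dh x. Qed.
Let ch1 : continuous h1.
Proof. by move=> x; apply/differentiable_continuous/derivable1_diffP; have [] := dh1 x. Qed.

Let A0 : 0 <= A. Proof. by rewrite (le_trans _ A1). Qed.

Let mcT : measurable_fun setT c.
Proof.
have [sF _ _ _] := hF; have [_ Fm] := sF s s0.
exact: measurable_wrt_measurable Fm mc.
Qed.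

Let mJ : measurable_fun [set: R * Omega] (fun z => J z.1 z.2).
Proof.
have mcc : measurable_fun [set: R * Omega] (fun z => c z.2).
  by apply: measurableT_comp => //; exact: measurable_snd.
have mg (g : R -> R) : continuous g -> measurable_fun [set: R * Omega] (fun z => g (V z.1 z.2)).
  by move=> cg; apply: (measurableT_comp (continuous_measurable_fun cg) mV).
apply: measurable_funM => //; apply: measurable_funB; last first.
  by apply: measurable_funM => //; exact: mg.
apply: measurable_funD; first by apply: measurable_funM => //; exact: mg.
apply: measurable_funM; last exact: measurable_funX.
by apply: measurable_funM => //; exact: mg.
Qed.

Let c2A w : c w ^+ 2 <= A ^+ 2.
Proof. by rewrite -[c w ^+ 2]real_normK ?num_real// lerXn2r ?nnegrE. Qed.

Let JA r w : `|J r w| <= 3 * A ^+ 3.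
Proof.
have /andP[D0 D1] := D01 r w; have /andP[k0 k1] := kpA r w.
rewrite /J normrM (ger0_norm D0) (@le_trans _ _ (1 * (3 * A ^+ 3)))//; last by rewrite mul1r.
apply: ler_pM => //.
have A3 : A ^+ 2 <= A ^+ 3 by rewrite ler_weXn2l.
have b1 : `|h1 (V r w) * bt r w| <= A ^+ 2 by rewrite normrM expr2 ler_pM.
have b3 : `|kp r w * h (V r w)| <= A ^+ 2 by rewrite normrM expr2 ler_pM// ger0_norm.
have b2 : `|2^-1 * h2 (V r w) * c w ^+ 2| <= A ^+ 3.
  rewrite normrM (ger0_norm (sqr_ge0 _)) (_ : A ^+ 3 = A * A ^+ 2); last by rewrite exprS.
  rewrite ler_pM ?sqr_ge0//.
  rewrite normrM (@ger0_norm _ (2^-1))// -[leRHS]mul1r ler_pM// invf_le1//; lra.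
rewrite (le_trans (ler_normB _ _))// (le_trans (lerD (ler_normD _ _) (lexx _)))//.
by move: b1 b2 b3 A3; lra.
Qed.

Let g r := 'E (J r).

Let mg : measurable_fun [set: R] g.
Proof.
apply: (@measurable_Rintegral_param _ _ _ _ _ P (fun z => J z.2 z.1)) => //.
exact: (measurableT_comp mJ (@measurable_swap _ _ _ _)).
Qed.

Let bmJ r : bounded_measurable (J r).
Proof.
split; last by exists (3 * A ^+ 3) => w; exact: JA.
exact: (adapted_joint_measurable_pair (f := J)).
Qed.

Let gA r : `|g r| <= 3 * A ^+ 3.
Proof.
have [m _] := bmJ r; have iJ := bounded_measurable_integrable P (bmJ r).
apply: (le_trans (le_normr_Rintegral _ iJ)) => //.
rewrite -[leRHS](expectation_cst P); apply: le_Rintegral => //.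
- exact: integrable_abse iJ.
- exact: integrable_EFin_cst.
Qed.

Let ig a b : mu.-integrable `[a, b] (EFin \o g).
Proof.
apply: (bounded_integrable_itv (M := 3 * A ^+ 3)); last by move=> r _; exact: gA.
exact: measurable_funTS.
Qed.

Let ibt u v w : mu.-integrable `[u, v] (EFin \o (bt ^~ w)).
Proof.
apply: (bounded_integrable_itv (M := A)) => //.
apply: measurable_funTS.
exact: (measurableT_comp mb (measurable_pair2 w : measurable_fun setT (fun r : R => (r, w)))).
Qed.

Let ikp u v w : mu.-integrable `[u, v] (EFin \o (kp ^~ w)).
Proof.
apply: (bounded_integrable_itv (M := A)); last by move=> r _; have /andP[k0 k1] := kpA r w; rewrite ger0_norm.
apply: measurable_funTS.
exact: (measurableT_comp mk (measurable_pair2 w : measurable_fun setT (fun r : R => (r, w)))).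
Qed.

Let mu_itv u v : u <= v -> fine (mu `[u, v]%classic) = v - u.
Proof.
rewrite le_eqVlt lebesgue_measure_itv/= lte_fin => /orP[/eqP ->|->//].
by rewrite ltxx subrr.
Qed.

Let int_le (f : R -> R) (M u v : R) : u <= v -> mu.-integrable `[u, v] (EFin \o f) ->
  (forall r, u <= r <= v -> `|f r| <= M) -> `|\int[mu]_(r in `[u, v]) f r| <= M * (v - u).
Proof.
move=> uv fi fM; apply: (le_trans (le_normr_Rintegral _ fi)) => //.
rewrite -(mu_itv uv) -Rintegral_cst//; apply: le_Rintegral => //.
- exact: integrable_abse fi.
- apply: (bounded_integrable_itv (M := `|M|)) => //; exact: measurable_cst.
Qed.

(** The terms of order [sqrt dl] in the expansion are centred and disappear in expectation. What is
    left is [dl] times a quantity that is small as soon as [e], and then [dl], is small. *)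
Lemma ito_cell_increment (e L u v : R) : 0 < e -> 0 <= L ->
  (forall y z, `|h2 z - h2 y| <= e + L * (z - y) ^+ 2) ->
  s <= u -> u <= v -> v <= t -> v - u <= 1 ->
  `|'E (fun w => D v w * h (V v w)) - 'E (fun w => D u w * h (V u w))
    - \int[mu]_(r in `[u, v]) g r|
  <= A ^+ 4 * (5 * e + (10 + 36 * L) * Num.sqrt (v - u)) * (v - u).
Proof.
move=> e0 L0 h2e su uv vt; set dl := v - u => dl1.
have dl0 : 0 <= dl by rewrite subr_ge0.
have u0 : 0 <= u by exact: le_trans su.
have v0 : 0 <= v by exact: le_trans uv.
have [sF Fmono _ _] := hF; have [sFu Fm] := sF u u0.
have bm1 (f : R -> R) (r : R) : 0 <= r -> continuous f -> (forall x, `|f x| <= A) ->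
    bounded_measurable (fun w => f (V r w)).
  move=> r0 cf fA; split; last by exists A => w; exact: fA.
  exact: (measurableT_comp (continuous_measurable_fun cf) (adapted_measurable hF aV r0)).
have bmD r : 0 <= r -> bounded_measurable (D r).
  move=> r0; split; first exact: (adapted_measurable hF aD).
  by exists 1 => w; have /andP[? ?] := D01 r w; rewrite ger0_norm.
have bmc : bounded_measurable c by split => //; exists A.
have bmc2 : bounded_measurable (fun w => c w ^+ 2) by exact: bounded_measurableM.
(* The integrand frozen at time [u], except that the discount term carries [h] at time [v]: the
   factor [expR (- k)] in [D v] multiplies [h (V v w)]. *)
pose J0 r w := D u w * h1 (V u w) * bt r w + D u w * (2^-1 * h2 (V u w) * c w ^+ 2) - D u w * h (V v w) * kp r w.
pose a1 w := D u w * h1 (V u w) * c w.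
pose a2 w := D u w * (2^-1 * h2 (V u w) * c w ^+ 2).
pose dW w := W v w - W u w.
have mwc (f : R -> R) : continuous f -> measurable_wrt (F u) (fun w => f (V u w)).
  by move=> cf; apply: measurable_wrt_comp; [exact: continuous_measurable_fun|exact: aV].
have cFu : measurable_wrt (F u) c by apply: measurable_wrt_mono mc; exact: Fmono.
have ma1 : measurable_wrt (F u) a1.
  apply: measurable_wrtM => //; apply: measurable_wrtM => //; [exact: aD|exact: mwc].
have ma2 : measurable_wrt (F u) a2.
  apply: measurable_wrtM => //; first exact: aD.
  apply: measurable_wrtM => //; last exact: measurable_wrtM.
  apply: measurable_wrtM => //; [exact: measurable_wrt_cst hF _ _ u0|exact: mwc].
have bma1 : bounded_measurable a1.
  by apply: bounded_measurableM => //; apply: bounded_measurableM; [exact: bmD|exact: bm1].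
have bma2 : bounded_measurable a2.
  apply: bounded_measurableM; first exact: bmD.
  apply: bounded_measurableM => //; apply: bounded_measurableM; last exact: bm1.
  exact: bounded_measurable_cst.
have [i1 E1] := brownian_increment_mean hF hW u0 uv ma1 bma1.2.
have [i2 E2] := brownian_increment_sqr hF hW u0 uv ma2 bma2.2.
have [i4 E4] := brownian_increment_pow4 hF hW u0 uv.
have one_b : exists M : R, forall w : Omega, `|1 : R| <= M by exists 1 => _; rewrite normr1.
have [i2' E2'] := brownian_increment_sqr hF hW u0 uv (measurable_wrt_cst hF 1 u0) one_b.
have [i1' E1'] := brownian_increment_norm hF hW u0 uv.
have mbt r : measurable_fun setT (bt r) by exact: (adapted_joint_measurable_pair (f := bt)).
have mkp r : measurable_fun setT (kp r) by exact: (adapted_joint_measurable_pair (f := kp)).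
have bmJ0 r : bounded_measurable (J0 r).
  apply: bounded_measurableB; first apply: bounded_measurableD => //.
    apply: bounded_measurableM; first by apply: bounded_measurableM; [exact: bmD|exact: bm1].
    by split => //; exists A => w; exact: btA.
  apply: bounded_measurableM; first by apply: bounded_measurableM; [exact: bmD|exact: bm1].
  by split => //; exists A => w; have /andP[? ?] := kpA r w; rewrite ger0_norm.
pose int_J0 w := \int[mu]_(r in `[u, v]) J0 r w.
have int_J0E w : int_J0 w = D u w * h1 (V u w) * (\int[mu]_(r in `[u, v]) bt r w) + a2 w * dl - D u w * h (V v w) * (\int[mu]_(r in `[u, v]) kp r w).
  have j1 : mu.-integrable `[u, v] (EFin \o (fun r => D u w * h1 (V u w) * bt r w)) by apply: integrable_EFinZl.
  have i3 : mu.-integrable `[u, v] (EFin \o (fun r => D u w * h (V v w) * kp r w)) by apply: integrable_EFinZl.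
  have j2 : mu.-integrable `[u, v] (EFin \o (fun=> a2 w)).
    by apply: (bounded_integrable_itv (M := `|a2 w|)) => //; exact: measurable_cst.
  rewrite /int_J0 RintegralB//; last exact: (integrable_EFinD _ j1 j2).
  by rewrite (RintegralD _ j1 j2)// (RintegralZl _ _ (ibt u v w))// (RintegralZl _ _ (ikp u v w))// Rintegral_cst// mu_itv.
have mJ0 : measurable_fun [set: R * Omega] (fun z => J0 z.1 z.2).
  have msnd (f : Omega -> R) : measurable_fun setT f -> measurable_fun [set: R * Omega] (fun z => f z.2).
    by move=> mf; apply: (measurableT_comp mf); exact: measurable_snd.
  apply: measurable_funB; first apply: measurable_funD.
  - apply: measurable_funM => //; apply: (msnd (fun w => D u w * h1 (V u w))).
    by have [] := bounded_measurableM (bmD _ u0) (bm1 h1 _ u0 ch1 h1A).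
  - by apply: (msnd a2); case: bma2.
  - apply: measurable_funM => //; apply: (msnd (fun w => D u w * h (V v w))).
    by have [] := bounded_measurableM (bmD _ u0) (bm1 h _ v0 ch hA).
have J0A r w : `|J0 r w| <= 3 * A ^+ 3.
  have /andP[D0 D1] := D01 u w; have /andP[k0 k1] := kpA r w.
  have A3 : A ^+ 2 <= A ^+ 3 by rewrite ler_weXn2l.
  have Dle x : `|D u w * x| <= `|x| by rewrite normrM ger0_norm// ler_piMl.
  have b1 : `|D u w * h1 (V u w) * bt r w| <= A ^+ 2.
    by rewrite -mulrA (le_trans (Dle _))// normrM expr2 ler_pM.
  have b3 : `|D u w * h (V v w) * kp r w| <= A ^+ 2.
    by rewrite -mulrA (le_trans (Dle _))// normrM expr2 ler_pM// ger0_norm.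
  have b2 : `|D u w * (2^-1 * h2 (V u w) * c w ^+ 2)| <= A ^+ 3.
    rewrite (le_trans (Dle _))// normrM (ger0_norm (sqr_ge0 _)) (_ : A ^+ 3 = A * A ^+ 2); last by rewrite exprS.
    rewrite ler_pM ?sqr_ge0//.
    by rewrite normrM (@ger0_norm _ (2^-1))// -[leRHS]mul1r ler_pM// invf_le1// ler1n.
  rewrite /J0 (le_trans (ler_normB _ _))// (le_trans (lerD (ler_normD _ _) (lexx _)))//.
  apply: (le_trans (lerD (lerD b1 b2) b3)).
  have -> : 3 * A ^+ 3 = A ^+ 3 + A ^+ 3 + A ^+ 3 by ring.
  by rewrite !lerD.
have fubJ0 : 'E int_J0 = \int[mu]_(r in `[u, v]) 'E (J0 r).
  by exact: (@fubini_itv _ _ _ P u v (fun z => J0 z.1 z.2) (3 * A ^+ 3)).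
have bmint : bounded_measurable int_J0.
  split; first by apply: (@measurable_Rintegral_param _ _ _ _ _ mu (fun z => J0 z.1 z.2)).
  exists (3 * A ^+ 3 * (v - u)) => w; apply: int_le => //.
  apply: (bounded_integrable_itv (M := 3 * A ^+ 3)) => //.
  apply: measurable_funTS.
  exact: (measurableT_comp mJ0 (measurable_pair2 w : measurable_fun setT (fun r : R => (r, w)))).
(* The subtracted terms [a1 dW] and [a2 (dW^2 - dl)] have mean zero, as [a1] and [a2] are known at
   time [u]. They change nothing in expectation but make [X1] small pointwise. *)
pose X1 w := D v w * h (V v w) - D u w * h (V u w) - int_J0 w - a1 w * dW w - (a2 w * dW w ^+ 2 - a2 w * dl).
pose B1 w := A ^+ 4 * (2 * dl ^+ 2 + dl * `|dW w| + 2 * e * (dl ^+ 2 + dW w ^+ 2)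
               + 8 * L * (dl ^+ 2 + dW w ^+ 4)).
have X1B w : `|X1 w| <= B1 w.
  rewrite /X1 int_J0E (DE w u0 uv) (VE w su uv vt) -mulrBr.
  apply: ito_step_bound => //; first exact: ltW.
  - rewrite Rintegral_ge0; last by move=> r _; have /andP[] := kpA r w.
    apply: (le_trans (ler_norm _)); apply: int_le => // r _.
    by have /andP[? ?] := kpA r w; rewrite ger0_norm.
  - by apply: int_le => // r _.
  - by rewrite dl0.
have bmDh r : 0 <= r -> bounded_measurable (fun w => D r w * h (V r w)).
  by move=> r0; apply: bounded_measurableM; [exact: bmD|exact: bm1].
have iX1 : P.-integrable setT (EFin \o X1).
  rewrite /X1; apply: integrable_EFinB => //; last first.
    apply: integrable_EFinB => //; apply: bounded_measurable_integrable.
    by apply: bounded_measurableM => //; exact: bounded_measurable_cst.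
  apply: integrable_EFinB => //; apply: bounded_measurable_integrable.
  by apply: bounded_measurableB => //; apply: bounded_measurableB; exact: bmDh.
have EX1 : 'E X1 = 'E (fun w => D v w * h (V v w)) - 'E (fun w => D u w * h (V u w)) - \int[mu]_(r in `[u, v]) 'E (J0 r).
  have bI (f : Omega -> R) : bounded_measurable f -> P.-integrable setT (EFin \o f) by exact: bounded_measurable_integrable.
  have iv := bI _ (bmDh v v0); have iu := bI _ (bmDh u u0); have ia2 := bI _ bma2.
  have iI := bI _ bmint.
  have ia2d : P.-integrable setT (EFin \o (fun w => a2 w * dl)).
    by apply: bI; apply: bounded_measurableM => //; exact: bounded_measurable_cst.
  have ivu := integrable_EFinB measurableT iv iu.
  have ivuI := integrable_EFinB measurableT ivu iI.
  rewrite /X1 RintegralB//; [|exact: (integrable_EFinB measurableT ivuI i1)|exact: (integrable_EFinB measurableT i2 ia2d)].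
  rewrite (RintegralB measurableT ivuI i1) (RintegralB measurableT ivu iI) (RintegralB measurableT iv iu).
  rewrite (RintegralB measurableT i2 ia2d) (RintegralZr _ measurableT ia2) E1 E2 fubJ0.
  by rewrite subrr !subr0.
have iB1 : P.-integrable setT (EFin \o B1).
  have -> : B1 = (fun w => A ^+ 4 * (2 * dl ^+ 2 + 2 * e * dl ^+ 2 + 8 * L * dl ^+ 2) +
      A ^+ 4 * dl * `|dW w| + A ^+ 4 * (2 * e) * (1 * dW w ^+ 2) + A ^+ 4 * (8 * L) * dW w ^+ 4).
    by apply/funext => w; rewrite /B1; ring.
  apply: integrable_EFinD => //; last exact: integrable_EFinZl.
  apply: integrable_EFinD => //; last exact: integrable_EFinZl.
  apply: integrable_EFinD => //; last exact: integrable_EFinZl.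
  exact: finite_measure_integrable_cst.
have EB1 : 'E B1 <= A ^+ 4 * (4 * e + (3 + 32 * L) * Num.sqrt dl) * dl.
  have -> : B1 = (fun w => A ^+ 4 * (2 * dl ^+ 2 + 2 * e * dl ^+ 2 + 8 * L * dl ^+ 2) +
      A ^+ 4 * dl * `|dW w| + A ^+ 4 * (2 * e) * (1 * dW w ^+ 2) + A ^+ 4 * (8 * L) * dW w ^+ 4).
    by apply/funext => w; rewrite /B1; ring.
  have j0 := integrable_EFin_cst P (A ^+ 4 * (2 * dl ^+ 2 + 2 * e * dl ^+ 2 + 8 * L * dl ^+ 2)).
  have j1 := integrable_EFinZl measurableT (A ^+ 4 * dl) i1'.
  have j2 := integrable_EFinZl measurableT (A ^+ 4 * (2 * e)) i2'.
  have j4 := integrable_EFinZl measurableT (A ^+ 4 * (8 * L)) i4.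
  have j01 := integrable_EFinD measurableT j0 j1.
  have j012 := integrable_EFinD measurableT j01 j2.
  rewrite (RintegralD measurableT j012 j4) (RintegralD measurableT j01 j2) (RintegralD measurableT j0 j1).
  rewrite (RintegralZl _ measurableT i1') (RintegralZl _ measurableT i2') (RintegralZl _ measurableT i4).
  rewrite E2' !expectation_cst mul1r.
  by apply: ito_moment_arith1 => //; [exact: exprn_ge0|exact: ltW].
have JJ0 r : u <= r <= v -> `|g r - 'E (J0 r)| <= A ^+ 4 * (e + (7 + 4 * L) * Num.sqrt dl).
  move=> /andP[ur rv].
  have r0 : 0 <= r by exact: le_trans ur.
  have iJ := bounded_measurable_integrable P (bmJ r).
  have iJ0 := bounded_measurable_integrable P (bmJ0 r).
  rewrite /g -RintegralB//.
  apply: (le_trans (le_normr_Rintegral _ (integrable_EFinB measurableT iJ iJ0))) => //.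
  have [k1 K1] := brownian_increment_norm hF hW u0 ur.
  have [k2 K2] := brownian_increment_norm hF hW r0 rv.
  have [k3 K3] := brownian_increment_sqr hF hW u0 ur (measurable_wrt_cst hF 1 u0) one_b.
  have j0 := integrable_EFin_cst P (A ^+ 4 * (5 * dl + e + 2 * L * dl ^+ 2)).
  have j1 := integrable_EFinZl measurableT (A ^+ 4) k1.
  have j2 := integrable_EFinZl measurableT (A ^+ 4) k2.
  have j3 := integrable_EFinZl measurableT (A ^+ 4 * (2 * L)) k3.
  have j01 := integrable_EFinD measurableT j0 j1.
  have j012 := integrable_EFinD measurableT j01 j2.
  have j0123 := integrable_EFinD measurableT j012 j3.
  apply: (@le_trans _ _ (\int[P]_w (A ^+ 4 * (5 * dl + e + 2 * L * dl ^+ 2) +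
      A ^+ 4 * `|W r w - W u w| + A ^+ 4 * `|W v w - W r w| + A ^+ 4 * (2 * L) * (1 * (W r w - W u w) ^+ 2)))).
    apply: le_Rintegral => //; first exact: integrable_abse (integrable_EFinB measurableT iJ iJ0).
    move=> w _.
    apply: (@le_trans _ _ (A ^+ 4 * (5 * dl + `|W r w - W u w| + `|W v w - W r w| + e + 2 * L * (dl ^+ 2 + (W r w - W u w) ^+ 2)))); last first.
      by rewrite le_eqVlt; apply/orP; left; apply/eqP; ring.
    have /andP[k0' k1'] := kpA r w; have /andP[D0 D1] := D01 u w.
    have rudl : r - u <= dl by rewrite lerD2r.
    have vrdl : v - r <= dl by rewrite lerD2l lerN2.
    apply: (ito_freeze_bound dh dh1) => //; first exact: ltW.
    - rewrite (DE w u0 ur) -{2}(mulr1 (D u w)) -mulrBr normrM ger0_norm//.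
      have kk0 : 0 <= \int[mu]_(r0 in `[u, r]) kp r0 w.
        by apply: Rintegral_ge0 => q _; have /andP[] := kpA q w.
      have kk1 : \int[mu]_(r0 in `[u, r]) kp r0 w <= A * dl.
        apply: (le_trans (ler_norm _)); apply: (@le_trans _ _ (A * (r - u))).
          apply: int_le => // q _; have /andP[? ?] := kpA q w; by rewrite ger0_norm.
        by rewrite ler_wpM2l.
      set kk := \int[mu]_(r0 in _) _ in kk0 kk1 *.
      rewrite (@le_trans _ _ (1 * kk))//; last by rewrite mul1r.
      rewrite ler_pM// ler0_norm ?subr_le0 ?expR_le1 ?oppr_le0//.
      by rewrite opprB lerBlDr -lerBlDl; exact: expR_ge1Dx.
    - by rewrite ger0_norm.
    - rewrite (VE w su ur (le_trans rv vt)).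
      rewrite (_ : _ - _ = \int[mu]_(q in `[u, r]) bt q w + c w * (W r w - W u w)); last by ring.
      rewrite (le_trans (ler_normD _ _))// lerD//; last by rewrite normrM ler_wpM2r.
      apply: (@le_trans _ _ (A * (r - u))); first by apply: int_le => // q _.
      by rewrite ler_wpM2l.
    - rewrite (VE w (le_trans su ur) rv vt).
      rewrite (_ : _ - _ = \int[mu]_(q in `[r, v]) bt q w + c w * (W v w - W r w)); last by ring.
      rewrite (le_trans (ler_normD _ _))// lerD//; last by rewrite normrM ler_wpM2r.
      apply: (@le_trans _ _ (A * (v - r))); first by apply: int_le => // q _.
      by rewrite ler_wpM2l.
  rewrite (RintegralD measurableT j012 j3) (RintegralD measurableT j01 j2) (RintegralD measurableT j0 j1).
  rewrite (RintegralZl _ measurableT k1) (RintegralZl _ measurableT k2) (RintegralZl _ measurableT k3).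
  rewrite K3 !expectation_cst mul1r.
  by apply: ito_moment_arith2 => //; exact: exprn_ge0.
have iEJ0 : mu.-integrable `[u, v] (EFin \o (fun r => 'E (J0 r))).
  apply: (bounded_integrable_itv (M := 3 * A ^+ 3)).
    apply: measurable_funTS; apply: (@measurable_Rintegral_param _ _ _ _ _ P (fun z => J0 z.2 z.1)) => //.
    exact: (measurableT_comp mJ0 (@measurable_swap _ _ _ _)).
  move=> r _; have [m _] := bmJ0 r; have iJ := bounded_measurable_integrable P (bmJ0 r).
  apply: (le_trans (le_normr_Rintegral _ iJ)) => //.
  rewrite -[leRHS](expectation_cst P); apply: le_Rintegral => //.
  - exact: integrable_abse iJ.
  - exact: finite_measure_integrable_cst.
have -> : 'E (fun w => D v w * h (V v w)) - 'E (fun w => D u w * h (V u w)) - \int[mu]_(r in `[u, v]) g r =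
   'E X1 - (\int[mu]_(r in `[u, v]) (g r - 'E (J0 r))).
  have cancel (a b' c' d' : R) : a - b' - d' = a - b' - c' - (d' - c') by ring.
  by rewrite EX1 RintegralB//; exact: cancel.
rewrite (le_trans (ler_normB _ _))//.
have b1 : `|'E X1| <= A ^+ 4 * (4 * e + (3 + 32 * L) * Num.sqrt dl) * dl.
  apply: (le_trans (le_normr_Rintegral _ iX1)) => //; apply: le_trans EB1.
  by apply: le_Rintegral => //; exact: integrable_abse iX1.
have b2 : `|\int[mu]_(r in `[u, v]) (g r - 'E (J0 r))| <= A ^+ 4 * (e + (7 + 4 * L) * Num.sqrt dl) * dl.
  apply: int_le => //; exact: integrable_EFinB.
apply: (le_trans (lerD b1 b2)).
by rewrite le_eqVlt; apply/orP; left; apply/eqP; ring.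
Qed.

Lemma ito_cell :
  'E (fun w => D t w * h (V t w)) - 'E (fun w => D s w * h (V s w)) =
  \int[mu]_(r in `[s, t]) 'E (fun w => D r w * (h1 (V r w) * bt r w
      + 2^-1 * h2 (V r w) * c w ^+ 2 - kp r w * h (V r w))).
Proof.
pose H u := 'E (fun w => D u w * h (V u w)) - \int[mu]_(r in `[s, u]) g r.
have : H t = H s.
  apply: eq_of_little_increments => // e e0.
  have A4 : 1 <= A ^+ 4 by rewrite exprn_ege1.
  have A40 : 0 < A ^+ 4 by rewrite (lt_le_trans _ A4).
  (* [e / (10 A^4)] and [q] are chosen so that the two terms of the bound in [ito_cell_increment]
     contribute at most [e / 2] each; steps of length at most [q^2] have square root at most [q]. *)
  have e'0 : 0 < e / (10 * A ^+ 4) by rewrite divr_gt0// mulr_gt0.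
  have [L L0 h2e] := h2mod e'0.
  set K := 10 + 36 * L; have K0 : 0 < K by rewrite /K; lra.
  set q := e / (2 * A ^+ 4 * K).
  have q0 : 0 < q by rewrite divr_gt0// mulr_gt0// mulr_gt0.
  exists (Num.min 1 (q ^+ 2)); first by rewrite lt_min ltr01 exprn_gt0.
  move=> u v su uv vt; rewrite le_min => /andP[d1 dq].
  have sq : Num.sqrt (v - u) <= q.
    by rewrite -(ger0_norm (ltW q0)) -sqrtr_sqr ler_wsqrtr.
  have := ito_cell_increment e'0 L0 h2e su uv vt d1.
  rewrite /H (@Rintegral_itv_split _ s u v)//.
  have cancel (a b i1 i2 : R) : a - (i1 + i2) - (b - i1) = a - b - i2 by ring.
  rewrite cancel.
  move=> /le_trans; apply; rewrite ler_wpM2r ?subr_ge0//.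
  have E5 (B4 : R) : 0 < B4 -> e = B4 * (5 * (e / (10 * B4)) + K * (e / (2 * B4 * K))).
    by move=> B0; field; rewrite !gt_eqF.
  rewrite [leRHS](E5 _ A40).
  by rewrite ler_wpM2l ?(ltW A40)// lerD2l ler_wpM2l// ltW.
rewrite /H => /eqP; rewrite subr_eq => /eqP ->.
have -> : \int[mu]_(r in `[s, s]) g r = 0.
  by rewrite set_itv1 Rintegral_set1.
by rewrite subr0 addrAC subrr add0r.
Qed.

End ito_cell.

(** Points are first clamped to [0, T]; for a point outside, the alternative holds trivially. After
    sorting, no point lies strictly between two consecutive ones. Repeated points give degenerate
    cells, which are harmless. *)
Lemma partition_refining {R : realType} (T : R) (s : seq R) : 0 <= T ->
  exists n (u : nat -> R), [/\ u 0 = 0, u n = T, forall k, u k <= u k.+1,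
    forall k, 0 <= u k <= T
    & forall p k, p \in s -> (k < n)%N -> p <= u k \/ u k.+1 <= p].
Proof.
move=> T0.
pose cl p := Num.max 0 (Num.min p T).
have cl01 p : 0 <= cl p <= T by rewrite /cl le_max lexx/= ge_max T0 ge_min lexx orbT.
pose l := sort <=%R (0 :: T :: map cl s).
have ls : sorted <=%R l by exact: sort_le_sorted.
have lmem p : (p \in l) = (p \in 0 :: T :: map cl s) by rewrite mem_sort.
have l01 p : p \in l -> 0 <= p <= T.
  rewrite lmem !inE => /or3P[/eqP->|/eqP->|/mapP[q _ ->]]; [by rewrite lexx T0|by rewrite lexx T0|exact: cl01].
have sl : (0 < size l)%N by rewrite size_sort.
have le_nth i j : (i <= j)%N -> (j < size l)%N -> nth T l i <= nth T l j.
  move=> ij jl; apply: (sorted_leq_nth le_trans lexx T ls) => //; rewrite inE//.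
  exact: leq_ltn_trans jl.
have nth01 i : 0 <= nth T l i <= T.
  have [il|li] := ltnP i (size l); first by apply: l01; exact: mem_nth.
  by rewrite nth_default// T0 lexx.
exists (size l).-1, (nth T l); split.
- apply/eqP; rewrite eq_le; apply/andP; split; last by have /andP[] := nth01 0%N.
  have l0 : 0 \in l by rewrite lmem inE eqxx.
  by rewrite -[X in _ <= X](nth_index T l0) le_nth// index_mem.
- apply/eqP; rewrite eq_le; apply/andP; split; first by have /andP[] := nth01 (size l).-1.
  have lT : T \in l by rewrite lmem !inE eqxx orbT.
  rewrite -[X in X <= _](nth_index T lT) le_nth//; last by rewrite prednK.
  by rewrite -ltnS prednK// index_mem.
- move=> k; have [kl|lk] := ltnP k.+1 (size l); first by rewrite le_nth.
  by rewrite [leRHS]nth_default//; have /andP[] := nth01 k.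
- exact: nth01.
- move=> p k ps kn.
  have pl : cl p \in l by rewrite lmem !inE map_f ?orbT.
  have il : (index (cl p) l < size l)%N by rewrite index_mem.
  have pE : cl p = nth T l (index (cl p) l) by rewrite nth_index.
  have kl : (k.+1 < size l)%N by rewrite -ltn_predRL.
  have [ik|ki] := leqP (index (cl p) l) k.
    have cu : cl p <= nth T l k by rewrite pE le_nth// ltnW.
    have [pT|Tp] := leP p T.
      by left; apply: le_trans cu; rewrite /cl min_l// le_max lexx orbT.
    right; apply: le_trans (ltW Tp); by have /andP[] := nth01 k.+1.
  have cu : nth T l k.+1 <= cl p by rewrite pE le_nth.
  have [p0|p0] := ltP 0 p.
    right; apply: (le_trans cu); rewrite /cl max_r; first by rewrite ge_min lexx.
    by rewrite le_min (ltW p0) T0.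
  left; apply: (le_trans p0); by have /andP[] := nth01 k.
Qed.

Section ito_partition.
Context {R : realType} {d : measure_display} {Omega : measurableType d}.
Variables (P : probability Omega R) (F : R -> set (set Omega)) (W : R -> Omega -> R).
Hypotheses (hF : usual_filtration P F) (hW : continuous_brownian P F W).
Variables (h h1 h2 : R -> R) (A : R).
Hypotheses (A1 : 1 <= A)
  (dh : forall x, is_derive x (1 : R) h (h1 x))
  (dh1 : forall x, is_derive x (1 : R) h1 (h2 x))
  (ch2 : continuous h2)
  (hA : forall x, `|h x| <= A) (h1A : forall x, `|h1 x| <= A) (h2A : forall x, `|h2 x| <= A)
  (h2mod : forall e, 0 < e -> exists2 L, 0 <= L &
     forall y z, `|h2 z - h2 y| <= e + L * (z - y) ^+ 2).
Variables V D bt kp : R -> Omega -> R.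
Hypotheses (mV : measurable_fun [set: R * Omega] (fun z => V z.1 z.2))
  (mD : measurable_fun [set: R * Omega] (fun z => D z.1 z.2))
  (mb : measurable_fun [set: R * Omega] (fun z => bt z.1 z.2))
  (mk : measurable_fun [set: R * Omega] (fun z => kp z.1 z.2))
  (aV : adapted F V) (aD : adapted F D)
  (D01 : forall u w, 0 <= D u w <= 1)
  (btA : forall u w, `|bt u w| <= A) (kpA : forall u w, 0 <= kp u w <= A)
  (DE : forall u v w, 0 <= u -> u <= v ->
     D v w = D u w * expR (- \int[lebesgue_measure]_(r in `[u, v]) kp r w)).
Variables (n : nat) (u : nat -> R) (c S : R -> Omega -> R) (cc : nat -> Omega -> R).
Hypotheses (u0 : u 0 = 0) (und : forall k, u k <= u k.+1)
  (mcc : forall k, (k < n)%N -> measurable_wrt (F (u k)) (cc k))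
  (ccA : forall k w, `|cc k w| <= A)
  (VE : forall k v1 v2 w, (k < n)%N -> u k <= v1 -> v1 <= v2 -> v2 <= u k.+1 ->
     V v2 w = V v1 w + \int[lebesgue_measure]_(r in `[v1, v2]) bt r w + cc k w * (W v2 w - W v1 w))
  (mS : measurable_fun [set: R * Omega] (fun z => S z.1 z.2))
  (SA : forall s w, `|S s w| <= A)
  (SE : forall k s w, (k < n)%N -> u k < s <= u k.+1 -> S s w = cc k w).
Local Notation mu := (@lebesgue_measure R).
Local Notation "''E' f" := (\int[P]_w f w) (at level 10, f at level 8).

Let J r w := D r w * (h1 (V r w) * bt r w + 2^-1 * h2 (V r w) * S r w ^+ 2 - kp r w * h (V r w)).

Let ch : continuous h.
Proof. by move=> x; apply/differentiable_continuous/derivable1_diffP; have [] := dh x. Qed.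
Let ch1 : continuous h1.
Proof. by move=> x; apply/differentiable_continuous/derivable1_diffP; have [] := dh1 x. Qed.

Let A0 : 0 <= A. Proof. by rewrite (le_trans _ A1). Qed.

Lemma ito_integrand_measurable : measurable_fun [set: R * Omega] (fun z => J z.1 z.2).
Proof.
have mg (g : R -> R) : continuous g -> measurable_fun [set: R * Omega] (fun z => g (V z.1 z.2)).
  by move=> cg; apply: (measurableT_comp (continuous_measurable_fun cg) mV).
apply: measurable_funM => //; apply: measurable_funB; last first.
  by apply: measurable_funM => //; exact: mg.
apply: measurable_funD; first by apply: measurable_funM => //; exact: mg.
apply: measurable_funM; last exact: measurable_funX.
by apply: measurable_funM => //; exact: mg.
Qed.

Lemma ito_integrand_le r w :
  `|J r w| <= 2 * A ^+ 2 + A * S r w ^+ 2.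
Proof.
have /andP[D0 D1] := D01 r w; have /andP[k0 k1] := kpA r w.
have q0 : 0 <= 2 * A ^+ 2 + A * S r w ^+ 2.
  by apply: addr_ge0; apply: mulr_ge0 => //; exact: sqr_ge0.
rewrite /J normrM (ger0_norm D0) -[leRHS]mul1r; apply: ler_pM => //.
have b1 : `|h1 (V r w) * bt r w| <= A ^+ 2 by rewrite normrM expr2 ler_pM.
have b3 : `|kp r w * h (V r w)| <= A ^+ 2 by rewrite normrM expr2 ler_pM// ger0_norm.
have b2 : `|2^-1 * h2 (V r w) * S r w ^+ 2| <= A * S r w ^+ 2.
  rewrite normrM (ger0_norm (sqr_ge0 _)) ler_wpM2r ?sqr_ge0//.
  rewrite normrM (@ger0_norm _ (2^-1))// -[leRHS]mul1r ler_pM// invf_le1//; lra.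
rewrite (le_trans (ler_normB _ _))// (le_trans (lerD (ler_normD _ _) (lexx _)))//.
by move: b1 b2 b3; lra.
Qed.

Let JA r w : `|J r w| <= 3 * A ^+ 3.
Proof.
apply: (le_trans (ito_integrand_le r w)).
have A3 : A ^+ 2 <= A ^+ 3 by rewrite ler_weXn2l.
have S2 : A * S r w ^+ 2 <= A ^+ 3.
  rewrite (_ : A ^+ 3 = A * A ^+ 2); last by rewrite exprS.
  rewrite ler_wpM2l// -[S r w ^+ 2]real_normK ?num_real// lerXn2r ?nnegrE//.
by move: A3 S2; lra.
Qed.

Let g r := 'E (J r).

Let ig a b : mu.-integrable `[a, b] (EFin \o g).
Proof.
apply: (bounded_integrable_itv (M := 3 * A ^+ 3)).
  apply: measurable_funTS; apply: (@measurable_Rintegral_param _ _ _ _ _ P (fun z => J z.2 z.1)) => //.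
  exact: (measurableT_comp ito_integrand_measurable (@measurable_swap _ _ _ _)).
move=> r _.
have bJ : bounded_measurable (J r).
  split; last by exists (3 * A ^+ 3) => w; exact: JA.
  exact: (adapted_joint_measurable_pair (f := J) r ito_integrand_measurable).
have iJ := bounded_measurable_integrable P bJ; have [m _] := bJ.
apply: (le_trans (le_normr_Rintegral _ iJ)) => //.
rewrite -[leRHS](expectation_cst P); apply: le_Rintegral => //.
- exact: integrable_abse iJ.
- exact: integrable_EFin_cst.
Qed.

Let u_ge0 k : 0 <= u k.
Proof. by elim: k => [|k IH]; [rewrite u0|rewrite (le_trans IH)]. Qed.

Lemma ito_partition :
  'E (fun w => D (u n) w * h (V (u n) w)) - 'E (fun w => D 0 w * h (V 0 w)) =
  \int[mu]_(r in `[0, u n]) 'E (J r).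
Proof.
rewrite -/g; suff H k : (k <= n)%N ->
  'E (fun w => D (u k) w * h (V (u k) w)) - 'E (fun w => D 0 w * h (V 0 w)) =
  \int[mu]_(r in `[0, u k]) g r by exact: H.
elim: k => [_|k IH kn]; first by rewrite u0 subrr set_itv1 Rintegral_set1.
rewrite (Rintegral_itv_split (u_ge0 k) (und k) (ig _ _)) -(IH (ltnW kn)).
have C := ito_cell hF hW A1 dh dh1 ch2 hA h1A h2A h2mod mV mD mb mk aV aD D01 btA kpA DE
  (u_ge0 k) (und k) (mcc kn) (ccA k) (fun v1 v2 w => @VE k v1 v2 w kn).
have -> : \int[mu]_(r in `[u k, u k.+1]) g r = \int[mu]_(r in `[u k, u k.+1])
   'E (fun w => D r w * (h1 (V r w) * bt r w + 2^-1 * h2 (V r w) * cc k w ^+ 2 - kp r w * h (V r w))).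
  (* [S] equals [cc k] only on the half-open cell; its value at the left end belongs to the previous
     cell, but a single point does not affect the integral. *)
  have gE : {in `]u k, u k.+1]%classic, g =1 (fun r => 'E (fun w => D r w * (h1 (V r w) * bt r w + 2^-1 * h2 (V r w) * cc k w ^+ 2 - kp r w * h (V r w))))}.
    move=> r; rewrite inE/= in_itv/= => rk; apply: eq_Rintegral => w _.
    by rewrite /J (SE w kn rk).
  have ig' : mu.-integrable `]u k, u k.+1] (EFin \o g).
    by apply: integrableS (ig (u k) (u k.+1)) => //; apply: subset_itvr; rewrite bnd_simp.
  rewrite -(Rintegral_itv_obnd_cbnd ig') -Rintegral_itv_obnd_cbnd.
    exact: eq_Rintegral.
  apply: eq_integrable ig' => // r rk /=; by rewrite gE.
by rewrite -C; ring.
Qed.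

End ito_partition.

Section path_integrals.
Context {R : realType}.
Local Notation mu := (@lebesgue_measure R).

Lemma lipschitz_increments_continuous (f : R -> R) (M : R) :
  (forall s t, s <= t -> `|f t - f s| <= M * (t - s)) -> continuous f.
Proof.
move=> H x; apply/cvgrPdist_le => e e0.
have M1 : 0 < `|M| + 1 by rewrite ltr_wpDl.
near=> y.
have yx : `|x - y| <= e / (`|M| + 1).
  by near: y; apply: cvgr_dist_le => //; exact: divr_gt0.
have HM s t : s <= t -> `|f t - f s| <= (`|M| + 1) * (t - s).
  move=> st; rewrite (le_trans (H s t st))// ler_wpM2r ?subr_ge0//.
  by rewrite (le_trans (ler_norm _))// lerDl.
apply: (@le_trans _ _ ((`|M| + 1) * `|x - y|)); last by rewrite mulrC -ler_pdivlMr.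
have [xy|/ltW yx'] := leP x y.
  by rewrite distrC (distrC x) (ger0_norm (_ : 0 <= y - x)) ?subr_ge0//; exact: HM.
by rewrite (ger0_norm (_ : 0 <= x - y)) ?subr_ge0//; exact: HM.
Unshelve. all: by end_near. Qed.

Lemma lebesgue_measure_segment (u v : R) : u <= v -> fine (mu `[u, v]%classic) = v - u.
Proof.
rewrite le_eqVlt lebesgue_measure_itv/= lte_fin => /orP[/eqP ->|->//].
by rewrite ltxx subrr.
Qed.

Lemma normr_Rintegral_itv_le (f : R -> R) (M u v : R) : u <= v -> mu.-integrable `[u, v] (EFin \o f) ->
  (forall r, u <= r <= v -> `|f r| <= M) -> `|\int[mu]_(r in `[u, v]) f r| <= M * (v - u).
Proof.
move=> uv fi fM; apply: (le_trans (le_normr_Rintegral _ fi)) => //.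
rewrite -(lebesgue_measure_segment uv) -Rintegral_cst//; apply: le_Rintegral => //.
- exact: integrable_abse fi.
- apply: (bounded_integrable_itv (M := `|M|)) => //; exact: measurable_cst.
Qed.

Lemma integral_itv_continuous (f : R -> R) (M : R) : measurable_fun setT f ->
  (forall s, `|f s| <= M) -> continuous (fun t : R => \int[mu]_(s in `[0, t]) f s).
Proof.
move=> mf fM; apply: (lipschitz_increments_continuous (M := M)) => s t st.
have fi a b : mu.-integrable `[a, b] (EFin \o f).
  by apply: (bounded_integrable_itv (M := M)) => //; exact: measurable_funTS.
have M0 : 0 <= M by rewrite (le_trans _ (fM 0)).
have [s0|s0] := leP 0 s.
  by rewrite (Rintegral_itv_split s0 st)// addrC addKr normr_Rintegral_itv_le.
rewrite [X in _ - X](_ : _ = 0) ?subr0; last first.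
  by rewrite set_itv_ge ?Rintegral_set0// bnd_simp -ltNge.
have [t0|t0] := leP 0 t; last first.
  by rewrite set_itv_ge ?Rintegral_set0 ?normr0 ?mulr_ge0 ?subr_ge0// bnd_simp -ltNge.
apply: (@le_trans _ _ (M * (t - 0))); first exact: normr_Rintegral_itv_le.
by rewrite ler_wpM2l// subr0 lerDl oppr_ge0 ltW.
Qed.

Lemma step_integral (u : nat -> R) (n : nat) (f : R -> R) (a : nat -> R) (M : R) :
  (forall k, u k <= u k.+1) -> measurable_fun setT f -> (forall s, `|f s| <= M) ->
  (forall k s, (k < n)%N -> u k < s <= u k.+1 -> f s = a k) ->
  \int[mu]_(s in `[u 0, u n]) f s = \sum_(k < n) a k * (u k.+1 - u k).
Proof.
move=> und mf fM fa.
have fi v1 v2 : mu.-integrable `[v1, v2] (EFin \o f).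
  by apply: (bounded_integrable_itv (M := M)) => //; exact: measurable_funTS.
have u0 k : u 0 <= u k by elim: k => // k IH; exact: le_trans (und k).
suff H k : (k <= n)%N -> \int[mu]_(s in `[u 0, u k]) f s = \sum_(l < k) a l * (u l.+1 - u l) by exact: H.
elim: k => [_|k IH kn]; first by rewrite big_ord0 set_itv1 Rintegral_set1.
rewrite (Rintegral_itv_split (u0 k) (und k))// IH ?(ltnW kn)// big_ord_recr/=; congr (_ + _).
have ig' : mu.-integrable `]u k, u k.+1] (EFin \o f).
  by apply: integrableS (fi (u k) (u k.+1)) => //; apply: subset_itvr; rewrite bnd_simp.
rewrite -(Rintegral_itv_obnd_cbnd ig') (_ : \int[mu]_(x in `]u k, u k.+1]) f x = \int[mu]_(x in `]u k, u k.+1]) a k); last first.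
  by apply: eq_Rintegral => s; rewrite inE/= in_itv/= => sk; rewrite (fa k).
rewrite Rintegral_itv_obnd_cbnd; first by rewrite Rintegral_cst// lebesgue_measure_segment.
apply: eq_integrable ig' => // s; rewrite inE/= in_itv/= => sk; by rewrite (fa k).
Qed.

(** Since [p] is never inside a cell, keeping the cells on the left of [p] is the same as replacing
    each [u k] by its minimum with [p], after which the sum telescopes. *)
Lemma telescope_stopped (u : nat -> R) (n : nat) (om : R -> R) (p : R) :
  (forall k, u k <= u k.+1) -> (forall k, (k < n)%N -> p <= u k \/ u k.+1 <= p) ->
  \sum_(k < n) (u k.+1 <= p)%R%:R * (om (u k.+1) - om (u k)) =
  om (Num.min (u n) p) - om (Num.min (u 0) p).
Proof.
move=> und up.
rewrite -(telescope_sumr (fun k => om (Num.min (u k) p)))// big_mkord; apply: eq_bigr => k _.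
have [h|h] := up k (ltn_ord k); last first.
  by rewrite h mul1r (min_l h) (min_l (le_trans (und k) h)).
have [h'|h'] := leP (u k.+1) p; last by rewrite mul0r (min_r h) subrr.
by rewrite mul1r (min_l (le_trans (und k) h')).
Qed.

(* Stopping a sum as soon as the accumulated weight would exceed [K]. *)
Lemma budget_sum_le (q : nat -> R) (K : R) (n : nat) : 0 <= K -> (forall k, 0 <= q k) ->
  \sum_(k < n) (\sum_(l < k.+1) q l <= K)%R%:R * q k <= K.
Proof.
move=> K0 q0.
suff /andP[] : (\sum_(k < n) (\sum_(l < k.+1) q l <= K)%R%:R * q k <= K) &&
  (\sum_(k < n) (\sum_(l < k.+1) q l <= K)%R%:R * q k <= \sum_(k < n) q k) by [].
elim: n => [|n /andP[IH1 IH2]]; first by rewrite !big_ord0 K0 lexx.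
rewrite !(big_ord_recr n)/=.
case: (leP (\sum_(l < n) q l + q n) K) => h; rewrite ?mul0r ?mul1r ?addr0.
  by rewrite lerD2r IH2 andbT (le_trans _ h)// lerD2r.
by rewrite IH1/= (le_trans IH2)// lerDl.
Qed.

End path_integrals.

Section measurable_wrt_big.
Context {R : realType} {d : measure_display} {Omega : measurableType d}.
Variable S : set (set Omega).
Hypothesis sS : sigma_algebra setT S.

Lemma measurable_wrt_sum n (f : 'I_n -> Omega -> R) :
  (forall i, measurable_wrt S (f i)) -> measurable_wrt S (fun w => \sum_i f i w).
Proof.
move=> mf; apply/(measurable_wrtP sS); apply: measurable_sum => i.
by apply/(measurable_wrtP sS).
Qed.

Lemma measurable_wrt_prod n (f : 'I_n -> Omega -> R) :
  (forall i, measurable_wrt S (f i)) -> measurable_wrt S (fun w => \prod_i f i w).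
Proof.
move=> mf; apply/(measurable_wrtP sS); apply: measurable_prod => i _.
by apply/(measurable_wrtP sS).
Qed.

Lemma measurable_wrt_const (a : R) : measurable_wrt S (fun=> a).
Proof. by apply/(measurable_wrtP sS); exact: measurable_cst. Qed.

End measurable_wrt_big.

(** * Exit from an interval observed on a finite grid *)

Section grid_exit.
Context {R : realType} {d : measure_display} {Omega : measurableType d}.
Variables (X : R -> Omega -> R) (T a0 b0 : R) (m : nat) (gd : nat -> R).
Hypotheses (gdT : forall j, 0 <= gd j <= T) (gdm : gd m = T).

(** The exit is noticed at grid points only. It thus takes finitely many values, and a partition
    containing the grid never has it in the interior of a cell. *)
Definition grid_exit w : R := \big[Num.min/T]_(j < m | X (gd j) w \notin `[a0, b0]) gd j.

Let T0 : 0 <= T. Proof. by have /andP[] := gdT m; rewrite gdm. Qed.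

Lemma le_grid_exit s w : (s <= grid_exit w) =
  (s <= T) && [forall j : 'I_m, (X (gd j) w \notin `[a0, b0]) ==> (s <= gd j)].
Proof.
apply/bigmin_geP/andP => [[sT H]|[sT /forallP H]]; split => //.
  by apply/forallP => j; apply/implyP; exact: H.
by move=> j jP; have := H j; rewrite jP.
Qed.

Lemma grid_exit_le w : grid_exit w <= T.
Proof. by have := le_grid_exit (grid_exit w) w; rewrite lexx => /esym/andP[]. Qed.

Lemma grid_exit_ge0 w : 0 <= grid_exit w.
Proof.
rewrite le_grid_exit T0; apply/forallP => j; apply/implyP => _.
by have /andP[] := gdT j.
Qed.

Lemma grid_exit_grid w : exists2 j, (j <= m)%N & grid_exit w = gd j.
Proof.
rewrite /grid_exit; apply: (big_ind (fun y => exists2 j, (j <= m)%N & y = gd j)).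
- by exists m.
- move=> x y [i im ->] [j jm ->].
  by rewrite /Num.min; case: ifP => _; [exists i|exists j].
- by move=> i _; exists i => //; exact/ltnW/ltn_ord.
Qed.

(** In this product the factor of a grid point differs from 1 only if the point lies strictly before
    [s]. Hence the indicator depends on the past of [X] alone, which gives adaptedness as well as
    joint measurability. *)
Lemma grid_exit_indic s w : (s <= grid_exit w)%R%:R =
  \1_(`]-oo, T]%classic) s * \prod_(j < m)
    (1 - \1_(`]gd j, +oo[%classic) s * \1_(~` `[a0, b0]%classic) (X (gd j) w)) :> R.
Proof.
rewrite le_grid_exit !indicE mem_setE in_itv/=; case: (leP s T) => sT/=; last by rewrite mul0r.
rewrite mul1r; case: forallP => [H|/forallP/forallPn[j]].
  rewrite big1// => j _; rewrite !indicE mem_setE in_itv/= andbT in_setC mem_setE.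
  have := H j; case: (boolP (_ \in _)) => _ /=; first by rewrite mulr0 subr0.
  by rewrite leNgt => /negbTE ->; rewrite mul0r subr0.
rewrite negb_imply -ltNge => /andP[oj sj].
rewrite (bigD1 j)//= !indicE mem_setE in_itv/= andbT in_setC mem_setE sj oj.
by rewrite mulr1 subrr mul0r.
Qed.

End grid_exit.

(** * The localized formula for a cut-off simple integrand *)

Section localized_ito.
Context {R : realType} {d : measure_display} {Omega : measurableType d}.
Variables (P : probability Omega R) (F : R -> set (set Omega)) (W : R -> Omega -> R).
Hypotheses (hF : usual_filtration P F) (hW : continuous_brownian P F W)
  (W_neg : forall t w, t <= 0 -> W t w = W 0 w).
Variable X : R -> Omega -> R.
Hypotheses (aX : adapted F X) (cX : forall w, continuous (X ^~ w))
  (X_neg : forall t w, t <= 0 -> X t w = X 0 w).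
Variables (h h1 h2 : R -> R) (A : R).
Hypotheses (A1 : 1 <= A)
  (dh : forall x, is_derive x (1 : R) h (h1 x))
  (dh1 : forall x, is_derive x (1 : R) h1 (h2 x))
  (ch2 : continuous h2)
  (hA : forall x, `|h x| <= A) (h1A : forall x, `|h1 x| <= A) (h2A : forall x, `|h2 x| <= A)
  (h2mod : forall e, 0 < e -> exists2 L, 0 <= L &
     forall y z, `|h2 z - h2 y| <= e + L * (z - y) ^+ 2).
Variables (be ke : R -> R).
Hypotheses (cbe : continuous be) (cke : continuous ke)
  (beA : forall x, `|be x| <= A) (keA : forall x, 0 <= ke x <= A).
Variables (T a0 b0 x0 : R) (m : nat) (gd : nat -> R).
Hypotheses (gdT : forall j, 0 <= gd j <= T) (gdm : gd m = T).
Local Notation mu := (@lebesgue_measure R).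
Local Notation "''E' f" := (\int[P]_w f w) (at level 10, f at level 8).

Let tau := grid_exit X T a0 b0 m gd.
Let chi s w : R := (s <= tau w)%R%:R.

Definition stopped_discount t w : R :=
  expR (- \int[mu]_(s in `[0, t]) (chi s w * ke (X s w))).

Let A0 : 0 <= A. Proof. by rewrite (le_trans _ A1). Qed.
Let T0 : 0 <= T. Proof. by have /andP[] := gdT m; rewrite gdm. Qed.

Let chi01 s w : 0 <= chi s w <= 1.
Proof. by rewrite /chi ler0n lern1 leq_b1. Qed.

Let chi_norm s w : `|chi s w| <= 1.
Proof. by have /andP[? ?] := chi01 s w; rewrite ger0_norm. Qed.

Lemma adapted_measurableR (Y : R -> Omega -> R) t : adapted F Y ->
  (forall t w, t <= 0 -> Y t w = Y 0 w) -> measurable_fun setT (Y t).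
Proof.
move=> aY Yneg; have [t0|/ltW t0] := leP 0 t; first exact: (adapted_measurable hF aY).
have -> : Y t = Y 0 by apply/funext => w; exact: Yneg.
exact: (adapted_measurable hF aY).
Qed.

Let mX t : measurable_fun setT (X t). Proof. exact: adapted_measurableR. Qed.
Let mW t : measurable_fun setT (W t).
Proof. by apply: adapted_measurableR => //; case: hW. Qed.

Let mout : measurable_fun [set: R] (\1_(~` `[a0, b0]%classic) : R -> R).
Proof. by apply: measurable_indic; exact: measurableC. Qed.

Let product_measurable d' (T' : measurableType d') (Y : 'I_m -> T' -> R) :
  (forall j, measurable_fun setT (Y j)) ->
  measurable_fun [set: R * T'] (fun z => \1_(`]-oo, T]%classic) z.1 *
    \prod_(j < m) (1 - \1_(`]gd j, +oo[%classic) z.1 * Y j z.2)).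
Proof.
move=> mY; apply: measurable_funM.
  by apply: measurableT_comp; [exact: measurable_indic|exact: measurable_fst].
apply: measurable_prod => j _; apply: measurable_funB => //.
apply: measurable_funM.
  by apply: measurableT_comp; [exact: measurable_indic|exact: measurable_fst].
by apply: measurableT_comp => //; exact: measurable_snd.
Qed.

Let chiE s w : chi s w = \1_(`]-oo, T]%classic) s * \prod_(j < m)
    (1 - \1_(`]gd j, +oo[%classic) s * \1_(~` `[a0, b0]%classic) (X (gd j) w)).
Proof. by rewrite /chi grid_exit_indic. Qed.

Let mchi : measurable_fun [set: R * Omega] (fun z => chi z.1 z.2).
Proof.
under eq_fun do rewrite chiE.
apply: (product_measurable (Y := fun j w => \1_(~` `[a0, b0]%classic) (X (gd j) w))) => j.
exact: measurableT_comp.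
Qed.

Let mX2 : measurable_fun [set: R * Omega] (fun z => X z.1 z.2).
Proof. exact: caratheodory_measurable. Qed.

Let mchig (g : R -> R) : continuous g ->
  measurable_fun [set: R * Omega] (fun z => chi z.1 z.2 * g (X z.1 z.2)).
Proof.
move=> cg; apply: measurable_funM => //.
exact: (measurableT_comp (continuous_measurable_fun cg) mX2).
Qed.

Let slice (f : R -> Omega -> R) w : measurable_fun [set: R * Omega] (fun z => f z.1 z.2) ->
  measurable_fun setT (f ^~ w).
Proof.
move=> mf.
exact: (measurableT_comp mf (measurable_pair2 w : measurable_fun setT (fun r : R => (r, w)))).
Qed.

Let chig_le (g : R -> R) : (forall x, `|g x| <= A) -> forall s w, `|chi s w * g (X s w)| <= A.
Proof. by move=> gA s w; rewrite normrM -[leRHS]mul1r ler_pM. Qed.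

Let keA' x : `|ke x| <= A.
Proof. by have /andP[? ?] := keA x; rewrite ger0_norm. Qed.

Let adapted_integral (g : R -> R) : continuous g ->
  adapted F (fun t w => \int[mu]_(s in `[0, t]) (chi s w * g (X s w))).
Proof.
move=> cg t t0; have [sF Fmono _ _] := hF; have [sFt _] := sF t t0.
apply/(measurable_wrtP sFt).
(* For [s <= t] only grid points before [t] and values of [X] up to [t] matter. [Y] and
   [Num.min s t] discard the rest, so that [f] is jointly measurable with respect to [F t]. *)
pose Y (j : 'I_m) w : R := if gd j < t then \1_(~` `[a0, b0]%classic) (X (gd j) w) else 0.
pose f (s : R) w : R := \1_(`]-oo, T]%classic) s * \prod_(j < m) (1 - \1_(`]gd j, +oo[%classic) s * Y j w) *
   g (X (Num.min s t) w).
have fE w : \int[mu]_(s in `[0, t]) (chi s w * g (X s w)) = \int[mu]_(s in `[0, t]) f s w.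
  apply: eq_Rintegral => s; rewrite inE/= in_itv/= => /andP[s0 st].
  rewrite /f (min_l st) chiE; congr (_ * _ * _); apply: eq_bigr => j _; congr (_ - _).
  rewrite /Y; case: ltP => // tj; rewrite indicE mem_setE in_itv/= andbT.
  by rewrite ltNge (le_trans st tj)/= !mul0r.
under eq_fun do rewrite fE.
apply: (@measurable_Rintegral_param _ _ _ _ (g_sigma_algebraType (F t)) mu (fun z => f z.1 z.2)) => //.
have FX s : s <= t -> measurable_fun setT (X s : g_sigma_algebraType (F t) -> R).
  move=> st; apply/(measurable_wrtP sFt).
  have [s0|/ltW s0] := leP 0 s; first by apply: measurable_wrt_mono (aX s0); exact: Fmono.
  have -> : X s = X 0 by apply/funext => w; exact: X_neg.
  by apply: measurable_wrt_mono (aX (lexx 0)); exact: Fmono.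
apply: measurable_funM.
  apply: (product_measurable (T' := g_sigma_algebraType (F t)) (Y := Y)) => j.
  rewrite /Y; case: ltP => // jt; apply: measurableT_comp => //.
  by apply: FX; exact: ltW.
apply: (measurableT_comp (continuous_measurable_fun cg)).
apply: (@caratheodory_measurable _ _ (g_sigma_algebraType (F t)) (fun s w => X (Num.min s t) w)).
  by move=> s; apply: FX; rewrite ge_min lexx orbT.
move=> w s; apply: (continuous_comp (f := fun s => Num.min s t) (g := X ^~ w)); last exact: cX.
by apply: continuous_min; [exact: cvg_id|exact: cvg_cst].
Qed.

Let integral_joint (g : R -> R) : continuous g -> (forall x, `|g x| <= A) ->
  measurable_fun [set: R * Omega] (fun z => \int[mu]_(s in `[0, z.1]) (chi s z.2 * g (X s z.2))).
Proof.
move=> cg gA.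
apply: (@caratheodory_measurable _ _ _ (fun t w => \int[mu]_(s in `[0, t]) (chi s w * g (X s w)))).
  move=> t; have [t0|t0] := leP 0 t.
    exact: (adapted_measurable hF (adapted_integral cg)).
  rewrite (_ : (fun w => _) = cst 0)//; apply/funext => w.
  by rewrite set_itv_ge ?Rintegral_set0// bnd_simp -ltNge.
move=> w; apply: (integral_itv_continuous (M := A)); last by move=> s; exact: chig_le.
exact: (slice (f := fun s w => chi s w * g (X s w)) _ (mchig cg)).
Qed.

Let bt s w := chi s w * be (X s w).
Let kp s w := chi s w * ke (X s w).
Let D := stopped_discount.

Let kp_ge0 s w : 0 <= kp s w <= A.
Proof.
have /andP[c0 c1] := chi01 s w; have /andP[k0 k1] := keA (X s w).
by rewrite mulr_ge0//= -[leRHS]mul1r ler_pM.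
Qed.

Let ichi (g : R -> R) (u v : R) w : continuous g -> (forall x, `|g x| <= A) ->
  mu.-integrable `[u, v] (EFin \o (fun s => chi s w * g (X s w))).
Proof.
move=> cg gA; apply: (bounded_integrable_itv (M := A)); last by move=> s _; exact: chig_le.
apply: measurable_funTS.
exact: (slice (f := fun s w => chi s w * g (X s w)) _ (mchig cg)).
Qed.

Let D01 t w : 0 <= D t w <= 1.
Proof.
rewrite /D /stopped_discount expR_ge0/= expR_le1 oppr_le0; apply: Rintegral_ge0 => s _.
by have /andP[] := kp_ge0 s w.
Qed.

Let aD : adapted F D.
Proof.
move=> t t0.
have me : measurable_fun [set: R] (fun x : R => expR (- x)).
  by apply: measurableT_comp => //; exact: measurable_expR.
exact: (measurable_wrt_comp me (adapted_integral cke t0)).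
Qed.

Let mD : measurable_fun [set: R * Omega] (fun z => D z.1 z.2).
Proof.
apply: measurableT_comp; first exact: measurable_expR.
by apply: measurableT_comp => //; exact: integral_joint.
Qed.

Let DE u v w : 0 <= u -> u <= v ->
  D v w = D u w * expR (- \int[mu]_(r in `[u, v]) kp r w).
Proof.
move=> u0 uv; rewrite /D /stopped_discount -expRD -opprD.
by rewrite (Rintegral_itv_split u0 uv)//; exact: ichi.
Qed.

Variables (S : simple_process F) (n : nat) (u : nat -> R) (K : R).
Hypothesis K0 : 0 <= K.
Hypotheses (u0 : u 0 = 0) (un : u n = T) (und : forall k, u k <= u k.+1)
  (upt : forall i k, (i <= sp_size S)%N -> (k < n)%N -> sp_time S i <= u k \/ u k.+1 <= sp_time S i)
  (upg : forall j k, (j <= m)%N -> (k < n)%N -> gd j <= u k \/ u k.+1 <= gd j).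

(* [S'] is the stopped simple process, switched off for good as soon as the
   integral of its square exceeds [K]; [ito_functional] is then bounded
   independently of [S]. *)
Let c k w := chi (u k.+1) w * sp_value S (u k.+1) w.
Let wt k w := c k w ^+ 2 * (u k.+1 - u k).
Let cc k w := (\sum_(l < k.+1) wt l w <= K)%R%:R * c k w.
Let S' s w := \sum_(k < n) \1_(`]u k, u k.+1]%classic) s * cc k w.
Let V t w := x0 + \int[mu]_(s in `[0, t]) bt s w +
  \sum_(k < n) cc k w * (W (Num.min (u k.+1) t) w - W (Num.min (u k) t) w).

Let ut k : 0 <= u k.
Proof. by elim: k => [|k IH]; [rewrite u0|rewrite (le_trans IH)]. Qed.

Let um i j : (i <= j)%N -> u i <= u j.
Proof. by move=> /subnK <-; elim: (j - i)%N => // k IH; rewrite addSn (le_trans IH). Qed.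

Let sp_time_mono i j : (i <= j)%N -> sp_time S i <= sp_time S j.
Proof.
by move=> /subnK <-; elim: (j - i)%N => // k IH; rewrite addSn (le_trans IH)// sp_time_nd.
Qed.

Let sp_t0 i : 0 <= sp_time S i.
Proof. by rewrite (le_trans (sp_time_ge0 S))// sp_time_mono. Qed.

(** [c k] is read at the right end of the cell, yet it is known at the left end: no grid point and
    no time of [S] lies strictly inside, and the indicators involved look only at points strictly
    before [u k.+1]. *)
Let mc k : (k < n)%N -> measurable_wrt (F (u k)) (c k).
Proof.
move=> kn; have [sF Fmono _ _] := hF; have [sFk _] := sF _ (ut k).
apply: measurable_wrtM => //.
  have -> := funext (chiE (u k.+1)); apply: measurable_wrtM => //; first exact: measurable_wrt_const.
  apply: measurable_wrt_prod => // j.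
  rewrite indicE mem_setE in_itv/= andbT; case: ltP => h'; last first.
    by under eq_fun do rewrite mul0r; exact: measurable_wrt_const.
  have ju : gd j <= u k.
    by have [//|] := upg (ltnW (ltn_ord j)) kn; rewrite leNgt h'.
  under eq_fun do rewrite mul1r.
  have mf : measurable_fun [set: R] (fun y : R => 1 - (\1_(~` `[a0, b0]%classic) y : R)).
    by apply: measurable_funB.
  apply: (measurable_wrt_comp mf); apply: measurable_wrt_mono (aX _); last by have /andP[] := gdT j.
  by apply: Fmono => //; have /andP[] := gdT j.
apply: measurable_wrt_sum => // i; rewrite indicE mem_setE in_itv/=.
case: ltP => h' /=; last by under eq_fun do rewrite mulr0; exact: measurable_wrt_const.
have iu : sp_time S i <= u k.
  by have [//|] := upt (ltnW (ltn_ord i)) kn; rewrite leNgt h'.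
apply: measurable_wrtM => //; last exact: measurable_wrt_const.
by apply: (@measurable_wrt_mono _ _ _ (F (sp_time S i))); [exact: Fmono|exact: sp_coef_meas].
Qed.

Let mcc k : (k < n)%N -> measurable_wrt (F (u k)) (cc k).
Proof.
move=> kn; have [sF Fmono _ _] := hF; have [sFk _] := sF _ (ut k).
apply: measurable_wrtM => //; last exact: mc.
have mf : measurable_fun [set: R] (fun y : R => (y <= K)%R%:R : R).
  rewrite (_ : (fun y : R => _) = \1_(`]-oo, K]%classic)); first exact: measurable_indic.
  by apply/funext => y; rewrite indicE mem_setE in_itv.
apply: (measurable_wrt_comp mf); apply: measurable_wrt_sum => // l.
have lk : (l < n)%N by apply: leq_ltn_trans kn; rewrite -ltnS.
have cl : measurable_wrt (F (u k)) (c l).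
  apply: measurable_wrt_mono (mc lk); apply: Fmono => //; apply: um.
  by rewrite -ltnS.
by apply: measurable_wrtM => //; [exact: measurable_wrtM|exact: measurable_wrt_const].
Qed.

Let M : R := \sum_(i < sp_size S) sval (cid (sp_coef_bounded S i)).

Let coef_le i w : `|sp_coef S i w| <= sval (cid (sp_coef_bounded S i)).
Proof. exact: (svalP (cid (sp_coef_bounded S i)) w). Qed.

Let sp_value_le s w : `|sp_value S s w| <= M.
Proof.
rewrite (le_trans (ler_norm_sum _ _ _))// ler_sum// => i _.
rewrite normrM -[leRHS]mulr1 ler_pM//.
by rewrite indicE normr_nat lern1 leq_b1.
Qed.

Let M0 : 0 <= M.
Proof.
rewrite sumr_ge0// => i _.
have [w|no] := pselect (exists w : Omega, True); last first.
  exfalso; have := probability_setT P; rewrite (_ : [set: Omega] = set0) ?measure0.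
    by move/eqP; rewrite eq_sym onee_eq0.
  by apply/seteqP; split => // w _; apply: no; exists w.
by case: w => w _; rewrite (le_trans _ (coef_le i w)).
Qed.

Let c_le k w : `|c k w| <= M.
Proof. by rewrite normrM -[leRHS]mul1r ler_pM. Qed.

Let cc_le k w : `|cc k w| <= M.
Proof.
rewrite normrM -[leRHS]mul1r ler_pM// ?normr_ge0//.
by rewrite normr_nat lern1 leq_b1.
Qed.

Let S'E k s w : (k < n)%N -> u k < s <= u k.+1 -> S' s w = cc k w.
Proof.
move=> kn /andP[ks sk]; rewrite /S' (bigD1 (Ordinal kn))//= indicE mem_setE in_itv/= ks sk mul1r.
rewrite big1 ?addr0// => l /eqP lk; rewrite indicE mem_setE in_itv/=.
have [lk'|kl] := ltnP l k.
  by rewrite [s <= _]leNgt (le_lt_trans (um lk') ks) andbF mul0r.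
have kl' : (k < l)%N.
  by rewrite ltn_neqAle kl andbT; apply/eqP => kl'; apply: lk; exact/val_inj.
by rewrite ltNge (le_trans sk (um kl')) mul0r.
Qed.

Let utT k : (k <= n)%N -> u k <= T.
Proof. by move=> kn; rewrite -un um. Qed.

Let S'_out s w : s <= 0 \/ T < s -> S' s w = 0.
Proof.
move=> sT; rewrite /S' big1// => k _; rewrite indicE mem_setE in_itv/=; case: sT => h'.
  by rewrite ltNge (le_trans h' (ut k)) mul0r.
by rewrite [s <= _]leNgt (le_lt_trans (utT (ltn_ord k)) h') andbF mul0r.
Qed.

Let cell s : 0 < s -> s <= T -> exists2 k, (k < n)%N & u k < s <= u k.+1.
Proof.
move=> s0 sT.
suff H k : (k <= n)%N -> s <= u k -> exists2 k, (k < n)%N & u k < s <= u k.+1.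
  by apply: (H n) => //; rewrite un.
elim: k => [_|k IH kn sk]; first by rewrite u0 leNgt s0.
by have [h'|h'] := leP s (u k); [apply: IH => //; exact: ltnW|exists k => //; rewrite h'].
Qed.

Let S'_le s w : `|S' s w| <= M.
Proof.
have [s0|s0] := leP s 0; first by rewrite S'_out ?normr0//; left.
have [sT|sT] := leP s T; last by rewrite S'_out ?normr0//; right.
by have [k kn ks] := cell s0 sT; rewrite (S'E w kn ks).
Qed.

Let mccT k : (k < n)%N -> measurable_fun setT (cc k).
Proof.
move=> kn; have [sF _ _ _] := hF; have [_ Fm] := sF _ (ut k).
exact: measurable_wrt_measurable Fm (mcc kn).
Qed.

Let mS' : measurable_fun [set: R * Omega] (fun z => S' z.1 z.2).
Proof.
apply: measurable_sum => k; apply: measurable_funM.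
  by apply: measurableT_comp; [exact: measurable_indic|exact: measurable_fst].
by apply: measurableT_comp; [exact: mccT|exact: measurable_snd].
Qed.

Let aV : adapted F V.
Proof.
move=> t t0; have [sF Fmono _ _] := hF; have [sFt _] := sF _ t0.
apply: measurable_wrtD => //; first apply: measurable_wrtD => //.
- exact: measurable_wrt_const.
- exact: adapted_integral.
apply: measurable_wrt_sum => // k; have [kt|] := boolP (u k <= t); last first.
  rewrite -ltNge => tk.
  under eq_fun do rewrite (min_r (ltW tk)) (min_r (le_trans (ltW tk) (und k))) subrr mulr0.
  exact: measurable_wrt_const.
apply: measurable_wrtM => //; first by apply: measurable_wrt_mono (mcc (ltn_ord k)); exact: Fmono.
have aW v : 0 <= v -> measurable_wrt (F t) (W (Num.min v t)).
  move=> v0; have [aW _ _] := hW.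
  have v0' : 0 <= Num.min v t by rewrite le_min v0 t0.
  by apply: measurable_wrt_mono (aW _ v0'); apply: Fmono => //; rewrite ge_min lexx orbT.
apply: measurable_wrtD => //; first exact: aW.
have mN : measurable_fun [set: R] (fun y : R => - y) by exact: oppr_measurable.
exact: (measurable_wrt_comp mN (aW _ (ut k))).
Qed.

Let mV : measurable_fun [set: R * Omega] (fun z => V z.1 z.2).
Proof.
apply: measurable_funD; first by apply: measurable_funD => //; exact: integral_joint.
apply: measurable_sum => k; apply: measurable_funM.
  by apply: measurableT_comp; [exact: mccT|exact: measurable_snd].
have cW v : measurable_fun [set: R * Omega] (fun z => W (Num.min v z.1) z.2).
  apply: (@caratheodory_measurable _ _ _ (fun t w => W (Num.min v t) w)) => // w t.
  have [_ cW _] := hW.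
  apply: (continuous_comp (f := fun s => Num.min v s) (g := W ^~ w)); last exact: cW.
  by apply: continuous_min; [exact: cvg_cst|exact: cvg_id].
by apply: measurable_funB.
Qed.

Let VE k v1 v2 w : (k < n)%N -> u k <= v1 -> v1 <= v2 -> v2 <= u k.+1 ->
  V v2 w = V v1 w + \int[mu]_(r in `[v1, v2]) bt r w + cc k w * (W v2 w - W v1 w).
Proof.
move=> kn kv1 v12 v2k.
have v10 : 0 <= v1 by exact: le_trans kv1.
rewrite /V (Rintegral_itv_split v10 v12); last exact: ichi.
have -> : \sum_(l < n) cc l w * (W (Num.min (u l.+1) v2) w - W (Num.min (u l) v2) w) =
  \sum_(l < n) cc l w * (W (Num.min (u l.+1) v1) w - W (Num.min (u l) v1) w) + cc k w * (W v2 w - W v1 w).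
  rewrite (bigD1 (Ordinal kn))//= [in RHS](bigD1 (Ordinal kn))//=.
  rewrite (min_r v2k) (min_l (le_trans kv1 v12)) (min_r (le_trans v12 v2k)) (min_l kv1).
  have -> : \sum_(i < n | i != Ordinal kn) cc i w * (W (Num.min (u i.+1) v2) w - W (Num.min (u i) v2) w) =
    \sum_(i < n | i != Ordinal kn) cc i w * (W (Num.min (u i.+1) v1) w - W (Num.min (u i) v1) w).
    apply: eq_bigr => l /eqP lk; congr (_ * _).
    have [lk'|kl] := ltnP l k.
      have h1' : u l.+1 <= v1 by rewrite (le_trans _ kv1)// um.
      have h2' : u l <= v1 by rewrite (le_trans _ h1').
      by rewrite !min_l// (le_trans _ v12).
    have kl' : (k < l)%N.
      by rewrite ltn_neqAle kl andbT; apply/eqP => kl'; apply: lk; exact/val_inj.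
    have h1' : v2 <= u l by rewrite (le_trans v2k)// um.
    have h2' : v2 <= u l.+1 by rewrite (le_trans h1').
    by rewrite !min_r// ?subrr// (le_trans v12).
  ring.
ring.
Qed.

(** [ito_partition] wants one bound for coefficients and integrand. That of the integrand depends on
    [S], without consequence, since the identity obtained does not mention the bound. *)
Let A' := Num.max A M.
Let leA' x : x <= A -> x <= A'. Proof. by move=> xA; rewrite /A' le_max xA. Qed.
Let leM' x : x <= M -> x <= A'. Proof. by move=> xA; rewrite /A' le_max xA orbT. Qed.

Let J r w := D r w * (h1 (V r w) * bt r w + 2^-1 * h2 (V r w) * S' r w ^+ 2 - kp r w * h (V r w)).

Definition ito_functional w : R := D T w * h (V T w) - h x0 - \int[mu]_(r in `[0, T]) J r w.

Let ch : continuous h.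
Proof. by move=> x; apply/differentiable_continuous/derivable1_diffP; have [] := dh x. Qed.
Let ch1 : continuous h1.
Proof. by move=> x; apply/differentiable_continuous/derivable1_diffP; have [] := dh1 x. Qed.

Let mJ : measurable_fun [set: R * Omega] (fun z => J z.1 z.2).
Proof. exact: (ito_integrand_measurable dh dh1 ch2 mV mD (mchig cbe) (mchig cke) mS'). Qed.

Let J_le r w : `|J r w| <= 2 * A ^+ 2 + A * S' r w ^+ 2.
Proof.
have btA r' w' : `|bt r' w'| <= A by exact: chig_le.
exact: (ito_integrand_le A1 hA h1A h2A V D01 btA kp_ge0).
Qed.

Let J_leM r w : `|J r w| <= 2 * A ^+ 2 + A * M ^+ 2.
Proof.
rewrite (le_trans (J_le r w))// lerD2l ler_wpM2l//.
by rewrite -[S' r w ^+ 2]real_normK ?num_real// lerXn2r ?nnegrE.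
Qed.

Let iJ w (v1 v2 : R) : mu.-integrable `[v1, v2] (EFin \o (J ^~ w)).
Proof.
apply: (bounded_integrable_itv (M := 2 * A ^+ 2 + A * M ^+ 2)); last by move=> r _; exact: J_leM.
by apply: measurable_funTS; exact: (slice (f := J)).
Qed.

Let iS'2 w (v1 v2 : R) : mu.-integrable `[v1, v2] (EFin \o (fun s => S' s w ^+ 2)).
Proof.
apply: (bounded_integrable_itv (M := M ^+ 2)).
  by apply: measurable_funTS; apply: measurable_funX; exact: (slice (f := S')).
by move=> s _; rewrite ger0_norm ?sqr_ge0// -[S' s w ^+ 2]real_normK ?num_real// lerXn2r ?nnegrE.
Qed.

Let wt_ge0 k w : 0 <= wt k w.
Proof. by rewrite mulr_ge0 ?sqr_ge0// subr_ge0. Qed.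

Let S'2_le w : \int[mu]_(s in `[0, T]) (S' s w ^+ 2) <= K.
Proof.
rewrite -[X in `[X, _]]u0 -un (@step_integral _ u n _ (fun k => cc k w ^+ 2) (M ^+ 2))//.
- have := @budget_sum_le _ (wt ^~ w) K n K0 (fun k => wt_ge0 k w).
  apply: le_trans; apply: ler_sum => k _; rewrite /cc /wt exprMn mulrA.
  by case: (_ <= K)%R; rewrite ?expr1n ?expr0n ?mul1r ?mul0r.
- by apply: measurable_funX; exact: (slice (f := S')).
- by move=> s; rewrite ger0_norm ?sqr_ge0// -[S' s w ^+ 2]real_normK ?num_real// lerXn2r ?nnegrE.
- by move=> k s kn ks; rewrite (S'E w kn ks).
Qed.

(** The generator integrand is dominated by a constant plus [A * S'^2], and the cut-off keeps the
    integral of [S'^2] below [K]. A bound free of [S] is what turns convergence in probability into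
    convergence of expectations. *)
Lemma ito_functional_le w : `|ito_functional w| <= 2 * A + (2 * A ^+ 2 * T + A * K).
Proof.
rewrite /ito_functional (le_trans (ler_normB _ _))// lerD//.
  rewrite mulr_natl mulr2n (le_trans (ler_normB _ _))// lerD// normrM -[leRHS]mul1r ler_pM//.
  by have /andP[? ?] := D01 T w; rewrite ger0_norm.
have i1 : mu.-integrable `[0, T] (EFin \o (fun=> 2 * A ^+ 2)).
  by apply: (bounded_integrable_itv (M := `|2 * A ^+ 2|)) => //; exact: measurable_cst.
have i2 : mu.-integrable `[0, T] (EFin \o (fun s => A * S' s w ^+ 2)) by exact: integrable_EFinZl.
apply: (le_trans (le_normr_Rintegral _ (iJ w 0 T))) => //.
apply: (@le_trans _ _ (\int[mu]_(s in `[0, T]) (2 * A ^+ 2 + A * S' s w ^+ 2))).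
  apply: le_Rintegral => //; [exact: integrable_abse (iJ w 0 T)|exact: integrable_EFinD].
rewrite RintegralD// Rintegral_cst// lebesgue_measure_segment// subr0 lerD2l.
by rewrite (RintegralZl _ _ (iS'2 w 0 T))// ler_wpM2l.
Qed.

Let mDhV t : 0 <= t -> bounded_measurable (fun w => D t w * h (V t w)).
Proof.
move=> t0; apply: bounded_measurableM.
  split; first exact: (adapted_measurable hF aD).
  by exists 1 => w; have /andP[? ?] := D01 t w; rewrite ger0_norm.
split; last by exists A => w; exact: hA.
exact: (measurableT_comp (continuous_measurable_fun ch) (adapted_measurable hF aV t0)).
Qed.

Let mintJ : bounded_measurable (fun w => \int[mu]_(r in `[0, T]) J r w).
Proof.
split; first by apply: (@measurable_Rintegral_param _ _ _ _ _ mu (fun z => J z.1 z.2)).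
exists ((2 * A ^+ 2 + A * M ^+ 2) * (T - 0)) => w.
by apply: normr_Rintegral_itv_le.
Qed.

Lemma ito_functional_measurable : measurable_fun setT ito_functional.
Proof.
have [m1 _] := mDhV T0; have [m2 _] := mintJ.
by apply: measurable_funB => //; apply: measurable_funB.
Qed.

Lemma ito_functional_mean : 'E ito_functional = 0.
Proof.
have h2mod' := h2mod.
have C := @ito_partition _ _ _ P F W hF hW h h1 h2 A' (leA' A1) dh dh1 ch2
  (fun x => leA' (hA x)) (fun x => leA' (h1A x)) (fun x => leA' (h2A x)) h2mod
  V D bt kp mV mD (mchig cbe) (mchig cke) aV aD D01
  (fun r w => leA' (chig_le beA r w)) _ DE n u S' cc u0 und mcc
  (fun k w => leM' (cc_le k w)) VE mS' (fun s w => leM' (S'_le s w)) (fun k s w kn ks => S'E w kn ks).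
have kpA' r w : 0 <= kp r w <= A'.
  by have /andP[-> k1] := kp_ge0 r w; exact: leA'.
have {C} := C kpA'; rewrite un -/J => C.
have iB (f : Omega -> R) : bounded_measurable f -> P.-integrable setT (EFin \o f) by exact: bounded_measurable_integrable.
rewrite /ito_functional RintegralB//; [|exact: integrable_EFinB (iB _ (mDhV T0)) (integrable_EFin_cst P (h x0))|exact: iB].
rewrite RintegralB//; [|exact: iB (mDhV T0)|exact: integrable_EFin_cst].
rewrite (@fubini_itv _ _ _ P 0 T (fun z => J z.1 z.2) (2 * A ^+ 2 + A * M ^+ 2))//.
rewrite -C.
have -> : 'E (fun w => D 0 w * h (V 0 w)) = 'E (fun=> h x0).
  apply: eq_Rintegral => w _.
  have D0 : D 0 w = 1 by rewrite /D /stopped_discount set_itv1 Rintegral_set1 oppr0 expR0.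
  have V0 : V 0 w = x0.
    rewrite /V set_itv1 Rintegral_set1 addr0 big1 ?addr0// => k _.
    by rewrite !min_r// subrr mulr0.
  by rewrite D0 V0 mul1r.
by rewrite subrr.
Qed.

Variables (sg ff bb : R -> R) (a b : R) (I : R -> Omega -> R).
Hypotheses (cI : forall w, continuous (I ^~ w)) (cff : continuous ff) (ffA : forall y, `|ff y| <= A)
  (XE : forall t w, 0 <= t -> t <= T -> X t w = x0 + \int[mu]_(s in `[0, t]) bb (X s w) + I t w)
  (gen : forall y, a <= y <= b -> [/\ be y = bb y, `|sg y| <= A &
    h1 y * be y + 2^-1 * h2 y * sg y ^+ 2 - ke y * h y = - ff y]).

(** The expected limit of [ito_functional]: [V] at time [T] becomes [X] at the exit, and the
    equation satisfied by [h] turns the generator integrand into [- ff]. *)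
Definition stopped_functional w : R := D T w * h (X (tau w) w) - h x0 +
  \int[mu]_(s in `[0, T]) (D s w * (chi s w * ff (X s w))).

Let tau_le w : tau w <= T. Proof. exact: grid_exit_le. Qed.
Let tau_ge0 w : 0 <= tau w. Proof. exact: (grid_exit_ge0 X a0 b0 gdT gdm). Qed.

Let integral_stop (g : R -> R) s w : continuous g -> (forall x, `|g x| <= A) -> 0 <= s ->
  \int[mu]_(r in `[0, s]) (chi r w * g (X r w)) = \int[mu]_(r in `[0, Num.min s (tau w)]) g (X r w).
Proof.
move=> cg gA s0.
have eqc v : v <= tau w -> \int[mu]_(r in `[0, v]) (chi r w * g (X r w)) = \int[mu]_(r in `[0, v]) g (X r w).
  move=> vt; apply: eq_Rintegral => r; rewrite inE/= in_itv/= => /andP[_ rv].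
  by rewrite /chi (le_trans rv vt) mul1r.
have [st|ts] := leP s (tau w); first exact: eqc.
rewrite (Rintegral_itv_split (tau_ge0 w) (ltW ts)); last exact: ichi.
rewrite eqc// [X in _ + X](_ : _ = 0) ?addr0//.
rewrite -Rintegral_itv_obnd_cbnd; last first.
  by apply: integrableS (ichi (tau w) s w cg gA) => //; apply: subset_itvr; rewrite bnd_simp.
rewrite /Rintegral integral0_eq// => r; rewrite /= in_itv/= => /andP[tr _].
by rewrite /chi leNgt tr mul0r.
Qed.

(** The exit time is the integral over [0, T] of the indicator of the times that precede it. *)
Lemma grid_exit_measurable : measurable_fun setT tau.
Proof.
have -> : tau = (fun w => \int[mu]_(r in `[0, T]) (chi r w * cst 1 (X r w))).
  apply/funext => w; rewrite integral_stop//; last by move=> x; rewrite normr1.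
    rewrite min_r// Rintegral_cst// lebesgue_measure_segment// subr0 mul1r//.
  by move=> x; exact: cvg_cst.
apply: (@measurable_Rintegral_param _ _ _ _ _ mu (fun z => chi z.1 z.2 * cst 1 (X z.1 z.2))) => //.
by apply: mchig => x; exact: cvg_cst.
Qed.

Let Dff_le (B : R) s w : (forall y, `|ff y| <= B) -> `|D s w * (chi s w * ff (X s w))| <= B.
Proof.
move=> ffB; rewrite normrM -[leRHS]mul1r ler_pM//.
  by have /andP[? ?] := D01 s w; rewrite ger0_norm.
by rewrite normrM -[leRHS]mul1r ler_pM.
Qed.

Let iDff w : mu.-integrable `[0, T] (EFin \o (fun s => D s w * (chi s w * ff (X s w)))).
Proof.
apply: (bounded_integrable_itv (M := A)); last by move=> s _; exact: Dff_le.
apply: measurable_funTS; apply: measurable_funM; first exact: (slice (f := D)).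
exact: (slice (f := fun s w => chi s w * ff (X s w)) _ (mchig cff)).
Qed.

Lemma stopped_functional_measurable : measurable_fun setT stopped_functional.
Proof.
apply: measurable_funD; last first.
  apply: (@measurable_Rintegral_param _ _ _ _ _ mu (fun z => D z.1 z.2 * (chi z.1 z.2 * ff (X z.1 z.2)))) => //.
  by apply: measurable_funM => //; exact: mchig.
apply: measurable_funB => //; apply: measurable_funM; first exact: (adapted_measurable hF aD).
apply: (measurableT_comp (continuous_measurable_fun ch)).
have := measurableT_comp mX2 (_ : measurable_fun setT (fun w => (tau w, w))); apply.
by apply: measurable_fun_pair => //; exact: grid_exit_measurable.
Qed.

Lemma stopped_functional_bound (C B : R) w : (forall y, `|h y| <= C) -> (forall y, `|ff y| <= B) ->
  `|stopped_functional w| <= 2 * C + B * T.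
Proof.
move=> hC ffB; rewrite /stopped_functional (le_trans (ler_normD _ _))// lerD//.
  rewrite mulr_natl mulr2n (le_trans (ler_normB _ _))// lerD// normrM -[leRHS]mul1r ler_pM//.
  by have /andP[? ?] := D01 T w; rewrite ger0_norm.
by rewrite -[X in _ * X](subr0 T) normr_Rintegral_itv_le// => s _; exact: Dff_le.
Qed.

(** Convergence in probability is known at deterministic times only. As the exit is one of the grid
    points, summing over all of them controls the error at the random time [Num.min s (tau w)]. *)
Definition simple_integral_error s w : R := \sum_(j < m.+1)
  Num.min 1 `|sp_integral S W (Num.min s (gd j)) w - I (Num.min s (gd j)) w|.

(* On the event where [S] approximates [sigma (X)] well up to [tau], the
   switching never occurs, so that [S'] is the stopped [S] and [V] is close to
   the stopped [X]. *)
Section comparison.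
Variables (w : Omega) (e L : R).
Hypotheses (e0 : 0 < e) (L0 : 0 <= L)
  (hmod : forall y z, `|h z - h y| <= e + L * Num.min 1 `|z - y|)
  (h1mod : forall y z, `|h1 z - h1 y| <= e + L * Num.min 1 `|z - y|)
  (h2mod' : forall y z, `|h2 z - h2 y| <= e + L * Num.min 1 `|z - y|)
  (Xab : forall s, 0 <= s -> s <= tau w -> a <= X s w <= b).
Let err s := sp_value S s w - sg (X s w).
Hypotheses (ierr : mu.-integrable `[0, T] (EFin \o (fun s => err s ^+ 2)))
  (errK : 2 * \int[mu]_(s in `[0, T]) (err s ^+ 2) + 2 * A ^+ 2 * T <= K).

Let tau_cell k : (k < n)%N -> tau w <= u k \/ u k.+1 <= tau w.
Proof.
move=> kn; have [j jm tE] := grid_exit_grid X a0 b0 gdm w.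
by rewrite /tau tE; exact: upg.
Qed.

Let chi_cell k s : (k < n)%N -> u k < s <= u k.+1 -> chi s w = chi (u k.+1) w.
Proof.
move=> kn /andP[ks sk]; rewrite /chi; have [h'|h'] := tau_cell kn.
  by rewrite !leNgt (le_lt_trans h' ks) (le_lt_trans h' (lt_le_trans ks sk)).
by rewrite h' (le_trans sk h').
Qed.

Let sp_cell k s : (k < n)%N -> u k < s <= u k.+1 -> sp_value S s w = sp_value S (u k.+1) w.
Proof.
move=> kn /andP[ks sk]; apply: eq_bigr => i _; congr (_ * _).
rewrite !indicE !mem_setE !in_itv/=; congr ((_ && _)%:R).
  have [h'|h'] := upt (ltnW (ltn_ord i)) kn.
    by rewrite (le_lt_trans h' ks) (le_lt_trans h' (lt_le_trans ks sk)).
  by rewrite !ltNge h' (le_trans sk h').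
have [h'|h'] := upt (ltn_ord i) kn.
  by rewrite !leNgt (le_lt_trans h' ks) (le_lt_trans h' (lt_le_trans ks sk)).
by rewrite h' (le_trans sk h').
Qed.

Let A2_le y : `|y| <= A -> y ^+ 2 <= A ^+ 2.
Proof. by move=> yA; rewrite -[y ^+ 2]real_normK ?num_real// lerXn2r ?nnegrE. Qed.

Let iK (g : R) : mu.-integrable `[0, T] (EFin \o (fun=> g)).
Proof. by apply: (bounded_integrable_itv (M := `|g|)) => //; exact: measurable_cst. Qed.

Let msp : measurable_fun setT (fun s => sp_value S s w).
Proof.
by apply: measurable_sum => i; apply: measurable_funM => //; exact: measurable_indic.
Qed.

Let budget_ok k : (k < n)%N -> \sum_(l < k.+1) wt l w <= K.
Proof.
move=> kn; apply: (@le_trans _ _ (\sum_(l < n) wt l w)).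
  rewrite -(big_mkord xpredT (fun l => wt l w)) -(big_mkord xpredT (fun l => wt l w)).
  by rewrite [leRHS](big_cat_nat (n := k.+1))//= lerDl sumr_ge0.
pose f s := (chi s w * sp_value S s w) ^+ 2.
have mf : measurable_fun setT f.
  apply: measurable_funX; apply: measurable_funM => //; exact: (slice (f := chi)).
have f_le s : `|f s| <= M ^+ 2.
  rewrite ger0_norm ?sqr_ge0// /f -[(_ * _) ^+ 2]real_normK ?num_real// lerXn2r ?nnegrE//.
  by rewrite normrM -[leRHS]mul1r ler_pM.
have <- : \int[mu]_(s in `[0, T]) f s = \sum_(l < n) wt l w.
  rewrite -[X in `[X, _]]u0 -un (@step_integral _ u n f (fun k => c k w ^+ 2) (M ^+ 2))//.
  by move=> l s ln ls; rewrite /f (chi_cell ln ls) (sp_cell ln ls).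
apply: le_trans errK.
have i3 : mu.-integrable `[0, T] (EFin \o (fun s => 2 * err s ^+ 2)) by exact: integrable_EFinZl.
have -> : 2 * (\int[mu]_(s in `[0, T]) (err s ^+ 2)) + 2 * A ^+ 2 * T =
   \int[mu]_(s in `[0, T]) (2 * err s ^+ 2 + 2 * A ^+ 2).
  rewrite RintegralD// Rintegral_cst// lebesgue_measure_segment// subr0.
  by rewrite (RintegralZl _ _ ierr).
apply: le_Rintegral => //.
- by apply: (bounded_integrable_itv (M := M ^+ 2)) => //; exact: measurable_funTS.
- exact: integrable_EFinD.
move=> s; rewrite /= in_itv/= => /andP[s0 sT]; rewrite /f /chi; case: (leP s (tau w)) => st; last first.
  by rewrite mul0r expr0n addr_ge0// mulr_ge0// sqr_ge0.
have [_ sgA _] := gen (Xab s0 st); rewrite mul1r /err.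
(* The inequality [p^2 <= 2 (p - q)^2 + 2 q^2] amounts to [(p - 2 q)^2 >= 0]. *)
have := A2_le sgA; have := sqr_ge0 (sp_value S s w - 2 * sg (X s w)).
set p := sp_value S s w; set q := sg _.
have -> : (p - 2 * q) ^+ 2 = p ^+ 2 - 4 * (p * q) + 4 * q ^+ 2 by ring.
have -> : (p - q) ^+ 2 = p ^+ 2 - 2 * (p * q) + q ^+ 2 by ring.
by lra.
Qed.

Let ccE k : (k < n)%N -> cc k w = c k w.
Proof. by move=> kn; rewrite /cc budget_ok// mul1r. Qed.

Let S'spE s : 0 <= s -> s <= T -> S' s w = chi s w * sp_value S s w.
Proof.
rewrite le_eqVlt => /orP[/eqP<- _|s0 sT].
  rewrite S'_out; last by left.
  rewrite /sp_value big1 ?mulr0// => i _; rewrite indicE mem_setE in_itv/=.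
  by rewrite ltNge sp_t0 mulr0.
have [k kn ks] := cell s0 sT.
by rewrite (S'E w kn ks) ccE// /c (chi_cell kn ks) (sp_cell kn ks).
Qed.

Let stopped_sp_integral s : 0 <= s -> s <= T ->
  \sum_(k < n) cc k w * (W (Num.min (u k.+1) s) w - W (Num.min (u k) s) w) =
  sp_integral S W (Num.min s (tau w)) w.
Proof.
move=> s0 sT.
(* The product of the indicator of ]t_i, t_{i+1}] and that of the times before [tau] is a difference
   of two indicators, of the times up to [min t_{i+1} tau] and up to [min t_i tau]. After exchanging
   the sums each of them telescopes. *)
transitivity (\sum_(k < n) \sum_(i < sp_size S) sp_coef S i w *
  ((u k.+1 <= Num.min (sp_time S i.+1) (tau w))%R%:R * (W (Num.min (u k.+1) s) w - W (Num.min (u k) s) w)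
  - (u k.+1 <= Num.min (sp_time S i) (tau w))%R%:R * (W (Num.min (u k.+1) s) w - W (Num.min (u k) s) w))).
  apply: eq_bigr => k _; rewrite ccE// /c /sp_value mulr_sumr mulr_suml; apply: eq_bigr => i _.
  rewrite indicE mem_setE in_itv/= !le_min /chi -mulrBl [RHS]mulrA; congr (_ * _).
  rewrite mulrCA; congr (_ * _).
  have := sp_time_nd S i.
  case: (leP (u k.+1) (tau w)); rewrite ?andbF ?andbT ?mul0r ?subrr// => _ ii.
  rewrite mul1r; case: (ltP (sp_time S i)) => h'/=; first by rewrite subr0.
  by rewrite (le_trans h' ii) subrr.
rewrite exchange_big/=; apply: eq_bigr => i _; rewrite -mulr_sumr; congr (_ * _).
rewrite sumrB.
have ptc i' : (i' <= sp_size S)%N -> forall k, (k < n)%N -> Num.min (sp_time S i') (tau w) <= u k \/ u k.+1 <= Num.min (sp_time S i') (tau w).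
  move=> i'S k kn; rewrite /Num.min; case: ifP => _; [exact: upt|exact: tau_cell].
rewrite (telescope_stopped (fun v => W (Num.min v s) w) und (ptc _ (ltn_ord i))).
rewrite (telescope_stopped (fun v => W (Num.min v s) w) und (ptc _ (ltnW (ltn_ord i)))).
have m0 i' : Num.min (u 0) (Num.min (sp_time S i') (tau w)) = 0.
  by rewrite u0 min_l// le_min sp_t0 tau_ge0.
rewrite !m0 un.
have mE i' : Num.min (Num.min T (Num.min (sp_time S i') (tau w))) s = Num.min (sp_time S i') (Num.min s (tau w)).
  rewrite (min_r (_ : _ <= T)); last by rewrite ge_min (tau_le w) orbT.
  by rewrite -minA (minC (tau w)).
by rewrite !mE; ring.
Qed.

(** [V] was given the drift of [X] itself, stopped at [tau], so that the drifts cancel and only the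
    error of the stochastic integral remains. *)
Let VXE s : 0 <= s -> s <= T ->
  V s w - X (Num.min s (tau w)) w =
  sp_integral S W (Num.min s (tau w)) w - I (Num.min s (tau w)) w.
Proof.
move=> s0 sT; set v := Num.min s (tau w).
have v0 : 0 <= v by rewrite le_min s0 tau_ge0.
have vT : v <= T by rewrite ge_min sT.
rewrite /V (integral_stop w cbe beA s0) -/v (stopped_sp_integral s0 sT) -/v (XE w v0 vT).
have -> : \int[mu]_(r in `[0, v]) be (X r w) = \int[mu]_(r in `[0, v]) bb (X r w).
  apply: eq_Rintegral => r; rewrite inE/= in_itv/= => /andP[r0 rv].
  have rt : r <= tau w by rewrite (le_trans rv)// /v ge_min lexx orbT.
  by have [] := gen (Xab r0 rt).
by ring.
Qed.

Let q s := simple_integral_error s w.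

Let q_ge0 s : 0 <= q s.
Proof. by apply: sumr_ge0 => j _; rewrite le_min ler01 normr_ge0. Qed.

Let Vq s : 0 <= s -> s <= T -> Num.min 1 `|V s w - X (Num.min s (tau w)) w| <= q s.
Proof.
move=> s0 sT; rewrite VXE//.
have [j jm tE] := grid_exit_grid X a0 b0 gdm w.
rewrite /tau tE /q /simple_integral_error (bigD1 (inord j))//= inordK// lerDl.
by apply: sumr_ge0 => i _; rewrite le_min ler01 normr_ge0.
Qed.

Let mq : measurable_fun [set: R] q.
Proof.
have [_ cW _] := hW.
have cmin (v : R) : continuous (fun s => Num.min s v).
  by move=> s; apply: continuous_min; [exact: cvg_id|exact: cvg_cst].
have mm (f : R -> R) (v : R) : measurable_fun [set: R] f -> measurable_fun [set: R] (fun s => f (Num.min s v)).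
  by move=> mf; apply: (measurableT_comp mf); exact: continuous_measurable_fun.
apply: measurable_sum => j.
apply: measurable_minr => //; apply: measurableT_comp => //; apply: measurable_funB; last first.
  by apply: (mm (I ^~ w)); exact: continuous_measurable_fun.
apply: (mm (fun s => sp_integral S W s w)).
apply: measurable_sum => i; apply: measurable_funM => //; apply: measurable_funB.
  under eq_fun do rewrite minC; apply: (mm (W ^~ w)); exact: continuous_measurable_fun.
under eq_fun do rewrite minC; apply: (mm (W ^~ w)); exact: continuous_measurable_fun.
Qed.

Let q_le s : q s <= m.+1%:R.
Proof.
rewrite /q /simple_integral_error (@le_trans _ _ (\sum_(j < m.+1) 1))//.
  by apply: ler_sum => j _; rewrite ge_min lexx.
by rewrite sumr_const card_ord.
Qed.

Let iq : mu.-integrable `[0, T] (EFin \o q).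
Proof.
apply: (bounded_integrable_itv (M := m.+1%:R)); last by move=> s _; rewrite ger0_norm.
exact: measurable_funTS.
Qed.

Let bound s := (2 * A + A ^+ 2) * (e + L * q s) + A * ((1 + A / e) * err s ^+ 2 + A * e).

Let integrand_close s : 0 <= s -> s <= T ->
  `|J s w + D s w * (chi s w * ff (X s w))| <= bound s.
Proof.
move=> s0 sT.
have Ae : 0 <= A / e by rewrite divr_ge0// ltW.
have b0' : 0 <= bound s.
  rewrite /bound addr_ge0// mulr_ge0//.
  - by rewrite addr_ge0 ?mulr_ge0// sqr_ge0.
  - by rewrite addr_ge0 ?mulr_ge0// ltW.
  - rewrite addr_ge0// mulr_ge0 ?sqr_ge0// ?addr_ge0//; exact: ltW.
have SE := S'spE s0 sT.
have [st|ts] := leP s (tau w); last first.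
  have c0 : chi s w = 0 by rewrite /chi leNgt ts.
  by rewrite /J SE /bt /kp c0 !mul0r expr0n/= !mulr0 !addr0 subr0 mulr0 normr0.
have [_ sgA genE] := gen (Xab s0 st).
have := Vq s0 sT; rewrite (min_l st) => Vqs.
move: SE; rewrite /J /bt /kp {1}/chi st mul1r => ->.
rewrite /chi st !mul1r -mulrDr.
have /andP[D0 D1] := D01 s w.
rewrite normrM (ger0_norm D0) -[leRHS]mul1r; apply: ler_pM => //.
have -> : ff (X s w) = - (h1 (X s w) * be (X s w) + 2^-1 * h2 (X s w) * sg (X s w) ^+ 2 - ke (X s w) * h (X s w)).
  by rewrite genE opprK.
set x := X s w in sgA Vqs *; set v := V s w in Vqs *; set p := sp_value S s w.
have ppE : p = err s + sg x by rewrite /err /p /x subrK.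
set o := e + L * q s.
have mod_le (f : R -> R) : `|f v - f x| <= e + L * Num.min 1 `|v - x| -> `|f v - f x| <= o.
  by move=> /le_trans; apply; rewrite lerD2l ler_wpM2l.
have m0 := mod_le h (hmod x v); have m1 := mod_le h1 (h1mod x v); have m2 := mod_le h2 (h2mod' x v).
have -> : h1 v * be x + 2^-1 * h2 v * p ^+ 2 - ke x * h v - (h1 x * be x + 2^-1 * h2 x * sg x ^+ 2 - ke x * h x) =
  (h1 v - h1 x) * be x - (h v - h x) * ke x + 2^-1 * (h2 v * (p ^+ 2 - sg x ^+ 2) + (h2 v - h2 x) * sg x ^+ 2) by ring.
have k1 : `|(h1 v - h1 x) * be x| <= A * o by rewrite normrM mulrC ler_pM.
have k2 : `|(h v - h x) * ke x| <= A * o by rewrite normrM mulrC ler_pM.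
have k3 : `|(h2 v - h2 x) * sg x ^+ 2| <= A ^+ 2 * o.
  by rewrite normrM mulrC ler_pM// ger0_norm ?sqr_ge0// A2_le.
(* The cross term [2 A |err|] is split as [A (err^2 / e + e)], which leaves only the square error to
   be integrated. *)
have k4 : `|p ^+ 2 - sg x ^+ 2| <= (1 + A / e) * err s ^+ 2 + A * e.
  have -> : p ^+ 2 - sg x ^+ 2 = err s ^+ 2 + 2 * (err s * sg x) by rewrite ppE; ring.
  rewrite (le_trans (ler_normD _ _))// ger0_norm ?sqr_ge0// [(1 + A / e) * _]mulrDl mul1r -addrA lerD2l.
  rewrite !normrM (ger0_norm (ler0n _ 2)) -[err s ^+ 2]real_normK ?num_real//.
  set y := `|err s|; have y0 : 0 <= y by exact: normr_ge0.
  apply: (@le_trans _ _ (2 * (y * A))); first by rewrite ler_pM2l// ler_wpM2l.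
  have -> : A / e * y ^+ 2 + A * e = A * (y ^+ 2 / e + e) by ring.
  rewrite mulrCA mulrA mulrC ler_wpM2l// -(ler_pM2r e0) mulrDl divfK ?gt_eqF//.
  by have := sqr_ge0 (y - e); rewrite sqrrB; lra.
have k5 : `|h2 v * (p ^+ 2 - sg x ^+ 2)| <= A * ((1 + A / e) * err s ^+ 2 + A * e).
  by rewrite normrM ler_pM.
rewrite (le_trans (ler_normD _ _))// (le_trans (lerD (ler_normB _ _) (lexx _)))//.
rewrite [`|2^-1 * _|]normrM (ger0_norm (_ : 0 <= 2^-1))//.
have k6 := ler_normD (h2 v * (p ^+ 2 - sg x ^+ 2)) ((h2 v - h2 x) * sg x ^+ 2).
have n1 := normr_ge0 (h2 v * (p ^+ 2 - sg x ^+ 2)).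
have n2 := normr_ge0 ((h2 v - h2 x) * sg x ^+ 2).
rewrite /bound -/o; move: k1 k2 k3 k5 k6 n1 n2; lra.
Qed.

Lemma ito_functional_close :
  `|ito_functional w - stopped_functional w| <= (e + L * q T) +
    ((2 * A + A ^+ 2) * (e * T + L * \int[mu]_(s in `[0, T]) q s) +
     A * ((1 + A / e) * \int[mu]_(s in `[0, T]) (err s ^+ 2) + A * e * T)).
Proof.
have iDf := iDff w.
have -> : ito_functional w - stopped_functional w = D T w * (h (V T w) - h (X (tau w) w)) -
   \int[mu]_(s in `[0, T]) (J s w + D s w * (chi s w * ff (X s w))).
  by rewrite RintegralD// /ito_functional /stopped_functional; ring.
rewrite (le_trans (ler_normB _ _))// lerD//.
  have /andP[D0 D1] := D01 T w; rewrite normrM (ger0_norm D0).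
  rewrite -[leRHS]mul1r ler_pM// (le_trans (hmod _ _))// lerD2l ler_wpM2l//.
  by have := Vq T0 (lexx T); rewrite (min_r (tau_le w)).
have iJD : mu.-integrable `[0, T] (EFin \o (fun s => J s w + D s w * (chi s w * ff (X s w)))).
  by apply: integrable_EFinD => //; exact: iJ.
have j1 : mu.-integrable `[0, T] (EFin \o (fun s => L * q s)) by exact: integrable_EFinZl.
have j2 : mu.-integrable `[0, T] (EFin \o (fun s => e + L * q s)) by apply: integrable_EFinD => //; exact: iK.
have j3 : mu.-integrable `[0, T] (EFin \o (fun s => (2 * A + A ^+ 2) * (e + L * q s))) by exact: integrable_EFinZl.
have j4 : mu.-integrable `[0, T] (EFin \o (fun s => (1 + A / e) * err s ^+ 2)) by exact: integrable_EFinZl.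
have j5 : mu.-integrable `[0, T] (EFin \o (fun s => (1 + A / e) * err s ^+ 2 + A * e)) by apply: integrable_EFinD => //; exact: iK.
have j6 : mu.-integrable `[0, T] (EFin \o (fun s => A * ((1 + A / e) * err s ^+ 2 + A * e))) by exact: integrable_EFinZl.
have j7 : mu.-integrable `[0, T] (EFin \o bound) by exact: integrable_EFinD.
apply: (le_trans (le_normr_Rintegral _ iJD)) => //.
apply: (@le_trans _ _ (\int[mu]_(s in `[0, T]) bound s)).
  apply: le_Rintegral => //; first exact: integrable_abse iJD.
  by move=> s; rewrite /= in_itv/= => /andP[s0 sT]; exact: integrand_close.
rewrite /bound (RintegralD _ j3 j6)// (RintegralZl _ _ j2)// (RintegralZl _ _ j5)//.
rewrite (RintegralD _ (iK e) j1)// (RintegralD _ j4 (iK (A * e)))// (RintegralZl _ _ iq)// (RintegralZl _ _ ierr)//.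
by rewrite !Rintegral_cst// lebesgue_measure_segment// subr0.
Qed.

End comparison.

End localized_ito.

(** * Passage to the limit and Dynkin's formula *)

Section convergence_in_probability.
Context {R : realType} {d : measure_display} {Omega : measurableType d}.
Variable P : probability Omega R.
Local Notation mu := (@lebesgue_measure R).

Lemma Rintegral_indic (B : set Omega) : measurable B -> \int[P]_w (\1_B w : R) = fine (P B).
Proof. by move=> mB; rewrite /Rintegral integral_indic// setIT. Qed.

Lemma le_Rintegral_expectation (f g : Omega -> R) :
  P.-integrable setT (EFin \o f) -> P.-integrable setT (EFin \o g) ->
  (forall w, f w <= g w) -> \int[P]_w f w <= \int[P]_w g w.
Proof. by move=> fi gi fg; apply: le_Rintegral => // w _; exact: fg. Qed.

Lemma normr_expectation_le (f g : Omega -> R) :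
  P.-integrable setT (EFin \o f) -> P.-integrable setT (EFin \o g) ->
  (forall w, `|f w| <= g w) -> `|\int[P]_w f w| <= \int[P]_w g w.
Proof.
move=> fi gi fg; apply: (le_trans (le_normr_Rintegral _ fi)) => //.
by apply: le_Rintegral_expectation => //; exact: integrable_abse fi.
Qed.

Lemma bounded_measurable_indic (B : set Omega) : measurable B -> bounded_measurable (\1_B : Omega -> R).
Proof.
move=> mB; split; first exact: measurable_indic.
by exists 1 => w; rewrite indicE normr_nat lern1 leq_b1.
Qed.

Variable U : nat -> Omega -> R.
Hypotheses (mU : forall n, measurable_fun setT (U n)).
Hypothesis U0 : to0_in_probability P (fun n w => (U n w)%:E).

Let mUe n (e : R) : measurable [set w | e <= U n w].
Proof.
rewrite -[X in measurable X]setTI (_ : [set w | e <= U n w] = U n @^-1` `[e, +oo[%classic); first exact: mU.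
by apply/seteqP; split => w /=; rewrite in_itv/= andbT.
Qed.

Lemma to0_in_probability_near (e dl : R) : 0 < e -> 0 < dl ->
  \forall n \near \oo, fine (P [set w | e <= U n w]) <= dl.
Proof.
move=> e0 dl0; have := U0 e0.
rewrite (_ : (fun n => P [set w | (e%:E <= (U n w)%:E)%E]) = (fun n => P [set w | e <= U n w])); last first.
  by apply/funext => n; congr (P _); apply/funext => w /=; rewrite lee_fin.
move=> /fine_cvg/= /cvgrPdist_le/(_ dl dl0); apply: filterS => n.
by rewrite sub0r normrN ger0_norm// fine_ge0.
Qed.

(** The truncated variable is at most [e / 2], except on an event of probability at most [e / 2],
    where it is at most 1. *)
Lemma expectation_min1_cvg0 : (forall n w, 0 <= U n w) ->
  (\int[P]_w Num.min 1 (U n w)) @[n --> \oo] --> (0 : R).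
Proof.
move=> Upos; apply/cvgrPdist_le => e e0.
have e20 : 0 < e / 2 by rewrite divr_gt0.
near=> n.
have bm : bounded_measurable (fun w => Num.min 1 (U n w)).
  split; first exact: measurable_minr.
  by exists 1 => w; rewrite ger0_norm ?ge_min ?lexx// le_min ler01 Upos.
rewrite sub0r normrN ger0_norm; last by apply: Rintegral_ge0 => w _; rewrite le_min ler01 Upos.
apply: (@le_trans _ _ (\int[P]_w (e / 2 + \1_[set w | e / 2 <= U n w] w))).
  apply: le_Rintegral_expectation.
  - exact: bounded_measurable_integrable.
  - apply: integrable_EFinD => //; first exact: integrable_EFin_cst.
    exact/bounded_measurable_integrable/bounded_measurable_indic.
  move=> w; rewrite indicE/=; case: (boolP (w \in _)) => h.
    by rewrite ge_min lerDr (ltW e20).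
  rewrite addr0 ge_min; apply/orP; right; apply/ltW.
  by rewrite ltNge; apply: contra h => h; rewrite inE.
rewrite RintegralD//; [|exact: integrable_EFin_cst|exact/bounded_measurable_integrable/bounded_measurable_indic].
rewrite expectation_cst Rintegral_indic// [leRHS]splitr lerD2l.
by near: n; exact: (to0_in_probability_near e20 e20).
Unshelve. all: by end_near. Qed.

End convergence_in_probability.

Lemma bounded_convergence_itv {R : realType} (f : nat -> R -> R) (M T : R) :
  (forall n, measurable_fun setT (f n)) -> (forall n s, `|f n s| <= M) ->
  (forall s, 0 <= s <= T -> f n s @[n --> \oo] --> (0 : R)) ->
  (\int[lebesgue_measure]_(s in `[0, T]) f n s) @[n --> \oo] --> (0 : R).
Proof.
move=> mf fM f0.
suff : (\int[lebesgue_measure]_(s in `[0%R, T]) (f n s)%:E)%E @[n --> \oo] --> (0%:E : \bar R).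
  exact: fine_cvg.
rewrite -[X in _ --> X](integral0 lebesgue_measure (`[0%R, T]%classic : set R)).
apply: (@dominated_cvg _ _ _ lebesgue_measure _ _ (fun n s => (f n s)%:E) (fun=> 0%:E) (fun=> M%:E)) => //.
- by move=> n; apply/measurable_EFinP; apply: measurable_funTS; exact: mf.
- by move=> s; rewrite /= in_itv/= => sT; apply: cvg_EFin; [exact: nearW|exact: f0].
- apply: (bounded_integrable_itv (f := fun=> M) (M := `|M|)) => //; exact: measurable_cst.
- by move=> n s _; rewrite /= lee_fin.
Qed.

Lemma cvg_sum_ord {R : realType} {T : Type} (F : set_system T) {FF : Filter F} n
  (f : T -> 'I_n -> R) (l : 'I_n -> R) :
  (forall j, f k j @[k --> F] --> l j) ->
  \sum_j f k j @[k --> F] --> \sum_j l j.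
Proof. by move=> fl; apply: cvg_big => //; exact: add_continuous. Qed.

Section bounded_expectation_linear.
Context {R : realType} {d : measure_display} {Omega : measurableType d}.
Variable P : probability Omega R.

Lemma expectationD (f g : Omega -> R) : bounded_measurable f -> bounded_measurable g ->
  \int[P]_w (f w + g w) = \int[P]_w f w + \int[P]_w g w.
Proof. by move=> bf bg; rewrite RintegralD//; exact: bounded_measurable_integrable. Qed.

Lemma expectationB (f g : Omega -> R) : bounded_measurable f -> bounded_measurable g ->
  \int[P]_w (f w - g w) = \int[P]_w f w - \int[P]_w g w.
Proof. by move=> bf bg; rewrite RintegralB//; exact: bounded_measurable_integrable. Qed.

Lemma expectationZl (k : R) (f : Omega -> R) : bounded_measurable f ->
  \int[P]_w (k * f w) = k * \int[P]_w f w.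
Proof. by move=> bf; rewrite RintegralZl//; exact: bounded_measurable_integrable. Qed.

Lemma bounded_measurableZl (k : R) (f : Omega -> R) : bounded_measurable f ->
  bounded_measurable (fun w => k * f w).
Proof. by move=> bf; apply: bounded_measurableM => //; exact: bounded_measurable_cst. Qed.

End bounded_expectation_linear.

Lemma expectation_sum {R : realType} {d} {Omega : measurableType d} (P : probability Omega R)
  n (f : 'I_n -> Omega -> R) : (forall j, bounded_measurable (f j)) ->
  \int[P]_w (\sum_j f j w) = \sum_j \int[P]_w f j w.
Proof.
elim: n f => [f _|n IH f bf]; first by under eq_Rintegral do rewrite big_ord0; rewrite Rintegral0_eq ?big_ord0.
under eq_Rintegral do rewrite big_ord_recl.
have bs k (g : 'I_k -> Omega -> R) : (forall j, bounded_measurable (g j)) -> bounded_measurable (fun w => \sum_j g j w).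
  elim: k g => [g _|k IHk g bg].
    by under eq_fun do rewrite big_ord0; exact: bounded_measurable_cst.
  by under eq_fun do rewrite big_ord_recl; apply: bounded_measurableD => //; exact: IHk.
rewrite RintegralD//; [|exact: bounded_measurable_integrable|exact/bounded_measurable_integrable/bs].
by rewrite big_ord_recl IH.
Qed.

(** * Expectation of the stopped functional *)

Section stopped_limit.
Context {R : realType} {d : measure_display} {Omega : measurableType d}.
Variables (P : probability Omega R) (F : R -> set (set Omega)) (W : R -> Omega -> R).
Hypotheses (hF : usual_filtration P F) (hW : continuous_brownian P F W)
  (W_neg : forall t w, t <= 0 -> W t w = W 0 w).
Variable X : R -> Omega -> R.
Hypotheses (aX : adapted F X) (cX : forall w, continuous (X ^~ w))
  (X_neg : forall t w, t <= 0 -> X t w = X 0 w).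
Variables (h h1 h2 : R -> R) (A : R).
Hypotheses (A1 : 1 <= A)
  (dh : forall x, is_derive x (1 : R) h (h1 x))
  (dh1 : forall x, is_derive x (1 : R) h1 (h2 x))
  (ch2 : continuous h2)
  (hA : forall x, `|h x| <= A) (h1A : forall x, `|h1 x| <= A) (h2A : forall x, `|h2 x| <= A)
  (h2mod : forall e, 0 < e -> exists2 L, 0 <= L &
     forall y z, `|h2 z - h2 y| <= e + L * (z - y) ^+ 2).
Variables (be ke : R -> R).
Hypotheses (cbe : continuous be) (cke : continuous ke)
  (beA : forall x, `|be x| <= A) (keA : forall x, 0 <= ke x <= A).
Variables (T a0 b0 x0 : R) (m : nat) (gd : nat -> R).
Hypotheses (gdT : forall j, 0 <= gd j <= T) (gdm : gd m = T).
Variables (sg ff bb : R -> R) (a b : R) (I : R -> Omega -> R).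
Hypotheses (cI : forall w, continuous (I ^~ w)) (mI : forall t, measurable_fun setT (I t))
  (cff : continuous ff) (ffA : forall y, `|ff y| <= A)
  (XE : forall t w, 0 <= t -> t <= T -> X t w = x0 + \int[lebesgue_measure]_(s in `[0, t]) bb (X s w) + I t w)
  (gen : forall y, a <= y <= b -> [/\ be y = bb y, `|sg y| <= A &
    h1 y * be y + 2^-1 * h2 y * sg y ^+ 2 - ke y * h y = - ff y]).
Variable S : nat -> simple_process F.
Local Notation mu := (@lebesgue_measure R).
Local Notation "''E' f" := (\int[P]_w f w) (at level 10, f at level 8).
Let err n w := \int[mu]_(s in `[0, T]) ((sp_value (S n) s w - sg (X s w)) ^+ 2).
Hypotheses (ierr : forall n w, mu.-integrable `[0, T] (EFin \o (fun s => (sp_value (S n) s w - sg (X s w)) ^+ 2)))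
  (merr : forall n, measurable_fun setT (err n))
  (err0 : to0_in_probability P (fun n w => (err n w)%:E))
  (sp0 : forall t, 0 <= t -> t <= T ->
     to0_in_probability P (fun n w => (`|sp_integral (S n) W t w - I t w|)%:E)).
Variable G : set Omega.
Hypotheses (mG : measurable G)
  (GX : forall w, G w -> forall s, 0 <= s -> s <= grid_exit X T a0 b0 m gd w -> a <= X s w <= b).

Let Z := stopped_functional X h ke T a0 b0 x0 m gd ff.

Let A0 : 0 <= A. Proof. by rewrite (le_trans _ A1). Qed.
Let T0 : 0 <= T. Proof. by have /andP[] := gdT m; rewrite gdm. Qed.
(** Up to the exit the square of [sg (X)] is at most [A^2] on [G]. With the extra 2, the cut-off
    cannot act there as long as the integrated square error is at most 1. *)
Let K := 2 + 2 * A ^+ 2 * T.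
Let K0 : 0 <= K.
Proof. by rewrite /K addr_ge0// mulr_ge0// mulr_ge0// exprn_ge0. Qed.

(** The bound of [ito_functional_le] for this [K]; no simple process enters it. *)
Definition stopped_error_constant : R := 2 * A + (2 * A ^+ 2 * T + A * (2 + 2 * A ^+ 2 * T)).
Let C := stopped_error_constant.

Let q n := simple_integral_error W m gd (S n) I.

Let mW t : measurable_fun setT (W t).
Proof. by apply: (adapted_measurableR hF) => //; case: hW. Qed.

Let msp n t : measurable_fun setT (sp_integral (S n) W t).
Proof.
apply: measurable_sum => i; apply: measurable_funM; last exact: measurable_funB.
have ti : 0 <= sp_time (S n) i.
  elim: (nat_of_ord i) => [|k IH]; first exact: sp_time_ge0.
  exact: le_trans (sp_time_nd _ _).
have [sF _ _ _] := hF; have [_ Fm] := sF _ ti.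
by apply: (measurable_wrt_measurable Fm); exact: sp_coef_meas.
Qed.

Let q_ge0 n s w : 0 <= q n s w.
Proof. by apply: sumr_ge0 => j _; rewrite le_min ler01 normr_ge0. Qed.

Let q_le n s w : `|q n s w| <= m.+1%:R.
Proof.
rewrite ger0_norm// /q /simple_integral_error (@le_trans _ _ (\sum_(j < m.+1) 1))//.
  by apply: ler_sum => j _; rewrite ge_min lexx.
by rewrite sumr_const card_ord.
Qed.

Let mq n : measurable_fun [set: R * Omega] (fun z => q n z.1 z.2).
Proof.
have [_ cW _] := hW.
have cm (f : R -> R) (v : R) : continuous f -> continuous (fun s => f (Num.min s v)).
  move=> cf s; apply: (continuous_comp (f := fun s => Num.min s v) (g := f)); last exact: cf.
  by apply: continuous_min; [exact: cvg_id|exact: cvg_cst].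
have mm (Y : R -> Omega -> R) (v : R) : (forall t, measurable_fun setT (Y t)) -> (forall w, continuous (Y ^~ w)) ->
    measurable_fun [set: R * Omega] (fun z => Y (Num.min z.1 v) z.2).
  move=> mY cY; apply: (@caratheodory_measurable _ _ _ (fun t w => Y (Num.min t v) w)) => // w.
  exact: (cm (Y ^~ w)).
apply: measurable_sum => j.
apply: measurable_minr => //; apply: measurableT_comp => //; apply: measurable_funB; last exact: mm.
apply: (mm (fun s w => sp_integral (S n) W s w)) => [t|w s]; first exact: msp.
rewrite /sp_integral; apply: cvg_sum_ord => i; apply: cvgM; first exact: cvg_cst.
have cm' v : continuous (fun s => W (Num.min v s) w).
  by under [X in continuous X]eq_fun do rewrite minC; exact: (cm (W ^~ w)).
by apply: cvgB; exact: cm'.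
Qed.

Let bmq n s : bounded_measurable (q n s).
Proof.
split; last by exists m.+1%:R => w; exact: q_le.
exact: (adapted_joint_measurable_pair (f := q n) s (mq n)).
Qed.

Let Eq_cvg0 s : 0 <= s -> s <= T -> 'E (q n s) @[n --> \oo] --> (0 : R).
Proof.
move=> s0 sT.
have qE n : 'E (q n s) = \sum_(j < m.+1) 'E (fun w => Num.min 1 `|sp_integral (S n) W (Num.min s (gd j)) w - I (Num.min s (gd j)) w|).
  rewrite /q /simple_integral_error; apply: expectation_sum => j.
  split; first by apply: measurable_minr => //; apply: measurableT_comp => //; apply: measurable_funB; [exact: msp|exact: mI].
  by exists 1 => w; rewrite ger0_norm ?ge_min ?lexx// le_min ler01 normr_ge0.
suff : (\sum_(j < m.+1) 'E (fun w => Num.min 1 `|sp_integral (S n) W (Num.min s (gd j)) w - I (Num.min s (gd j)) w|))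
    @[n --> \oo] --> \sum_(j < m.+1) (0 : R).
  by rewrite big1//; apply: cvg_trans; apply: near_eq_cvg; apply: nearW => n; rewrite qE.
apply: cvg_sum_ord => j; apply: expectation_min1_cvg0 => //.
- by move=> n; apply: measurableT_comp => //; apply: measurable_funB; [exact: msp|exact: mI].
- have /andP[g0 gT] := gdT j; apply: sp0; first by rewrite le_min s0 g0.
  by rewrite ge_min sT.
Qed.

Let Z_le w : `|Z w| <= C.
Proof.
apply: (le_trans (stopped_functional_bound hF aX cX X_neg cke keA a0 b0 x0 gdT gdm cff ffA w hA ffA)).
rewrite /C /stopped_error_constant lerD2l.
have A2 : A <= A ^+ 2 by rewrite expr2 ler_peMl.
have t1 : A * T <= A ^+ 2 * T by rewrite ler_wpM2r.
have t2 : 0 <= A * (2 + 2 * A ^+ 2 * T) by exact: mulr_ge0.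
have t3 : 0 <= A ^+ 2 * T by rewrite mulr_ge0// sqr_ge0.
by move: t1 t2 t3; lra.
Qed.

Let C0 : 0 <= C.
Proof.
rewrite /C /stopped_error_constant -/K.
by apply: addr_ge0; [exact: mulr_ge0|apply: addr_ge0; apply: mulr_ge0 => //; apply: mulr_ge0 => //; exact: exprn_ge0].
Qed.

(** For distances at least 1 the sup bounds suffice. Below 1, [h] and [h1] are Lipschitz by the mean
    value theorem, and a square is at most its base. The truncated distance is the one whose
    expectation is known to vanish. *)
Let modulus (e L : R) : 0 <= e -> 0 <= L -> (forall y z, `|h2 z - h2 y| <= e + L * (z - y) ^+ 2) ->
  [/\ forall y z, `|h z - h y| <= e + (L + 2 * A) * Num.min 1 `|z - y|,
      forall y z, `|h1 z - h1 y| <= e + (L + 2 * A) * Num.min 1 `|z - y|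
    & forall y z, `|h2 z - h2 y| <= e + (L + 2 * A) * Num.min 1 `|z - y|].
Proof.
move=> e0 L0 h2e.
have far (f : R -> R) y z : (forall x, `|f x| <= A) -> 1 <= `|z - y| ->
    `|f z - f y| <= e + (L + 2 * A) * Num.min 1 `|z - y|.
  move=> fA yz; rewrite min_l// mulr1 (le_trans (ler_normB _ _))//.
  by have := fA z; have := fA y; move: e0 L0; lra.
have near_ (f f' : R -> R) y z : (forall x, is_derive x (1 : R) f (f' x)) -> (forall x, `|f' x| <= A) ->
    `|z - y| <= 1 -> `|f z - f y| <= e + (L + 2 * A) * Num.min 1 `|z - y|.
  move=> df fA yz; rewrite min_r//; have [u _ ->] := @mean_value _ f f' y z df.
  rewrite normrM (@le_trans _ _ ((L + 2 * A) * `|z - y|))//; last by rewrite lerDr.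
  by rewrite ler_wpM2r// (le_trans (fA u))//; move: L0 A0; lra.
split=> y z; (have [yz|] := boolP (1 <= `|z - y|); first exact: far); rewrite -ltNge => /ltW yz.
- exact: (near_ h h1).
- exact: (near_ h1 h2).
rewrite min_r// (le_trans (h2e y z))// lerD2l -[(z - y) ^+ 2]real_normK ?num_real//.
have : `|z - y| ^+ 2 <= `|z - y| by rewrite expr2 ler_piMl.
set v := `|z - y|; have v0 : 0 <= v by exact: normr_ge0.
have Av : 0 <= A * v by exact: mulr_ge0.
by move=> vv; rewrite mulrDl (@le_trans _ _ (L * v))// ?ler_wpM2l// lerDl; move: Av; lra.
Qed.

Let bq_int n : bounded_measurable (fun w => \int[mu]_(s in `[0, T]) q n s w).
Proof.
split; first by apply: (@measurable_Rintegral_param _ _ _ _ _ mu (fun z => q n z.1 z.2)) => //; exact: mq.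
exists (m.+1%:R * (T - 0)) => w; apply: normr_Rintegral_itv_le => //.
apply: (bounded_integrable_itv (M := m.+1%:R)) => //; apply: measurable_funTS.
exact: (measurableT_comp (mq n) (measurable_pair2 w : measurable_fun setT (fun r : R => (r, w)))).
Qed.

Let Eq_int_cvg0 : 'E (fun w => \int[mu]_(s in `[0, T]) q n s w) @[n --> \oo] --> (0 : R).
Proof.
have E n : 'E (fun w => \int[mu]_(s in `[0, T]) q n s w) = \int[mu]_(s in `[0, T]) 'E (q n s).
  by apply: (@fubini_itv _ _ _ P 0 T (fun z => q n z.1 z.2) m.+1%:R) => //; exact: mq.
rewrite (funext E); apply: (bounded_convergence_itv (f := fun n s => 'E (q n s)) (M := m.+1%:R)).
- move=> n; apply: (@measurable_Rintegral_param _ _ _ _ _ P (fun z => q n z.2 z.1)) => //.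
  exact: (measurableT_comp (mq n) (@measurable_swap _ _ _ _)).
- move=> n s; rewrite -[leRHS](expectation_cst P); apply: normr_expectation_le => //.
  + exact: bounded_measurable_integrable.
  + exact: integrable_EFin_cst.
- by move=> s /andP[s0 sT]; exact: Eq_cvg0.
Qed.

(** The cut-off functional [Zn] has mean zero. On [G], and where the approximation is good, it is
    close to [Z]; off [G] it is at most [C]. The probability of the complement of [G] is therefore
    the only error that survives the limit. *)
Lemma stopped_functional_expectation :
  `|'E (fun w => Z w * \1_G w)| <= C * fine (P (~` G)).
Proof.
apply/ler_addgt0Pl => dl dl0.
set B := 1 + (2 * A + A ^+ 2) * T + A ^+ 2 * T.
have A2 : 0 <= A ^+ 2 by exact: sqr_ge0.
have B0 : 0 < B.
  by rewrite /B -addrA ltr_wpDr// addr_ge0// mulr_ge0// addr_ge0// mulr_ge0.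
have dl4 : 0 < dl / 4 by rewrite divr_gt0.
pose e := dl / 4 / B; have e0 : 0 < e by exact: divr_gt0.
have [L2 L20 h2e] := h2mod e0.
have [m0 m1 m2] := modulus (ltW e0) L20 h2e.
set L := L2 + 2 * A in m0 m1 m2; have L0 : 0 <= L by rewrite /L addr_ge0// mulr_ge0.
set E1 := A * (1 + A / e); have E10 : 0 < E1.
  by rewrite mulr_gt0 ?(lt_le_trans ltr01 A1)// ltr_wpDr// divr_ge0// ltW.
pose eta := Num.min 1 (dl / 4 / E1); have eta0 : 0 < eta by rewrite lt_min ltr01 divr_gt0.
set k2 := (2 * A + A ^+ 2) * L.
have k20 : 0 <= k2 by apply: mulr_ge0 => //; apply: addr_ge0 => //; exact: mulr_ge0.
have x10 : 0 < dl / 4 / (L + k2 + 1) by rewrite divr_gt0// ltr_wpDl// addr_ge0.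
have x20 : 0 < dl / 4 / (2 * C + 1) by rewrite divr_gt0// ltr_wpDl// mulr_ge0.
have /cvgrPdist_le/(_ _ x10) N1 := Eq_cvg0 T0 (lexx T).
have /cvgrPdist_le/(_ _ x10) N2 := Eq_int_cvg0.
have N3 := to0_in_probability_near err0 eta0 x20.
near \oo => n.
have qT : 'E (q n T) <= dl / 4 / (L + k2 + 1).
  apply: le_trans (ler_norm _) _; rewrite -normrN -sub0r; near: n.
  exact: N1.
have qI : 'E (fun w => \int[mu]_(s in `[0, T]) q n s w) <= dl / 4 / (L + k2 + 1).
  apply: le_trans (ler_norm _) _; rewrite -normrN -sub0r; near: n.
  exact: N2.
have Pe : fine (P [set w | eta <= err n w]) <= dl / 4 / (2 * C + 1).
  by near: n; exact: N3.
have [N [u [u0 un und u01 upt]]] := partition_refining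
  ([seq sp_time (S n) i | i <- iota 0 (sp_size (S n)).+1] ++ [seq gd j | j <- iota 0 m.+1]) T0.
have upS i k : (i <= sp_size (S n))%N -> (k < N)%N -> sp_time (S n) i <= u k \/ u k.+1 <= sp_time (S n) i.
  move=> iS; apply: upt; rewrite mem_cat; apply/orP; left; apply/mapP; exists i => //.
  by rewrite mem_iota.
have upg j k : (j <= m)%N -> (k < N)%N -> gd j <= u k \/ u k.+1 <= gd j.
  move=> jm; apply: upt; rewrite mem_cat; apply/orP; right; apply/mapP; exists j => //.
  by rewrite mem_iota.
pose Zn := ito_functional W X h h1 h2 be ke T a0 b0 x0 m gd (S n) N u K.
have EZn : 'E Zn = 0.
  exact: (ito_functional_mean hF hW W_neg aX cX X_neg A1 dh dh1 ch2 hA h1A h2A h2mod cbe cke beA keA a0 b0 x0 gdT gdm K u0 un und upS upg).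
have mZn : measurable_fun setT Zn.
  exact: (ito_functional_measurable hF hW W_neg aX cX X_neg A1 dh dh1 ch2 hA h1A h2A cbe cke beA keA a0 b0 x0 gdT gdm K u0 un und upS upg).
have leZn w : `|Zn w| <= C.
  exact: (ito_functional_le hF hW W_neg aX cX X_neg A1 dh dh1 ch2 hA h1A h2A cbe cke beA keA a0 b0 x0 gdT gdm K0 u0 un und upS upg).
have bZn : bounded_measurable Zn by split => //; exists C.
have bZG : bounded_measurable (fun w => Z w * \1_G w).
  apply: bounded_measurableM; last exact: bounded_measurable_indic.
  split; last by exists C.
  exact: (stopped_functional_measurable hF aX cX X_neg A1 dh cke keA a0 b0 x0 gdT gdm cff).
set Er := [set w | eta <= err n w].
have mEr : measurable Er.
  rewrite -[X in measurable X]setTI (_ : Er = err n @^-1` `[eta, +oo[%classic); first exact: merr.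
  by apply/seteqP; split => w /=; rewrite in_itv/= andbT.
pose k0 := e + (2 * A + A ^+ 2) * (e * T) + A * ((1 + A / e) * eta + A * e * T).
pose Bn w := k0 + L * q n T w + k2 * \int[mu]_(s in `[0, T]) q n s w + 2 * C * \1_Er w + C * \1_(~` G) w.
have k00 : 0 <= k0.
  have eT : 0 <= e * T by rewrite mulr_ge0// ltW.
  have p1 : 0 <= (2 * A + A ^+ 2) * (e * T) by apply: mulr_ge0 => //; apply: addr_ge0 => //; exact: mulr_ge0.
  have p2 : 0 <= A * ((1 + A / e) * eta + A * e * T).
    apply: mulr_ge0 => //; apply: addr_ge0; last by rewrite -mulrA; exact: mulr_ge0.
    by apply: mulr_ge0; [apply: addr_ge0 => //; apply: divr_ge0 => //; exact: ltW|exact: ltW].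
  by rewrite /k0; apply: addr_ge0 => //; apply: addr_ge0 => //; exact: ltW.
have q0 w : 0 <= \int[mu]_(s in `[0, T]) q n s w by apply: Rintegral_ge0 => s _; exact: q_ge0.
have Bn_rest w : 0 <= k0 + L * q n T w + k2 * \int[mu]_(s in `[0, T]) q n s w.
  by apply: addr_ge0; [apply: addr_ge0 => //; exact: mulr_ge0|exact: mulr_ge0].
have ZZn w : `|Z w * \1_G w - Zn w| <= Bn w.
  rewrite /Bn !indicE in_setC.
  case: (boolP (w \in G)) => wG /=; last first.
    rewrite mulr0 sub0r normrN mulr1 (le_trans (leZn w))// lerDr.
    by apply: addr_ge0 => //; apply: mulr_ge0 => //; exact: mulr_ge0.
  rewrite mulr1 mulr0 addr0; case: (boolP (w \in Er)) => wE /=.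
    rewrite mulr1 (le_trans (ler_normB _ _))// (@le_trans _ _ (2 * C))//; last by rewrite lerDr.
    by rewrite mulr_natl mulr2n lerD.
  rewrite mulr0 addr0.
  have errlt : err n w < eta by move: wE; rewrite notin_setE /Er/= => /negP; rewrite -ltNge.
  have errK : 2 * \int[mu]_(s in `[0, T]) ((sp_value (S n) s w - sg (X s w)) ^+ 2) + 2 * A ^+ 2 * T <= K.
    rewrite /K lerD2r -[leRHS]mulr1 ler_pM2l// -/(err n w) (le_trans (ltW errlt))// /eta.
    by rewrite ge_min lexx.
  have Xab := GX (set_mem wG).
  rewrite distrC.
  have := ito_functional_close hF hW W_neg aX cX X_neg A1 dh dh1 ch2 hA h1A h2A cbe cke beA keA
     gdT gdm u0 un und upS upg cI cff ffA XE gen e0 L0 m0 m1 m2 Xab (ierr n w) errK.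
  rewrite -/Z -/Zn -/(err n w) => /le_trans; apply.
  have e1 : A * ((1 + A / e) * err n w) <= A * ((1 + A / e) * eta).
    apply: ler_wpM2l => //; apply: ler_wpM2l; last exact: ltW.
    by apply: addr_ge0 => //; apply: divr_ge0 => //; exact: ltW.
  rewrite /k0 /k2 -/(q n) -/(q n T w).
  have -> : A * ((1 + A / e) * err n w + A * e * T) = A * ((1 + A / e) * err n w) + A * (A * e * T) by ring.
  have -> : A * ((1 + A / e) * eta + A * e * T) = A * ((1 + A / e) * eta) + A * (A * e * T) by ring.
  set i := \int[mu]_(s in _) _; move: e1.
  set y := A * ((1 + A / e) * err n w); set y' := A * ((1 + A / e) * eta); set z := A * (A * e * T).
  set a' := 2 * A + A ^+ 2; move=> yy.
  by rewrite mulrDr -subr_ge0 (_ : _ - _ = y' - y) ?subr_ge0//; ring.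
have EZ : 'E (fun w => Z w * \1_G w) = 'E (fun w => Z w * \1_G w - Zn w).
  by rewrite expectationB// EZn subr0.
have bm1 : bounded_measurable (fun w => L * q n T w) by exact: bounded_measurableZl.
have bm2 : bounded_measurable (fun w => k2 * \int[mu]_(s in `[0, T]) q n s w) by exact: bounded_measurableZl.
have bm3 : bounded_measurable (fun w => 2 * C * \1_Er w) by apply: bounded_measurableZl; exact: bounded_measurable_indic.
have mGc : measurable (~` G) by exact: measurableC.
have bm4 : bounded_measurable (fun w => C * \1_(~` G) w) by apply: bounded_measurableZl; exact: bounded_measurable_indic.
have bm0 : bounded_measurable (fun _ : Omega => k0) by exact: bounded_measurable_cst.
have bm01 := bounded_measurableD bm0 bm1; have bm012 := bounded_measurableD bm01 bm2.
have bm0123 := bounded_measurableD bm012 bm3.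
rewrite EZ (le_trans (normr_expectation_le _ _ ZZn))//.
- by apply: bounded_measurable_integrable; exact: bounded_measurableB.
- by apply: bounded_measurable_integrable; exact: (bounded_measurableD bm0123 bm4).
rewrite /Bn (expectationD P bm0123 bm4) (expectationD P bm012 bm3) (expectationD P bm01 bm2) (expectationD P bm0 bm1).
rewrite expectation_cst (expectationZl P L (bmq n T)) (expectationZl P k2 (bq_int n)).
rewrite !expectationZl; [|exact: bounded_measurable_indic..].
rewrite !Rintegral_indic// lerD2r.
have t0 : k0 <= dl / 4 + dl / 4.
  have -> : k0 = e * B + E1 * eta by rewrite /k0 /B /E1; ring.
  rewrite lerD//; first by rewrite /e divfK// gt_eqF.
  by rewrite mulrC -ler_pdivlMr// /eta ge_min lexx orbT.
have t1 : L * 'E (q n T) + k2 * 'E (fun w => \int[mu]_(s in `[0, T]) q n s w) <= dl / 4.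
  apply: (@le_trans _ _ ((L + k2) * (dl / 4 / (L + k2 + 1)))).
    by rewrite [leRHS]mulrDl lerD// ler_wpM2l.
  rewrite mulrCA ler_piMr ?(ltW dl4)// ler_pdivrMr ?mul1r ?lerDl//.
  by rewrite ltr_wpDl// addr_ge0.
have t2 : 2 * C * fine (P Er) <= dl / 4.
  apply: (@le_trans _ _ (2 * C * (dl / 4 / (2 * C + 1)))); first by rewrite ler_wpM2l// mulr_ge0.
  rewrite mulrCA ler_piMr ?(ltW dl4)// ler_pdivrMr ?mul1r ?lerDl//.
  by rewrite ltr_wpDl// mulr_ge0.
have := lerD (lerD t0 t1) t2; rewrite !addrA => /le_trans; apply.
by rewrite -[leRHS](_ : dl / 4 + dl / 4 + dl / 4 + dl / 4 = dl)//; field.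
Unshelve. all: by end_near. Qed.

End stopped_limit.

(** * Compactness and smooth truncation *)

Section compact_intervals.
Context {R : realType}.

(** Heine-Borel in the form used below: radii valid around each point of a segment can be replaced
    by a single one. *)
Lemma segment_near_covering (a b : R) (Q : R -> R -> Prop) :
  (forall x, a <= x <= b -> exists2 r, 0 < r &
     forall y dl, `|y - x| < r -> 0 < dl -> dl < r -> Q dl y) ->
  exists2 r, 0 < r & forall y dl, a <= y <= b -> 0 < dl -> dl < r -> Q dl y.
Proof.
move=> loc.
have [cov _] := @compact_near_coveringP R `[a, b]%classic.
have /cov := @segment_compact R a b.
move=> /(_ R (0^'+) Q _)[|r /= r0 H].
  move=> x; rewrite /= in_itv/= => /loc[r r0 H].
  exists (ball x r, [set dl | 0 < dl /\ dl < r]) => /=.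
    split; first exact: nbhsx_ballx.
    by near=> dl; split; near: dl; [exact: nbhs_right_gt|exact: nbhs_right_lt].
  by move=> [y dl]/= [yx [dl0 dlr]]; apply: H => //; rewrite distrC.
exists r => // y dl yab dl0 dlr; apply: (H dl) => //=.
by rewrite sub0r normrN gtr0_norm.
Unshelve. all: by end_near. Qed.

Lemma uniformly_continuous_segment (g : R -> R) (a b e : R) : continuous g -> 0 < e ->
  exists2 r, 0 < r & forall y z, a <= y <= b -> `|z - y| < r -> `|g z - g y| <= e.
Proof.
move=> cg e0.
have [|r r0 H] := @segment_near_covering a b (fun dl y => forall z, `|z - y| < dl -> `|g z - g y| <= e).
  move=> x _; have /cvgrPdist_lt/(_ (e / 2)) := cg x.
  rewrite divr_gt0// => /(_ isT)/nbhs_ballP[r /= r0 rH].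
  exists (r / 2); first by rewrite divr_gt0.
  move=> y dl yx dl0 dlr z zy.
  have gy : `|g x - g y| < e / 2.
    by apply: rH; rewrite /ball/= distrC (lt_le_trans yx)// ler_pdivrMr// ler_peMr ?ler1n ?(ltW r0).
  have gz : `|g x - g z| < e / 2.
    apply: rH; rewrite /ball/= (_ : x - z = (x - y) + (y - z)); last by ring.
    rewrite (le_lt_trans (ler_normD _ _))// (splitr r) ltrD//; first by rewrite distrC.
    by rewrite distrC (lt_trans zy).
  rewrite (_ : g z - g y = (g x - g y) - (g x - g z)); last by ring.
  by rewrite (le_trans (ler_normB _ _))// (splitr e) lerD// ltW.
exists (r / 2); first by rewrite divr_gt0.
move=> y z yab zy; apply: (H y (r / 2)) => //; first by rewrite divr_gt0.
by rewrite ltr_pdivrMr// ltr_pMr// ltr1n.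
Qed.

Lemma bounded_segment (g : R -> R) (a b : R) :
  (forall x, a <= x <= b -> {for x, continuous g}) ->
  exists M, forall x, a <= x <= b -> `|g x| <= M.
Proof.
move=> cg; have [ab|ba] := leP a b; last first.
  by exists 0 => x /andP[ax xb]; have := le_trans ax xb; rewrite leNgt ba.
have cg' : {within `[a, b], continuous (fun x => `|g x|)}.
  apply: continuous_in_subspaceT => x; rewrite inE/= in_itv/= => xab.
  by apply: (continuous_comp (cg x xab)); exact: norm_continuous.
have [c _ H] := EVT_max ab cg'.
by exists `|g c| => x xab; apply: H; rewrite in_itv.
Qed.

(** For close points, uniform continuity gives [e]. For points at distance at least [r], the
    difference is at most [2 |M|], hence at most [(2 |M| / r^2) (z - y)^2]. *)
Lemma compact_support_modulus (g : R -> R) (a b : R) : continuous g ->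
  (forall x, ~~ (a <= x <= b) -> g x = 0) ->
  exists2 M, forall x, `|g x| <= M &
  forall e, 0 < e -> exists2 L, 0 <= L & forall y z, `|g z - g y| <= e + L * (z - y) ^+ 2.
Proof.
move=> cg g0.
have [M HM] := @bounded_segment g a b (fun x _ => cg x).
have gM x : `|g x| <= `|M|.
  have [xab|xab] := boolP (a <= x <= b); last by rewrite g0// normr0.
  by rewrite (le_trans (HM x xab))// ler_norm.
exists `|M| => // e e0.
have [r r0 Hr] := uniformly_continuous_segment a b cg e0.
have L0 : 0 <= 2 * `|M| / r ^+ 2 by apply: divr_ge0; [exact: mulr_ge0|exact/ltW/exprn_gt0].
exists (2 * `|M| / r ^+ 2) => //.
move=> y z; have [zy|zy] := ltP `|z - y| r; last first.
  apply: (@le_trans _ _ (2 * `|M|)).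
    by rewrite (le_trans (ler_normB _ _))// mulr_natl mulr2n lerD.
  rewrite (@le_trans _ _ (2 * `|M| / r ^+ 2 * (z - y) ^+ 2))//; last by rewrite lerDr ltW.
  rewrite -mulrA ler_peMr ?mulr_ge0// mulrC ler_pdivlMr ?exprn_gt0// mul1r.
  by rewrite -[(z - y) ^+ 2]real_normK ?num_real// lerXn2r// nnegrE ltW.
rewrite (@le_trans _ _ e)//; last by rewrite lerDl mulr_ge0// sqr_ge0.
have [yab|yab] := boolP (a <= y <= b); first exact: Hr.
have [zab|zab] := boolP (a <= z <= b); first by rewrite distrC; apply: Hr => //; rewrite distrC.
by rewrite !g0// subrr normr0 ltW.
Qed.

End compact_intervals.

Section smooth_clamp.
Context {R : realType}.
Local Notation pp := (fun x : R => Num.max 0 x).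

Let cpp : continuous pp.
Proof. by move=> x; apply: continuous_max; [exact: cvg_cst|exact: cvg_id]. Qed.

Lemma is_derive_pos_part_exprn k (x : R) :
  is_derive x (1 : R) (fun x => Num.max 0 x ^+ k.+2) (k.+2%:R * Num.max 0 x ^+ k.+1).
Proof.
have dX (z : R) : is_derive z (1 : R) (fun x => x ^+ k.+2) (k.+2%:R * z ^+ k.+1).
  apply: DeriveDef; first exact: exprn_derivable.
  by rewrite exp_derive /GRing.scale/= mulr1.
have [x0|x0|<-] := ltgtP 0 x.
- apply: near_eq_is_derive (dX x); near=> y.
  by rewrite max_r// ltW//; near: y; exact: lt_nbhsr.
- rewrite expr0n/= mulr0.
  apply: near_eq_is_derive (is_derive_cst (0 : R) x 1); near=> y.
  rewrite max_l ?expr0n//= ltW//; near: y; exact: lt_nbhsl.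
- rewrite ?maxxx expr0n/= mulr0; apply/is_derive1_caratheodory.
  exists (fun z => Num.max 0 z ^+ k.+1); split.
  + move=> z; rewrite maxxx expr0n/= !subr0 exprS mulrC.
    by case: (leP 0 z) => // z0; rewrite expr0n/= !mul0r.
  + by apply: (@continuous_comp _ _ _ pp (fun z => z ^+ k.+1)); [exact: cpp|exact: exprn_continuous].
  + by rewrite maxxx expr0n.
Unshelve. all: by end_near. Qed.

Let K (x : R) := 6^-1 * (pp x ^+ 3 - 2 * pp (x - 1) ^+ 3 + pp (x - 2) ^+ 3).
Let K1 (x : R) := 2^-1 * (pp x ^+ 2 - 2 * pp (x - 1) ^+ 2 + pp (x - 2) ^+ 2).
Let K2 (x : R) := pp x - 2 * pp (x - 1) + pp (x - 2).

Let shift_derive (f f' : R -> R) (c : R) : (forall x, is_derive x (1 : R) f (f' x)) ->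
  forall x, is_derive x (1 : R) (fun x => f (x - c)) (f' (x - c)).
Proof.
move=> df x.
have ds : is_derive x (1 : R) (fun x => x - c) 1 by apply: is_derive_eq; rewrite subr0.
by have := @is_derive1_comp _ f (fun x => x - c) x _ _ (df (x - c)) ds; rewrite mulr1.
Qed.

Let dK x : is_derive x (1 : R) K (K1 x).
Proof.
have d0 := is_derive_pos_part_exprn 1 x.
have d1 := shift_derive 1 (is_derive_pos_part_exprn 1) x.
have d2 := shift_derive 2 (is_derive_pos_part_exprn 1) x.
apply: (is_derive_eq (is_deriveZ 6^-1 (is_deriveD (is_deriveB d0 (is_deriveZ 2 d1)) d2))).
by rewrite /GRing.scale/= /K1; field.
Qed.

Let dK1 x : is_derive x (1 : R) K1 (K2 x).
Proof.
have d0 := is_derive_pos_part_exprn 0 x.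
have d1 := shift_derive 1 (is_derive_pos_part_exprn 0) x.
have d2 := shift_derive 2 (is_derive_pos_part_exprn 0) x.
apply: (is_derive_eq (is_deriveZ 2^-1 (is_deriveD (is_deriveB d0 (is_deriveZ 2 d1)) d2))).
by rewrite /GRing.scale/= /K2 !expr1; field.
Qed.

Let cK2 : continuous K2.
Proof.
have cs (c : R) : continuous (fun x => pp (x - c)).
  move=> x; apply: (@continuous_comp _ _ _ (fun x => x - c) pp); last exact: cpp.
  by apply: cvgB; [exact: cvg_id|exact: cvg_cst].
move=> x; apply: cvgD; last exact: (cs 2).
by apply: cvgB; [exact: cpp|apply: cvgM; [exact: cvg_cst|exact: (cs 1)]].
Qed.

Let K_neg x : x <= 0 -> [/\ K x = 0, K1 x = 0 & K2 x = 0].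
Proof.
move=> x0; rewrite /K /K1 /K2 !max_l//; [|lra..].
by rewrite !expr0n/= !mulr0 !subr0 !addr0 !mulr0.
Qed.

Let K_ge2 x : 2 <= x -> [/\ K x = x - 1, K1 x = 1 & K2 x = 0].
Proof. by move=> x2; rewrite /K /K1 /K2 !max_r//; [split; field|lra..]. Qed.

Let K_mid x : 0 <= x -> x <= 2 -> 0 <= K x <= x.
Proof.
move=> x0 x2; rewrite /K (max_r x0) (max_l (_ : x - 2 <= 0)); last by lra.
rewrite expr0n/= addr0; have [x1|x1] := leP x 1.
  rewrite (max_l (_ : x - 1 <= 0)); last by lra.
  rewrite expr0n/= mulr0 subr0 mulr_ge0 ?exprn_ge0//=.
  have : x ^+ 3 <= x by rewrite exprS ler_piMr// exprn_ile1.
  by move: x0; set y := x ^+ 3; lra.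
rewrite (max_r (_ : 0 <= x - 1)); last by lra.
have h1 : 0 <= (x - 1) * (2 - x) by apply: mulr_ge0; lra.
have h2 : 0 <= x * ((x - 1) * (2 - x)) by exact: mulr_ge0.
by apply/andP; split; nra.
Qed.

(* The cubic spline [K] vanishes on the left of 0 and has slope 1 on the right
   of 2; two rescaled copies flatten the identity at both ends. *)
Lemma smooth_clamp (a b : R) : 0 < a -> a <= b ->
  exists t t1 t2 : R -> R,
  [/\ forall x, is_derive x (1 : R) t (t1 x), forall x, is_derive x (1 : R) t1 (t2 x),
      continuous t2,
      forall x, a <= x <= b -> [/\ t x = x, t1 x = 1 & t2 x = 0]
    & (forall x, a / 2 <= t x <= b + 2) /\
      (forall x, ~~ (a / 2 <= x <= b + 2) -> t1 x = 0 /\ t2 x = 0)].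
Proof.
move=> a0 ab; pose v := a / 4; have v0 : 0 < v by rewrite divr_gt0.
pose l x := (a - x) / v.
exists (fun x => x - K (x - b) + v * K (l x)), (fun x => 1 - K1 (x - b) - K1 (l x)),
  (fun x => - K2 (x - b) + v^-1 * K2 (l x)).
have dl x : is_derive x (1 : R) l (- v^-1).
  by apply: is_derive_eq; rewrite /GRing.scale/=; ring.
have dlf (f f' : R -> R) : (forall x, is_derive x (1 : R) f (f' x)) ->
    forall x, is_derive x (1 : R) (fun x => f (l x)) (- v^-1 * f' (l x)).
  by move=> df x; have := @is_derive1_comp _ f l x _ _ (df (l x)) (dl x); rewrite mulrC.
have lv x : x = a - v * l x by rewrite /l; field; rewrite gt_eqF.
have va : a = 4 * v by rewrite /v; field.
split.
- move=> x; have d1 := shift_derive b dK x; have d2 := dlf K K1 dK x.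
  apply: (is_derive_eq (is_deriveD (is_deriveB (is_derive_id x 1) d1) (is_deriveZ v d2))).
  by rewrite /GRing.scale/=; field; rewrite gt_eqF.
- move=> x; have d1 := shift_derive b dK1 x; have d2 := dlf K1 K2 dK1 x.
  apply: (is_derive_eq (is_deriveB (is_deriveB (is_derive_cst (1 : R) x 1) d1) d2)).
  by ring.
- move=> x; apply: cvgD.
    apply: cvgN; apply: (@continuous_comp _ _ _ (fun x => x - b) K2); last exact: cK2.
    by apply: cvgB; [exact: cvg_id|exact: cvg_cst].
  apply: cvgM; first exact: cvg_cst.
  apply: (@continuous_comp _ _ _ l K2); last exact: cK2.
  by apply: cvgM; [apply: cvgB; [exact: cvg_cst|exact: cvg_id]|exact: cvg_cst].
- move=> x /andP[ax xb].
  have [|k k1 k2] := @K_neg (x - b); first by rewrite subr_le0.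
  have [|k' k1' k2'] := @K_neg (l x); first by rewrite pmulr_lle0 ?invr_gt0// subr_le0.
  by rewrite k k1 k2 k' k1' k2' !mulr0 !subr0 oppr0 !addr0.
split=> x.
  have [xa|ax] := leP x a.
    have l0 : 0 <= l x by rewrite divr_ge0 ?subr_ge0// ltW.
    have [|-> _ _] := @K_neg (x - b); first by rewrite subr_le0 (le_trans xa).
    have xE := lv x; have [l2|/ltW l2] := leP (l x) 2.
      have /andP[k0 k1] := K_mid l0 l2.
      have q1 : 0 <= v * K (l x) by rewrite mulr_ge0// ltW.
      have q2 : v * K (l x) <= v * l x by rewrite ler_wpM2l// ltW.
      have q3 : v * l x <= v * 2 by rewrite ler_wpM2l// ltW.
      by move: xE q1 q2 q3 va v0 ab; lra.
    have [-> _ _] := K_ge2 l2; rewrite mulrBr mulr1.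
    by move: xE va v0 ab; lra.
  have [|-> _ _] := @K_neg (l x).
    by rewrite pmulr_lle0 ?invr_gt0// subr_le0 ltW.
  rewrite mulr0 addr0; have [xb|/ltW bx] := leP x b.
    by have [|-> _ _] := @K_neg (x - b); [rewrite subr_le0|move: ax xb a0; lra].
  have [x2|/ltW x2] := leP (x - b) 2.
    by have /andP[k0 k1] := @K_mid (x - b) (ltac:(lra)) x2; move: k0 k1 ax bx a0 ab; lra.
  by have [-> _ _] := K_ge2 x2; move: x2 a0 ab; lra.
rewrite negb_and -!ltNge => /orP[xa|xb].
  have [|_ -> ->] := @K_neg (x - b); first by move: xa ab a0; lra.
  have [|_ -> ->] := @K_ge2 (l x).
    by rewrite ler_pdivlMr//; move: xa va; lra.
  by rewrite subr0 subrr mulr0 oppr0 addr0.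
have [|_ -> ->] := @K_ge2 (x - b); first by move: xb; lra.
have [|_ -> ->] := @K_neg (l x).
  by rewrite pmulr_lle0 ?invr_gt0// subr_le0; move: xb ab; lra.
by rewrite subrr subr0 mulr0 oppr0 addr0.
Qed.

End smooth_clamp.

Section rational_paths.
Context {R : realType}.

(** Lets statements about all times of a continuous path be written as countable, hence measurable,
    events. *)
Lemma le_of_rat_le (f : R -> R) (t c : R) : continuous f ->
  (forall q : rat, 0 <= (ratr q : R) <= t -> f (ratr q) <= c) ->
  forall s, 0 <= s <= t -> f s <= c.
Proof.
move=> cf H s /andP[s0 st].
have [t0|t0] := leP t 0.
  have r0 : ratr 0 = 0 :> R by rewrite rmorph0.
  have -> : s = ratr 0 by rewrite r0; apply/eqP; rewrite eq_le s0 (le_trans st).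
  by apply: H; rewrite r0 lexx (le_trans s0 st).
apply/ler_addgt0Pl => e e0.
have /cvgrPdist_le/(_ e e0)/nbhs_ballP[r /= r0 rH] := cf s.
have lt_itv : Num.max 0 (s - r) < Num.min t (s + r).
  by rewrite lt_min !gt_max t0 /=; apply/andP; split; [|apply/andP; split]; move: s0 st r0; lra.
have [q] := rat_in_itvoo lt_itv; rewrite in_itv/= gt_max lt_min => /andP[/andP[q0 sq] /andP[qt qs]].
have fq : `|f s - f (ratr q)| <= e.
  by apply: rH; rewrite /ball/= ltr_distl; apply/andP; split; move: sq qs; lra.
move: fq; rewrite ler_distl => /andP[_ fs].
by rewrite (le_trans fs)// addrC lerD2l H// !ltW.
Qed.

Lemma segment_of_rat (f : R -> R) (t lo hi : R) : continuous f ->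
  (forall q : rat, 0 <= (ratr q : R) <= t -> lo <= f (ratr q) <= hi) ->
  forall s, 0 <= s <= t -> lo <= f s <= hi.
Proof.
move=> cf H s st; apply/andP; split.
  rewrite -lerN2; apply: (@le_of_rat_le (fun s => - f s) t) => //.
    by move=> x; apply: cvgN; exact: cf.
  by move=> q qt; rewrite lerN2; have /andP[] := H q qt.
by apply: (@le_of_rat_le f t) => // q qt; have /andP[] := H q qt.
Qed.

Lemma partition_cell (u : nat -> R) (n : nat) (s : R) : u 0 < s -> s <= u n ->
  exists2 k, (k < n)%N & u k < s <= u k.+1.
Proof.
move=> u0s; elim: n => [|n IH] su; first by move: u0s; rewrite ltNge su.
have [h'|h'] := leP s (u n); last by exists n => //; rewrite h'.
by have [k kn ks] := IH h'; exists k => //; exact: ltnW.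
Qed.

End rational_paths.

Lemma probability_event_cvg0 {R : realType} {d} {Omega : measurableType d} (P : probability Omega R)
  (E : nat -> set Omega) : (forall n, measurable (E n)) ->
  (forall w, \forall n \near \oo, ~ E n w) ->
  forall dl : R, 0 < dl -> \forall n \near \oo, fine (P (E n)) <= dl.
Proof.
move=> mE E0 dl dl0.
have : (\int[P]_w (\1_(E n) w)%:E)%E @[n --> \oo] --> (0%:E : \bar R).
  rewrite -[X in _ --> X](integral0 P [set: Omega]).
  apply: (@dominated_cvg _ _ _ P _ _ (fun n w => (\1_(E n) w)%:E) (fun=> 0%:E) (fun=> 1%:E)) => //.
  - by move=> n; apply/measurable_EFinP; exact: measurable_indic.
  - move=> w _; apply: cvg_near_cst; apply: filterS (E0 w) => n En.
    by rewrite indicE memNset.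
  - exact: finite_measure_integrable_cst.
  - by move=> n w _; rewrite /= lee_fin indicE normr_nat lern1 leq_b1.
move=> /fine_cvg/cvgrPdist_le/(_ _ dl0); apply: filterS => n.
by rewrite /= integral_indic// setIT sub0r normrN ger0_norm// fine_ge0.
Qed.

Lemma positive_measurable_comp {R : realType} {d} {T : measurableType d} (g : R -> R) (X : T -> R) :
  (forall y : R, 0 < y -> {for y, continuous g}) -> measurable_fun setT X -> (forall w, 0 < X w) ->
  measurable_fun setT (g \o X).
Proof.
move=> cg mX X0.
have mg : measurable_fun (`]0, +oo[ : set R) g.
  apply: open_continuous_measurable_fun; first exact: interval_open.
  by move=> y; rewrite inE/= in_itv/= andbT; exact: cg.
apply: (measurable_comp _ _ mg mX) => //.
by move=> _ [w _ <-]; rewrite /= in_itv/= X0.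
Qed.

Lemma cvg_ge0_integral_itvy {R : realType} (f : R -> R) : measurable_fun [set: R] f -> (forall x, 0 <= f x) ->
  (\int[lebesgue_measure]_(x in `[0%R, n%:R]) (f x)%:E)%E @[n --> \oo] -->
  (\int[lebesgue_measure]_(x in `[0%R, +oo[) (f x)%:E)%E.
Proof.
move=> mf f0; set E : set R := `[0, +oo[%classic.
have mfE : measurable_fun [set: R] (fun x => f x * \1_E x).
  by apply: measurable_funM => //; apply: measurable_indic; exact: measurable_itv.
have fE0 x : 0 <= f x * \1_E x by rewrite mulr_ge0// indicE.
have EE (A : set R) : (\int[lebesgue_measure]_(x in A) (f x * \1_E x)%:E)%E =
    (\int[lebesgue_measure]_(x in A `&` E) (f x)%:E)%E.
  rewrite integral_mkcondr; apply: eq_integral => x _; rewrite patchE indicE.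
  by case: ifP => _; rewrite ?mulr1 ?mulr0.
have En (n : nat) : (\int[lebesgue_measure]_(x in `[(- n%:R)%R, n%:R]) (f x * \1_E x)%:E)%E =
    (\int[lebesgue_measure]_(x in `[0%R, n%:R]) (f x)%:E)%E.
  rewrite EE; congr (integral _ _ _).
  apply/seteqP; split => x /=; rewrite /E/= !in_itv/= ?andbT.
    by case=> /andP[_ ->] ->.
  by move=> /andP[x0 ->]; rewrite x0 andbT; split=> //; rewrite (le_trans _ x0)// oppr_le0.
have := cvg_ge0_integral_itv mfE fE0; rewrite EE setTI.
by under eq_cvg do rewrite En.
Qed.

(** * Dynkin's formula on a finite and on an infinite horizon *)

Section dynkin.
Context {R : realType} {d : measure_display} {Omega : measurableType d}.
Variables (P : probability Omega R) (F : R -> set (set Omega)) (W : R -> Omega -> R).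
Hypotheses (hF : usual_filtration P F) (hW : continuous_brownian P F W)
  (W_neg : forall t w, t <= 0 -> W t w = W 0 w).
Variables (X : R -> Omega -> R) (x0 : R).
Hypotheses (aX : adapted F X) (cX : forall w, continuous (X ^~ w))
  (X_neg : forall t w, t <= 0 -> X t w = X 0 w)
  (X0 : forall w, X 0 w = x0) (Xpos : forall t w, 0 < X t w).
Variables (h h1 h2 bb sg kk ff : R -> R) (Ch B : R).
Hypotheses (dh : forall x : R, 0 < x -> is_derive x (1 : R) h (h1 x))
  (dh1 : forall x : R, 0 < x -> is_derive x (1 : R) h1 (h2 x))
  (ch2 : forall x : R, 0 < x -> {for x, continuous h2})
  (hC : forall x : R, 0 < x -> `|h x| <= Ch)
  (cbb : forall x : R, 0 < x -> {for x, continuous bb})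
  (csg : forall x : R, 0 < x -> {for x, continuous sg})
  (ckk : forall x : R, 0 < x -> {for x, continuous kk})
  (kk_ge0 : forall x : R, 0 < x -> 0 <= kk x)
  (cff : continuous ff) (ffB : forall x, 0 <= ff x <= B)
  (gen : forall y : R, 0 < y -> h1 y * bb y + 2^-1 * h2 y * sg y ^+ 2 - kk y * h y = - ff y).
Variables (I : R -> Omega -> R) (S : nat -> simple_process F).
Hypotheses (cI : forall w, continuous (I ^~ w)) (mI : forall t, measurable_fun setT (I t))
  (XE : forall t w, 0 <= t -> X t w = x0 + \int[lebesgue_measure]_(s in `[0, t]) bb (X s w) + I t w).
Local Notation mu := (@lebesgue_measure R).
Local Notation "''E' f" := (\int[P]_w f w) (at level 10, f at level 8).
Let err T n w := \int[mu]_(s in `[0, T]) ((sp_value (S n) s w - sg (X s w)) ^+ 2).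
Hypotheses (ierr : forall T n w, mu.-integrable `[0, T] (EFin \o (fun s => (sp_value (S n) s w - sg (X s w)) ^+ 2)))
  (merr : forall T n, measurable_fun setT (err T n))
  (err0 : forall T, 0 <= T -> to0_in_probability P (fun n w => (err T n w)%:E))
  (sp0 : forall t, 0 <= t ->
     to0_in_probability P (fun n w => (`|sp_integral (S n) W t w - I t w|)%:E)).

Let x0_gt0 : 0 < x0.
Proof.
have [w|no] := pselect (exists w : Omega, True); first by case: w => w _; rewrite -(X0 w).
have := probability_setT P; rewrite (_ : [set: Omega] = set0) ?measure0; last first.
  by apply/seteqP; split => // w _; apply: no; exists w.
by move/eqP; rewrite eq_sym onee_eq0.
Qed.

(** All functions are composed with the smooth clamp of [a, b]. They become globally bounded, the
    derivatives of [H] get compact support, hence a uniform modulus, and nothing changes on [a, b]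
    itself, where the equation is needed. The bound of [H] by [Ch] does not depend on the
    interval. *)
Lemma localized_coefficients (a b : R) : 0 < a -> a <= b ->
  exists H H1 H2 be ke : R -> R, exists A : R,
  [/\ 1 <= A, forall x, is_derive x (1 : R) H (H1 x), forall x, is_derive x (1 : R) H1 (H2 x) & continuous H2] /\
  [/\ forall x, `|H x| <= A, forall x, `|H1 x| <= A, forall x, `|H2 x| <= A &
    forall e, 0 < e -> exists2 L, 0 <= L & forall y z, `|H2 z - H2 y| <= e + L * (z - y) ^+ 2] /\
  [/\ continuous be, continuous ke, forall x, `|be x| <= A & forall x, 0 <= ke x <= A] /\
  [/\ forall x, `|H x| <= Ch, forall x, `|ff x| <= A, forall y, a <= y <= b -> H y = h y /\ ke y = kk y &
    forall y, a <= y <= b -> [/\ be y = bb y, `|sg y| <= A &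
      H1 y * be y + 2^-1 * H2 y * sg y ^+ 2 - ke y * H y = - ff y]].
Proof.
move=> a0 ab; have [t [t1 [t2 [dt dt1 ct2 tid [trange tout]]]]] := smooth_clamp a0 ab.
have t0 x : 0 < t x by have /andP[l _] := trange x; apply: lt_le_trans l; rewrite divr_gt0.
have ct : continuous t.
  by move=> x; apply/differentiable_continuous/derivable1_diffP; have [] := dt x.
have ct1 : continuous t1.
  by move=> x; apply/differentiable_continuous/derivable1_diffP; have [] := dt1 x.
have ch1 x : 0 < x -> {for x, continuous h1}.
  by move=> x0'; apply/differentiable_continuous/derivable1_diffP; have [] := dh1 x0'.
have ctc (g : R -> R) : (forall x : R, 0 < x -> {for x, continuous g}) -> continuous (fun x => g (t x)).
  by move=> cg x; apply: (@continuous_comp _ _ _ t g); [exact: ct|exact: cg].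
pose H x := h (t x); pose H1 x := h1 (t x) * t1 x.
pose H2 x := h2 (t x) * t1 x ^+ 2 + h1 (t x) * t2 x.
have dH x : is_derive x (1 : R) H (H1 x).
  exact: (@is_derive1_comp _ h t x _ _ (dh (t0 x)) (dt x)).
have dH1 x : is_derive x (1 : R) H1 (H2 x).
  have dc := @is_derive1_comp _ h1 t x _ _ (dh1 (t0 x)) (dt x).
  apply: (is_derive_eq (is_deriveM dc (dt1 x))).
  by rewrite /GRing.scale/= /H2; ring.
have cH2 : continuous H2.
  move=> x; apply: cvgD; apply: cvgM; [exact: ctc| |exact: ctc|exact: ct2].
  by apply: (@continuous_comp _ _ _ t1 (fun z => z ^+ 2)); [exact: ct1|exact: exprn_continuous].
have cH1 : continuous H1 by move=> x; apply: cvgM; [exact: ctc|exact: ct1].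
have out1 x : ~~ (a / 2 <= x <= b + 2) -> H1 x = 0 by rewrite /H1 => /tout[-> _]; rewrite mulr0.
have out2 x : ~~ (a / 2 <= x <= b + 2) -> H2 x = 0.
  by rewrite /H2 => /tout[-> ->]; rewrite expr0n/= !mulr0 addr0.
have [M1 HM1 _] := compact_support_modulus cH1 out1.
have [M2 HM2 mod2] := compact_support_modulus cH2 out2.
have bnd (g : R -> R) lo hi : 0 < lo -> (forall x : R, 0 < x -> {for x, continuous g}) ->
    exists M, forall x, lo <= x <= hi -> `|g x| <= M.
  by move=> lo0 cg; apply: bounded_segment => x /andP[lx _]; apply: cg; exact: lt_le_trans lx.
have a20 : 0 < a / 2 by rewrite divr_gt0.
have [Mb HMb] := bnd bb (a / 2) (b + 2) a20 cbb.
have [Mk HMk] := bnd kk (a / 2) (b + 2) a20 ckk.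
have [Ms HMs] := bnd sg a b a0 csg.
have n0 (M : R) : 0 <= `|M| by [].
pose A := 1 + `|M1| + `|M2| + `|Mb| + `|Mk| + `|Ms| + `|Ch| + `|B|.
have Ale (M : R) (y : R) : `|y| <= M -> (`|M| <= A) -> `|y| <= A.
  by move=> yM; apply: le_trans; apply: (le_trans yM); exact: ler_norm.
have g1 := n0 M1; have g2 := n0 M2; have g3 := n0 Mb; have g4 := n0 Mk; have g5 := n0 Ms.
have g6 := n0 Ch; have g7 := n0 B.
exists H, H1, H2, (fun x => bb (t x)), (fun x => kk (t x)), A; split; [|split; [|split]].
- by split => //; rewrite /A; move: g1 g2 g3 g4 g5 g6 g7; lra.
- split=> //.
  + by move=> x; apply: (Ale Ch); [exact: hC|rewrite /A; move: g1 g2 g3 g4 g5 g6 g7; lra].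
  + by move=> x; apply: (Ale M1) => //; rewrite /A; move: g1 g2 g3 g4 g5 g6 g7; lra.
  + by move=> x; apply: (Ale M2) => //; rewrite /A; move: g1 g2 g3 g4 g5 g6 g7; lra.
- split; [exact: ctc|exact: ctc| |].
  + by move=> x; apply: (Ale Mb); [exact: HMb|rewrite /A; move: g1 g2 g3 g4 g5 g6 g7; lra].
  + move=> x; rewrite kk_ge0//=; apply: le_trans (ler_norm _) _.
    by apply: (Ale Mk); [exact: HMk|rewrite /A; move: g1 g2 g3 g4 g5 g6 g7; lra].
- split.
  + by move=> x; exact: hC.
  + move=> x; have /andP[f0 fB] := ffB x; apply: (Ale B); first by rewrite ger0_norm.
    by rewrite /A; move: g1 g2 g3 g4 g5 g6 g7; lra.
  + by move=> y /tid[ty _ _]; rewrite /H ty.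
  + move=> y yab; have [ty t1y t2y] := tid y yab; have y0 : 0 < y by case/andP: yab => ay _; exact: lt_le_trans ay.
    rewrite ty /H1 /H2 /H ty t1y t2y expr1n !mulr1 mulr0 addr0; split=> //; last exact: gen.
    by apply: (Ale Ms); [exact: HMs|rewrite /A; move: g1 g2 g3 g4 g5 g6 g7; lra].
Qed.

Definition path_discount t w : R := expR (- \int[mu]_(s in `[0, t]) kk (X s w)).
Let D := path_discount.

Let mX t : measurable_fun setT (X t).
Proof. exact: (adapted_measurableR hF). Qed.

Let cXg (g : R -> R) w : (forall x : R, 0 < x -> {for x, continuous g}) -> continuous (fun s => g (X s w)).
Proof. by move=> cg s; apply: (@continuous_comp _ _ _ (X ^~ w) g); [exact: cX|exact: cg]. Qed.

Let ickk u v w : mu.-integrable `[u, v] (EFin \o (fun s => kk (X s w))).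
Proof.
apply: continuous_compact_integrable; first exact: segment_compact.
by apply: continuous_subspaceT; exact: cXg.
Qed.

Lemma path_discount01 t w : 0 <= D t w <= 1.
Proof.
rewrite expR_ge0 expR_le1 oppr_le0; apply: Rintegral_ge0 => s _; exact: kk_ge0.
Qed.

(** [kk] may be unbounded on the half-line, but it is bounded along one path on a compact time
    interval; freezing time outside [0, T] reduces to a bounded integrand. *)
Lemma path_integral_continuous w : continuous (fun t : R => \int[mu]_(s in `[0, t]) kk (X s w)).
Proof.
move=> t; pose T := `|t| + 1.
have [M HM] := @bounded_segment R (fun s => kk (X s w)) 0 T (fun x _ => @cXg kk w ckk x).
pose f s := kk (X (Num.min (Num.max 0 s) T) w).
have T0 : 0 <= T by rewrite addr_ge0.
have fM s : `|f s| <= M by apply: HM; rewrite le_min le_max lexx T0/= ge_min lexx orbT.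
have mf : measurable_fun setT f.
  apply: continuous_measurable_fun => s.
  apply: (@continuous_comp _ _ _ (fun s : R => Num.min (Num.max 0 s) T) (fun s : R => kk (X s w))); last exact: cXg.
  apply: continuous_min; last exact: cvg_cst.
  by apply: continuous_max; [exact: cvg_cst|exact: cvg_id].
have ci : continuous_at t (fun u : R => \int[mu]_(s in `[0, u]) f s).
  exact: (integral_itv_continuous mf fM).
have tE u : u <= T -> \int[mu]_(s in `[0, u]) kk (X s w) = \int[mu]_(s in `[0, u]) f s.
  move=> uT; apply: eq_Rintegral => s; rewrite inE/= in_itv/= => /andP[s0 su].
  by rewrite /f max_r// min_l// (le_trans su).
rewrite /continuous_at tE; last by rewrite /T (le_trans (ler_norm _))// lerDl.
apply: cvg_trans ci; apply: near_eq_cvg; near=> u; rewrite tE//; near: u.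
have tT : t < T by rewrite /T (le_lt_trans (ler_norm _))// ltrDl.
by near=> u; apply/ltW; near: u; exact: lt_nbhsl.
Unshelve. all: by end_near. Qed.

Lemma path_discount_measurable : measurable_fun [set: R * Omega] (fun z => D z.1 z.2).
Proof.
apply: (@caratheodory_measurable _ _ _ D).
  move=> t; apply: measurableT_comp; first exact: measurable_expR.
  apply: measurableT_comp => //.
  apply: (@measurable_Rintegral_param _ _ _ _ _ mu (fun z => kk (X z.1 z.2))) => //.
  apply: (@caratheodory_measurable _ _ _ (fun s w => kk (X s w))).
    by move=> s; exact: positive_measurable_comp.
  by move=> w; exact: cXg.
move=> w t; rewrite /D /path_discount.
apply: (@continuous_comp _ _ _ (fun t : R => - \int[mu]_(s in `[0, t]) kk (X s w)) expR).
  by apply: cvgN; exact: path_integral_continuous.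
exact: continuous_expR.
Qed.

Let Dff_le s w : `|D s w * ff (X s w)| <= B.
Proof.
have /andP[d0 d1] := path_discount01 s w; have /andP[f0 fB] := ffB (X s w).
by rewrite ger0_norm ?mulr_ge0// -[leRHS]mul1r ler_pM.
Qed.

Lemma path_resolvent_measurable : measurable_fun [set: R * Omega] (fun z => D z.1 z.2 * ff (X z.1 z.2)).
Proof.
apply: measurable_funM; first exact: path_discount_measurable.
apply: (measurableT_comp (continuous_measurable_fun cff)).
exact: caratheodory_measurable.
Qed.

Let iDff w u v : mu.-integrable `[u, v] (EFin \o (fun s => D s w * ff (X s w))).
Proof.
apply: (bounded_integrable_itv (M := B)) => //; apply: measurable_funTS.
exact: (measurableT_comp path_resolvent_measurable (measurable_pair2 w : measurable_fun setT (fun r : R => (r, w)))).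
Qed.

Lemma path_discount_h_measurable T : bounded_measurable (fun w => D T w * h (X T w)).
Proof.
apply: bounded_measurableM.
  split; last by exists 1 => w; have /andP[? ?] := path_discount01 T w; rewrite ger0_norm.
  exact: (adapted_joint_measurable_pair (f := D) T path_discount_measurable).
split; last by exists Ch => w; exact: hC.
apply: positive_measurable_comp => // y y0.
by apply/differentiable_continuous/derivable1_diffP; have [] := dh y0.
Qed.

Lemma path_resolvent_int_measurable T : bounded_measurable (fun w => \int[mu]_(s in `[0, T]) (D s w * ff (X s w))).
Proof.
split.
  apply: (@measurable_Rintegral_param _ _ _ _ _ mu (fun z => D z.1 z.2 * ff (X z.1 z.2))) => //.
  exact: path_resolvent_measurable.
exists (B * `|T|) => w; have [T0|T0] := leP 0 T; last first.
  rewrite set_itv_ge ?Rintegral_set0 ?normr0 ?bnd_simp -?ltNge//.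
  by rewrite mulr_ge0// (le_trans (normr_ge0 _) (Dff_le 0 w)).
have := normr_Rintegral_itv_le (f := fun s => D s w * ff (X s w)) T0 (iDff w 0 T) (fun s _ => Dff_le s w); rewrite subr0 (ger0_norm T0); exact.
Qed.

Section fixed_horizon.
Variable T : R.
Hypothesis T0 : 0 < T.

Let Z w := D T w * h (X T w) - h x0 + \int[mu]_(s in `[0, T]) (D s w * ff (X s w)).

(** The exit is watched for [a0 N, b0 N], while the path is controlled in the larger [a N, b N]. The
    margins, [a0 N / 2] below and 1 above, absorb the motion between two grid points. *)
Let a0 N : R := N.+1%:R^-1.
Let b0 N : R := N.+1%:R.
Let a N : R := a0 N / 2.
Let b N : R := b0 N + 1.
(** The uniform grid of [0, T]; [minn] sends all further indices to [T], so that the bounds hold for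
    every [j]. *)
Let gd m j : R := (minn j m.+1)%:R * (T / m.+1%:R).

Let gdT m j : 0 <= gd m j <= T.
Proof.
rewrite /gd mulr_ge0 ?divr_ge0 ?(ltW T0)//= mulrA ler_pdivrMr ?ltr0n// mulrC ler_pM2l//.
by rewrite ler_nat geq_minr.
Qed.

Let gdm m : gd m m.+1 = T.
Proof. by rewrite /gd minnn mulrCA divff ?mulr1// pnatr_eq0. Qed.

Let tau N m := grid_exit X T (a0 N) (b0 N) m.+1 (gd m).

(** [EN] is the event that the path leaves the inner interval before [T], and [bad] that it leaves
    the outer one before the exit is noticed. Rational times make both countable unions. *)
Let EN N : set Omega := \bigcup_(q in [set: rat])
  [set w | 0 <= (ratr q : R) <= T /\ ~ (a0 N <= X (ratr q) w <= b0 N)].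
Let bad N m : set Omega := \bigcup_(q in [set: rat])
  [set w | 0 <= (ratr q : R) <= tau N m w /\ ~ (a N <= X (ratr q) w <= b N)].

Let m_out q lo hi : measurable [set w | ~ (lo <= X q w <= hi)].
Proof.
rewrite -[X in measurable X]setTI (_ : [set w | _] = X q @^-1` (~` `[lo, hi]%classic)).
  by apply: mX => //; exact: measurableC.
by apply/seteqP; split => w /=; rewrite in_itv.
Qed.

Let mEN N : measurable (EN N).
Proof.
apply: bigcupT_measurable_rat => q.
have [qT|qT] := boolP (0 <= (ratr q : R) <= T); last first.
  rewrite (_ : [set w | _] = set0)//; apply/seteqP; split => w //= [h' _].
  by [].
rewrite (_ : [set w | _] = [set w | ~ (a0 N <= X (ratr q) w <= b0 N)]); first exact: m_out.
by apply/seteqP; split => w /= => [[]|].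
Qed.

Let mbad N m : measurable (bad N m).
Proof.
apply: bigcupT_measurable_rat => q.
rewrite (_ : [set w | _] = [set w | 0 <= (ratr q : R) <= tau N m w] `&` [set w | ~ (a N <= X (ratr q) w <= b N)])//.
apply: measurableI; last exact: m_out.
have mt : measurable_fun setT (tau N m).
  exact: (grid_exit_measurable hF aX cX X_neg).
have [q0|q0] := leP 0 (ratr q : R); last first.
  by rewrite (_ : [set w | _] = set0)//; apply/seteqP; split => w.
rewrite -[X in measurable X]setTI (_ : [set w | _] = tau N m @^-1` `[ratr q, +oo[%classic); first exact: mt.
by apply/seteqP; split => w /=; rewrite in_itv/= andbT.
Qed.

Let not_EN N w : ~ EN N w -> forall s, 0 <= s <= T -> a0 N <= X s w <= b0 N.
Proof.
move=> nE; apply: (segment_of_rat (f := X ^~ w)) => // q qT.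
by apply: contrapT => h'; apply: nE; exists q.
Qed.

Let not_bad N m w : ~ bad N m w -> forall s, 0 <= s -> s <= tau N m w -> a N <= X s w <= b N.
Proof.
move=> nE s s0 st.
apply: (segment_of_rat (f := X ^~ w) (t := tau N m w)) => //; last by rewrite s0.
by move=> q qT; apply: contrapT => h'; apply: nE; exists q.
Qed.

Let a0_gt0 N : 0 < a0 N. Proof. by rewrite /a0 invr_gt0 ltr0n. Qed.

Let EN_near w : \forall N \near \oo, ~ EN N w.
Proof.
have [M HM] := @bounded_segment R (X ^~ w) 0 T (fun x _ => @cX w x).
have [M' HM'] := @bounded_segment R (fun s => (X s w)^-1) 0 T (fun x _ => cvgV (lt0r_neq0 (Xpos x w)) (@cX w x)).
near=> N; case=> q _ /= [qT]; apply; apply/andP; split.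
  have := HM' _ qT; rewrite ger0_norm; last by rewrite invr_ge0 ltW.
  move=> h'; rewrite /a0 -[leRHS]invrK lef_pV2 ?posrE ?invr_gt0 ?ltr0n//.
  apply: (le_trans h'); rewrite (@le_trans _ _ N%:R)// ?ler_nat//.
  by near: N; exact: nbhs_infty_ger.
have := HM _ qT; rewrite ger0_norm; last exact: ltW.
move=> h'; apply: (le_trans h'); rewrite (@le_trans _ _ N%:R)// ?ler_nat//.
by near: N; exact: nbhs_infty_ger.
Unshelve. all: by end_near. Qed.

(** At the last grid point strictly before a time not exceeding the exit, the path is still in the
    inner interval; when the mesh is below the radius of uniform continuity, it cannot have crossed
    the margin since. *)
Let bad_near N w : a0 N <= x0 <= b0 N -> \forall m \near \oo, ~ bad N m w.
Proof.
move=> x0N; pose e := Num.min (a0 N / 2) 1.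
have e0 : 0 < e by rewrite lt_min ltr01 divr_gt0.
have [r r0 Hr] := uniformly_continuous_segment 0 T (@cX w) e0.
near=> m; case=> q _ /= [/andP[q0 qt]]; apply.
have e1 : e <= a0 N / 2 by rewrite ge_min lexx.
have e2 : e <= 1 by rewrite ge_min lexx orbT.
have in_ab y z : a0 N <= y <= b0 N -> `|z - y| <= e -> a N <= z <= b N.
  move=> /andP[y1 y2]; rewrite ler_distl => /andP[z1 z2]; rewrite /a /b.
  by apply/andP; split; move: y1 y2 z1 z2 e1 e2; lra.
have [q0'|q0'] := leP (ratr q : R) 0.
  have -> : (ratr q : R) = 0 by apply/eqP; rewrite eq_le q0 q0'.
  by apply: (in_ab x0) => //; rewrite X0 subrr normr0 ltW.
have qT : (ratr q : R) <= T by rewrite (le_trans qt)// grid_exit_le.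
have g0 : gd m 0 < ratr q by rewrite /gd min0n mul0r.
have gq : ratr q <= gd m m.+1 by rewrite gdm.
have [j jm /andP[jq qj]] := partition_cell g0 gq.
have Xj : a0 N <= X (gd m j) w <= b0 N.
  have := le_grid_exit X T (a0 N) (b0 N) m.+1 (gd m) (ratr q) w.
  rewrite -/(tau N m w) qt => /esym/andP[_ /forallP/(_ (Ordinal jm))/=/implyP H'].
  apply: contrapT => h'; have := H' _; rewrite in_itv/= => /(_ (introN idP h')).
  by rewrite leNgt jq.
apply: (in_ab _ _ Xj); apply: Hr => //.
rewrite ger0_norm ?subr_ge0 ?(ltW jq)//.
apply: (@le_lt_trans _ _ (gd m j.+1 - gd m j)); first by rewrite lerD2r.
rewrite /gd !(minn_idPl _)//; last exact: ltnW.
rewrite -mulrBl -natrB// subSnn mul1r ltr_pdivrMr ?ltr0n// mulrC -ltr_pdivrMr//.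
rewrite (@lt_le_trans _ _ m.+1%:R)//.
near: m; exists (Num.truncn (T / r)) => // m /= mT.
by rewrite (lt_le_trans (truncnS_gt _))// ler_nat ltnS.
Unshelve. all: by end_near. Qed.

(** The order of the limits matters. [N] is chosen first, with an error constant [C] made of [Ch],
    [B] and [T] only. The constant [CN] depends on the localization, hence on [N], but it multiplies
    the probability of [bad N m] alone, which the later choice of [m] makes small. *)
Lemma dynkin_formula :
  'E (fun w => D T w * h (X T w)) + 'E (fun w => \int[mu]_(s in `[0, T]) (D s w * ff (X s w))) = h x0.
Proof.
have bZ : bounded_measurable Z.
  apply: bounded_measurableD; last exact: path_resolvent_int_measurable.
  by apply: bounded_measurableB; [exact: path_discount_h_measurable|exact: bounded_measurable_cst].
suff EZ : 'E Z = 0.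
  move: EZ; rewrite /Z expectationD; [|apply: bounded_measurableB; [exact: path_discount_h_measurable|exact: bounded_measurable_cst]|exact: path_resolvent_int_measurable].
  rewrite expectationB; [|exact: path_discount_h_measurable|exact: bounded_measurable_cst].
  by rewrite expectation_cst => /eqP; rewrite addrAC subr_eq0 => /eqP.
pose C := 2 * Ch + B * T.
have Ch0 : 0 <= Ch by rewrite (le_trans _ (hC x0_gt0)).
have B0 : 0 <= B by have /andP[p1 p2] := ffB 0; exact: le_trans p2.
have C0 : 0 <= C by rewrite /C addr_ge0 ?mulr_ge0// ltW.
have ZC w : `|Z w| <= C.
  rewrite /Z /C (le_trans (ler_normD _ _))// lerD//.
    rewrite mulr_natl mulr2n (le_trans (ler_normB _ _))// lerD//; last exact: hC.
    rewrite normrM -[leRHS]mul1r ler_pM//; last exact: hC.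
    by have /andP[? ?] := path_discount01 T w; rewrite ger0_norm.
  by rewrite -[X in _ * X](subr0 T) normr_Rintegral_itv_le// ltW.
apply/eqP; rewrite -normr_le0; apply/ler_addgt0Pl => e e0; rewrite addr0.
have eN0 : 0 < e / 2 / (2 * C + 1) by rewrite !divr_gt0// ltr_wpDl// mulr_ge0.
have N1 := probability_event_cvg0 P mEN EN_near eN0.
have N2 : \forall N \near \oo, a0 N <= x0 <= b0 N.
  near=> N; apply/andP; split.
    rewrite /a0 -[leRHS]invrK lef_pV2 ?posrE ?invr_gt0 ?ltr0n//.
    rewrite (@le_trans _ _ N%:R)// ?ler_nat//; near: N; exact: nbhs_infty_ger.
  rewrite /b0 (@le_trans _ _ N%:R)// ?ler_nat//; near: N; exact: nbhs_infty_ger.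
near \oo => N.
have PN : fine (P (EN N)) <= e / 2 / (2 * C + 1) by near: N; exact: N1.
have xN : a0 N <= x0 <= b0 N by near: N; exact: N2.
have aN0 : 0 < a N by rewrite divr_gt0.
have abN : a N <= b N.
  have /andP[h' h''] := xN; rewrite /a /b; have := a0_gt0 N; move: h' h''; lra.
have [H [H1 [H2 [be [ke [A [[A1 dH dH1 cH2] [[HA H1A H2A H2mod] [[cbe cke beA keA] [HC ffA Heq Hgen]]]]]]]]]] :=
  localized_coefficients aN0 abN.
have A0 : 0 <= A by rewrite (le_trans _ A1).
set CN := stopped_error_constant A T.
have CN0 : 0 <= CN.
  rewrite /CN /stopped_error_constant; have T0' := ltW T0.
  by apply: addr_ge0; [exact: mulr_ge0|apply: addr_ge0; apply: mulr_ge0 => //; [apply: mulr_ge0 => //; exact: exprn_ge0|apply: addr_ge0 => //; apply: mulr_ge0 => //; apply: mulr_ge0 => //; exact: exprn_ge0]].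
have em0 : 0 < e / 2 / (CN + 2 * C + 1).
  by rewrite !divr_gt0// ltr_wpDl// addr_ge0// mulr_ge0.
have M1 := probability_event_cvg0 P (mbad N) (fun w => bad_near w xN) em0.
near \oo => m.
have Pm : fine (P (bad N m)) <= e / 2 / (CN + 2 * C + 1) by near: m; exact: M1.
pose ZN := stopped_functional X H ke T (a0 N) (b0 N) x0 m.+1 (gd m) ff.
have mG : measurable (~` bad N m) by exact/measurableC/mbad.
have XE' t w : 0 <= t -> t <= T -> X t w = x0 + \int[mu]_(s in `[0, t]) bb (X s w) + I t w.
  by move=> t0 _; exact: XE.
have GX w : (~` bad N m) w -> forall s, 0 <= s -> s <= grid_exit X T (a0 N) (b0 N) m.+1 (gd m) w -> a N <= X s w <= b N.
  by move=> nb s s0 st; exact: not_bad nb s s0 st.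
have E1 := stopped_functional_expectation hF hW W_neg aX cX X_neg A1 dH dH1 cH2 HA H1A H2A H2mod
  cbe cke beA keA (gdT m) (gdm m) cI mI cff ffA XE' Hgen (ierr T) (merr T) (err0 (ltW T0))
  (fun t t0 _ => sp0 t0) mG GX.
rewrite setCK -/ZN -/CN in E1.
have mZN : measurable_fun setT ZN.
  exact: (stopped_functional_measurable hF aX cX X_neg A1 dH cke keA _ _ _ (gdT m) (gdm m) cff).
have ffB' y : `|ff y| <= B by have /andP[? ?] := ffB y; rewrite ger0_norm.
have ZNC w : `|ZN w| <= C.
  exact: (stopped_functional_bound hF aX cX X_neg cke keA _ _ _ (gdT m) (gdm m) cff ffA w HC ffB').
have bZN : bounded_measurable ZN by split => //; exists C.
have bZNG : bounded_measurable (fun w => ZN w * \1_(~` bad N m) w).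
  by apply: bounded_measurableM => //; exact: bounded_measurable_indic.
have diff w : `|Z w - ZN w * \1_(~` bad N m) w| <= 2 * C * \1_(EN N) w + 2 * C * \1_(bad N m) w.
  rewrite !indicE in_setC; case: (boolP (w \in bad N m)) => wb /=.
    rewrite mulr0 subr0 mulr1 (le_trans (ZC w))//.
    have : 0 <= 2 * C * (w \in EN N)%:R by rewrite !mulr_ge0.
    by move: C0; lra.
  rewrite !mulr1 mulr0 addr0; case: (boolP (w \in EN N)) => wE.
    by rewrite mulr1 (le_trans (ler_normB _ _))// mulr_natl mulr2n lerD.
  rewrite mulr0; move: wE; rewrite notin_setE => /not_EN XT.
  have tT : grid_exit X T (a0 N) (b0 N) m.+1 (gd m) w = T.
    apply/eqP; rewrite eq_le grid_exit_le le_grid_exit lexx/=; apply/forallP => j; apply/implyP.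
    by rewrite in_itv/= XT.
  have XT' s : 0 <= s <= T -> a N <= X s w <= b N.
    move=> /XT/andP[p1 p2]; rewrite /a /b.
    by apply/andP; split; move: p1 p2 (a0_gt0 N); lra.
  have DE s : 0 <= s -> s <= T -> stopped_discount X ke T (a0 N) (b0 N) m.+1 (gd m) s w = D s w.
    move=> s0 sT; rewrite /stopped_discount /D /path_discount tT; congr (expR (- _)).
    apply: eq_Rintegral => v; rewrite inE/= in_itv/= => /andP[v0 vs].
    have vT := le_trans vs sT.
    by rewrite vT mul1r; have [|_ ->//] := Heq (X v w); apply: XT'; rewrite v0.
  rewrite le_eqVlt; apply/orP; left; rewrite normr_eq0 subr_eq0; apply/eqP.
  have T0' := ltW T0.
  rewrite /Z /ZN /stopped_functional tT DE//; congr (_ - _ + _).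
  - by have [|-> _//] := Heq (X T w); apply: XT'; rewrite T0' lexx.
  - by have [|-> _//] := Heq x0; rewrite -(X0 w); apply: XT'; rewrite T0' lexx.
  - apply: eq_Rintegral => s; rewrite inE/= in_itv/= => /andP[s0 sT].
    by rewrite DE// sT mul1r.
have bm1 : bounded_measurable (fun w => 2 * C * \1_(EN N) w).
  by apply: bounded_measurableZl; exact: bounded_measurable_indic.
have bm2 : bounded_measurable (fun w => 2 * C * \1_(bad N m) w).
  by apply: bounded_measurableZl; exact: bounded_measurable_indic.
have E2 : `|'E (fun w => Z w - ZN w * \1_(~` bad N m) w)| <= 2 * C * fine (P (EN N)) + 2 * C * fine (P (bad N m)).
  have i1 : P.-integrable setT (EFin \o (fun w => Z w - ZN w * \1_(~` bad N m) w)).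
    by apply: bounded_measurable_integrable; exact: bounded_measurableB.
  have i2 : P.-integrable setT (EFin \o (fun w => 2 * C * \1_(EN N) w + 2 * C * \1_(bad N m) w)).
    by apply: bounded_measurable_integrable; exact: bounded_measurableD.
  apply: (le_trans (normr_expectation_le i1 i2 diff)).
  rewrite expectationD// !expectationZl; [|exact: bounded_measurable_indic..].
  by rewrite !Rintegral_indic.
have -> : 'E Z = 'E (fun w => Z w - ZN w * \1_(~` bad N m) w) + 'E (fun w => ZN w * \1_(~` bad N m) w).
  by rewrite expectationB// subrK.
rewrite (le_trans (ler_normD _ _))//.
have u1 : 2 * C * fine (P (EN N)) <= e / 2.
  apply: (@le_trans _ _ (2 * C * (e / 2 / (2 * C + 1)))); first by rewrite ler_wpM2l// mulr_ge0.
  rewrite mulrCA ler_piMr ?divr_ge0 ?(ltW e0)// ler_pdivrMr ?mul1r ?lerDl//.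
  by rewrite ltr_wpDl// mulr_ge0.
have u2 : (CN + 2 * C) * fine (P (bad N m)) <= e / 2.
  apply: (@le_trans _ _ ((CN + 2 * C) * (e / 2 / (CN + 2 * C + 1)))).
    by rewrite ler_wpM2l// addr_ge0// mulr_ge0.
  rewrite mulrCA ler_piMr ?divr_ge0 ?(ltW e0)// ler_pdivrMr ?mul1r ?lerDl//.
  by rewrite ltr_wpDl// addr_ge0// mulr_ge0.
have u3 : CN * fine (P (bad N m)) + 2 * C * fine (P (bad N m)) <= e / 2 by rewrite -mulrDl.
move: E1 E2 u1 u3; set q1 := CN * _; set q2 := 2 * C * _; set q3 := 2 * C * _.
set z1 := `|_|; set z2 := `|_|; lra.
Unshelve. all: by end_near. Qed.

End fixed_horizon.

(** In Dynkin's formula at time [n], the terminal term is at most [Ch * exp (- r0 n)], while the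
    integral increases to the discounted one because [ff] is nonnegative. *)
Lemma smooth_resolvent_formula (r0 : R) : 0 < r0 -> (forall x : R, 0 < x -> r0 <= kk x) ->
  (\int[P]_w discounted_integral kk ff X w = (h x0)%:E)%E.
Proof.
move=> r0_gt0 r0kk.
have Ch0 : 0 <= Ch by rewrite (le_trans _ (hC x0_gt0)).
pose J (n : nat) w := \int[mu]_(s in `[0, n%:R]) (D s w * ff (X s w)).
have JE n w : (J n w)%:E = (\int[mu]_(s in `[0%R, n%:R]) (D s w * ff (X s w))%:E)%E.
  by rewrite /J /Rintegral fineK//; exact: integrable_fin_num (iDff w 0 n%:R).
have Df0 s w : 0 <= D s w * ff (X s w).
  by have /andP[d0 _] := path_discount01 s w; have /andP[f0 _] := ffB (X s w); exact: mulr_ge0.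
have mDf w : measurable_fun setT (fun s => D s w * ff (X s w)).
  exact: (measurableT_comp path_resolvent_measurable (measurable_pair2 w : measurable_fun setT (fun r : R => (r, w)))).
have cJ w : (J n w)%:E @[n --> \oo] --> discounted_integral kk ff X w.
  rewrite (_ : (fun n => (J n w)%:E) = (fun n : nat => \int[mu]_(s in `[0%R, n%:R]) (D s w * ff (X s w))%:E)%E).
    exact: (cvg_ge0_integral_itvy (mDf w) (fun s => Df0 s w)).
  by apply/funext => n; rewrite JE.
have bJ n : bounded_measurable (J n) by exact: path_resolvent_int_measurable.
have EJ n : (\int[P]_w (J n w)%:E)%E = ('E (J n))%:E.
  by rewrite /Rintegral fineK//; exact/integrable_fin_num/bounded_measurable_integrable.
have cEJ : (\int[P]_w (J n w)%:E)%E @[n --> \oo] --> (\int[P]_w discounted_integral kk ff X w)%E.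
  have -> : (fun w => discounted_integral kk ff X w) = (fun w => limn (fun n => (J n w)%:E)).
    by apply/funext => w; apply/esym/cvg_lim => //; exact: cJ.
  apply: (@cvg_monotone_convergence _ _ _ P _ measurableT (fun n w => (J n w)%:E)) => //.
  - by move=> n; apply/measurable_EFinP; have [] := bJ n.
  - by move=> n w _; rewrite lee_fin Rintegral_ge0.
  - move=> w _ m n mn; rewrite !JE; apply: ge0_subset_integral => //=.
    + apply/measurable_EFinP; exact: (measurable_funTS (mDf w)).
    + by move=> s _; rewrite lee_fin.
    + by apply: subset_itvl; rewrite bnd_simp ler_nat.
have Dn n w : D n%:R w <= expR (- r0) ^+ n.
  rewrite -expRM_natr /D /path_discount ler_expR mulNr lerN2.
  have := @le_Rintegral _ _ _ mu `[0, n%:R]%classic (fun=> r0) (fun s => kk (X s w)).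
  rewrite Rintegral_cst// lebesgue_measure_segment// subr0; apply => //.
    by apply: (bounded_integrable_itv (M := r0)) => // t _; rewrite ger0_norm// ltW.
  by move=> s _; exact: r0kk.
have Dh n : `|'E (fun w => D n%:R w * h (X n%:R w))| <= Ch * expR (- r0) ^+ n.
  rewrite -[leRHS](expectation_cst P).
  apply: normr_expectation_le; [exact/bounded_measurable_integrable/path_discount_h_measurable|exact/bounded_measurable_integrable/bounded_measurable_cst|].
  move=> w; rewrite normrM mulrC ler_pM//; first exact: hC.
  by have /andP[d0 _] := path_discount01 n%:R w; rewrite ger0_norm.
have cD : 'E (fun w => D n%:R w * h (X n%:R w)) @[n --> \oo] --> 0.
  apply/norm_cvg0P; apply: (@squeeze_cvgr _ _ _ _ (fun=> 0) (fun n => Ch * expR (- r0) ^+ n)).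
  - by near=> n; rewrite normr_ge0 Dh.
  - exact: cvg_cst.
  - rewrite -[X in _ --> X](mulr0 Ch); apply: cvgMr; apply: cvg_expr.
    by rewrite ger0_norm ?expR_ge0// expR_lt1 oppr_lt0.
suff cEJ' : (\int[P]_w (J n w)%:E)%E @[n --> \oo] --> (h x0)%:E by exact: (cvg_unique _ cEJ cEJ').
under eq_cvg do rewrite EJ.
apply: cvg_EFin; first by near=> n.
rewrite -[X in _ --> X](subr0 (h x0)).
have cB : h x0 - 'E (fun w => D n%:R w * h (X n%:R w)) @[n --> \oo] --> h x0 - 0.
  by apply: cvgB => //; exact: cvg_cst.
apply: cvg_trans cB.
apply: near_eq_cvg; near=> n => /=.
rewrite -(@dynkin_formula n%:R); last by rewrite ltr0n; near: n; exists 1.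
by rewrite addrC addKr.
Unshelve. all: by end_near. Qed.

End dynkin.

(** * Continuous modifications of the solutions *)

Section null_modifications.
Context {R : realType} {d : measure_display} {Omega : measurableType d}.
Variables (P : probability Omega R) (F : R -> set (set Omega)).
Hypothesis hF : usual_filtration P F.

Lemma usual_filtration_complete : measure_is_complete P.
Proof.
by case: hF => sF _ _ nF A /nF; have [_] := sF 0 (lexx 0); apply.
Qed.

(** Every subset of [N] is measurable by completeness; so [B], which differs from [A] only inside
    [N], inherits measurability and measure. *)
Lemma measure_modification (N A B : set Omega) : P.-negligible N ->
  (forall w, ~ N w -> (A w <-> B w)) -> measurable A -> measurable B /\ P A = P B.
Proof.
move=> nN AB mA; have cP := usual_filtration_complete.
have mN (C : set Omega) : C `<=` N -> measurable C by move=> CN; exact/cP/(negligibleS CN).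
have mN0 : measurable N by exact: mN.
have P0 : P N = 0 :> \bar R by exact/negligibleP.
have AN : A `\` N = B `\` N by apply/seteqP; split => w [h' h'']; split => //; apply/(AB w h'').
have mB : measurable B.
  rewrite -(setUIDK B N) -AN setUC; apply: measurableU; first exact: measurableD.
  by apply: mN; exact: subIsetr.
have PD (C : set Omega) : measurable C -> P C = P (C `\` N).
  move=> mC; have PN : P (C `&` N) = 0 :> \bar R.
    by apply/negligibleP; [exact: measurableI|apply: negligibleS nN; exact: subIsetr].
  by transitivity (P (C `\` N) + P (C `&` N))%E; [exact: measureDI|rewrite PN adde0].
by split => //; rewrite PD// [RHS]PD// AN.
Qed.

Lemma filtration_modification t (N A B : set Omega) : 0 <= t -> P.-negligible N ->
  (forall w, ~ N w -> (A w <-> B w)) -> F t A -> F t B.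
Proof.
move=> t0 nN AB FA; have [sF mF _ nF] := hF.
have [[F0 FC FU] _] := sF t t0.
have FN (C : set Omega) : C `<=` N -> F t C.
  by move=> CN; apply: (mF 0 t (lexx 0) t0); exact/nF/(negligibleS CN).
have FsU (C D : set Omega) : F t C -> F t D -> F t (C `|` D).
  by move=> FC' FD; rewrite -bigcup2E; apply: FU => -[//|[//|n]] /=.
have Fc C : F t C -> F t (~` C) by move=> FC'; rewrite -setTD; exact: FC.
have -> : B = ~` (~` A `|` A `&` N) `|` B `&` N.
  apply/seteqP; split => w /=; last first.
    case=> [nA|[]//]; have Aw : A w by apply: contrapT => ?; apply: nA; left.
    by apply/AB => // Nw; apply: nA; right.
  move=> Bw; have [Nw|Nw] := pselect (N w); first by right.
  by left => -[nA|[_ //]]; apply: nA; exact/AB.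
apply: (FsU); last by apply: FN; exact: subIsetr.
by apply: (Fc); apply: (FsU); [exact: Fc|apply: FN; exact: subIsetr].
Qed.

Lemma measurable_wrt_modification t (N : set Omega) (X Y : Omega -> R) : 0 <= t -> P.-negligible N ->
  (forall w, ~ N w -> X w = Y w) -> measurable_wrt (F t) X -> measurable_wrt (F t) Y.
Proof.
move=> t0 nN XY mX B mB; apply: (filtration_modification t0 nN _ (mX B mB)) => w Nw.
by rewrite /preimage/= XY.
Qed.

Lemma to0_in_probability_modification (N : set Omega) (U V : nat -> Omega -> \bar R) : P.-negligible N ->
  (forall n w, ~ N w -> U n w = V n w) -> (forall n, measurable_fun setT (V n)) ->
  to0_in_probability P U -> to0_in_probability P V.
Proof.
move=> nN UV mV U0 e e0; suff -> : (fun n => P [set w | (e%:E <= V n w)%E]) = (fun n => P [set w | (e%:E <= U n w)%E]) by exact: U0.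
apply/funext => n; have mVe : measurable [set w | (e%:E <= V n w)%E].
  by rewrite -[X in measurable X]setTI; exact: emeasurable_fun_c_infty.
have [] := measure_modification nN _ mVe (B := [set w | (e%:E <= U n w)%E]).
  by move=> w Nw; rewrite /= UV.
by move=> _ ->.
Qed.

End null_modifications.

Lemma continuous_within_max0 {R : realType} (f : R -> R) : {within `[0, +oo[, continuous f} ->
  continuous (fun t : R => f (Num.max t 0)).
Proof.
move=> /subspace_continuousP cf s.
have s0 : `[0, +oo[%classic (Num.max s 0) by rewrite /= in_itv/= andbT le_max lexx orbT.
apply: (@cvg_comp _ _ _ (fun t : R => Num.max t 0) f _ (within `[0, +oo[ (nbhs (Num.max s 0)))); last exact: cf.
have cg : continuous (fun t : R => Num.max t 0).
  by move=> t; apply: continuous_max; [exact: cvg_id|exact: cvg_cst].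
move=> U HU.
have H : \forall t \near s, (`[0, +oo[%classic : set R) (Num.max t 0) -> U (Num.max t 0) by exact: (cg s _ HU).
change (\forall t \near s, U (Num.max t 0)); apply: filterS H => t; apply.
by rewrite /= in_itv/= andbT le_max lexx orbT.
Qed.

Section continuous_solution.
Context {R : realType} {d : measure_display} {Omega : measurableType d}.
Variables (P : probability Omega R) (F : R -> set (set Omega)) (W : R -> Omega -> R).
Hypotheses (hF : usual_filtration P F) (hW : brownian_motion P F W).
Variables (X : R -> Omega -> R) (x0 : R) (bb sg : R -> R).
Hypotheses (x0_gt0 : 0 < x0)
  (cbb : forall x : R, 0 < x -> {for x, continuous bb})
  (csg : forall x : R, 0 < x -> {for x, continuous sg})
  (hX : nonexplosive_sde_solution P F W bb sg x0 X).
Local Notation mu := (@lebesgue_measure R).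

(** The extension to negative times makes the paths continuous on the whole line. The value [y] on
    [N], taken to be [x0] for the solution, keeps them in the half-line. *)
Definition continuous_version_at (N : set Omega) (y : R) (Y : R -> Omega -> R) t w :=
  if w \in N then y else Y (Num.max t 0) w.

Let vE N y Y t w : 0 <= t -> ~ N w -> continuous_version_at N y Y t w = Y t w.
Proof. by move=> t0 Nw; rewrite /continuous_version_at memNset// max_l. Qed.

Let v_neg N y Y t w : t <= 0 -> continuous_version_at N y Y t w = continuous_version_at N y Y 0 w.
Proof. by move=> t0; rewrite /continuous_version_at max_r// maxxx. Qed.

Let v_cont (N : set Omega) y (Y : R -> Omega -> R) : (forall w, ~ N w -> {within `[0, +oo[, continuous (Y ^~ w)}) ->
  forall w, continuous (continuous_version_at N y Y ^~ w).
Proof.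
move=> cY w; rewrite /continuous_version_at; have [wN|] := boolP (w \in N); first by move=> t; exact: cvg_cst.
by rewrite notin_setE => Nw t; exact: (continuous_within_max0 (cY w Nw)).
Qed.

Let v_adapted N y Y : P.-negligible N -> adapted F Y -> adapted F (continuous_version_at N y Y).
Proof.
move=> nN aY t t0; apply: (measurable_wrt_modification hF t0 nN _ (aY t t0)) => w Nw.
by rewrite vE.
Qed.

Lemma continuous_brownian_modification (N : set Omega) : P.-negligible N ->
  (forall w, ~ N w -> {within `[0, +oo[, continuous (W ^~ w)}) ->
  continuous_brownian P F (continuous_version_at N 0 W).
Proof.
move=> nN cW; have [aW _ indW normW] := hW; split; [exact: v_adapted|exact: v_cont|].
move=> s t A B s0 st FA mB; have t0 : 0 <= t by rewrite ltW// (le_lt_trans s0).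
have [sF _ _ _] := hF; have [_ Fm] := sF s s0.
have mW u : 0 <= u -> measurable_fun setT (W u) by exact: (adapted_measurable hF).
have mI : measurable (A `&` (W t \- W s)%R @^-1` B).
  apply: measurableI; first exact: Fm.
  by rewrite -[X in measurable X]setTI; apply: measurable_funB => //; exact: mW.
rewrite -normW// -indW//.
have [] := measure_modification hF nN _ mI (B := A `&` (continuous_version_at N 0 W t \- continuous_version_at N 0 W s)%R @^-1` B).
  by move=> w Nw; rewrite /= !vE.
by move=> _ ->.
Qed.

(* [F 0] contains the null sets, so the paths can be changed on the null set
   where they are not continuous or leave the half-line without losing
   adaptedness. *)
Lemma continuous_solution : exists X' : R -> Omega -> R,
  [/\ adapted F X', forall w, continuous (X' ^~ w), forall t w, t <= 0 -> X' t w = X' 0 w,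
      forall w, X' 0 w = x0 & forall t w, 0 < X' t w] /\
  {ae P, forall w, forall t, 0 <= t -> X t w = X' t w} /\
  forall (h h1 h2 kk ff : R -> R) (Ch B r0 : R),
    (forall x : R, 0 < x -> is_derive x (1 : R) h (h1 x)) ->
    (forall x : R, 0 < x -> is_derive x (1 : R) h1 (h2 x)) ->
    (forall x : R, 0 < x -> {for x, continuous h2}) ->
    (forall x : R, 0 < x -> `|h x| <= Ch) ->
    (forall x : R, 0 < x -> {for x, continuous kk}) ->
    continuous ff -> (forall x : R, 0 <= ff x <= B) ->
    (forall y : R, 0 < y -> h1 y * bb y + 2^-1 * h2 y * sg y ^+ 2 - kk y * h y = - ff y) ->
    0 < r0 -> (forall x : R, 0 < x -> r0 <= kk x) ->
    (\int[P]_w discounted_integral kk ff X' w = (h x0)%:E)%E.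
Proof.
have [aX ae1 [I [ae2 [S HS]] ae3]] := hX.
have [aW ae4 _ _] := hW.
pose N : set Omega := ~` [set w | [/\ X 0 w = x0 /\ {within `[0, +oo[, continuous (fun t => X t w)},
  forall t, 0 <= t -> 0 < X t w, {within `[0, +oo[, continuous (fun t => W t w)} &
  forall t, 0 <= t -> X t w = x0 + \int[mu]_(u in `[0, t]) bb (X u w) + I t w]].
have nN : P.-negligible N.
  change {ae P, forall w, [/\ X 0 w = x0 /\ {within `[0, +oo[, continuous (fun t => X t w)},
    forall t, 0 <= t -> 0 < X t w, {within `[0, +oo[, continuous (fun t => W t w)} &
    forall t, 0 <= t -> X t w = x0 + \int[mu]_(u in `[0, t]) bb (X u w) + I t w]}.
  by move: ae1 ae3 ae4; apply: filterS3 => w [? ? ?] ? [_ ?]; split.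
have NP w : ~ N w -> [/\ X 0 w = x0 /\ {within `[0, +oo[, continuous (fun t => X t w)},
    forall t, 0 <= t -> 0 < X t w, {within `[0, +oo[, continuous (fun t => W t w)} &
    forall t, 0 <= t -> X t w = x0 + \int[mu]_(u in `[0, t]) bb (X u w) + I t w].
  by move=> Nw; exact: contrapT Nw.
pose X' := continuous_version_at N x0 X; pose W' := continuous_version_at N 0 W.
have aX' : adapted F X' by exact: v_adapted.
have cX' w : continuous (X' ^~ w) by apply: v_cont => {}w /NP[[]].
have X'_neg t w : t <= 0 -> X' t w = X' 0 w by exact: v_neg.
have X'0 w : X' 0 w = x0.
  rewrite /X' /continuous_version_at maxxx; have [//|] := boolP (w \in N).
  by rewrite notin_setE => /NP[[]].
have X'pos t w : 0 < X' t w.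
  rewrite /X' /continuous_version_at; case: ifPn => //.
  by rewrite notin_setE => /NP[_ + _ _]; apply; rewrite le_max lexx orbT.
have XX' w t : ~ N w -> 0 <= t -> X t w = X' t w by move=> Nw t0; rewrite /X' vE.
exists X'; split; first by split.
split.
  apply: negligibleS nN => w /= h' nN'; apply: h'.
  by move=> t t0; apply: XX' => // /(_ nN').
move=> h h1 h2 kk ff Ch B r0 dh dh1 ch2 hC ckk cff ffB gen r0_gt0 r0kk.
have hW' : continuous_brownian P F W' by apply: continuous_brownian_modification => // w /NP[].
have mX' t : measurable_fun setT (X' t) by exact: (adapted_measurableR hF).
have mW' t : measurable_fun setT (W' t).
  by apply: (adapted_measurableR hF); [case: hW'|move=> s w; exact: v_neg].
(* [I'] is defined by the equation instead of being a modification of [I], so that the equation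
   holds on every path; off [N] the two agree. *)
pose I' t w := X' t w - x0 - \int[mu]_(s in `[0, t]) bb (X' s w).
have cI' w : continuous (I' ^~ w).
  move=> t; apply: cvgB; last exact: path_integral_continuous.
  by apply: cvgB; [exact: cX'|exact: cvg_cst].
have jbb : measurable_fun setT (fun z : R * Omega => bb (X' z.1 z.2)).
  apply: (@caratheodory_measurable _ _ _ (fun s w => bb (X' s w))).
    by move=> s; exact: positive_measurable_comp.
  by move=> w s; apply: (@continuous_comp _ _ _ (X' ^~ w) bb); [exact: cX'|exact: cbb].
have jsg : measurable_fun setT (fun z : R * Omega => sg (X' z.1 z.2)).
  apply: (@caratheodory_measurable _ _ _ (fun s w => sg (X' s w))).
    by move=> s; exact: positive_measurable_comp.
  by move=> w s; apply: (@continuous_comp _ _ _ (X' ^~ w) sg); [exact: cX'|exact: csg].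
have mI' t : measurable_fun setT (I' t).
  apply: measurable_funB; first exact: measurable_funB.
  exact: (@measurable_Rintegral_param _ _ _ _ _ mu (fun z => bb (X' z.1 z.2))).
have X'E t w : 0 <= t -> X' t w = x0 + \int[mu]_(s in `[0, t]) bb (X' s w) + I' t w.
  by move=> _; rewrite /I'; ring.
have II' w t : ~ N w -> 0 <= t -> I t w = I' t w.
  move=> Nw t0; have [_ _ _ XE] := NP w Nw.
  have : X t w = x0 + \int[mu]_(s in `[0, t]) bb (X' s w) + I t w.
    rewrite {1}XE//; congr (_ + _ + _); apply: eq_Rintegral => s; rewrite inE/= in_itv/= => /andP[s0 _].
    by rewrite XX'.
  by rewrite /I' -XX'// => ->; ring.
have st0 n i : 0 <= sp_time (S n) i.
  elim: i => [|i IH]; first exact: sp_time_ge0.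
  by rewrite (le_trans IH)// sp_time_nd.
have mco n i : measurable_fun setT (sp_coef (S n) i).
  have [sF _ _ _] := hF; have [_ Fm] := sF _ (st0 n i).
  by apply: (measurable_wrt_measurable Fm); exact: sp_coef_meas.
have jS n : measurable_fun setT (fun z : R * Omega => sp_value (S n) z.1 z.2).
  apply: measurable_sum => i; apply: measurable_funM.
    by apply: measurableT_comp; [exact: mco|exact: measurable_snd].
  apply: (@measurableT_comp _ _ _ _ _ _ (\1_(`]sp_time (S n) i, sp_time (S n) i.+1]%classic) : R -> R)); last exact: measurable_fst.
  by apply: measurable_indic; exact: measurable_itv.
have jerr n : measurable_fun setT (fun z : R * Omega => (sp_value (S n) z.1 z.2 - sg (X' z.1 z.2)) ^+ 2).
  by apply: measurable_funX; exact: measurable_funB.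
have merr T n : measurable_fun setT (fun w => \int[mu]_(s in `[0, T]) ((sp_value (S n) s w - sg (X' s w)) ^+ 2)).
  exact: (@measurable_Rintegral_param _ _ _ _ _ mu (fun z => (sp_value (S n) z.1 z.2 - sg (X' z.1 z.2)) ^+ 2) _ (measurable_itv _) (jerr n)).
have ierr T n w : mu.-integrable `[0, T] (EFin \o (fun s => (sp_value (S n) s w - sg (X' s w)) ^+ 2)).
  have [M HM] := @bounded_segment R (fun s => sg (X' s w)) 0 T
    (fun x _ => @continuous_comp _ _ _ (X' ^~ w) sg x (@cX' w x) (csg (X'pos x w))).
  apply: (bounded_integrable_itv (M := (\sum_(i < sp_size (S n)) `|sp_coef (S n) i w| + M) ^+ 2)).
    apply: measurable_funTS.
    exact: (measurableT_comp (jerr n) (measurable_pair2 w : measurable_fun setT (fun r : R => (r, w)))).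
  move=> s sT; rewrite normrX lerXn2r ?nnegrE//.
    by rewrite addr_ge0 ?sumr_ge0// (le_trans _ (HM s sT)).
  rewrite (le_trans (ler_normB _ _))// lerD ?HM//.
  rewrite (le_trans (ler_norm_sum _ _ _))//; apply: ler_sum => i _.
  by rewrite normrM ler_piMr// indicE normr_nat lern1 leq_b1.
have err0 T : 0 <= T -> to0_in_probability P (fun n w => (\int[mu]_(s in `[0, T]) ((sp_value (S n) s w - sg (X' s w)) ^+ 2))%:E).
  move=> T0; have [E1 _] := HS T T0.
  apply: (to0_in_probability_modification hF nN _ _ E1); last by move=> n; exact/measurable_EFinP.
  move=> n w Nw; rewrite /Rintegral fineK; last exact: integrable_fin_num (ierr T n w).
  apply: eq_integral => s; rewrite inE/= in_itv/= => /andP[s0 _].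
  by rewrite XX'.
have sp0 t : 0 <= t -> to0_in_probability P (fun n w => (`|sp_integral (S n) W' t w - I' t w|)%:E).
  move=> t0; have [_ E2] := HS t t0.
  apply: (to0_in_probability_modification hF nN _ _ E2).
    move=> n w Nw; rewrite -II'//; congr (`|_ - _|%:E); apply: eq_bigr => i _.
    by rewrite /W' !vE// le_min st0.
  move=> n; apply/measurable_EFinP; apply: measurableT_comp => //; apply: measurable_funB => //.
  by apply: measurable_sum => i; apply: measurable_funM; [exact: mco|exact: measurable_funB].
have kk0 x : 0 < x -> 0 <= kk x by move=> x_gt0; rewrite (le_trans (ltW r0_gt0))// r0kk.
exact: (smooth_resolvent_formula hF hW' (fun t w => @v_neg N 0 W t w) aX' cX' X'_neg X'0 X'pos
  dh dh1 ch2 hC cbb csg ckk kk0 cff ffB gen cI' mI' X'E ierr merr err0 sp0 r0_gt0 r0kk).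
Qed.

End continuous_solution.

(** * Green representation of the resolvents *)

Section finite_measure_of_set_function.
Context {d} {T : measurableType d} {R : realType} (nu : set T -> \bar R).
Hypotheses (nu0 : nu set0 = 0%E) (nu_ge0 : forall A, (0 <= nu A)%E)
  (nuS : semi_sigma_additive nu) (nufin : fin_num_fun nu).

(* Packs a set function with proofs into the hierarchy of measures, for use
   inside proofs, where no instance can be declared. *)
Definition finite_measure_of of nu set0 = 0%E & (forall A, (0 <= nu A)%E) &
  semi_sigma_additive nu & fin_num_fun nu : set T -> \bar R := nu.

Local Notation m := (finite_measure_of nu0 nu_ge0 nuS nufin).

HB.instance Definition _ := isMeasure.Build _ _ _ m nu0 nu_ge0 nuS.
HB.instance Definition _ := Measure_isFinite.Build _ _ _ m nufin.

Lemma exists_finite_measure : exists N : {finite_measure set T -> \bar R}, forall A, N A = nu A.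
Proof. by exists m. Qed.

End finite_measure_of_set_function.

Lemma density_finite_measure {d} {T : measurableType d} {R : realType}
  (m : {measure set T -> \bar R}) (k : T -> R) :
  measurable_fun setT k -> (forall x, 0 <= k x) -> (\int[m]_x (k x)%:E < +oo)%E ->
  exists N : {finite_measure set T -> \bar R},
    forall A, measurable A -> N A = (\int[m]_(x in A) (k x)%:E)%E.
Proof.
move=> mk k0 kfin; pose nu (A : set T) : \bar R := (\int[m]_(x in A) (k x)%:E)%E.
have mkE : measurable_fun setT (fun x => (k x)%:E) by exact/measurable_EFinP.
have k0E x : (0 <= (k x)%:E)%E by rewrite lee_fin.
have nu0 : nu set0 = 0%E by exact: integral_set0.
have nuge A : (0 <= nu A)%E by exact: integral_ge0.
have nuS : semi_sigma_additive nu by exact: semi_sigma_additive_nng_induced.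
have nufin : fin_num_fun nu.
  move=> A mA; rewrite ge0_fin_numE//; apply: le_lt_trans kfin.
  exact: ge0_subset_integral.
by have [N NE] := exists_finite_measure nu0 nuge nuS nufin; exists N.
Qed.

Lemma pushforward_finite_measure {d} {T : measurableType d} {d'} {T' : measurableType d'} {R : realType}
  (N : {finite_measure set T -> \bar R}) (phi : T -> T') : measurable_fun setT phi ->
  exists M : {finite_measure set T' -> \bar R}, forall A, M A = pushforward N phi A.
Proof.
move=> mphi; pose nu (A : set T') : \bar R := pushforward N phi A.
have mp (A : set T') : measurable A -> measurable (phi @^-1` A).
  by move=> mA; rewrite -[X in measurable X]setTI; exact: mphi.
have nu0 : nu set0 = 0%E by rewrite /nu /pushforward preimage_set0 measure0.
have nuge A : (0 <= nu A)%E by exact: measure_ge0.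
have nuS : semi_sigma_additive nu.
  move=> A mA tA mUA; rewrite /nu /pushforward preimage_bigcup.
  apply: measure_semi_sigma_additive => [n| |]; first exact: mp.
  - apply/trivIsetP => i j _ _ ij; rewrite -preimage_setI.
    by move/trivIsetP : tA => /(_ _ _ I I ij) ->; rewrite preimage_set0.
  - by rewrite -preimage_bigcup; exact: mp.
have nufin : fin_num_fun nu by move=> A mA; apply: fin_num_measure; exact: mp.
exact: (exists_finite_measure nu0 nuge nuS nufin).
Qed.

Section hats.
Context {R : realType}.

(* Continuous functions with compact support in ]a, b[, increasing to its
   indicator. *)
Definition hat (a b : R) (n : nat) (s : R) : R :=
  Num.min 1 (Num.max 0 (Num.min (n%:R * (s - a) - 1) (n%:R * (b - s) - 1))).

Lemma hat01 a b n s : 0 <= hat a b n s <= 1.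
Proof. by rewrite /hat le_min ge_min lexx ler01 le_max lexx. Qed.

Lemma hat_continuous a b n : continuous (hat a b n).
Proof.
have cl (c : R) (g : R -> R) : continuous g -> continuous (fun s => c * g s - 1).
  by move=> cg s; apply: cvgB; [apply: cvgM; [exact: cvg_cst|exact: cg]|exact: cvg_cst].
move=> s; apply: (@continuous_min _ _ (fun=> 1) (fun s => Num.max 0 (Num.min (n%:R * (s - a) - 1) (n%:R * (b - s) - 1)))).
  exact: cvg_cst.
apply: (@continuous_max _ _ (fun=> 0) (fun s => Num.min (n%:R * (s - a) - 1) (n%:R * (b - s) - 1))).
  exact: cvg_cst.
apply: (@continuous_min _ _ (fun s => n%:R * (s - a) - 1) (fun s => n%:R * (b - s) - 1)).
  by apply: (cl _ (fun s => s - a)) => {}s; apply: cvgB; [exact: cvg_id|exact: cvg_cst].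
by apply: (cl _ (fun s => b - s)) => {}s; apply: cvgB; [exact: cvg_cst|exact: cvg_id].
Qed.

Lemma hat_out a b n s : ~~ (a + n.+1%:R^-1 <= s <= b - n.+1%:R^-1) -> hat a b n.+1 s = 0.
Proof.
move=> h; have n0 : 0 < n.+1%:R :> R by rewrite ltr0n.
have m0 : Num.min (n.+1%:R * (s - a) - 1) (n.+1%:R * (b - s) - 1) <= 0.
  rewrite ge_min; move: h; rewrite negb_and -!ltNge.
  by case/orP => h'; apply/orP; [left|right]; rewrite subr_le0 -ler_pdivlMl// mulr1; move: h'; set i := _^-1; lra.
by rewrite /hat (max_l m0) min_r.
Qed.

Lemma hat_nondecreasing a b s : nondecreasing_seq (fun n => hat a b n.+1 s).
Proof.
move=> m n mn; have mn' : m.+1%:R <= n.+1%:R :> R by rewrite ler_nat.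
have [h|h] := boolP (a + m.+1%:R^-1 <= s <= b - m.+1%:R^-1); last first.
  by rewrite hat_out//; have /andP[] := hat01 a b n.+1 s.
have i0 : 0 < m.+1%:R^-1 :> R by rewrite invr_gt0 ltr0n.
have [sa sb] : a <= s /\ s <= b by case/andP: h; move: i0; set i := _^-1 => ? ? ?; split; lra.
have l1 : m.+1%:R * (s - a) - 1 <= n.+1%:R * (s - a) - 1 by rewrite lerD2r ler_wpM2r ?subr_ge0.
have l2 : m.+1%:R * (b - s) - 1 <= n.+1%:R * (b - s) - 1 by rewrite lerD2r ler_wpM2r ?subr_ge0.
by rewrite /hat le_min2// le_max2// le_min2.
Qed.

Lemma hat_cvg a b s : hat a b n.+1 s @[n --> \oo] --> (\1_(`]a, b[%classic) s : R).
Proof.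
rewrite indicE; have [|] := boolP (s \in `]a, b[%classic) => h; last first.
  apply: cvg_near_cst; near=> n; apply: hat_out; apply: contra h => /andP[h1 h2].
  have i0 : 0 < n.+1%:R^-1 :> R by rewrite invr_gt0 ltr0n.
  by rewrite inE/= in_itv/=; move: h1 h2 i0; set i := n.+1%:R^-1 => h1 h2 i0; apply/andP; split; lra.
have /andP[sa sb] : a < s < b by move: h; rewrite inE/= in_itv.
apply: cvg_near_cst; near=> n; rewrite /hat /=.
have big (y : R) : 0 < y -> 2 / y <= n%:R -> 1 <= n.+1%:R * y - 1.
  by move=> y0; rewrite ler_pdivrMr// -natr1; lra.
by rewrite min_l// le_max le_min !big ?orbT ?subr_gt0//; near: n; exact: nbhs_infty_ger.
Unshelve. all: by end_near. Qed.

End hats.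

(** * From test functions to measures on the half-line *)

Section determining_class.
Context {d} {T : measurableType d} {R : realType}.
Variables (m : {sigma_finite_measure set T -> \bar R}) (k phi : T -> R) (g : R -> R).
Hypotheses (mk : measurable_fun setT k) (k0 : forall z, 0 <= k z)
  (kfin : (\int[m]_z (k z)%:E < +oo)%E) (mphi : measurable_fun setT phi) (phi0 : forall z, 0 < phi z)
  (mg : measurable_fun setT g) (g0 : forall s, 0 <= g s).
Local Notation mu := (@lebesgue_measure R).
Hypothesis kg : forall f : R -> R, continuous f -> (forall x, 0 <= f x <= 1) ->
  (exists a b : R, 0 < a /\ forall x, ~~ (a <= x <= b) -> f x = 0) ->
  (\int[m]_z (f (phi z) * k z)%:E = \int[mu]_(s in `]0%R, +oo[) (f s * g s)%:E)%E.

Let mf_phi (f : R -> R) : measurable_fun setT f -> measurable_fun setT (fun z => (f (phi z) * k z)%:E).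
Proof.
by move=> mf; apply/measurable_EFinP; apply: measurable_funM => //; exact: measurableT_comp.
Qed.

Let mf_g (f : R -> R) (D : set R) : measurable_fun setT f -> measurable_fun D (fun s => (f s * g s)%:E).
Proof. by move=> mf; apply: measurable_funTS; apply/measurable_EFinP; exact: measurable_funM. Qed.

(** As [0 <= a], each hat vanishes off a compact part of ]0, +oo[, so that [kg] applies to it;
    monotone convergence gives the indicator. *)
Lemma weighted_law_open_interval (a b : R) : 0 <= a ->
  (\int[m]_z (\1_(`]a, b[%classic) (phi z) * k z)%:E =
   \int[mu]_(s in `]0%R, +oo[) (\1_(`]a, b[%classic) s * g s)%:E)%E.
Proof.
move=> a0.
have mh n : measurable_fun setT (hat a b n.+1) by apply: continuous_measurable_fun; exact: hat_continuous.
have lim (x y : R) : limn (fun n => (hat a b n.+1 x * y)%:E) = (\1_(`]a, b[%classic) x * y)%:E.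
  apply/cvg_lim => //; apply: cvg_EFin; first by near=> n.
  by apply: cvgMl; exact: hat_cvg.
have nd (x y : R) : 0 <= y -> nondecreasing_seq (fun n => (hat a b n.+1 x * y)%:E).
  by move=> y0 i j ij; rewrite lee_fin ler_wpM2r//; exact: hat_nondecreasing.
have pos (x y : R) n : 0 <= y -> (0 <= (hat a b n.+1 x * y)%:E)%E.
  by move=> y0; rewrite lee_fin mulr_ge0//; have /andP[] := hat01 a b n.+1 x.
under eq_integral do rewrite -lim.
under [RHS]eq_integral do rewrite -lim.
rewrite monotone_convergence//; first last.
- by move=> z _; exact: nd.
- by move=> n z _; exact: pos.
- by move=> n; exact: mf_phi.
rewrite monotone_convergence//; first last.
- by move=> z _; exact: nd.
- by move=> n z _; exact: pos.
- by move=> n; exact: mf_g.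
congr (limn _); apply/funext => n; apply: kg; first exact: hat_continuous.
  exact: hat01.
exists (a + n.+1%:R^-1), (b - n.+1%:R^-1); split; first by rewrite ltr_wpDl// invr_gt0 ltr0n.
exact: hat_out.
Unshelve. all: by end_near. Qed.

(** The image under [phi] of the measure with density [k] and the measure with density [g] on the
    half-line agree on open intervals. These are stable under intersection and generate the Borel
    sets, so the measures agree, and with them the integrals. *)
Lemma weighted_law (f : R -> R) : measurable_fun setT f -> (forall x, 0 <= f x) ->
  (\int[m]_z (f (phi z) * k z)%:E = \int[mu]_(s in `]0%R, +oo[) (f s * g s)%:E)%E.
Proof.
move=> mf f0.
have [N NE] := density_finite_measure mk k0 kfin.
have [M ME] := @pushforward_finite_measure _ _ _ (measurableTypeR R) _ N phi mphi.
pose E : set R := `]0, +oo[%classic; have mE : measurable E by exact: measurable_itv.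
have mgE : measurable_fun setT (fun s => g s * \1_E s).
  by apply: measurable_funM => //; exact: measurable_indic.
have gE0 s : 0 <= g s * \1_E s by rewrite mulr_ge0// indicE.
have restrE (f' : R -> R) : (\int[mu]_(s in E) (f' s * g s)%:E = \int[mu]_s (f' s * (g s * \1_E s))%:E)%E.
  rewrite integral_mkcond; apply: eq_integral => s _; rewrite patchE indicE.
  by case: ifP => _; rewrite ?mulr1 ?mulr0.
have indE (A : set R) : measurable A -> (M A = \int[m]_z (\1_A (phi z) * k z)%:E)%E.
  move=> mA; rewrite ME /pushforward NE; last by rewrite -[X in measurable X]setTI; exact: mphi.
  rewrite integral_mkcond; apply: eq_integral => z _; rewrite patchE indicE.
  have -> : (z \in phi @^-1` A) = (phi z \in A) by apply/idP/idP; rewrite !inE.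
  by case: ifP => _; rewrite ?mul1r ?mul0r.
have M_itv (x y : R) : (M `]x, y[%classic = \int[mu]_s (\1_(`]x, y[%classic) s * (g s * \1_E s))%:E)%E.
  rewrite indE; last exact: measurable_itv.
  (* Both measures live on ]0, +oo[, so an interval may be cut at 0, as the previous lemma
     requires. *)
  have eqi (s : R) : 0 < s -> \1_(`]x, y[%classic) s = \1_(`]Num.max x 0, y[%classic) s :> R.
    by move=> s0; rewrite !indicE; congr (nat_of_bool _)%:R; apply/idP/idP; rewrite !inE/= !in_itv/= gt_max s0 andbT.
  under eq_integral => z _ do rewrite eqi//.
  rewrite weighted_law_open_interval; last by rewrite le_max lexx orbT.
  rewrite restrE; apply: eq_integral => s _; rewrite [\1_E s]indicE.
  by case: (boolP (s \in E)) => [|_]; rewrite ?mulr0// inE /E/= in_itv/= andbT => s0; rewrite eqi.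
(* The mass of [g] is not assumed finite: it inherits finiteness from [M] through the intervals ]-n,
   n[. *)
have Gfin : (\int[mu]_s (g s * \1_E s)%:E < +oo)%E.
  have lim s : limn (fun n => (\1_(`](- n%:R), n%:R[%classic) s * (g s * \1_E s))%:E) = (g s * \1_E s)%:E.
    apply/cvg_lim => //; apply: cvg_near_cst; near=> n.
    rewrite indicE mem_set ?mul1r//= in_itv/= -ltr_norml.
    near: n; exists (Num.truncn `|s|).+1 => // n /= sn.
    by rewrite (lt_le_trans (truncnS_gt _))// ler_nat.
  under eq_integral do rewrite -lim.
  rewrite monotone_convergence//; first last.
  - move=> s _ i j ij; rewrite lee_fin ler_wpM2r// !indicE ler_nat.
    case: (boolP (s \in _)) => //; rewrite inE/= in_itv/= => /andP[s1 s2].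
    rewrite mem_set//= in_itv/= (lt_le_trans s2) ?ler_nat// andbT.
    by rewrite (le_lt_trans _ s1)// lerN2 ler_nat.
  - by move=> n s _; rewrite lee_fin mulr_ge0// indicE.
  - by move=> n; apply/measurable_EFinP; apply: measurable_funM => //; apply: measurable_indic; exact: measurable_itv.
  rewrite (@le_lt_trans _ _ (M setT))//; last by rewrite ltey_eq fin_num_measure.
  apply: lime_le.
    apply: ereal_nondecreasing_is_cvgn => i j ij; rewrite -!M_itv le_measure ?inE//; try exact: measurable_itv.
    move=> s /=; rewrite !in_itv/= => /andP[s1 s2].
    by rewrite (lt_le_trans s2) ?ler_nat// andbT (le_lt_trans _ s1)// lerN2 ler_nat.
  by apply: nearW => n; rewrite -M_itv le_measure ?inE//; exact: measurable_itv.
have [G GE] := @density_finite_measure _ (measurableTypeR R) _ mu _ mgE gE0 Gfin.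
have GEi (A : set R) : measurable A -> (G A = \int[mu]_s (\1_A s * (g s * \1_E s))%:E)%E.
  move=> mA; rewrite GE// integral_mkcond; apply: eq_integral => s _; rewrite patchE [\1_A s]indicE.
  by case: ifP => _; rewrite ?mul1r ?mul0r.
have setIG : setI_closed (@RGenOpens.G R).
  move=> _ _ [x [y ->]] [x' [y' ->]]; exists (Num.max x x'), (Num.min y y').
  apply/seteqP; split => s /=; rewrite !in_itv/= gt_max lt_min.
    by case=> /andP[-> ->] /andP[-> ->].
  by move=> /andP[/andP[-> ->] /andP[-> ->]].
have Gg (n : nat) : @RGenOpens.G R `](- n%:R), n%:R[%classic by exists (- n%:R), n%:R.
have cov : \bigcup_n (`](- n%:R), n%:R[%classic : set R) = [set: R].
  apply/seteqP; split => // s _; exists (Num.truncn `|s|).+1 => //=.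
  by rewrite in_itv/= -ltr_norml; exact: truncnS_gt.
have MGoo (A : set (measurableTypeR R)) : @RGenOpens.G R A -> M A = G A.
  by move=> [x [y ->]]; rewrite M_itv GEi//; exact: measurable_itv.
have Mfin (n : nat) : (M (`](- n%:R)%R, n%:R%R[%classic : set (measurableTypeR R)) < +oo)%E.
  by rewrite ltey_eq fin_num_measure//; exact: measurable_itv.
have MG (A : set (measurableTypeR R)) : measurable A -> M A = G A.
  exact: (@measure_unique _ _ (measurableTypeR R) (@RGenOpens.G R) (fun n => `](- n%:R), n%:R[%classic)
    (RGenOpens.measurableE R) setIG Gg cov M G MGoo Mfin).
have mfE : measurable_fun setT (EFin \o f) by exact/measurable_EFinP.
rewrite restrE -(ge0_integral_density (T := measurableTypeR R) (mgE : measurable_fun [set: measurableTypeR R] _) GE)//.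
rewrite -(@eq_measure_integral _ _ _ _ G M); last by move=> A mA _; exact: MG.
have MN : (M : set (measurableTypeR R) -> \bar R) = pushforward N (phi : T -> measurableTypeR R).
  by apply/funext => A; exact: ME.
transitivity (\int[pushforward N (phi : T -> measurableTypeR R)]_x (f x)%:E)%E; last first.
  apply/esym; transitivity (\int[(M : set (measurableTypeR R) -> \bar R)]_x (f x)%:E)%E; [by []|by rewrite MN].
rewrite (@ge0_integral_pushforward _ _ _ (measurableTypeR R))//; last by move=> y _; rewrite lee_fin.
rewrite preimage_setT -(ge0_integral_density mk NE)//.
exact: measurableT_comp.
Unshelve. all: by end_near. Qed.

Lemma weighted_law_integrable (f : R -> R) : measurable_fun setT f ->
  (\int[mu]_(s in `]0%R, +oo[) (`|f s| * g s)%:E < +oo)%E ->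
  m.-integrable setT (fun z => (f (phi z) * k z)%:E) /\
  (\int[m]_z (f (phi z) * k z)%:E = \int[mu]_(s in `]0%R, +oo[) (f s * g s)%:E)%E.
Proof.
move=> mf fin; split.
  apply/integrableP; split; first exact: mf_phi.
  move: fin; rewrite -weighted_law//; last exact: measurableT_comp.
  by congr (_ < _)%E; apply: eq_integral => z _; rewrite abse_EFin normrM (ger0_norm (k0 z)).
have pos (S : Type) (p q : S -> R) : (forall z, 0 <= q z) ->
    (fun z => (p z * q z)%:E)^\+%E = (fun z => (p^\+%R z * q z)%:E) /\
    (fun z => (p z * q z)%:E)^\-%E = (fun z => (p^\-%R z * q z)%:E).
  move=> q0; rewrite (_ : (fun z => (p z * q z)%:E) = EFin \o (fun z => p z * q z)%R)// funerpos funerneg.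
  by split; apply/funext => z; rewrite /= /funrpos /funrneg maxr_pMl// mul0r ?mulNr.
have [fg1 fg2] := pos _ f g g0; have [fk1 fk2] := pos _ (f \o phi) k k0.
rewrite integralE [RHS]integralE fg1 fg2 fk1 fk2.
congr (_ - _)%E; rewrite -weighted_law//.
- exact: measurable_funrpos.
- exact: measurable_funrneg.
Qed.

End determining_class.

Section sigma_finite_packing.
Context {d} {T : measurableType d} {R : realType} (m : {measure set T -> \bar R}).
Hypothesis sm : sigma_finite setT m.

Definition sigma_finite_of of sigma_finite setT m : set T -> \bar R := m.

HB.instance Definition _ := Measure.copy (sigma_finite_of sm) m.
HB.instance Definition _ := Measure_isSigmaFinite.Build _ _ _ (sigma_finite_of sm) sm.

(** Replaces a measure proved to be sigma-finite by one that carries the structure and has the same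
    integrals. *)
Lemma exists_sigma_finite_measure : exists m' : {sigma_finite_measure set T -> \bar R},
  forall f : T -> \bar R, (\int[m']_z f z = \int[m]_z f z)%E.
Proof. by exists (sigma_finite_of sm). Qed.

End sigma_finite_packing.

Lemma sigma_finite_lebesgue_product {d} {Omega : measurableType d} {R : realType} (P : probability Omega R) :
  sigma_finite setT ((@lebesgue_measure R \x P)%E : {measure set (measurableTypeR R * Omega)%type -> \bar R}).
Proof.
exists (fun n => `](- n%:R), n%:R[%classic `*` setT).
  apply/seteqP; split => // z _; exists (Num.truncn `|z.1|).+1 => //=; split => //=.
  by rewrite in_itv/= -ltr_norml; exact: truncnS_gt.
move=> n; have mI : measurable (`](- n%:R), n%:R[%classic : set R) by exact: measurable_itv.
split; first by apply: measurableX.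
have := @product_measure1E _ _ _ _ _ (@lebesgue_measure R) P _ setT mI measurableT.
rewrite [X in (_ = _ * X)%E -> _](_ : _ = 1%E); last exact: probability_setT.
rewrite mule1 => muE.
apply: (@le_lt_trans _ _ (@lebesgue_measure R `](- n%:R), n%:R[%classic)).
  by rewrite le_eqVlt; apply/orP; left; apply/eqP; exact: muE.
by rewrite lebesgue_measure_itv/=; case: ifP => _; rewrite -?EFinB ltry.
Qed.

Lemma integrable_setU d (T : measurableType d) {R : realType} (nu : {measure set T -> \bar R}) (A B : set T)
  (f : T -> \bar R) : measurable A -> measurable B ->
  nu.-integrable A f -> nu.-integrable B f -> nu.-integrable (A `|` B) f.
Proof.
move=> mA mB /integrableP[mfA fA] fB; have /integrableP[mfB _] := fB.
have mf : measurable_fun (A `|` B) f by apply/measurable_funU.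
apply/integrableP; split => //.
have /integrableP[_ fBA] : nu.-integrable (B `\` A) f.
  by apply: integrableS fB => //; exact: measurableD.
have -> : A `|` B = A `|` (B `\` A) by apply/seteqP; split => x /=; [case=> [|Bx]; [left|have [|nA] := pselect (A x); [left|right]]|case=> [|[]]; [left|right]].
rewrite ge0_integral_setU//=; first exact: lte_add_pinfty.
- exact: measurableD.
- apply: measurableT_comp => //; apply/measurable_funU => //; first exact: measurableD.
  by split=> //; apply: measurable_funS mfB => //; exact: subDsetl.
- by apply/disj_setPS => x [Ax []].
Qed.

Section derivative_tools.
Context {R : realType}.
Local Notation mu := (@lebesgue_measure R).

Lemma is_derive_continuous (f : R -> R) (x df : R) : is_derive x (1 : R) f df -> {for x, continuous f}.
Proof. by case=> dfx _; apply/differentiable_continuous/derivable1_diffP. Qed.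

Lemma continuous_pos_within (f : R -> R) (a b : R) : 0 < a -> (forall x : R, 0 < x -> {for x, continuous f}) ->
  {within `[a, b], continuous f}.
Proof.
move=> a0 cf; apply: continuous_in_subspaceT => x; rewrite inE/= in_itv/= => /andP[ax _].
by apply: cf; exact: lt_le_trans ax.
Qed.

Lemma pos_derive_increment (f f' : R -> R) (a b : R) : 0 < a -> a < b ->
  (forall x : R, 0 < x -> is_derive x (1 : R) f (f' x)) ->
  exists2 z, a < z < b & f b - f a = f' z * (b - a).
Proof.
move=> a0 ab df.
have [||z] := @MVT _ f f' a b ab.
- by move=> x; rewrite in_itv/= => /andP[ax _]; apply: df; exact: lt_trans ax.
- by apply: continuous_pos_within => // x x0; exact: is_derive_continuous (df x x0).
by rewrite in_itv/=; exists z.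
Qed.

Lemma pos_derive_nondecreasing (f f' : R -> R) : (forall x : R, 0 < x -> is_derive x (1 : R) f (f' x)) ->
  (forall x : R, 0 < x -> 0 <= f' x) -> forall a b, 0 < a -> a <= b -> f a <= f b.
Proof.
move=> df f'0 a b a0; rewrite le_eqVlt => /predU1P[->//|ab].
have [z /andP[az _] fz] := pos_derive_increment a0 ab df.
by rewrite -subr_ge0 fz mulr_ge0 ?subr_ge0 ?(ltW ab)// f'0// (lt_trans a0).
Qed.

Lemma pos_derive_nonincreasing (f f' : R -> R) : (forall x : R, 0 < x -> is_derive x (1 : R) f (f' x)) ->
  (forall x : R, 0 < x -> f' x <= 0) -> forall a b, 0 < a -> a <= b -> f b <= f a.
Proof.
move=> df f'0 a b a0 ab; rewrite -lerN2.
apply: (@pos_derive_nondecreasing (fun x => - f x) (fun x => - f' x)) => // x x0.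
  exact: is_deriveN (df x x0).
by rewrite oppr_ge0 f'0.
Qed.

Lemma is_derive_integral_itv (f : R -> R) (x : R) : continuous f -> 0 < x ->
  is_derive x (1 : R) (fun t : R => \int[mu]_(s in `[0, t]) f s) (f x).
Proof.
move=> cf x0.
have fi : mu.-integrable `[0, x + 1] (EFin \o f).
  apply: continuous_compact_integrable; first exact: segment_compact.
  exact: continuous_subspaceT.
have [dF FE] := @continuous_FTC1_closed R f 0 x (x + 1) (ltr_pwDr ltr01 (lexx x)) fi x0 (cf x).
by apply: DeriveDef; [exact: dF|rewrite -FE derive1E].
Qed.

End derivative_tools.

(** * Green functions *)

Section green_function.
Context {R : realType}.
Variables (u u1 u2 v v1 v2 bb sg kk : R -> R).
Hypotheses (du : forall x : R, 0 < x -> is_derive x (1 : R) u (u1 x))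
  (du1 : forall x : R, 0 < x -> is_derive x (1 : R) u1 (u2 x))
  (cu2 : forall x : R, 0 < x -> {for x, continuous u2})
  (dv : forall x : R, 0 < x -> is_derive x (1 : R) v (v1 x))
  (dv1 : forall x : R, 0 < x -> is_derive x (1 : R) v1 (v2 x))
  (cv2 : forall x : R, 0 < x -> {for x, continuous v2})
  (u_ge0 : forall x : R, 0 < x -> 0 <= u x) (v_ge0 : forall x : R, 0 < x -> 0 <= v x)
  (u1_le0 : forall x : R, 0 < x -> u1 x <= 0) (v1_ge0 : forall x : R, 0 < x -> 0 <= v1 x)
  (wr_gt0 : forall x : R, 0 < x -> 0 < u x * v1 x - u1 x * v x)
  (csg : forall x : R, 0 < x -> {for x, continuous sg})
  (sg_gt0 : forall x : R, 0 < x -> 0 < sg x ^+ 2)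
  (odeu : forall x : R, 0 < x -> 2^-1 * sg x ^+ 2 * u2 x + bb x * u1 x - kk x * u x = 0)
  (odev : forall x : R, 0 < x -> 2^-1 * sg x ^+ 2 * v2 x + bb x * v1 x - kk x * v x = 0).
Local Notation mu := (@lebesgue_measure R).

Definition speed_wronskian x := sg x ^+ 2 * (u x * v1 x - u1 x * v x).

(** Kernel of the inverse of [kk - (1/2 sg^2 d^2 + bb d)]. Only nonnegativity and monotonicity of
    [u] and [v] and a positive Wronskian are asked, so that the pairs [phi], [psi] and [- phi'],
    [psi'] are both admissible. *)
Definition green_function x s :=
  (if s <= x then u x * v s else v x * u s) * (2 / speed_wronskian s).

Let sw_gt0 (x : R) : 0 < x -> 0 < speed_wronskian x.
Proof. by move=> x0; rewrite mulr_gt0// ?sg_gt0// wr_gt0. Qed.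

Lemma green_function_ge0 x s : 0 < x -> 0 < s -> 0 <= green_function x s.
Proof.
move=> x0 s0; rewrite /green_function mulr_ge0// ?divr_ge0 ?(ltW (sw_gt0 s0))//.
by case: ifP => _; rewrite mulr_ge0 ?u_ge0 ?v_ge0.
Qed.

Let cu (x : R) : 0 < x -> {for x, continuous u}. Proof. by move=> x0; exact: is_derive_continuous (du x0). Qed.
Let cv (x : R) : 0 < x -> {for x, continuous v}. Proof. by move=> x0; exact: is_derive_continuous (dv x0). Qed.
Let cu1 (x : R) : 0 < x -> {for x, continuous u1}. Proof. by move=> x0; exact: is_derive_continuous (du1 x0). Qed.
Let cv1 (x : R) : 0 < x -> {for x, continuous v1}. Proof. by move=> x0; exact: is_derive_continuous (dv1 x0). Qed.

Let csw (x : R) : 0 < x -> {for x, continuous (fun s => 2 / speed_wronskian s)}.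
Proof.
move=> x0; apply: cvgM; first exact: cvg_cst.
apply: cvgV; first by rewrite gt_eqF// sw_gt0.
apply: cvgM.
  by apply: (@continuous_comp _ _ _ sg (fun z => z ^+ 2)); [exact: csg|exact: exprn_continuous].
apply: cvgB; apply: cvgM; [exact: cu|exact: cv1|exact: cu1|exact: cv].
Qed.

Lemma green_function_measurable x : 0 < x -> measurable_fun (`]0, +oo[ : set R) (green_function x).
Proof.
move=> x0; have mE : measurable (`]0, +oo[ : set R) by exact: measurable_itv.
have mc (g : R -> R) : (forall y : R, 0 < y -> {for y, continuous g}) -> measurable_fun (`]0, +oo[ : set R) g.
  move=> cg; apply: open_continuous_measurable_fun; first exact: interval_open.
  by move=> y; rewrite inE/= in_itv/= andbT; exact: cg.
apply: measurable_funM; last by apply: mc => y; exact: csw.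
apply: (@measurable_fun_if _ _ _ _ (fun s => u x * v s) (fun s => v x * u s) _ mE (fun s : R => s <= x)).
- by apply: measurable_funTS; apply: measurable_fun_ler; [exact: measurable_id|exact: measurable_cst].
- apply: measurable_funM; first exact: measurable_cst.
  by apply: measurable_funS (mc v _).
- apply: measurable_funM; first exact: measurable_cst.
  by apply: measurable_funS (mc u _).
Qed.

Section test_function.
Variables (f : R -> R) (a b : R).
Hypotheses (cf : continuous f) (f0 : forall x, 0 <= f x) (a0 : 0 < a)
  (f_out : forall x, ~~ (a <= x <= b) -> f x = 0).

Let weighted (w : R -> R) s := f s * (w s * (2 / speed_wronskian s)).

Let weighted_continuous (w : R -> R) : (forall x : R, 0 < x -> {for x, continuous w}) -> continuous (weighted w).
Proof.
move=> cw x; have [x0|x0] := leP x 0; last first.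
  by apply: cvgM; [exact: cf|apply: cvgM; [exact: cw|exact: csw]].
have xa : x < a by exact: le_lt_trans a0.
have w0 y : y < a -> weighted w y = 0.
  by move=> ya; rewrite /weighted f_out ?mul0r// negb_and -ltNge ya.
rewrite /continuous_at w0//; apply: cvg_near_cst; near=> y; apply: w0; near: y.
exact: lt_nbhsl.
Unshelve. all: by end_near. Qed.

Let weighted_ge0 (w : R -> R) : (forall x : R, 0 < x -> 0 <= w x) -> forall s, 0 <= weighted w s.
Proof.
move=> w0 s; have [s0|s0] := leP s 0.
  by rewrite /weighted f_out ?mul0r// negb_and -ltNge (le_lt_trans s0).
by rewrite /weighted !mulr_ge0 ?invr_ge0 ?(ltW (sw_gt0 s0))// w0.
Qed.

Let weighted_out (w : R -> R) (s : R) : ~~ (a <= s <= b) -> weighted w s = 0.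
Proof. by move=> sab; rewrite /weighted f_out ?mul0r. Qed.

Let primitive w (x : R) := \int[mu]_(s in `[0, x]) weighted w s.

Let iw (w : R -> R) (x y : R) : (forall x : R, 0 < x -> {for x, continuous w}) -> mu.-integrable `[x, y] (EFin \o weighted w).
Proof.
move=> cw; apply: continuous_compact_integrable; first exact: segment_compact.
by apply: continuous_subspaceT; exact: weighted_continuous.
Qed.

Let primitive_left (w : R -> R) (x : R) : x < a -> primitive w x = 0.
Proof.
move=> xa; apply: Rintegral0_eq => s; rewrite /= in_itv/= => /andP[_ sx].
by rewrite weighted_out// negb_and -ltNge (le_lt_trans sx).
Qed.

Let primitive_split (w : R -> R) (x y : R) : (forall x : R, 0 < x -> {for x, continuous w}) -> 0 <= x -> x <= y ->
  primitive w y = primitive w x + \int[mu]_(s in `[x, y]) weighted w s.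
Proof. by move=> cw x0 xy; rewrite /primitive (Rintegral_itv_split x0 xy)//; exact: iw. Qed.

Let primitive_right (w : R -> R) (x : R) : (forall x : R, 0 < x -> {for x, continuous w}) -> b <= x -> 0 <= b -> primitive w x = primitive w b.
Proof.
move=> cw bx b0; rewrite (primitive_split cw b0 bx) [X in _ + X](_ : _ = 0) ?addr0//.
have z s : b < s -> weighted w s = 0 by move=> bs; rewrite weighted_out// negb_and -!ltNge bs orbT.
rewrite -Rintegral_itv_obnd_cbnd; last first.
  by apply: integrableS (iw b x cw) => //; apply: subset_itvr; rewrite bnd_simp.
by apply: Rintegral0_eq => s; rewrite /= in_itv/= => /andP[bs _]; exact: z.
Qed.

Let primitive_mono (w : R -> R) (x y : R) : (forall x : R, 0 < x -> {for x, continuous w}) -> (forall x : R, 0 < x -> 0 <= w x) -> 0 <= x -> x <= y -> primitive w x <= primitive w y.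
Proof.
move=> cw w0 x0 xy; rewrite (primitive_split cw x0 xy) lerDl.
by apply: Rintegral_ge0 => s _; exact: weighted_ge0.
Qed.

(** The right end of the support, kept positive even if [a, b] is empty. *)
Let b' := Num.max b a.
Let b'0 : 0 < b'. Proof. by rewrite lt_max a0 orbT. Qed.

Let cw_primitive (w : R -> R) : (forall x : R, 0 < x -> {for x, continuous w}) -> (forall x : R, 0 < x -> 0 <= w x) -> forall x : R, 0 < x -> 0 <= primitive w x <= primitive w b'.
Proof.
move=> cw w0 x x0; apply/andP; split.
  by apply: Rintegral_ge0 => s _; exact: weighted_ge0.
have [xb|/ltW bx] := leP x b'; first by apply: primitive_mono => //; exact: ltW.
have [ab|ba] := leP a b.
  have bE : b' = b by rewrite /b' max_l.
  by rewrite bE in bx *; rewrite primitive_right// (le_trans (ltW a0)).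
have z s : weighted w s = 0.
  by apply: weighted_out; rewrite negb_and -!ltNge; have [//|as'] := ltP s a; rewrite (lt_le_trans ba).
by rewrite /primitive !Rintegral0_eq// => s _; exact: z.
Qed.

(* [h] is the Green potential of [f]; it is bounded because it is a multiple
   of [v] on the left, and of [u] on the right, of the support of [f]. *)
Lemma green_potential : exists h h1 h2 : R -> R, exists Ch : R,
  [/\ forall x : R, 0 < x -> is_derive x (1 : R) h (h1 x),
      forall x : R, 0 < x -> is_derive x (1 : R) h1 (h2 x),
      forall x : R, 0 < x -> {for x, continuous h2} &
      forall x : R, 0 < x -> `|h x| <= Ch] /\
  (forall y : R, 0 < y -> h1 y * bb y + 2^-1 * h2 y * sg y ^+ 2 - kk y * h y = - f y) /\
  forall x : R, 0 < x -> (\int[mu]_(s in `]0%R, +oo[) (f s * green_function x s)%:E = (h x)%:E)%E.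
Proof.
pose A := primitive v; pose B := primitive u; pose Cu := B b'.
have dA (x : R) : 0 < x -> is_derive x (1 : R) A (weighted v x).
  by move=> x0; apply: is_derive_integral_itv => //; exact: weighted_continuous.
have dB (x : R) : 0 < x -> is_derive x (1 : R) (fun x => Cu - B x) (- weighted u x).
  move=> x0; have db : is_derive x (1 : R) B (weighted u x).
    by apply: is_derive_integral_itv => //; exact: weighted_continuous.
  have dc : is_derive x (1 : R) (fun=> Cu) 0 by exact: is_derive_cst.
  by apply: (is_derive_eq (is_deriveB dc db)); rewrite sub0r.
pose h x := u x * A x + v x * (Cu - B x).
pose h1 x := u1 x * A x + v1 x * (Cu - B x).
pose h2 x := u2 x * A x + v2 x * (Cu - B x) + (u1 x * weighted v x - v1 x * weighted u x).
have dh (x : R) : 0 < x -> is_derive x (1 : R) h (h1 x).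
  move=> x0; apply: (is_derive_eq (is_deriveD (is_deriveM (du x0) (dA x x0)) (is_deriveM (dv x0) (dB x x0)))).
  by rewrite /GRing.scale/= /h1 /weighted; ring.
have dh1 (x : R) : 0 < x -> is_derive x (1 : R) h1 (h2 x).
  move=> x0; apply: (is_derive_eq (is_deriveD (is_deriveM (du1 x0) (dA x x0)) (is_deriveM (dv1 x0) (dB x x0)))).
  by rewrite /GRing.scale/= /h2; ring.
have cA (x : R) : 0 < x -> {for x, continuous A} by move=> x0; exact: is_derive_continuous (dA x x0).
have cB (x : R) : 0 < x -> {for x, continuous (fun x => Cu - B x)} by move=> x0; exact: is_derive_continuous (dB x x0).
have ch2 (x : R) : 0 < x -> {for x, continuous h2}.
  move=> x0; apply: cvgD.
    by apply: cvgD; apply: cvgM; [exact: cu2|exact: cA|exact: cv2|exact: cB].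
  by apply: cvgB; apply: cvgM; [exact: cu1|exact: weighted_continuous|exact: cv1|exact: weighted_continuous].
have A0 (x : R) (x0 : 0 < x) : 0 <= A x <= A b' by exact: cw_primitive.
have B0 (x : R) (x0 : 0 < x) : 0 <= B x <= Cu by exact: cw_primitive.
have ub (x : R) : 0 < x -> `|h x| <= u a * A b' + v b' * Cu.
  move=> x0; have /andP[A1 A2] := A0 x x0; have /andP[B1 B2] := B0 x x0.
  have CB : 0 <= Cu - B x by rewrite subr_ge0.
  rewrite ger0_norm; last by rewrite addr_ge0// mulr_ge0// ?u_ge0// v_ge0.
  apply: lerD.
    have [xa|ax] := ltP x a; first by rewrite /A primitive_left// mulr0 mulr_ge0 ?u_ge0// (le_trans A1).
    by rewrite ler_pM// ?u_ge0//; exact: (pos_derive_nonincreasing du u1_le0).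
  have [xb|bx] := leP x b'.
    rewrite ler_pM// ?v_ge0//; first exact: (pos_derive_nondecreasing dv v1_ge0).
    by rewrite gerBl.
  have -> : B x = Cu.
    apply/eqP; rewrite eq_le B2/=; apply: primitive_mono => //; exact: ltW.
  by rewrite subrr mulr0 mulr_ge0 ?v_ge0// (le_trans B1).
exists h, h1, h2, (u a * A b' + v b' * Cu); split; first by split.
split=> [y y0|x x0].
  have sy := sg_gt0 y0; have wy := wr_gt0 y0.
  (* The derivatives of the two primitives cancel in [h1] and enter [h2] only through this term; the
     Wronskian in the weight is what normalizes it to [- f]. *)
  have key : 2^-1 * sg y ^+ 2 * (u1 y * weighted v y - v1 y * weighted u y) = - f y.
    rewrite /weighted /speed_wronskian; field.
    by rewrite (gt_eqF wy) -(@sqrf_eq0 _ (sg y)) (gt_eqF sy).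
  rewrite -key /h /h1 /h2.
  transitivity ((2^-1 * sg y ^+ 2 * u2 y + bb y * u1 y - kk y * u y) * A y
    + (2^-1 * sg y ^+ 2 * v2 y + bb y * v1 y - kk y * v y) * (Cu - B y)
    + 2^-1 * sg y ^+ 2 * (u1 y * weighted v y - v1 y * weighted u y)); first by ring.
  by rewrite odeu// odev// !mul0r !add0r.
pose M := Num.max x b'.
have xM : x <= M by rewrite le_max lexx.
have M0 : 0 <= M by rewrite (le_trans (ltW x0)).
pose G s := if s <= x then u x * weighted v s else v x * weighted u s.
have fG s : f s * green_function x s = G s.
  by rewrite /green_function /G /weighted; case: ifP => _; ring.
have Gout s : ~~ (a <= s <= b) -> G s = 0.
  by move=> sab; rewrite /G !weighted_out// !mulr0 if_same.
have E1 : (\int[mu]_(s in `]0%R, +oo[) (f s * green_function x s)%:E = \int[mu]_(s in `[0%R, M]) (G s)%:E)%E.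
  rewrite integral_mkcond [RHS]integral_mkcond; apply: eq_integral => s _; rewrite !patchE fG.
  have [sab|/Gout ->] := boolP (a <= s <= b); last by rewrite !if_same.
  case/andP: sab => as' sb.
  rewrite !mem_set//= in_itv/=.
    by rewrite (le_trans (ltW a0) as')/= /M /b' !le_max sb !orbT.
  by rewrite andbT (lt_le_trans a0).
have iG1 : mu.-integrable `[0, x] (EFin \o G).
  apply: (@eq_integrable _ _ _ mu _ (measurable_itv _) (EFin \o (fun s => u x * weighted v s))).
    by move=> s; rewrite inE/= in_itv/= => /andP[_ sx]; rewrite /G sx.
  by apply: integrable_EFinZl => //; exact: iw.
have GE2 s : x <= s -> G s = v x * weighted u s.
  rewrite le_eqVlt /G => /predU1P[<-|xs]; last by rewrite leNgt xs.
  by rewrite lexx /weighted; ring.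
have iG2 : mu.-integrable `[x, M] (EFin \o G).
  apply: (@eq_integrable _ _ _ mu _ (measurable_itv _) (EFin \o (fun s => v x * weighted u s))).
    by move=> s; rewrite inE/= in_itv/= => /andP[xs _]; rewrite /= GE2.
  by apply: integrable_EFinZl => //; exact: iw.
have iG : mu.-integrable `[0, M] (EFin \o G).
  have -> : `[0, M]%classic = (`[0, x] `|` `[x, M])%classic.
    apply/seteqP; split => s /=; rewrite !in_itv/=.
      by move=> /andP[s0 sM]; have [sx|/ltW xs] := leP s x; [left; rewrite s0|right; rewrite xs].
    by case=> /andP[p1 p2]; rewrite ?p1 ?p2 ?(le_trans p2)// ?(le_trans (ltW x0)).
  by apply: integrable_setU => //; exact: measurable_itv.
rewrite E1; transitivity (\int[mu]_(s in `[0, M]) G s)%:E.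
  by rewrite /Rintegral fineK//; exact: integrable_fin_num.
congr (_%:E); rewrite (Rintegral_itv_split (ltW x0) xM iG) /h; congr (_ + _).
  rewrite -RintegralZl//; last exact: iw.
  by apply: eq_Rintegral => s; rewrite inE/= in_itv/= => /andP[_ sx]; rewrite /G sx.
transitivity (v x * \int[mu]_(s in `[x, M]) weighted u s).
  rewrite -RintegralZl//; last exact: iw.
  by apply: eq_Rintegral => s; rewrite inE/= in_itv/= => /andP[xs _]; rewrite GE2.
congr (_ * _); have MB : B M = Cu.
  have bM : b' <= M by rewrite le_max lexx orbT.
  apply/eqP; rewrite eq_le; have /andP[_ ->] := B0 M (lt_le_trans x0 xM).
  by apply: primitive_mono => //; exact: ltW.
by rewrite -MB /B (primitive_split cu (ltW x0) xM) addrAC subrr add0r.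
Qed.

End test_function.

End green_function.

(** * The resolvent as an integral against the Green function *)

Section resolvent_representation.
Context {R : realType} {d : measure_display} {Omega : measurableType d}.
Variables (P : probability Omega R) (F : R -> set (set Omega)) (W : R -> Omega -> R).
Hypotheses (hF : usual_filtration P F) (hW : brownian_motion P F W).
Variables (X : R -> Omega -> R) (x0 : R) (bb sg kk : R -> R) (r0 : R).
Hypotheses (x0_gt0 : 0 < x0) (r0_gt0 : 0 < r0)
  (cbb : forall x : R, 0 < x -> {for x, continuous bb})
  (csg : forall x : R, 0 < x -> {for x, continuous sg})
  (sg_gt0 : forall x : R, 0 < x -> 0 < sg x ^+ 2)
  (ckk : forall x : R, 0 < x -> {for x, continuous kk})
  (r0kk : forall x : R, 0 < x -> r0 <= kk x)
  (hX : nonexplosive_sde_solution P F W bb sg x0 X).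
Variables (u u1 u2 v v1 v2 : R -> R).
Hypotheses (du : forall x : R, 0 < x -> is_derive x (1 : R) u (u1 x))
  (du1 : forall x : R, 0 < x -> is_derive x (1 : R) u1 (u2 x))
  (cu2 : forall x : R, 0 < x -> {for x, continuous u2})
  (dv : forall x : R, 0 < x -> is_derive x (1 : R) v (v1 x))
  (dv1 : forall x : R, 0 < x -> is_derive x (1 : R) v1 (v2 x))
  (cv2 : forall x : R, 0 < x -> {for x, continuous v2})
  (u_ge0 : forall x : R, 0 < x -> 0 <= u x) (v_ge0 : forall x : R, 0 < x -> 0 <= v x)
  (u1_le0 : forall x : R, 0 < x -> u1 x <= 0) (v1_ge0 : forall x : R, 0 < x -> 0 <= v1 x)
  (wr_gt0 : forall x : R, 0 < x -> 0 < u x * v1 x - u1 x * v x)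
  (odeu : forall x : R, 0 < x -> 2^-1 * sg x ^+ 2 * u2 x + bb x * u1 x - kk x * u x = 0)
  (odev : forall x : R, 0 < x -> 2^-1 * sg x ^+ 2 * v2 x + bb x * v1 x - kk x * v x = 0).
Local Notation mu := (@lebesgue_measure R).
Let green := green_function u u1 v v1 sg x0.

(** The resolvent integrates [f] against the discounted occupation measure. For continuous [f] with
    compact support Dynkin's formula, applied to its Green potential, identifies this integral;
    [weighted_law] extends the identity to all measurable [f]. *)
Lemma resolvent_green (f : R -> R) : measurable_fun (`]0, +oo[ : set R) f ->
  ((forall s : R, 0 < s -> 0 <= f s) ->
    (resolvent P kk f X = \int[mu]_(s in `]0%R, +oo[) (f s * green s)%:E)%E) /\
  ((\int[mu]_(s in `]0%R, +oo[) (`|f s| * green s)%:E < +oo)%E ->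
    resolvent_well_defined P kk f X /\
    (resolvent P kk f X = \int[mu]_(s in `]0%R, +oo[) (f s * green s)%:E)%E).
Proof.
move: f; have [X' [[aX' cX' X'_neg X'0 X'pos] [XX' res]]] := continuous_solution hF hW x0_gt0 cbb csg hX.
pose E : set R := `]0, +oo[%classic; pose E0 : set R := `[0, +oo[%classic.
have mE : measurable E by exact: measurable_itv.
have mE0 : measurable E0 by exact: measurable_itv.
pose D t w := path_discount X' kk t w.
(* The discounted occupation measure of [X'] is the image under [phi] of the measure with density
   [k] on time and [Omega]. *)
pose k (z : R * Omega) := D z.1 z.2 * \1_E0 z.1; pose phi (z : R * Omega) := X' z.1 z.2.
pose g s := green s * \1_E s.
have mk : measurable_fun setT k.
  apply: measurable_funM; first exact: (path_discount_measurable hF).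
  by apply: (measurableT_comp (f := \1_E0 : R -> R)); [exact: measurable_indic|exact: measurable_fst].
have k0 z : 0 <= k z by rewrite mulr_ge0 ?expR_ge0// indicE.
have mX' t : measurable_fun setT (X' t) by exact: (adapted_measurableR hF).
have mphi : measurable_fun setT phi by exact: caratheodory_measurable.
have phi0 z : 0 < phi z by exact: X'pos.
have mext (f : R -> R) : measurable_fun E f -> measurable_fun setT (fun s => f s * \1_E s).
  move=> mf; have := (measurable_restrictT f mE).1 mf; congr (measurable_fun _ _).
  by apply/funext => s; rewrite patchE indicE; case: ifP => _; rewrite ?mulr1 ?mulr0.
have mg : measurable_fun setT g by apply: mext; exact: green_function_measurable.
have g0 s : 0 <= g s.
  rewrite /g indicE; have [|_] := boolP (s \in E); last by rewrite mulr0.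
  by rewrite inE /E/= in_itv/= andbT mulr1 => s0; exact: green_function_ge0.
have kernel_itv (f : R -> R) w :
    (\int[mu]_t (f (phi (t, w)) * k (t, w))%:E = discounted_integral kk f X' w)%E.
  rewrite /discounted_integral [RHS]integral_mkcond; apply: eq_integral => t _.
  rewrite patchE /k /phi/= indicE /E0; case: ifP => _; last by rewrite !mulr0.
  by rewrite mulr1 mulrC.
have fub (f : R -> R) : measurable_fun setT f -> (forall s, 0 <= f s) ->
    (\int[mu \x P]_z (f (phi z) * k z)%:E = \int[P]_w discounted_integral kk f X' w)%E.
  move=> mf f0; rewrite (@fubini_tonelli2 _ _ _ _ _ mu P (fun z => (f (phi z) * k z)%:E)).
  - by apply: eq_integral => w _; rewrite /fubini_G/= kernel_itv.
  - by apply/measurable_EFinP; apply: measurable_funM => //; exact: measurableT_comp.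
  - by move=> z; rewrite lee_fin mulr_ge0.
have Dle t w : 0 <= t -> D t w <= expR (- r0 * t).
  move=> t0; rewrite /D /path_discount ler_expR mulNr lerN2.
  have := @le_Rintegral _ _ _ mu `[0, t]%classic (fun=> r0) (fun s => kk (X' s w)).
  rewrite Rintegral_cst// lebesgue_measure_segment// subr0; apply => //.
  - by apply: (bounded_integrable_itv (M := r0)) => // s _; rewrite ger0_norm// ltW.
  - apply: continuous_compact_integrable; first exact: segment_compact.
    apply: continuous_subspaceT => s.
    by apply: (@continuous_comp _ _ _ (X' ^~ w) kk); [exact: cX'|exact: ckk].
  - by move=> s _; exact: r0kk.
have mD w : measurable_fun setT (fun t => D t w).
  exact: (measurableT_comp (path_discount_measurable hF aX' cX' X'_neg X'pos ckk) (measurable_pair2 w : measurable_fun setT (fun r : R => (r, w)))).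
(* The rate is at least [r0], so the total discounted mass is at most [1 / r0]. *)
have kfin : (\int[mu \x P]_z (k z)%:E < +oo)%E.
  have E1 := fub (fun=> 1) (@measurable_cst _ _ _ _ setT (1 : R)) (fun=> ler01).
  have -> : (\int[mu \x P]_z (k z)%:E = \int[P]_w discounted_integral kk (fun=> 1%R) X' w)%E.
    by rewrite -E1; apply: eq_integral => z _; rewrite mul1r.
  have mexp : measurable_fun setT (fun t : R => expR (- r0 * t)).
    by apply: measurableT_comp => //; apply: measurable_funM.
  have E2 : (\int[mu]_(t in `[0%R, +oo[) (expR (- r0 * t))%:E = (r0^-1)%:E)%E.
    have E3 : (r0%:E * \int[mu]_(t in `[0%R, +oo[) (expR (- r0 * t))%:E = 1)%E.
      rewrite -ge0_integralZl//.
      - rewrite -(integral_exponential_pdf r0_gt0) [LHS]integral_mkcond; apply: eq_integral => t _.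
        by rewrite /exponential_pdf !patchE; case: ifP => _.
      - by apply/measurable_EFinP; exact: measurable_funTS.
      - by rewrite lee_fin ltW.
    by rewrite -[LHS]mul1e -(mulVf (lt0r_neq0 r0_gt0)) EFinM -muleA E3 mule1.
  have disc_le w : (discounted_integral kk (fun=> 1%R) X' w <= (r0^-1)%:E)%E.
    rewrite -E2; apply: ge0_le_integral.
    - exact: measurable_itv.
    - by move=> t _; rewrite lee_fin mulr1 expR_ge0.
    - by apply/measurable_EFinP; apply: measurable_funTS; apply: measurable_funM => //; exact: mD.
    - by apply/measurable_EFinP; exact: measurable_funTS.
    - by move=> t; rewrite /= in_itv/= andbT => t0; rewrite lee_fin mulr1 Dle.
  apply: (@le_lt_trans _ _ (\int[P]_w (r0^-1)%:E)%E); last by rewrite integral_cst//= probability_setT mule1 ltry.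
  apply: ge0_le_integral.
  - exact: measurableT.
  - by move=> w _; apply: integral_ge0 => t _; rewrite lee_fin mulr1 expR_ge0.
  - have mG : measurable_fun setT (fun w => \int[mu]_t ((fun=> 1%R) (phi (t, w)) * k (t, w))%:E)%E.
      apply: (@measurable_fun_fubini_tonelli_G _ _ _ _ _ mu (fun z => ((fun=> 1) (phi z) * k z)%:E)).
      + by apply/measurable_EFinP; apply: measurable_funM.
      + by move=> z; rewrite lee_fin mul1r.
    have GE : (fun w => \int[mu]_t ((fun=> 1%R) (phi (t, w)) * k (t, w))%:E)%E = discounted_integral kk (fun=> 1%R) X'.
      by apply/funext => w; rewrite -(kernel_itv (fun=> 1)).
    by move: mG; rewrite GE.
  - exact: measurable_cst.
  - by move=> w _; exact: disc_le.
have gE (f : R -> R) : (\int[mu]_(s in E) (f s * g s)%:E = \int[mu]_(s in E) (f s * green s)%:E)%E.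
  by apply: eq_integral => s sE; rewrite /g indicE sE mulr1.
have kg (f : R -> R) : continuous f -> (forall x, 0 <= f x <= 1) ->
    (exists a b : R, 0 < a /\ forall x, ~~ (a <= x <= b) -> f x = 0) ->
    (\int[mu \x P]_z (f (phi z) * k z)%:E = \int[mu]_(s in `]0%R, +oo[) (f s * g s)%:E)%E.
  move=> cf f01 [a [b [a0 fout]]].
  have f0 x : 0 <= f x by have /andP[] := f01 x.
  rewrite fub//; last exact: continuous_measurable_fun.
  rewrite (gE f).
  have [h [h1 [h2 [Ch [[dh dh1 ch2 hC] [gen ->]]]]]]:= green_potential du du1 cu2 dv dv1 cv2 u_ge0 v_ge0 u1_le0 v1_ge0
    wr_gt0 csg sg_gt0 odeu odev cf f0 a0 fout.
  - exact: (res h h1 h2 kk f Ch 1 r0).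
  - exact: x0_gt0.
have [m intm] := exists_sigma_finite_measure (sigma_finite_lebesgue_product P).
have kfin' : (\int[m]_z (k z)%:E < +oo)%E by rewrite intm.
have kg' (f : R -> R) : continuous f -> (forall x, 0 <= f x <= 1) ->
    (exists a b : R, 0 < a /\ forall x, ~~ (a <= x <= b) -> f x = 0) ->
    (\int[m]_z (f (phi z) * k z)%:E = \int[mu]_(s in `]0%R, +oo[) (f s * g s)%:E)%E.
  by move=> ? ? ?; rewrite intm; exact: kg.
have law (f : R -> R) : measurable_fun setT f -> (forall s, 0 <= f s) ->
    (\int[mu \x P]_z (f (phi z) * k z)%:E = \int[mu]_(s in `]0%R, +oo[) (f s * g s)%:E)%E.
  by move=> mf f0; rewrite -intm; exact: (@weighted_law _ (measurableTypeR R * Omega)%type R m k phi g mk k0 kfin' mphi phi0 mg g0 kg').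
have law_int (f : R -> R) : measurable_fun setT f -> (\int[mu]_(s in `]0%R, +oo[) (`|f s| * g s)%:E < +oo)%E ->
    (mu \x P)%E.-integrable setT (fun z => (f (phi z) * k z)%:E) /\
    (\int[mu \x P]_z (f (phi z) * k z)%:E = \int[mu]_(s in `]0%R, +oo[) (f s * g s)%:E)%E.
  move=> mf fin; have [im <-] := @weighted_law_integrable _ (measurableTypeR R * Omega)%type R m k phi g mk k0 kfin' mphi phi0 mg g0 kg' f mf fin.
  split; last by rewrite intm.
  by have /integrableP[mH iH] := im; apply/integrableP; split => //; rewrite -intm.
(* [f] is constrained on the half-line only. Its extension by 0 is measurable on the whole line, and
   the resolvent is unchanged because almost all paths stay positive. *)
move=> f mf; pose f' s := f s * \1_E s.
have f'E s : 0 < s -> f' s = f s.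
  by move=> s0; rewrite /f' indicE mem_set ?mulr1// /E/= in_itv/= s0.
have mf' : measurable_fun setT f' by exact: mext.
have path_eq (f1 f2 : R -> R) w : (forall s : R, 0 < s -> f1 s = f2 s) -> (forall t, 0 <= t -> X t w = X' t w) ->
    forall t, 0 <= t -> expR (- Lambda kk X t w) * f1 (X t w) = expR (- Lambda kk X' t w) * f2 (X' t w).
  move=> f12 XX t t0; rewrite XX// f12//; congr (expR (- _) * _).
  by apply: eq_Rintegral => s; rewrite inE/= in_itv/= => /andP[s0 _]; rewrite XX.
have disc_eq (f1 f2 : R -> R) : (forall s : R, 0 < s -> f1 s = f2 s) ->
    ae_eq P setT (discounted_integral kk f2 X') (discounted_integral kk f1 X).
  move=> f12; apply: filterS XX' => w XX _; apply: eq_integral => t.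
  by rewrite inE/= in_itv/= andbT => t0; rewrite (path_eq f1 f2).
have mdisc (f2 : R -> R) : measurable_fun setT f2 -> measurable_fun setT (discounted_integral kk f2 X').
  move=> mf2; have mH : measurable_fun setT (fun z => (f2 (phi z) * k z)%:E).
    by apply/measurable_EFinP; apply: measurable_funM => //; exact: measurableT_comp.
  have -> : discounted_integral kk f2 X' = ((fun w => \int[mu]_t ((fun z => (f2 (phi z) * k z)%:E)^\+) (t, w)) \-
      (fun w => \int[mu]_t ((fun z => (f2 (phi z) * k z)%:E)^\-) (t, w)))%E.
    apply/funext => w; rewrite -kernel_itv integralE; congr (_ - _)%E; apply: eq_integral => t _.
      by rewrite !funeposE.
    by rewrite !funenegE.
  apply: emeasurable_funB.
    apply: (@measurable_fun_fubini_tonelli_G _ _ _ _ _ mu ((fun z => (f2 (phi z) * k z)%:E)^\+)%E) => //.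
    exact: measurable_funepos.
  apply: (@measurable_fun_fubini_tonelli_G _ _ _ _ _ mu ((fun z => (f2 (phi z) * k z)%:E)^\-)%E) => //.
  exact: measurable_funeneg.
have mdiscX (f1 f2 : R -> R) : measurable_fun setT f2 -> (forall s : R, 0 < s -> f1 s = f2 s) ->
    measurable_fun setT (discounted_integral kk f1 X).
  by move=> mf2 f12; apply: (ae_measurable_fun (usual_filtration_complete hF) (disc_eq _ _ f12)); exact: mdisc.
have res_eq (f1 f2 : R -> R) : measurable_fun setT f2 -> (forall s : R, 0 < s -> f1 s = f2 s) ->
    (resolvent P kk f1 X = \int[P]_w discounted_integral kk f2 X' w)%E.
  move=> mf2 f12; apply/esym; apply: ae_eq_integral => //; first exact: mdisc.
    exact: (mdiscX f1 f2).
  exact: disc_eq.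
have res_ge0 (f1 : R -> R) : measurable_fun E f1 -> (forall s : R, 0 < s -> 0 <= f1 s) ->
    (resolvent P kk f1 X = \int[mu]_(s in `]0%R, +oo[) (f1 s * green s)%:E)%E.
  move=> mf1 f10; pose f2 s := f1 s * \1_E s.
  have f2E s : 0 < s -> f1 s = f2 s.
    by move=> s0; rewrite /f2 indicE mem_set ?mulr1// /E/= in_itv/= s0.
  have f20 s : 0 <= f2 s.
    rewrite /f2 indicE; have [|_] := boolP (s \in E); last by rewrite mulr0.
    by rewrite inE /E/= in_itv/= andbT mulr1; exact: f10.
  have mf2 : measurable_fun setT f2 by exact: mext.
  rewrite (res_eq f1 f2)// -fub// law// gE.
  by apply: eq_integral => s; rewrite inE /E/= in_itv/= andbT => s0; rewrite f2E.
split=> [f0|fin]; first exact: res_ge0.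
have fin' : (\int[mu]_(s in `]0%R, +oo[) (`|f' s| * g s)%:E < +oo)%E.
  rewrite (gE (fun s => `|f' s|)); apply: le_lt_trans fin; rewrite le_eqVlt; apply/orP; left; apply/eqP.
  by apply: eq_integral => s; rewrite inE /E/= in_itv/= andbT => s0; rewrite f'E.
have [iH HE] := law_int f' mf' fin'.
have resabs : (resolvent P kk (fun y => `|f y|%R) X = \int[mu]_(s in `]0%R, +oo[) (`|f s| * green s)%:E)%E.
  by apply: res_ge0 => //; exact: measurableT_comp.
have resE : (resolvent P kk f X = \int[mu]_(s in `]0%R, +oo[) (f s * green s)%:E)%E.
  rewrite (res_eq f f')//; last by move=> s s0; rewrite f'E.
  transitivity (\int[mu \x P]_z (f' (phi z) * k z)%:E)%E.
    rewrite -(@integral21_prod_meas1 _ _ _ _ _ mu P _ iH); apply: eq_integral => w _.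
    by rewrite /fubini_G kernel_itv.
  rewrite HE gE; apply: eq_integral => s; rewrite inE /E/= in_itv/= andbT => s0; rewrite f'E//.
split=> //; split; first by rewrite resabs.
  have ae1 := @ae_integrable2 _ _ _ _ _ mu P _ iH.
  move: ae1 XX'; apply: filterS2 => w iw XX.
  have := iw; rewrite (_ : (fun t => _) = (fun t => (D t w * f' (X' t w))%:E) \_ E0).
    move=> /(proj2 (integrable_mkcond _ (mE0 : measurable (E0 : set (measurableTypeR R))))); apply: eq_integrable => // t.
    by rewrite inE /E0/= in_itv/= andbT => t0; rewrite (path_eq f f')// => s s0; rewrite f'E.
  apply/funext => t; rewrite patchE /k /phi/= indicE; case: ifP => _; last by rewrite !mulr0.
  by rewrite mulr1 mulrC.
apply/integrableP; split; first by apply: (mdiscX f f') => // s s0; rewrite f'E.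
apply: (@le_lt_trans _ _ (resolvent P kk (fun y => `|f y|%R) X)); last by rewrite resabs.
have mabs : measurable_fun setT (fun s => `|f' s|) by exact: measurableT_comp.
have ae2 : (\int[P]_w `|discounted_integral kk f X w| = \int[P]_w `|discounted_integral kk f' X' w|)%E.
  apply: ae_eq_integral => //.
  - by apply: measurableT_comp => //; apply: (mdiscX f f') => // s s0; rewrite f'E.
  - by apply: measurableT_comp => //; exact: mdisc.
  - by apply: filterS (disc_eq f f' _) => [w /(_ I) ->//|s s0]; rewrite f'E.
rewrite ae2 (res_eq _ (fun s => `|f' s|))//; last by move=> s s0; rewrite f'E.
apply: ge0_le_integral.
- exact: measurableT.
- by move=> w _; exact: abse_ge0.
- by apply: measurableT_comp => //; exact: mdisc.
- exact: mdisc.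
- move=> w _; apply: (le_trans (le_abse_integral _ _ _)).
  + exact: measurable_itv.
  + apply/measurable_EFinP; apply: measurable_funTS; apply: measurable_funM; first exact: mD.
    apply: (measurableT_comp mf'); exact: continuous_measurable_fun.
  + rewrite le_eqVlt; apply/orP; left; apply/eqP; apply: eq_integral => t _.
    by rewrite abse_EFin normrM ger0_norm// expR_ge0.
Qed.

End resolvent_representation.

(** * The fundamental solutions and their derivatives *)

Section scale.
Context {R : realType}.
Local Notation mu := (@lebesgue_measure R).

Lemma C1_pos_is_derive (f : R -> R) (x : R) : C1_pos f -> 0 < x -> is_derive x (1 : R) f (derive1 f x).
Proof. by move=> hf x0; have [df _] := hf x x0; apply: DeriveDef => //; rewrite derive1E. Qed.

Lemma C1_pos_continuous (f : R -> R) (x : R) : C1_pos f -> 0 < x -> {for x, continuous f}.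
Proof. by move=> hf x0; exact: is_derive_continuous (C1_pos_is_derive hf x0). Qed.

Lemma is_derive_pos_integral (f : R -> R) (a x : R) : 0 < a -> a < x ->
  (forall y : R, 0 < y -> {for y, continuous f}) ->
  is_derive x (1 : R) (fun t : R => \int[mu]_(s in `[a, t]) f s) (f x).
Proof.
move=> a0 ax cf; have x0 := lt_trans a0 ax.
have fi : mu.-integrable `[a, x + 1] (EFin \o f).
  apply: continuous_compact_integrable; first exact: segment_compact.
  exact: continuous_pos_within.
have [dF FE] := @continuous_FTC1_closed R f a x (x + 1) (ltr_pwDr ltr01 (lexx x)) fi ax (cf x x0).
by apply: DeriveDef; [exact: dF|rewrite -FE derive1E].
Qed.

Lemma is_derive_oriented_integral (f : R -> R) (c x : R) : 0 < c -> 0 < x ->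
  (forall y : R, 0 < y -> {for y, continuous f}) ->
  is_derive x (1 : R) (oriented_integral f c) (f x).
Proof.
(* [a] lies below both [c] and [x]: near [x] the oriented integral is then the integral from [a]
   minus a constant, whichever of [c] and [y] is larger. *)
move=> c0 x0 cf; pose a := Num.min c x / 2.
have mcx : 0 < Num.min c x by rewrite lt_min c0.
have a0 : 0 < a by rewrite divr_gt0.
have am : a < Num.min c x by rewrite /a; move: mcx; set m := Num.min c x; lra.
have [ac ax] : a < c /\ a < x by move: am; rewrite lt_min => /andP[].
have ii u v : 0 < u -> mu.-integrable `[u, v] (EFin \o f).
  move=> u0; apply: continuous_compact_integrable; first exact: segment_compact.
  exact: continuous_pos_within.
have dx := is_derive_pos_integral a0 ax cf.
have dc : is_derive x (1 : R) (fun=> \int[mu]_(s in `[a, c]) f s) 0 by exact: is_derive_cst.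
have dd := is_deriveB dx dc; rewrite subr0 in dd.
apply: near_eq_is_derive dd; near=> y.
have ay : a < y by near: y; exact: lt_nbhsr.
have split u v w : a <= u -> u <= v -> v <= w ->
    \int[mu]_(s in `[u, w]) f s = \int[mu]_(s in `[u, v]) f s + \int[mu]_(s in `[v, w]) f s.
  by move=> au uv vw; rewrite (Rintegral_itv_split uv vw)//; apply: ii; exact: lt_le_trans au.
rewrite /oriented_integral; have [cy|yc] := leP c y.
  by change (\int[mu]_(s in `[a, y]) f s - \int[mu]_(s in `[a, c]) f s = \int[mu]_(s in `[c, y]) f s); rewrite (split a c y)// ?(ltW ac)//; ring.
by change (\int[mu]_(s in `[a, y]) f s - \int[mu]_(s in `[a, c]) f s = - \int[mu]_(s in `[y, c]) f s); rewrite (split a y c)// ?(ltW ay) ?(ltW yc)//; ring.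
Unshelve. all: by end_near. Qed.

Lemma scale_density_gt0 (b sigma : R -> R) (c x : R) : 0 < scale_density b sigma c x.
Proof. exact: expR_gt0. Qed.

Lemma is_derive_scale_density (b sigma : R -> R) (c x : R) : 0 < c -> 0 < x ->
  (forall y : R, 0 < y -> {for y, continuous b}) -> (forall y : R, 0 < y -> {for y, continuous sigma}) ->
  (forall y : R, 0 < y -> 0 < sigma y ^+ 2) ->
  is_derive x (1 : R) (scale_density b sigma c) (- 2 * (b x / sigma x ^+ 2) * scale_density b sigma c x).
Proof.
move=> c0 x0 cb cs s0.
have cf (y : R) : 0 < y -> {for y, continuous (fun s => b s / sigma s ^+ 2)}.
  move=> y0; apply: cvgM; first exact: cb.
  apply: cvgV; first by rewrite gt_eqF// s0.
  by apply: (@continuous_comp _ _ _ sigma (fun z => z ^+ 2)); [exact: cs|exact: exprn_continuous].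
have d1 := is_derive_oriented_integral c0 x0 cf.
have d2 := is_deriveZ (- 2) d1.
have d3 : is_derive (- 2 * oriented_integral (fun s => b s / sigma s ^+ 2) c x) (1 : R) expR
  (expR (- 2 * oriented_integral (fun s => b s / sigma s ^+ 2) c x)) by exact: is_derive_expR.
apply: (is_derive_eq (@is_derive1_comp _ expR (fun y => - 2 * oriented_integral (fun s => b s / sigma s ^+ 2) c y) x _ _ d3 d2)).
by rewrite mulrC.
Qed.

Lemma pos_derive0_constant (f : R -> R) : (forall x : R, 0 < x -> is_derive x (1 : R) f 0) ->
  forall x y : R, 0 < x -> 0 < y -> f x = f y.
Proof.
move=> df x y x0 y0; wlog xy : x y x0 y0 / x <= y.
  by move=> wl; have [/wl->//|/ltW /wl ->] := leP x y.
apply/eqP; rewrite eq_le (pos_derive_nondecreasing (f' := fun=> 0) df)// (pos_derive_nonincreasing (f' := fun=> 0) df)//.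
Qed.

End scale.

Section fundamental_solutions.
Context {R : realType}.
Variables (b sigma r : R -> R) (r0 c : R) (phi psi : R -> R).
Hypotheses (cb : C1_pos b) (cs : C1_pos sigma) (s_gt0 : forall x : R, 0 < x -> 0 < sigma x ^+ 2)
  (cr : C1_pos r) (r0_gt0 : 0 < r0) (r0r : forall x : R, 0 < x -> r0 <= r x)
  (r0rho : forall x : R, 0 < x -> r0 <= rate_rho b r x) (c_gt0 : 0 < c)
  (hpp : fundamental_pair b sigma r c phi psi).
Variable p : R -> R.
Hypotheses (p_gt0 : forall x : R, 0 < p x)
  (is_derive_scale : forall x : R, 0 < x -> is_derive x (1 : R) p (- 2 * (b x / sigma x ^+ 2) * p x)).

Let r_gt0 (x : R) : 0 < x -> 0 < r x. Proof. by move=> x0; exact: lt_le_trans (r0r x0). Qed.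
Let rho_gt0 (x : R) : 0 < x -> 0 < rate_rho b r x. Proof. by move=> x0; exact: lt_le_trans (r0rho x0). Qed.
Let s_neq0 (x : R) : 0 < x -> sigma x != 0.
Proof. by move=> x0; have := s_gt0 x0; rewrite -sqrf_eq0 => /gt_eqF ->. Qed.

Definition ode_second (w : R -> R) (x : R) : R := 2 / sigma x ^+ 2 * (r x * w x - b x * derive1 w x).

(* For a solution [w], [ode_second w] is [w''] and [ode_flux w] is
   [sigma^2 w'' / (2 r p)], whose derivative is [rho w' / (r p)]. *)
Definition ode_flux (w : R -> R) (x : R) : R := w x / p x - b x * derive1 w x / (r x * p x).

Lemma ode_flux_second w (x : R) : 0 < x ->
  ode_second w x = 2 * r x * p x / sigma x ^+ 2 * ode_flux w x.
Proof.
move=> x0; rewrite /ode_second /ode_flux; field.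
by rewrite (gt_eqF (p_gt0 x)) (gt_eqF (r_gt0 x0)) s_neq0.
Qed.

Let continuous_sqr (f : R -> R) (x : R) : {for x, continuous f} -> {for x, continuous (fun y => f y ^+ 2)}.
Proof. by move=> cf; apply: (@continuous_comp _ _ _ f (fun z => z ^+ 2)); [exact: cf|exact: exprn_continuous]. Qed.

Lemma rate_rho_continuous (x : R) : 0 < x -> {for x, continuous (rate_rho b r)}.
Proof.
move=> x0; have cC (f : R -> R) : C1_pos f -> {for x, continuous f} by move=> hf; exact: C1_pos_continuous.
have cC' (f : R -> R) : C1_pos f -> {for x, continuous (derive1 f)} by move=> hf; have [] := hf x x0.
apply: cvgM; last by apply: cvgV; [rewrite gt_eqF// r_gt0|exact: cC].
apply: cvgD; last by apply: cvgM; [exact: cC'|exact: cC].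
apply: cvgB; first by apply: continuous_sqr; exact: cC.
by apply: cvgM; [exact: cC|exact: cC'].
Qed.

Lemma drift_mu_continuous (x : R) : 0 < x -> {for x, continuous (drift_mu b sigma r)}.
Proof.
move=> x0; have cC (f : R -> R) : C1_pos f -> {for x, continuous f} by move=> hf; exact: C1_pos_continuous.
have cC' (f : R -> R) : C1_pos f -> {for x, continuous (derive1 f)} by move=> hf; have [] := hf x x0.
apply: cvgB; first by apply: cvgD; [exact: cC|apply: cvgM; [exact: cC|exact: cC']].
apply: cvgM; first by apply: cvgM; [exact: cvg_cst|apply: continuous_sqr; exact: cC].
by apply: cvgM; [exact: cC'|apply: cvgV; [rewrite gt_eqF// r_gt0|exact: cC]].
Qed.

Section solution.
Variable w : R -> R.
Hypothesis hw : ode_solution b sigma r w.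

Lemma ode_is_derive (x : R) : 0 < x -> is_derive x (1 : R) w (derive1 w x).
Proof. by move=> x0; case: hw => [[cw _] _]; exact: C1_pos_is_derive. Qed.

Lemma ode_is_derive2 (x : R) : 0 < x -> is_derive x (1 : R) (derive1 w) (ode_second w x).
Proof.
move=> x0; case: hw => [[_ cw] ode]; apply: (is_derive_eq (C1_pos_is_derive cw x0)).
have := ode x x0; rewrite /ode_second => odex.
have -> : r x * w x - b x * derive1 w x = 2^-1 * sigma x ^+ 2 * derive1 (derive1 w) x.
  by apply/eqP; rewrite -subr_eq0 -oppr_eq0; apply/eqP; rewrite -[RHS]odex; ring.
by field; exact: s_neq0.
Qed.

Lemma ode_second_eq (x : R) : 0 < x ->
  2^-1 * sigma x ^+ 2 * ode_second w x + b x * derive1 w x - r x * w x = 0.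
Proof. by move=> x0; rewrite /ode_second; field; exact: s_neq0. Qed.

Let cw (x : R) : 0 < x -> {for x, continuous w}.
Proof. by move=> x0; exact: is_derive_continuous (ode_is_derive x0). Qed.
Let cw1 (x : R) : 0 < x -> {for x, continuous (derive1 w)}.
Proof. by move=> x0; exact: is_derive_continuous (ode_is_derive2 x0). Qed.

(** Self-adjoint form of the equation: [p] is an integrating factor that removes the first-order
    term. *)
Lemma is_derive_scaled_derivative (x : R) : 0 < x ->
  is_derive x (1 : R) (fun y => derive1 w y / p y) (2 * r x * w x / (sigma x ^+ 2 * p x)).
Proof.
move=> x0; have px := gt_eqF (p_gt0 x).
have dV := is_deriveV (negbT px) (is_derive_scale x0).
apply: (is_derive_eq (is_deriveM (ode_is_derive2 x0) dV)).
rewrite /GRing.scale/= /ode_second; field.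
by rewrite px s_neq0.
Qed.

Definition ode_third (x : R) : R := 2 / sigma x ^+ 2 * (rate_rho b r x * derive1 w x - drift_mu b sigma r x * ode_second w x).

(** [w] is only given as C2, but the equation expresses [w''] through C1 functions and so makes it
    derivable. Differentiating the equation is what produces [drift_mu] and [rate_rho]. *)
Lemma ode_is_derive3 (x : R) : 0 < x -> is_derive x (1 : R) (ode_second w) (ode_third x).
Proof.
move=> x0; have sx := s_neq0 x0; have rx := gt_eqF (r_gt0 x0).
have dsg := C1_pos_is_derive cs x0.
have ds2 : is_derive x (1 : R) (fun y => sigma y ^+ 2) (2 * sigma x * derive1 sigma x).
  have -> : (fun y => sigma y ^+ 2) = sigma * sigma by apply/funext => y; rewrite expr2.
  by apply: (is_derive_eq (is_deriveM dsg dsg)); rewrite /GRing.scale/=; ring.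
have s2x : sigma x ^+ 2 != 0 by rewrite sqrf_eq0.
have dV : is_derive x (1 : R) (fun y => 2 / sigma y ^+ 2) (- (4 * derive1 sigma x / sigma x ^+ 3)).
  apply: (is_derive_eq (is_deriveZ 2 (@is_deriveV _ (fun y => sigma y ^+ 2) x _ 1 s2x ds2))).
  by rewrite /GRing.scale/=; field.
have dB : is_derive x (1 : R) (fun y => r y * w y - b y * derive1 w y)
    (derive1 r x * w x + r x * derive1 w x - (derive1 b x * derive1 w x + b x * ode_second w x)).
  apply: (is_derive_eq (is_deriveB (is_deriveM (C1_pos_is_derive cr x0) (ode_is_derive x0))
    (is_deriveM (C1_pos_is_derive cb x0) (ode_is_derive2 x0)))).
  by rewrite /GRing.scale/=; ring.
apply: (is_derive_eq (is_deriveM dV dB)).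
rewrite /GRing.scale/= /ode_third /rate_rho /drift_mu /ode_second; field.
by rewrite rx sx.
Qed.

Lemma ode_third_continuous (x : R) : 0 < x -> {for x, continuous ode_third}.
Proof.
move=> x0; apply: cvgM.
  apply: cvgM; first exact: cvg_cst.
  apply: cvgV; first by rewrite sqrf_eq0 s_neq0.
  by apply: (@continuous_comp _ _ _ sigma (fun z => z ^+ 2)); [exact: C1_pos_continuous|exact: exprn_continuous].
apply: cvgB; apply: cvgM; [exact: rate_rho_continuous|exact: cw1|exact: drift_mu_continuous|].
exact: is_derive_continuous (ode_is_derive3 x0).
Qed.

Lemma ode_third_eq (x : R) : 0 < x ->
  2^-1 * sigma x ^+ 2 * ode_third x + drift_mu b sigma r x * ode_second w x - rate_rho b r x * derive1 w x = 0.
Proof. by move=> x0; rewrite /ode_third; field; exact: s_neq0. Qed.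

Lemma is_derive_ode_flux (x : R) : 0 < x ->
  is_derive x (1 : R) (ode_flux w) (rate_rho b r x * derive1 w x / (r x * p x)).
Proof.
move=> x0; have px := gt_eqF (p_gt0 x); have rx := gt_eqF (r_gt0 x0); have sx := s_neq0 x0.
have dp := is_derive_scale x0.
have d1 := is_deriveM (ode_is_derive x0) (is_deriveV (negbT px) dp).
have rpx : r x * p x != 0 by rewrite mulf_eq0 rx px.
have drp : is_derive x (1 : R) (fun y => r y * p y) (derive1 r x * p x - 2 * b x / sigma x ^+ 2 * r x * p x).
  apply: (is_derive_eq (is_deriveM (C1_pos_is_derive cr x0) dp)).
  by rewrite /GRing.scale/=; field.
have dbw : is_derive x (1 : R) (fun y => b y * derive1 w y) (derive1 b x * derive1 w x + b x * ode_second w x).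
  apply: (is_derive_eq (is_deriveM (C1_pos_is_derive cb x0) (ode_is_derive2 x0))).
  by rewrite /GRing.scale/=; ring.
have d2 := is_deriveM dbw (@is_deriveV _ (fun y => r y * p y) x _ 1 rpx drp).
apply: (is_derive_eq (is_deriveB d1 d2)).
rewrite /GRing.scale/= /rate_rho /ode_second; field.
by rewrite px rx sx.
Qed.

End solution.

Let hphi : ode_solution b sigma r phi. Proof. by case: hpp => -[]. Qed.
Let hpsi : ode_solution b sigma r psi. Proof. by case: hpp => -[]. Qed.
Let phi_gt0 (x : R) : 0 < x -> 0 < phi x. Proof. by move=> x0; case: hpp => _ [+ _ _ _ _] => /(_ x x0)[]. Qed.
Let phi1_lt0 (x : R) : 0 < x -> derive1 phi x < 0. Proof. by move=> x0; case: hpp => _ [+ _ _ _ _] => /(_ x x0)[]. Qed.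
Let psi_gt0 (x : R) : 0 < x -> 0 < psi x. Proof. by move=> x0; case: hpp => _ [_ + _ _ _] => /(_ x x0)[]. Qed.
Let psi1_gt0 (x : R) : 0 < x -> 0 < derive1 psi x. Proof. by move=> x0; case: hpp => _ [_ + _ _ _] => /(_ x x0)[]. Qed.

Definition wronskian_constant : R := (phi c * derive1 psi c - derive1 phi c * psi c) / p c.
Local Notation C := wronskian_constant.

Lemma wronskian_constant_gt0 : 0 < C.
Proof.
rewrite divr_gt0// subr_gt0 (@lt_trans _ _ 0)//.
  by rewrite nmulr_rlt0 ?phi1_lt0// psi_gt0.
by rewrite mulr_gt0 ?phi_gt0// psi1_gt0.
Qed.

(** Abel's identity. In self-adjoint form the cross terms [2 r phi psi / (sigma^2 p)] cancel, hence
    the Wronskian divided by [p] is constant. *)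
Lemma wronskianE (x : R) : 0 < x -> phi x * derive1 psi x - derive1 phi x * psi x = C * p x.
Proof.
move=> x0; pose wr y := phi y * (derive1 psi y / p y) - psi y * (derive1 phi y / p y).
have dwr (y : R) : 0 < y -> is_derive y (1 : R) wr 0.
  move=> y0; have d1 := is_deriveM (ode_is_derive hphi y0) (is_derive_scaled_derivative hpsi y0).
  have d2 := is_deriveM (ode_is_derive hpsi y0) (is_derive_scaled_derivative hphi y0).
  by apply: (is_derive_eq (is_deriveB d1 d2)); rewrite /GRing.scale/=; ring.
have wE y : wr y = (phi y * derive1 psi y - derive1 phi y * psi y) / p y by rewrite /wr; ring.
have := pos_derive0_constant dwr x0 c_gt0; rewrite !wE -/C => <-.
by rewrite divfK// gt_eqF.
Qed.

Lemma phi_flux_decreasing (x y : R) : 0 < x -> x < y -> ode_flux phi y < ode_flux phi x.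
Proof.
move=> x0 xy.
have [z /andP[xz _] E] := pos_derive_increment x0 xy (is_derive_ode_flux hphi).
have z0 := lt_trans x0 xz.
rewrite -subr_lt0 E pmulr_llt0 ?subr_gt0// pmulr_llt0 ?invr_gt0 ?mulr_gt0 ?r_gt0//.
by rewrite pmulr_rlt0 ?rho_gt0// phi1_lt0.
Qed.

Let coef_gt0 (x : R) : 0 < x -> 0 < 2 * r x * p x / sigma x ^+ 2.
Proof. by move=> x0; rewrite divr_gt0 ?s_gt0// !mulr_gt0// r_gt0. Qed.

(* Otherwise [phi'] would be bounded away from 0 on the right of [x], and
   [phi] would become negative. *)
Lemma phi_flux_ge0 (x : R) : 0 < x -> 0 <= ode_flux phi x.
Proof.
move=> x0; rewrite leNgt; apply/negP => Ex.
have neg (y : R) : x <= y -> ode_second phi y < 0.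
  move=> xy; have y0 := lt_le_trans x0 xy.
  rewrite (ode_flux_second _ y0) (pmulr_rlt0 _ (coef_gt0 y0)); apply: le_lt_trans Ex.
  by move: xy; rewrite le_eqVlt => /predU1P[->//|/(phi_flux_decreasing x0)/ltW].
pose L := x - phi x / derive1 phi x + 1.
have d0 := phi1_lt0 x0.
have xL : x < L.
  rewrite /L -addrA ltrDl ltr_pwDr// oppr_ge0 mulr_ge0_le0 ?invr_le0 ?(ltW d0)//.
  by rewrite ltW// phi_gt0.
have [z /andP[xz zL] E] := pos_derive_increment x0 xL (ode_is_derive hphi).
have dz : derive1 phi z <= derive1 phi x.
  have [t /andP[xt _] Et] := pos_derive_increment x0 xz (ode_is_derive2 hphi).
  by rewrite -subr_le0 Et mulr_le0_ge0 ?subr_ge0 ?(ltW xz)// ltW// neg// ltW.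
have : phi L <= 0.
  rewrite -(subrK (phi x) (phi L)) E.
  apply: (@le_trans _ _ (derive1 phi x * (L - x) + phi x)).
    by rewrite lerD2r ler_wpM2r ?subr_ge0// ltW.
  have -> : derive1 phi x * (L - x) + phi x = derive1 phi x.
    by rewrite /L; field; rewrite lt_eqF.
  exact: ltW.
by rewrite leNgt phi_gt0// (lt_trans x0).
Qed.

Lemma phi_flux_gt0 (x : R) : 0 < x -> 0 < ode_flux phi x.
Proof.
move=> x0; have x1 : x < x + 1 by rewrite ltrDl.
by apply: le_lt_trans (phi_flux_decreasing x0 x1); apply: phi_flux_ge0; exact: lt_trans x1.
Qed.

Lemma phi_second_ge0 (x : R) : 0 < x -> 0 <= ode_second phi x.
Proof. by move=> x0; rewrite ode_flux_second// mulr_ge0// ?phi_flux_ge0// ltW// coef_gt0. Qed.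

Lemma flux_wronskian (x : R) : 0 < x ->
  ode_flux phi x * derive1 psi x - ode_flux psi x * derive1 phi x = C.
Proof.
move=> x0; have px := gt_eqF (p_gt0 x).
transitivity ((phi x * derive1 psi x - derive1 phi x * psi x) / p x).
  by rewrite /ode_flux; ring.
by rewrite (wronskianE x0) mulfK// px.
Qed.

(** The Wronskian of the pair [- phi'], [psi']. The factor [sigma^2] of the speed measure cancels
    against it, which explains the kernels with denominator [r p]. *)
Lemma wronskian_second (x : R) : 0 < x ->
  - derive1 phi x * ode_second psi x - - ode_second phi x * derive1 psi x = 2 * r x * p x * C / sigma x ^+ 2.
Proof.
move=> x0; rewrite !ode_flux_second// -(flux_wronskian x0); ring.
Qed.

(** Drops the nonnegative term [- phi' psi] from the Wronskian. As [phi] is infinite at 0, it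
    follows that [psi' / p] vanishes there; likewise [phi' / p] vanishes at infinity. *)
Lemma psi1_scaled_le (x : R) : 0 < x -> derive1 psi x / p x <= C / phi x.
Proof.
move=> x0; rewrite ler_pdivrMr// mulrAC ler_pdivlMr ?phi_gt0// -wronskianE//.
by rewrite mulrC lerDl oppr_ge0 nmulr_rle0 ?phi1_lt0// ltW// psi_gt0.
Qed.

Lemma phi1_scaled_le (x : R) : 0 < x -> - derive1 phi x / p x <= C / psi x.
Proof.
move=> x0; rewrite ler_pdivrMr// mulrAC ler_pdivlMr ?psi_gt0// -wronskianE//.
by rewrite mulNr lerDr mulr_ge0// ltW// ?phi_gt0 ?psi1_gt0.
Qed.

Let phi_oo (A : R) : exists2 e, 0 < e & forall x, 0 < x < e -> A < phi x.
Proof.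
have [_ [_ _ + _ _]] := hpp => /cvgryPgt/(_ A)[e /= e0 he]; exists e => // x /andP[x0 xe].
by apply: he => //=; rewrite sub0r normrN gtr0_norm.
Qed.

(* If [ode_flux psi] were negative at [x], the monotonicity of
   [ode_flux psi / ode_flux phi] would make [psi' + q phi'] nonincreasing on
   ]0, x] for some [q > 0]. As [psi' / p] tends to 0 at 0 while [- phi' / p]
   does not, [phi'] would be bounded near 0, against [phi (0+) = +oo]. *)
Lemma psi_flux_ge0 (x : R) : 0 < x -> 0 <= ode_flux psi x.
Proof.
move=> x0; rewrite leNgt; apply/negP => Ex.
(* By [flux_wronskian] the numerator of the derivative of this quotient is a positive multiple of
   the constant [C], which gives its monotonicity. *)
pose Q y := ode_flux psi y / ode_flux phi y.
pose Q' y := rate_rho b r y * C / (r y * p y) / ode_flux phi y ^+ 2.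
have dQ (y : R) : 0 < y -> is_derive y (1 : R) Q (Q' y).
  move=> y0; have fy := gt_eqF (phi_flux_gt0 y0).
  have dV := is_deriveV (negbT fy) (is_derive_ode_flux hphi y0).
  apply: (is_derive_eq (is_deriveM (is_derive_ode_flux hpsi y0) dV)).
  rewrite /GRing.scale/= /Q' -(flux_wronskian y0); field.
  by rewrite fy (gt_eqF (p_gt0 y)) (gt_eqF (r_gt0 y0)).
have Q'0 (y : R) : 0 < y -> 0 <= Q' y.
  move=> y0; rewrite /Q' divr_ge0 ?exprn_ge0 ?phi_flux_ge0// divr_ge0//.
    by rewrite mulr_ge0// ltW// ?rho_gt0 ?wronskian_constant_gt0.
  by rewrite mulr_ge0// ltW// r_gt0.
pose q := - Q x.
have q0 : 0 < q by rewrite oppr_gt0 pmulr_llt0 ?invr_gt0 ?phi_flux_gt0.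
pose S y := derive1 psi y + q * derive1 phi y.
have Smono (y : R) : 0 < y -> y <= x -> S x <= S y.
  move=> y0; rewrite le_eqVlt => /predU1P[->//|yx].
  have dS (z : R) : 0 < z -> is_derive z (1 : R) S (ode_second psi z + q * ode_second phi z).
    by move=> z0; exact: is_deriveD (ode_is_derive2 hpsi z0) (is_deriveZ q (ode_is_derive2 hphi z0)).
  have [z /andP[yz zx] E] := pos_derive_increment y0 yx dS.
  have z0 := lt_trans y0 yz.
  rewrite -subr_le0 E mulr_le0_ge0 ?subr_ge0 ?(ltW yx)//.
  rewrite !ode_flux_second// mulrCA -mulrDr pmulr_rle0 ?coef_gt0//.
  have := pos_derive_nondecreasing dQ Q'0 z0 (ltW zx).
  have -> : Q x = - q by rewrite opprK.
  by rewrite /Q ler_pdivrMr ?phi_flux_gt0// mulNr => h; rewrite -lerBrDr sub0r.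
pose c0 := - derive1 phi x / p x.
have c00 : 0 < c0 by rewrite divr_gt0// oppr_gt0 phi1_lt0.
have c0le (y : R) : 0 < y -> y <= x -> c0 * p y <= - derive1 phi y.
  move=> y0 yx; rewrite -(ler_pdivlMr _ _ (p_gt0 y)) /c0 !mulNr lerN2.
  apply: (pos_derive_nondecreasing (is_derive_scaled_derivative hphi) _ y0 yx) => z z0.
  apply/ltW/divr_gt0; last by apply: mulr_gt0; [exact: s_gt0|exact: p_gt0].
  by apply: mulr_gt0; [apply: mulr_gt0 => //; exact: r_gt0|exact: phi_gt0].
have C0 := wronskian_constant_gt0.
(* Above this level of [phi] the bounds on [psi'] and [phi'] give [2 psi' <= q (- phi')]. With
   [S x <= psi' + q phi'] this leaves [- phi' <= 2 |S x| / q], the value of [M]. *)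
have [e e0 He] := phi_oo (2 * C / (c0 * q)).
pose x2 := Num.min x e / 2; have m0 : 0 < Num.min x e by rewrite lt_min x0.
have x20 : 0 < x2 by rewrite divr_gt0.
have x2m : x2 < Num.min x e by rewrite /x2; move: m0; set m := Num.min x e; lra.
have [x2x x2e] : x2 < x /\ x2 < e by move: x2m; rewrite lt_min => /andP[].
pose M := 2 * `|S x| / q.
have M0 : 0 <= M by rewrite divr_ge0 ?mulr_ge0// ltW.
have bound (y : R) : 0 < y -> y <= x2 -> - derive1 phi y <= M.
  move=> y0 yx2; have yx : y <= x by rewrite (le_trans yx2)// ltW.
  have ph : 2 * C / (c0 * q) < phi y by apply: He; rewrite y0 (le_lt_trans yx2).
  have cq0 : 0 < c0 * q by rewrite mulr_gt0.
  have ph' : 2 * C <= phi y * (c0 * q) by rewrite -(ler_pdivrMr _ _ cq0) ltW.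
  have k1 : derive1 psi y * phi y <= C * p y.
    by have := psi1_scaled_le y0; rewrite ler_pdivrMr// mulrAC ler_pdivlMr ?phi_gt0.
  have k2 := c0le y y0 yx.
  have k3 := Smono y y0 yx.
  have d0 : 0 <= - derive1 phi y by rewrite oppr_ge0 ltW// phi1_lt0.
  have d1 : 0 <= derive1 psi y by rewrite ltW// psi1_gt0.
  have k4 : 2 * derive1 psi y <= q * - derive1 phi y.
    rewrite -(ler_pM2r (mulr_gt0 c00 C0)).
    apply: (@le_trans _ _ (derive1 psi y * c0 * (phi y * (c0 * q)))).
      rewrite (_ : 2 * derive1 psi y * (c0 * C) = derive1 psi y * c0 * (2 * C)); last by ring.
      by apply: ler_wpM2l ph'; apply: mulr_ge0 d1 (ltW c00).
    rewrite (_ : derive1 psi y * c0 * (phi y * (c0 * q)) = (derive1 psi y * phi y) * (c0 * c0 * q)); last by ring.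
    apply: (@le_trans _ _ (C * p y * (c0 * c0 * q))).
      by apply: ler_wpM2r k1; exact: mulr_ge0 (mulr_ge0 (ltW c00) (ltW c00)) (ltW q0).
    rewrite (_ : C * p y * (c0 * c0 * q) = (c0 * p y) * (q * (c0 * C))); last by ring.
    rewrite (_ : q * - derive1 phi y * (c0 * C) = - derive1 phi y * (q * (c0 * C))); last by ring.
    by apply: ler_wpM2r k2; exact: mulr_ge0 (ltW q0) (mulr_ge0 (ltW c00) (ltW C0)).
  rewrite /M ler_pdivlMr// mulrC.
  have nS := ler_norm (- S x); rewrite normrN in nS.
  move: k3 k4 nS; rewrite [S y]/S mulrN; set A := derive1 psi y; set B := q * derive1 phi y; set N := `|_|.
  lra.
have [e' e'0 He'] := phi_oo (phi x2 + M * x2).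
pose y := Num.min x2 e' / 2; have m'0 : 0 < Num.min x2 e' by rewrite lt_min x20.
have y0 : 0 < y by rewrite divr_gt0.
have ym : y < Num.min x2 e' by rewrite /y; move: m'0; set m := Num.min x2 e'; lra.
have [yx2 ye'] : y < x2 /\ y < e' by move: ym; rewrite lt_min => /andP[].
have := He' y; rewrite y0 ye' => /(_ isT); apply/negP; rewrite -leNgt.
have [z /andP[yz zx2] E] := pos_derive_increment y0 yx2 (ode_is_derive hphi).
have z0 := lt_trans y0 yz.
rewrite -lerBlDl.
have -> : phi y - phi x2 = - derive1 phi z * (x2 - y) by rewrite mulNr -E opprB.
by apply: ler_pM; rewrite ?subr_ge0 ?(ltW yx2) ?oppr_ge0 ?(ltW (phi1_lt0 z0)) ?bound// ?(ltW zx2)// gerBl ltW.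
Qed.

Lemma psi_second_ge0 (x : R) : 0 < x -> 0 <= ode_second psi x.
Proof. by move=> x0; rewrite ode_flux_second// mulr_ge0// ?psi_flux_ge0// ltW// coef_gt0. Qed.

End fundamental_solutions.

(** * Boundary terms and the derivative of the resolvent *)

Section exhaustion.
Context {d} {T : measurableType d} {R : realType} (nu : {measure set T -> \bar R}).
Variables (J : set T) (I : nat -> set T).
Hypotheses (mJ : measurable J) (mI : forall n, measurable (I n))
  (I_nd : forall m n, (m <= n)%N -> I m `<=` I n) (IJ : forall n, I n `<=` J)
  (J_cover : forall x, J x -> exists n, I n x).

Let near_in x : J x -> \forall n \near \oo, I n x.
Proof. by move=> /J_cover[n In]; exists n => // m /= nm; exact: I_nd nm _ In. Qed.

Let restrictE (f : T -> \bar R) n : (\int[nu]_(x in I n) f x = \int[nu]_(x in J) (f \_ (I n)) x)%E.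
Proof. by rewrite -integral_mkcondr setIidr. Qed.

Lemma exhaustion_cvg (f : T -> R) : nu.-integrable J (EFin \o f) ->
  \int[nu]_(x in I n) f x @[n --> \oo] --> \int[nu]_(x in J) f x.
Proof.
move=> fi; apply: fine_cvg; rewrite fineK; last exact: integrable_fin_num.
under eq_cvg do rewrite restrictE.
have /integrableP[mf _] := fi.
apply: (@dominated_cvg _ _ _ nu J mJ _ _ (fun x => `|(f x)%:E|)%E) => //.
- move=> n; apply/(measurable_restrict _ (mI n) mJ).
  by rewrite setIidr//; exact: measurable_funS mf.
- move=> x Jx; apply: cvg_near_cst; apply: filterS (near_in Jx) => n In.
  by rewrite patchE mem_set.
- exact: integrable_abse.
- by move=> n x Jx; rewrite patchE; case: ifP => // _; rewrite abse0.
Qed.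

Lemma exhaustion_measurable (f : T -> R) : (forall n, measurable_fun (I n) f) -> measurable_fun J f.
Proof.
move=> mf; have -> : J = \bigcup_n I n.
  apply/seteqP; split => [x /J_cover[n In]|x [n _ In]]; [by exists n|exact: IJ In].
by apply/measurable_fun_bigcup.
Qed.

Lemma exhaustion_integrable (f : T -> R) (K : R) : (forall n, nu.-integrable (I n) (EFin \o f)) ->
  (\forall n \near \oo, \int[nu]_(x in I n) `|f x| <= K) -> nu.-integrable J (EFin \o f).
Proof.
move=> fi fK.
have mf : measurable_fun J f.
  by apply: exhaustion_measurable => n; have /integrableP[/measurable_EFinP] := fi n.
have ma : measurable_fun J (fun x => `|f x|%:E).
  by apply/measurable_EFinP; exact: measurableT_comp.
apply/integrableP; split; first exact/measurable_EFinP.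
apply: (@le_lt_trans _ _ K%:E); last by rewrite ltry.
have lim x : J x -> limn (fun n => ((fun x => `|f x|%:E) \_ (I n)) x) = `|f x|%:E.
  move=> Jx; apply/cvg_lim => //; apply: cvg_near_cst; apply: filterS (near_in Jx) => n In.
  by rewrite patchE mem_set.
rewrite (eq_integral (fun x => limn (fun n => ((fun x => `|f x|%:E) \_ (I n)) x))); last first.
  by move=> x; rewrite inE => Jx; rewrite lim.
have mp n : measurable_fun J ((fun x => `|f x|%:E) \_ (I n)).
  apply/(measurable_restrict _ (mI n) mJ).
  by rewrite setIidr//; exact: measurable_funS ma.
have p0 n x : J x -> (0 <= ((fun x => `|f x|%:E) \_ (I n)) x)%E.
  by move=> Jx; rewrite patchE; case: ifP => // _; rewrite lee_fin.
have nd x : J x -> nondecreasing_seq (fun n => ((fun x => `|f x|%:E) \_ (I n)) x).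
  move=> Jx m n mn; rewrite !patchE; case: ifPn => [|_]; last by case: ifP => // _; rewrite lee_fin.
  by rewrite inE => Im; rewrite mem_set//; exact: I_nd mn _ Im.
rewrite monotone_convergence//; apply: lime_le.
  apply: ereal_nondecreasing_is_cvgn => m n mn; apply: ge0_le_integral => //.
  - by move=> x; exact: p0.
  - by move=> x Jx; exact: nd.
apply: filterS fK => n; rewrite -restrictE /Rintegral -lee_fin fineK//.
by apply: integrable_fin_num => //; exact: (integrable_norm (fi n)).
Qed.

(** Outside [I n0] the function [f] has a constant sign, so the integral of its absolute value is
    that of [f] up to sign, and the formula on [I n] bounds it uniformly in [n]. Integrability is
    thus a consequence of the formula, which then passes to the limit. *)
Lemma exhaustion_by_parts (f k : T -> R) (A s : R) (e : nat -> R) (n0 : nat) :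
  (forall n, nu.-integrable (I n) (EFin \o f)) -> nu.-integrable J (EFin \o k) ->
  (forall n, \int[nu]_(x in I n) f x = A - e n + \int[nu]_(x in I n) k x) ->
  e n @[n --> \oo] --> 0 -> `|s| = 1 ->
  {ae nu, forall x, J x -> ~ I n0 x -> 0 <= s * f x} ->
  nu.-integrable J (EFin \o f) /\ \int[nu]_(x in J) f x = A + \int[nu]_(x in J) k x.
Proof.
move=> fi ki fE e0 s1 sf.
have ikn n : nu.-integrable (I n) (EFin \o k) by exact: integrableS ki.
have kle n : `|\int[nu]_(x in I n) k x| <= \int[nu]_(x in J) `|k x|.
  apply: (le_trans (le_normr_Rintegral _ (ikn n))) => //.
  rewrite /Rintegral fine_le//.
  - by apply: integrable_fin_num => //; exact: (integrable_norm (ikn n)).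
  - by apply: integrable_fin_num => //; exact: (integrable_norm ki).
  - apply: ge0_subset_integral => //.
    by have /integrableP[mk _] := ki; apply/measurable_EFinP; apply: measurableT_comp => //; exact/measurable_EFinP.
have fJ : nu.-integrable J (EFin \o f).
  pose K := \int[nu]_(x in I n0) `|f x| + (1 + `|e n0| + 2 * \int[nu]_(x in J) `|k x|).
  apply: (@exhaustion_integrable f K fi).
  have near_e : \forall n \near \oo, `|e n| <= 1.
    by move/cvgrPdist_le : e0 => /(_ _ ltr01); apply: filterS => n; rewrite sub0r normrN.
  near=> n; have n0n : (n0 <= n)%N by near: n; exact: nbhs_infty_ge.
  have en : `|e n| <= 1 by near: n.
  have mD : measurable (I n `\` I n0) by exact: measurableD.
  have IE : I n = I n0 `|` (I n `\` I n0) by rewrite setDUK//; exact: I_nd.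
  have dI : [disjoint I n0 & I n `\` I n0] by apply/disj_setPS => x [Ix []].
  have split (g : T -> R) : nu.-integrable (I n) (EFin \o g) ->
      \int[nu]_(x in I n) g x = \int[nu]_(x in I n0) g x + \int[nu]_(x in I n `\` I n0) g x.
    by move=> gi; rewrite [in LHS]IE Rintegral_setU// -IE.
  rewrite (split (fun x => `|f x|)); last exact: (integrable_norm (fi n)).
  rewrite lerD2l.
  have fiD : nu.-integrable (I n `\` I n0) (EFin \o f) by apply: integrableS (fi n) => //; exact: subDsetl.
  have -> : \int[nu]_(x in I n `\` I n0) `|f x| = s * \int[nu]_(x in I n `\` I n0) f x.
    rewrite -RintegralZl// /Rintegral; congr fine; apply: ae_eq_integral => //.
    - by have /integrableP[mf _] := fiD; apply/measurable_EFinP; apply: measurableT_comp => //; exact/measurable_EFinP.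
    - have /integrableP[mf _] := fiD; apply/measurable_EFinP; apply: measurable_funM => //.
      exact/measurable_EFinP.
    - apply: filterS sf => x H [Ix nIx]; congr (_%:E).
      by rewrite -[RHS]ger0_norm ?H// ?normrM ?s1 ?mul1r//; exact: IJ Ix.
  have -> : \int[nu]_(x in I n `\` I n0) f x = e n0 - e n + (\int[nu]_(x in I n) k x - \int[nu]_(x in I n0) k x).
    have := split f (fi n); rewrite !fE => E.
    by apply: (addrI (A - e n0 + \int[nu]_(x in I n0) k x)); rewrite -E; ring.
  apply: (le_trans (ler_norm _)); rewrite normrM s1 mul1r.
  have k1 := kle n; have k2 := kle n0.
  move: en k1 k2; rewrite !ler_norml.
  set a := e n; set a' := e n0; set i1 := \int[nu]_(x in I n) k x; set i2 := \int[nu]_(x in I n0) k x.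
  set KJ := \int[nu]_(x in J) _ => /andP[p1 p2] /andP[p3 p4] /andP[p5 p6].
  have q1 := ler_norm a'; have q2 := ler_norm (- a'); rewrite normrN in q2.
  by apply/andP; split; move: p1 p2 p3 p4 p5 p6 q1 q2; set na := `|a'|; lra.
split=> //.
have c1 := exhaustion_cvg fJ; have c2 := exhaustion_cvg ki.
have c3 : A - e n + \int[nu]_(x in I n) k x @[n --> \oo] --> A - 0 + \int[nu]_(x in J) k x.
  by apply: cvgD => //; apply: cvgB => //; exact: cvg_cst.
rewrite subr0 in c3.
have c4 : \int[nu]_(x in I n) f x @[n --> \oo] --> A + \int[nu]_(x in J) k x.
  by under eq_cvg do rewrite fE.
exact: (cvg_unique _ c1 c4).
Unshelve. all: by end_near. Qed.

Lemma exhaustion_remainder (f : T -> R) : nu.-integrable J (EFin \o f) ->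
  \int[nu]_(x in J `\` I n) f x @[n --> \oo] --> 0.
Proof.
move=> fi; have c1 := exhaustion_cvg fi.
have c2 : \int[nu]_(x in J) f x - \int[nu]_(x in I n) f x @[n --> \oo] --> 0.
  by rewrite -[X in _ --> X](subrr (\int[nu]_(x in J) f x)); apply: cvgB => //; exact: cvg_cst.
apply: cvg_trans c2; apply: near_eq_cvg; near=> n.
have IE : J = I n `|` (J `\` I n) by rewrite setDUK.
rewrite [in LHS]IE Rintegral_setU//; first by rewrite addrC addKr.
- exact: measurableD.
- by rewrite -IE.
- by apply/disj_setPS => x [Ix []].
Unshelve. all: by end_near. Qed.

End exhaustion.

Section abs_continuous_products.
Context {R : realType}.
Variables (G : R -> R).
Hypothesis hG : abs_continuous_pos G.
Local Notation mu := (@lebesgue_measure R).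

Lemma abs_continuous_pos_continuous (x : R) : 0 < x -> {for x, continuous G}.
Proof.
move=> x0; have x20 : 0 < x / 2 by rewrite divr_gt0.
have [lex xx2 x2x] : [/\ x / 2 <= 2 * x, x / 2 <= x & x <= 2 * x] by split; move: x0; lra.
apply/cvgrPdist_lt => e e0.
have [dl dl0 H] := abs_continuous_on_continuous (hG x20 lex) e0.
near=> y.
have yd : `|x - y| < dl by near: y; exact: (@cvgr_dist_lt _ _ _ _ _ id x cvg_id).
have y1 : x / 2 <= y by apply/ltW; near: y; apply: lt_nbhsr; move: x0; lra.
have y2 : y <= 2 * x by apply/ltW; near: y; apply: lt_nbhsl; move: x0; lra.
have [xy|/ltW yx] := leP x y.
  rewrite distrC; apply: H => //.
  by rewrite distrC ger0_norm ?subr_ge0 in yd.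
apply: H => //.
by rewrite ger0_norm ?subr_ge0 in yd.
Unshelve. all: by end_near. Qed.

Variables (g g' : R -> R).
Hypotheses (dg : forall x : R, 0 < x -> is_derive x (1 : R) g (g' x))
  (cg' : forall x : R, 0 < x -> {for x, continuous g'}).

Let cg (x : R) : 0 < x -> {for x, continuous g}.
Proof. by move=> x0; exact: is_derive_continuous (dg x0). Qed.

(** On [a, b] both factors are bounded and [g] is Lipschitz. The two entries of the minimum give
    half of [e] to the increments of [G] and half to those of [g]. *)
Lemma abs_continuous_pos_mul : abs_continuous_pos (fun x => G x * g x).
Proof.
move=> a b a0 ab e e0.
have bnd (f : R -> R) : (forall x : R, 0 < x -> {for x, continuous f}) -> exists2 M, 0 < M & forall x, a <= x <= b -> `|f x| <= M.
  move=> cf; have [M HM] := @bounded_segment R f a b (fun x H => cf x (lt_le_trans a0 (proj1 (andP H)))).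
  exists (`|M| + 1); first by rewrite ltr_wpDl.
  by move=> x /HM fM; rewrite (le_trans fM)// (le_trans (ler_norm _))// lerDl.
have [MG MG0 HG] := bnd G abs_continuous_pos_continuous.
have [Mg Mg0 Hg] := bnd g cg.
have [L L0 HL] := bnd g' cg'.
have e1 : 0 < e / (2 * Mg) by rewrite divr_gt0// mulr_gt0.
have [dl dl0 H] := hG a0 ab e1.
exists (Num.min dl (e / (2 * MG * L))); first by rewrite lt_min dl0 divr_gt0// !mulr_gt0.
move=> n u v uv tuv; rewrite lt_min => /andP[sd sL].
have step i : `|G (v i) * g (v i) - G (u i) * g (u i)| <= Mg * `|G (v i) - G (u i)| + MG * L * (v i - u i).
  have [au [ui vb]] := uv i.
  have av := le_trans au ui; have ub := le_trans ui vb.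
  have -> : G (v i) * g (v i) - G (u i) * g (u i) = g (v i) * (G (v i) - G (u i)) + G (u i) * (g (v i) - g (u i)) by ring.
  rewrite (le_trans (ler_normD _ _))// !normrM lerD//.
    by rewrite ler_wpM2r// Hg// av.
  rewrite -mulrA ler_pM//; first by rewrite HG// au.
  move: ui; rewrite le_eqVlt => /predU1P[->|ui]; first by rewrite !subrr normr0 mulr0.
  have [z /andP[uz zv] ->] := pos_derive_increment (lt_le_trans a0 au) ui dg.
  rewrite normrM (ger0_norm (_ : 0 <= v i - u i)) ?subr_ge0 ?(ltW ui)//.
  by rewrite ler_wpM2r ?subr_ge0 ?(ltW ui)// HL// (le_trans au (ltW uz)) (le_trans (ltW zv)).
apply: (@le_lt_trans _ _ (\sum_(i < n) (Mg * `|G (v i) - G (u i)| + MG * L * (v i - u i)))).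
  by apply: ler_sum => i _.
rewrite big_split/= -!mulr_sumr.
have h1 : Mg * \sum_(i < n) `|G (v i) - G (u i)| < e / 2.
  have h0 := H n u v uv tuv sd; rewrite -(ltr_pM2l Mg0) in h0; apply: (lt_le_trans h0).
  by rewrite le_eqVlt; apply/orP; left; apply/eqP; field; rewrite gt_eqF.
have h2 : MG * L * \sum_(i < n) (v i - u i) < e / 2.
  have ML0 : 0 < MG * L by rewrite mulr_gt0.
  have h0 := sL; rewrite -(ltr_pM2l ML0) in h0; apply: (lt_le_trans h0).
  by rewrite le_eqVlt; apply/orP; left; apply/eqP; field; rewrite !gt_eqF.
by rewrite [e]splitr ltrD.
Qed.

Lemma abs_continuous_by_parts (a b : R) : 0 < a -> a < b ->
  mu.-integrable `[a, b] (EFin \o (fun t => (derive1 G t : R) * g t + G t * g' t)) /\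
  \int[mu]_(t in `[a, b]) ((derive1 G t : R) * g t + G t * g' t) = G b * g b - G a * g a.
Proof.
move=> a0 ab.
have [ae1 i1 E1] := abs_continuous_FTC ab (abs_continuous_pos_mul a0 (ltW ab)).
have [ae2 _ _] := abs_continuous_FTC ab (hG a0 (ltW ab)).
have mc (f : R -> R) : (forall x : R, 0 < x -> {for x, continuous f}) -> measurable_fun (`[a, b] : set R) f.
  move=> cf; apply: subspace_continuous_measurable_fun; first exact: measurable_itv.
  exact: continuous_pos_within.
have mF : measurable_fun (`[a, b] : set R) (fun t => (derive1 G t : R) * g t + G t * g' t).
  apply: measurable_funD; apply: measurable_funM.
  - exact: abs_continuous_measurable_derive1 (hG a0 (ltW ab)).
  - exact: mc.
  - by apply: mc => x; exact: abs_continuous_pos_continuous.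
  - exact: mc.
have ae_ends : {ae mu, forall x : R, x != a /\ x != b}.
  have n1 (y : R) : mu.-negligible [set y].
    by exists [set y]; split => //; exact: lebesgue_measure_set1.
  have := negligibleU (n1 a) (n1 b); apply: negligibleS => x /= H.
  apply: contrapT => nH; apply: H; split; apply/eqP => xE; apply: nH; [left|right]; exact: xE.
have aeE : {ae mu, forall x : R, `[a, b]%classic x ->
    (derive1 (fun x => G x * g x) x : R)%:E = ((derive1 G x : R) * g x + G x * g' x)%:E}.
  move: ae2 ae_ends; apply: filterS2; first exact: (ae_filter_ringOfSetsType mu).
  move=> x dG [xa xb]; rewrite /= in_itv/= => /andP[ax xb'].
  have xab : a < x < b by rewrite !lt_neqAle ax xb' eq_sym xa xb.
  have dGx : is_derive x (1 : R) G (derive1 G x) by apply: DeriveDef; [exact: dG|rewrite derive1E].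
  have x0 := lt_le_trans a0 ax.
  have dp := is_deriveM dGx (dg x0).
  congr (_%:E); rewrite derive1E; rewrite (@derive_val _ _ _ _ _ _ _ dp).
  by rewrite /GRing.scale/=; ring.
have iF : mu.-integrable `[a, b] (EFin \o (fun t => (derive1 G t : R) * g t + G t * g' t)).
  have /integrableP[m1 f1] := i1; apply/integrableP; split; first exact/measurable_EFinP.
  rewrite (_ : (\int[mu]_(x in `[a, b]) _ = \int[mu]_(x in `[a, b]) `|(derive1 (fun x => G x * g x) x : R)%:E|)%E)//.
  apply/esym/ae_eq_integral => //.
  - exact: measurableT_comp.
  - by apply: measurableT_comp => //; exact/measurable_EFinP.
  - move: aeE; apply: filterS; first exact: (ae_filter_ringOfSetsType mu).
    by move=> x H /H ->.
split=> //; rewrite -E1; apply/esym; rewrite /Rintegral; congr fine.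
apply: ae_eq_integral => //; first by have /integrableP[] := i1.
exact/measurable_EFinP.
Qed.

End abs_continuous_products.

Lemma lebesgue_integrableS {R : realType} (A B : set R) (f : R -> \bar R) : measurable A -> measurable B -> B `<=` A ->
  lebesgue_measure.-integrable A f -> lebesgue_measure.-integrable B f.
Proof. by move=> mA mB BA fi; apply: integrableS fi. Qed.

Lemma lebesgue_integrableZl {R : realType} (A : set R) (k : R) (f : R -> R) : measurable A ->
  lebesgue_measure.-integrable A (EFin \o f) -> lebesgue_measure.-integrable A (EFin \o (fun t => k * f t)).
Proof. by move=> mA fi; apply: integrable_EFinZl. Qed.

Lemma lebesgue_RintegralZl {R : realType} (A : set R) (k : R) (f : R -> R) : measurable A ->
  lebesgue_measure.-integrable A (EFin \o f) ->
  \int[lebesgue_measure]_(t in A) (k * f t) = k * \int[lebesgue_measure]_(t in A) f t.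
Proof. by move=> mA fi; rewrite RintegralZl. Qed.

Lemma green_integral {R : realType} (u v kap f : R -> R) (y : R) : 0 < y ->
  lebesgue_measure.-integrable `]0, y] (EFin \o (fun s => f s * (v s * kap s))) ->
  lebesgue_measure.-integrable `]y, +oo[ (EFin \o (fun s => f s * (u s * kap s))) ->
  let green s := (if s <= y then u y * v s else v y * u s) * kap s in
  lebesgue_measure.-integrable `]0, +oo[ (EFin \o (fun s => f s * green s)) /\
  \int[lebesgue_measure]_(s in `]0, +oo[) (f s * green s) =
    u y * \int[lebesgue_measure]_(s in `]0, y]) (f s * (v s * kap s)) +
    v y * \int[lebesgue_measure]_(s in `]y, +oo[) (f s * (u s * kap s)).
Proof.
move=> y0 iv iu green; set mu := lebesgue_measure in iv iu *.
have m1 : measurable (`]0, y] : set R) by exact: measurable_itv.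
have m2 : measurable (`]y, +oo[ : set R) by exact: measurable_itv.
have JE : `]0, +oo[%classic = `]0, y]%classic `|` `]y, +oo[%classic :> set R.
  apply/seteqP; split => s /=; rewrite !in_itv/= ?andbT.
    by move=> s0; have [sy|ys] := leP s y; [left; rewrite s0|right].
  by case=> [/andP[]//|]; exact: lt_trans.
have e1 s : s \in `]0, y]%classic -> f s * green s = u y * (f s * (v s * kap s)).
  by rewrite inE/= in_itv/= => /andP[_ sy]; rewrite /green sy; ring.
have e2 s : s \in `]y, +oo[%classic -> f s * green s = v y * (f s * (u s * kap s)).
  by rewrite inE/= in_itv/= andbT => ys; rewrite /green leNgt ys/=; ring.
have i1 : mu.-integrable `]0, y] (EFin \o (fun s => f s * green s)).
  have := lebesgue_integrableZl (u y) m1 iv.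
  by apply: eq_integrable => // s sI; rewrite /= e1.
have i2 : mu.-integrable `]y, +oo[ (EFin \o (fun s => f s * green s)).
  have := lebesgue_integrableZl (v y) m2 iu.
  by apply: eq_integrable => // s sI; rewrite /= e2.
have i12 : mu.-integrable (`]0, y]%classic `|` `]y, +oo[%classic) (EFin \o (fun s => f s * green s)) by exact: integrable_setU.
split; first by rewrite JE.
rewrite JE Rintegral_setU//; last first.
  apply/disj_setPS => s /= []; rewrite !in_itv/= andbT => /andP[_ sy] ys.
  by move: (le_lt_trans sy ys); rewrite ltxx.
congr (_ + _); rewrite -RintegralZl//; apply: eq_Rintegral => s sI; [exact: e1|exact: e2].
Qed.

(** * Boundary terms at 0 and at infinity *)

Section boundary.
Context {R : realType}.
Variables (b sigma r : R -> R) (r0 c : R) (phi psi : R -> R).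
Hypotheses (cb : C1_pos b) (cs : C1_pos sigma) (s_gt0 : forall x : R, 0 < x -> 0 < sigma x ^+ 2)
  (cr : C1_pos r) (r0_gt0 : 0 < r0) (r0r : forall x : R, 0 < x -> r0 <= r x)
  (c_gt0 : 0 < c) (hpp : fundamental_pair b sigma r c phi psi).
Variable p : R -> R.
Hypotheses (p_gt0 : forall x : R, 0 < p x)
  (dp : forall x : R, 0 < x -> is_derive x (1 : R) p (- 2 * (b x / sigma x ^+ 2) * p x)).
Variable G : R -> R.
Hypothesis hG : abs_continuous_pos G.
Local Notation mu := (@lebesgue_measure R).
Local Notation D := (D_op r G).

Let r_gt0 (x : R) : 0 < x -> 0 < r x. Proof. by move=> x0; exact: lt_le_trans (r0r x0). Qed.
Let cG (x : R) : 0 < x -> {for x, continuous G}. Proof. exact: abs_continuous_pos_continuous. Qed.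
Let cp (x : R) : 0 < x -> {for x, continuous p}. Proof. by move=> x0; exact: is_derive_continuous (dp x0). Qed.
Let cC (f : R -> R) (x : R) : C1_pos f -> 0 < x -> {for x, continuous f}. Proof. by move=> hf x0; exact: C1_pos_continuous. Qed.
Let cC' (f : R -> R) (x : R) : C1_pos f -> 0 < x -> {for x, continuous (derive1 f)}. Proof. by move=> hf x0; have [] := hf x x0. Qed.

Section one_solution.
Variable w : R -> R.
Hypotheses (hw : ode_solution b sigma r w) (w_ge0 : forall x : R, 0 < x -> 0 <= w x).

Let q t := derive1 w t / p t.
Let z t := q t / r t.
Let K t := G t * (w t / (sigma t ^+ 2 * p t)).
Let q' t := 2 * r t * w t / (sigma t ^+ 2 * p t).

Let dq (x : R) : 0 < x -> is_derive x (1 : R) q (q' x).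
Proof. by move=> x0; exact: (is_derive_scaled_derivative s_gt0 p_gt0 dp hw). Qed.

Let csp (x : R) : 0 < x -> {for x, continuous (fun t => (sigma t ^+ 2 * p t)^-1)}.
Proof.
move=> x0; apply: cvgV; first by rewrite mulf_neq0 ?(gt_eqF (p_gt0 x)) ?(gt_eqF (s_gt0 x0)).
apply: cvgM; last exact: cp.
by apply: (@continuous_comp _ _ _ sigma (fun z => z ^+ 2)); [exact: cC|exact: exprn_continuous].
Qed.

Let cw (x : R) : 0 < x -> {for x, continuous w}.
Proof. by move=> x0; exact: is_derive_continuous (ode_is_derive hw x0). Qed.

Let cK (x : R) : 0 < x -> {for x, continuous K}.
Proof. by move=> x0; apply: cvgM; [exact: cG|apply: cvgM; [exact: cw|exact: csp]]. Qed.

Let cq' (x : R) : 0 < x -> {for x, continuous q'}.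
Proof.
move=> x0; apply: cvgM; last exact: csp.
by apply: cvgM; [apply: cvgM; [exact: cvg_cst|exact: cC]|exact: cw].
Qed.

Let ii (f : R -> R) (x y : R) : (forall t : R, 0 < t -> {for t, continuous f}) -> 0 < x -> mu.-integrable `[x, y] (EFin \o f).
Proof.
move=> cf x0; apply: continuous_compact_integrable; first exact: segment_compact.
exact: continuous_pos_within.
Qed.

Let dinv (x : R) : 0 < x -> is_derive x (1 : R) (fun t => (r t)^-1) (- (derive1 r x / r x ^+ 2)).
Proof.
move=> x0; have rx : r x != 0 by rewrite gt_eqF ?r_gt0.
apply: (is_derive_eq (@is_deriveV _ r x _ 1 rx (C1_pos_is_derive cr x0))).
by rewrite /GRing.scale/=; field.
Qed.

Let cinv (x : R) : 0 < x -> {for x, continuous (fun t => - (derive1 r t / r t ^+ 2))}.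
Proof.
move=> x0; apply: cvgN; apply: cvgM; first exact: cC'.
apply: cvgV; first by rewrite sqrf_eq0 gt_eqF ?r_gt0.
by apply: (@continuous_comp _ _ _ r (fun z => z ^+ 2)); [exact: cC|exact: exprn_continuous].
Qed.

Lemma D_op_by_parts (x y : R) : 0 < x -> x < y ->
  mu.-integrable `[x, y] (EFin \o (fun t => D t * z t)) /\
  \int[mu]_(t in `[x, y]) (D t * z t) = G y * z y - G x * z x - 2 * \int[mu]_(t in `[x, y]) K t.
Proof.
move=> x0 xy.
pose z' t := q t * - (derive1 r t / r t ^+ 2) + q' t / r t.
have dz (t : R) : 0 < t -> is_derive t (1 : R) z (z' t).
  move=> t0; apply: (is_derive_eq (is_deriveM (dq t0) (dinv t0))).
  by rewrite /GRing.scale/= /z'; ring.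
have cz' (t : R) : 0 < t -> {for t, continuous z'}.
  move=> t0; apply: cvgD; apply: cvgM.
  - exact: is_derive_continuous (dq t0).
  - exact: cinv.
  - exact: cq'.
  - exact: is_derive_continuous (dinv t0).
have [iF FE] := abs_continuous_by_parts hG dz cz' x0 xy.
have iK := ii y cK x0.
have E t : t \in `[x, y]%classic -> D t * z t = (derive1 G t : R) * z t + G t * z' t - 2 * K t.
  rewrite inE/= in_itv/= => /andP[xt _]; have t0 := lt_le_trans x0 xt.
  have rt := gt_eqF (r_gt0 t0).
  rewrite /D_op /z' /q' /K /z /q; field.
  by rewrite rt (gt_eqF (p_gt0 t)) -(@sqrf_eq0 _ (sigma t)) (gt_eqF (s_gt0 t0)).
have iK2 := lebesgue_integrableZl 2 (measurable_itv _) iK.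
split.
  have iD : mu.-integrable `[x, y] (EFin \o (fun t => (derive1 G t : R) * z t + G t * z' t - 2 * K t)) by exact: integrable_EFinB.
  by move: iD; apply: eq_integrable => // t tI; rewrite /= E.
rewrite (@eq_Rintegral _ _ _ mu _ (fun t => (derive1 G t : R) * z t + G t * z' t - 2 * K t)) // RintegralB// FE RintegralZl//.
Qed.

Lemma D_op_ratio (x y : R) : 0 < x -> x < y ->
  mu.-integrable `[x, y] (EFin \o (fun t => D t / r t)) /\
  \int[mu]_(t in `[x, y]) (D t / r t) = G y / r y - G x / r x.
Proof.
move=> x0 xy; have [iF FE] := abs_continuous_by_parts hG dinv cinv x0 xy.
have E t : t \in `[x, y]%classic -> D t / r t = (derive1 G t : R) * (r t)^-1 + G t * - (derive1 r t / r t ^+ 2).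
  rewrite inE/= in_itv/= => /andP[xt _]; have t0 := lt_le_trans x0 xt.
  by rewrite /D_op; field; rewrite gt_eqF ?r_gt0.
split; last by rewrite -FE; apply: eq_Rintegral.
by move: iF; apply: eq_integrable => // t tI; rewrite /= E.
Qed.

(** [D / r] is the almost everywhere derivative of [G / r], and the latter is absolutely continuous,
    so a sign of [D] almost everywhere is enough. *)
Lemma ratio_monotone (s x y : R) : `|s| = 1 -> 0 < x -> x <= y ->
  {ae mu, forall t : R, x <= t <= y -> 0 <= s * D t} -> s * (G x / r x) <= s * (G y / r y).
Proof.
move=> s1 x0; rewrite le_eqVlt => /predU1P[->//|xy] sD.
have [iF FE] := D_op_ratio x0 xy.
rewrite -subr_ge0 -mulrBr -FE -RintegralZl//.
have -> : \int[mu]_(t in `[x, y]) (s * (D t / r t)) = \int[mu]_(t in `[x, y]) `|D t / r t|.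
  have /integrableP[/measurable_EFinP mD _] := iF.
  rewrite /Rintegral; congr fine; apply: ae_eq_integral => //.
  - by apply/measurable_EFinP; apply: measurable_funM => //; exact: measurable_cst.
  - by apply/measurable_EFinP; exact: measurableT_comp.
  - move: sD; apply: filterS; first exact: (ae_filter_ringOfSetsType mu).
    move=> t H; rewrite /= in_itv/= => txy; congr (_%:E).
    have t0 : 0 < t by case/andP: txy => xt _; exact: lt_le_trans xt.
    rewrite mulrA normrM -(ger0_norm (H txy)) normrM s1 mul1r; congr (_ * _).
    by rewrite ger0_norm// invr_ge0 ltW// r_gt0.
by apply: Rintegral_ge0.
Qed.

(* [q' = 2 r w / (sigma^2 p)] makes [|G / r| q'] equal to [2 |K|]. *)
Lemma ratio_scaled_le (l h A k : R) : 0 < l -> l <= h -> 0 <= A -> 0 <= k ->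
  (forall t, l <= t <= h -> A <= `|G t / r t| + k) ->
  A * (q h - q l) <= 2 * \int[mu]_(t in `[l, h]) `|K t| + k * (q h - q l).
Proof.
move=> l0; rewrite le_eqVlt => /predU1P[->|lh] A0 k0 H.
  by rewrite subrr !mulr0 addr0 mulr_ge0//; exact: Rintegral_ge0.
have QE : q h - q l = \int[mu]_(t in `[l, h]) q' t.
  apply/esym/continuous_FTC2_derive1 => //; last exact: continuous_pos_within.
  by move=> t lt _; apply: dq; exact: lt_le_trans lt.
have iq' := ii h cq' l0.
have iK := integrable_norm (ii h cK l0).
have iK2 := lebesgue_integrableZl 2 (measurable_itv _) iK; have ik := lebesgue_integrableZl k (measurable_itv _) iq'; have iA := lebesgue_integrableZl A (measurable_itv _) iq'.
rewrite QE -!RintegralZl// -RintegralD//.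
apply: le_Rintegral => //; first exact: integrable_EFinD.
move=> t; rewrite /= in_itv/= => tlh.
have t0 : 0 < t by case/andP: tlh => lt _; exact: lt_le_trans lt.
have rt := r_gt0 t0.
have kk0 : 0 <= w t / (sigma t ^+ 2 * p t).
  by apply: divr_ge0; [exact: w_ge0|apply: mulr_ge0; [exact/ltW/s_gt0|exact/ltW/p_gt0]].
have q'0 : 0 <= q' t.
  rewrite /q' (_ : _ / _ = 2 * r t * (w t / (sigma t ^+ 2 * p t))); last by rewrite mulrA.
  by rewrite mulr_ge0// mulr_ge0// ltW.
apply: (le_trans (ler_wpM2r q'0 (H t tlh))); rewrite mulrDl lerD2r.
rewrite le_eqVlt; apply/orP; left; apply/eqP.
rewrite /K (normrM (G t) (w t / _)) (ger0_norm kk0) (normrM (G t) (r t)^-1) (ger0_norm (_ : 0 <= (r t)^-1)) ?invr_ge0 ?ltW// /q'; field.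
by rewrite (gt_eqF rt) (gt_eqF (p_gt0 t)) -(@sqrf_eq0 _ (sigma t)) (gt_eqF (s_gt0 t0)).
Qed.

Lemma speed_integrable (J : set R) : measurable J -> J `<=` `]0, +oo[ ->
  (\int[mu]_(s in J) (`|G s| * w s / (sigma s ^+ 2 * p s))%:E < +oo)%E -> mu.-integrable J (EFin \o K).
Proof.
move=> mJ J0 fin.
have mK : measurable_fun J K.
  apply: measurable_funS J0 _; first exact: measurable_itv.
  apply: open_continuous_measurable_fun; first exact: interval_open.
  by move=> y; rewrite inE/= in_itv/= andbT; exact: cK.
apply/integrableP; split; first exact/measurable_EFinP.
rewrite (_ : (\int[mu]_(x in J) _ = \int[mu]_(s in J) (`|G s| * w s / (sigma s ^+ 2 * p s))%:E)%E)//.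
apply: eq_integral => t; rewrite inE => /J0; rewrite /= in_itv/= andbT => t0.
have kk0 : 0 <= w t / (sigma t ^+ 2 * p t).
  by apply: divr_ge0; [exact: w_ge0|apply: mulr_ge0; [exact/ltW/s_gt0|exact/ltW/p_gt0]].
by rewrite /= normrM (ger0_norm kk0) mulrA.
Qed.

End one_solution.

Let hphi : ode_solution b sigma r phi. Proof. by case: hpp => -[]. Qed.
Let hpsi : ode_solution b sigma r psi. Proof. by case: hpp => -[]. Qed.
Let phi_gt0 (x : R) : 0 < x -> 0 < phi x. Proof. by move=> x0; case: hpp => _ [+ _ _ _ _] => /(_ x x0)[]. Qed.
Let phi1_lt0 (x : R) : 0 < x -> derive1 phi x < 0. Proof. by move=> x0; case: hpp => _ [+ _ _ _ _] => /(_ x x0)[]. Qed.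
Let psi_gt0 (x : R) : 0 < x -> 0 < psi x. Proof. by move=> x0; case: hpp => _ [_ + _ _ _] => /(_ x x0)[]. Qed.
Let psi1_gt0 (x : R) : 0 < x -> 0 < derive1 psi x. Proof. by move=> x0; case: hpp => _ [_ + _ _ _] => /(_ x x0)[]. Qed.
Local Notation C := (wronskian_constant c phi psi p).

(** A value between two others is at most the sum of their absolute values; [s] covers both
    directions of monotonicity. *)
Let between (s u1 u2 u3 : R) : `|s| = 1 -> s * u1 <= s * u2 -> s * u2 <= s * u3 -> `|u2| <= `|u1| + `|u3|.
Proof.
move=> s1 h1 h2; rewrite -(mul1r `|u2|) -(mul1r `|u1|) -(mul1r `|u3|) -s1 -!normrM.
rewrite ler_norml; apply/andP; split.
  rewrite lerNl (@le_trans _ _ `|s * u1|)// ?lerDl// (@le_trans _ _ (- (s * u1)))// ?lerN2// -normrN.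
  exact: ler_norm.
by rewrite (le_trans h2)// (le_trans (ler_norm _))// lerDr.
Qed.

Lemma left_boundary (s eps x : R) : `|s| = 1 -> 0 < eps ->
  {ae mu, forall t : R, 0 < t <= eps -> 0 <= s * D t} -> 0 < x ->
  mu.-integrable `]0, x] (EFin \o (fun t => G t * (psi t / (sigma t ^+ 2 * p t)))) ->
  mu.-integrable `]0, x] (EFin \o (fun t => D t * (derive1 psi t / p t / r t))) /\
  \int[mu]_(t in `]0, x]) (D t * (derive1 psi t / p t / r t)) =
  G x * (derive1 psi x / p x / r x) - 2 * \int[mu]_(t in `]0, x]) (G t * (psi t / (sigma t ^+ 2 * p t))).
Proof.
move=> s1 eps0 sD x0 iK.
pose K t := G t * (psi t / (sigma t ^+ 2 * p t)).
pose q t := derive1 psi t / p t; pose z t := q t / r t.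
(* The shift by two makes even [a 0] strictly smaller than [x]. *)
pose a n : R := x / n.+2%:R.
have a0 n : 0 < a n by rewrite divr_gt0.
have ax n : a n < x by rewrite ltr_pdivrMr// ltr_pMr// ltr1n.
pose I n := `[a n, x]%classic; pose J := `]0, x]%classic.
have mI n : measurable (I n) by exact: measurable_itv.
have mJ : measurable J by exact: measurable_itv.
have a_ni m n : (m <= n)%N -> a n <= a m.
  by move=> mn; rewrite /a ler_pM2l// lef_pV2 ?posrE// ler_nat.
have I_nd m n : (m <= n)%N -> I m `<=` I n.
  by move=> /a_ni amn t; rewrite /I /= !in_itv/= => /andP[at_ ->]; rewrite (le_trans amn).
have IJ n : I n `<=` J by move=> t; rewrite /I /J /= !in_itv/= => /andP[at_ ->]; rewrite (lt_le_trans (a0 n)).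
have a_small (y : R) : 0 < y -> \forall n \near \oo, a n <= y.
  move=> y0; near=> n; rewrite /a ler_pdivrMr// -ler_pdivrMl//.
  have yn : y^-1 * x <= n%:R by near: n; exact: nbhs_infty_ger.
  by rewrite (le_trans yn)// ler_nat; exact: leqW.
have J_cover t : J t -> exists n, I n t.
  rewrite /J /= in_itv/= => /andP[t0 tx]; have [n _ H] := a_small t t0.
  by exists n; rewrite /I /= in_itv/= tx andbT; apply: H => /=.
have q_ge0 t : 0 < t -> 0 <= q t by move=> t0; rewrite divr_ge0// ltW// psi1_gt0.
have C0 : 0 < C by exact: (wronskian_constant_gt0 c_gt0 hpp p_gt0).
(* [psi' / p] is at most [C / phi], and [phi] tends to infinity at 0. *)
have q_small (e : R) : 0 < e -> exists2 dl, 0 < dl & forall t, 0 < t <= dl -> q t <= e.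
  move=> e0; have [_ [_ _ + _ _]] := hpp => /cvgryPge/(_ (C / e))[dl /= dl0 H].
  exists (dl / 2); first by rewrite divr_gt0.
  move=> t /andP[t0 tdl]; apply: (le_trans (psi1_scaled_le s_gt0 c_gt0 hpp p_gt0 dp t0)).
  rewrite ler_pdivrMr ?phi_gt0// mulrC -ler_pdivrMr//; apply: H => //=.
  by rewrite sub0r normrN gtr0_norm//; move: dl0 tdl; lra.
have [n0 _ Hn0] := a_small eps eps0.
have KJ : mu.-integrable J (EFin \o K) by exact: iK.
have nKJ : mu.-integrable J (EFin \o (fun t => `|K t|)) by exact: (integrable_norm KJ).
(* [G / r] is monotone on ]0, eps], so its size at [h] is at most its size at an earlier point plus
   its size at [eps]. Integrated against [q'] this bounds the boundary term by the integral of [|K|]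
   over ]0, h[ and a multiple of [q h], both small with [h]; the lower end [l] is sent to 0, where
   [q] vanishes. *)
have ratio_le (h : R) : 0 < h -> h <= eps -> h <= x ->
    `|G h / r h| * q h <= 2 * \int[mu]_(t in `]0, h[) `|K t| + `|G eps / r eps| * q h.
  move=> h0 he hx; apply/ler_addgt0Pl => e e0.
  have ub0 : 0 < `|G h / r h| + 1 by rewrite ltr_wpDl.
  have [dl dl0 Hdl] := q_small _ (divr_gt0 e0 ub0).
  pose l := Num.min dl h; have l0 : 0 < l by rewrite lt_min dl0.
  have lh : l <= h by rewrite ge_min lexx orbT.
  have ql : q l <= e / (`|G h / r h| + 1) by apply: Hdl; rewrite l0 ge_min lexx.
  have mono (t1 t2 : R) : 0 < t1 -> t1 <= t2 -> t2 <= eps -> s * (G t1 / r t1) <= s * (G t2 / r t2).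
    move=> t10 t12 t2e; apply: ratio_monotone => //.
    move: sD; apply: filterS; first exact: (ae_filter_ringOfSetsType mu).
    by move=> t H /andP[p1 p2]; apply: H; rewrite (lt_le_trans t10)//= (le_trans p2).
  have key := @ratio_scaled_le psi hpsi (fun x x0 => ltW (psi_gt0 x0)) l h `|G h / r h| `|G eps / r eps| l0 lh (normr_ge0 _) (normr_ge0 _).
  have {}key : `|G h / r h| * (q h - q l) <= 2 * \int[mu]_(t in `[l, h]) `|K t| + `|G eps / r eps| * (q h - q l).
    apply: key => t /andP[lt_ th]; have t0 := lt_le_trans l0 lt_.
    by apply: (between s1); apply: mono.
  have IK : \int[mu]_(t in `[l, h]) `|K t| <= \int[mu]_(t in `]0, h[) `|K t|.
    have iJh : mu.-integrable `]0, h] (EFin \o (fun t => `|K t|)).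
      apply: integrableS nKJ => //.
      by apply: subset_itvl; rewrite bnd_simp.
    rewrite (@Rintegral_itv_bndo_bndc _ (BRight 0) h); last first.
      by apply: integrableS iJh => //; apply: subset_itvl; rewrite bnd_simp.
    have sub : `[l, h]%classic `<=` `]0, h]%classic by apply: subset_itvr; rewrite bnd_simp.
    rewrite /Rintegral fine_le//.
    - by apply: integrable_fin_num => //; apply: integrableS iJh.
    - exact: integrable_fin_num.
    - by apply: ge0_subset_integral => //; have /integrableP[] := iJh.
  have el : `|G h / r h| * q l <= e.
    have := ql; rewrite ler_pdivlMr// mulrC; apply: le_trans.
    by rewrite ler_wpM2r// ?lerDl// q_ge0.
  have k0 : 0 <= `|G eps / r eps| * q l by rewrite mulr_ge0// q_ge0.
  move: key IK el k0; rewrite !mulrBr.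
  set i1 := \int[mu]_(t in `[l, h]) _; set i2 := \int[mu]_(t in `]0, h[) _.
  set t1 := `|G h / r h| * q h; set t2 := `|G h / r h| * q l.
  set t3 := `|G eps / r eps| * q h; set t4 := `|G eps / r eps| * q l.
  by lra.
have JI n : J `\` I n = `]0, a n[%classic.
  apply/seteqP; split => t; rewrite /J /I /= !in_itv/=.
    by case=> /andP[t0 tx]; rewrite tx andbT t0/= => /negP; rewrite -ltNge.
  move=> /andP[t0 ta]; rewrite t0 (ltW (lt_trans ta (ax n))); split=> //.
  by rewrite leNgt ta.
have Tn := @exhaustion_remainder _ _ _ mu J I mJ mI I_nd IJ J_cover _ nKJ.
pose e n := G (a n) * z (a n).
have e_cvg : e n @[n --> \oo] --> 0.
  apply/cvgrPdist_le => ep ep0.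
  have ub0 : 0 < `|G eps / r eps| + 1 by rewrite ltr_wpDl.
  have [dl dl0 Hdl] := q_small _ (divr_gt0 ep0 (mulr_gt0 (ltr0n _ 2) ub0)).
  have ep4 : 0 < ep / 4 by rewrite divr_gt0.
  move/cvgrPdist_le : Tn => /(_ _ ep4) Tn.
  have aeps := a_small eps eps0; have adl := a_small dl dl0.
  near=> n.
  have a1 : a n <= eps by near: n.
  have a2 : a n <= dl by near: n.
  have Tn1 : `|0 - \int[mu]_(t in J `\` I n) `|K t| | <= ep / 4 by near: n.
  rewrite sub0r normrN JI in Tn1.
  have H1 := ratio_le (a n) (a0 n) a1 (ltW (ax n)).
  have qa : q (a n) <= ep / (2 * (`|G eps / r eps| + 1)) by apply: Hdl; rewrite a0.
  have H2 : `|G eps / r eps| * q (a n) <= ep / 2.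
    have := qa; rewrite ler_pdivlMr ?mulr_gt0// => H3.
    have : (`|G eps / r eps| + 1) * q (a n) <= ep / 2 by rewrite ler_pdivlMr//; move: H3; set u := q (a n); set v := `|G eps / r eps|; lra.
    by apply: le_trans; rewrite ler_wpM2r ?lerDl// q_ge0.
  rewrite sub0r normrN (_ : e n = G (a n) / r (a n) * q (a n)); last by rewrite /e /z; ring.
  rewrite normrM (ger0_norm (q_ge0 _ (a0 n))).
  have := ler_norm (\int[mu]_(t in `]0, a n[) `|K t|).
  move: H1 H2 Tn1; set i2 := \int[mu]_(t in `]0, a n[) _.
  set t1 := `|_ / _| * _; set t3 := `|_ / _| * _; set t4 := `|i2|.
  by lra.
have bp n : mu.-integrable (I n) (EFin \o (fun t => D t * z t)) /\
    \int[mu]_(t in I n) (D t * z t) = G x * z x - G (a n) * z (a n) - 2 * \int[mu]_(t in I n) K t.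
  exact: (@D_op_by_parts psi hpsi (a n) x (a0 n) (ax n)).
have ik : mu.-integrable J (EFin \o (fun t => - 2 * K t)) by exact: (lebesgue_integrableZl (- 2) mJ KJ).
have nIK n : mu.-integrable (I n) (EFin \o K) by exact: (lebesgue_integrableS mJ (mI n) (IJ n) KJ).
have kE n : \int[mu]_(t in I n) (- 2 * K t) = - 2 * \int[mu]_(t in I n) K t by exact: lebesgue_RintegralZl (mI n) (nIK n).
have [||iF FE] := @exhaustion_by_parts _ _ _ mu J I mJ mI I_nd IJ J_cover (fun t => D t * z t) (fun t => - 2 * K t) (G x * z x) s e n0 (fun n => (bp n).1) ik _ e_cvg s1 _.
- by move=> n; rewrite (bp n).2 kE /e; ring.
- move: sD; apply: filterS; first exact: (ae_filter_ringOfSetsType mu).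
  move=> t H; rewrite /J /I /= !in_itv/= => /andP[t0 tx]; rewrite tx andbT => /negP; rewrite -ltNge => ta.
  rewrite mulrA mulr_ge0//; last by rewrite mulr_ge0 ?q_ge0// invr_ge0 ltW// r_gt0.
  by apply: H; rewrite t0/= (le_trans (ltW ta))//; exact: Hn0 (leqnn n0).
split; first exact: iF.
by move: FE; rewrite (lebesgue_RintegralZl _ mJ KJ) mulNr.
Unshelve. all: by end_near. Qed.

(** Mirror image of [left_boundary]: now [- phi' / p], at most [C / psi], vanishes at infinity, and
    the upper end [h] of the comparison interval is taken large. *)
Lemma right_boundary (s eps x : R) : `|s| = 1 -> 0 < eps ->
  {ae mu, forall t : R, eps <= t -> 0 <= s * D t} -> 0 < x ->
  mu.-integrable `]x, +oo[ (EFin \o (fun t => G t * (phi t / (sigma t ^+ 2 * p t)))) ->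
  mu.-integrable `]x, +oo[ (EFin \o (fun t => D t * (derive1 phi t / p t / r t))) /\
  \int[mu]_(t in `]x, +oo[) (D t * (derive1 phi t / p t / r t)) =
  - (G x * (derive1 phi x / p x / r x)) - 2 * \int[mu]_(t in `]x, +oo[) (G t * (phi t / (sigma t ^+ 2 * p t))).
Proof.
move=> s1 eps0 sD x0 iK.
pose K t := G t * (phi t / (sigma t ^+ 2 * p t)).
pose q t := derive1 phi t / p t; pose z t := q t / r t.
pose a n : R := x + n.+1%:R.
have ax n : x < a n by rewrite ltrDl.
have a0 n : 0 < a n by exact: lt_trans (ax n).
pose I n := `]x, a n]%classic; pose J := `]x, +oo[%classic.
have mI n : measurable (I n) by exact: measurable_itv.
have mJ : measurable J by exact: measurable_itv.
have I_nd m n : (m <= n)%N -> I m `<=` I n.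
  move=> mn t; rewrite /I /= !in_itv/= => /andP[-> ta]; rewrite (le_trans ta)//.
  by rewrite lerD2l ler_nat.
have IJ n : I n `<=` J by move=> t; rewrite /I /J /= !in_itv/= andbT => /andP[].
have a_big (y : R) : \forall n \near \oo, y <= a n.
  near=> n; have yn : y <= n%:R by near: n; exact: nbhs_infty_ger.
  rewrite (le_trans yn)// (@le_trans _ _ n.+1%:R)// ?ler_nat//.
  by rewrite lerDr ltW.
have J_cover t : J t -> exists n, I n t.
  rewrite /J /= in_itv/= andbT => xt; have [n _ H] := a_big t.
  by exists n; rewrite /I /= in_itv/= xt/=; apply: H => /=.
have q_le0 t : 0 < t -> q t <= 0.
  by move=> t0; rewrite /q mulr_le0_ge0 ?invr_ge0 ?(ltW (p_gt0 t))// ltW// phi1_lt0.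
have C0 : 0 < C by exact: (wronskian_constant_gt0 c_gt0 hpp p_gt0).
have q_small (e : R) : 0 < e -> exists M, forall t, 0 < t -> M <= t -> - q t <= e.
  move=> e0; have [_ [_ _ _ + _]] := hpp => /cvgryPge/(_ (C / e))[M [_ H]].
  exists (M + 1) => t t0 Mt; rewrite -mulNr.
  apply: (le_trans (phi1_scaled_le s_gt0 c_gt0 hpp p_gt0 dp t0)).
  rewrite ler_pdivrMr ?psi_gt0// mulrC -ler_pdivrMr//; apply: H => //=.
  by move: Mt; lra.
have [n0 _ Hn0] := a_big eps.
have KJ : mu.-integrable J (EFin \o K) by exact: iK.
have nKJ : mu.-integrable J (EFin \o (fun t => `|K t|)) by exact: (integrable_norm KJ).
have ratio_le (l : R) : eps <= l -> x <= l ->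
    `|G l / r l| * - q l <= 2 * \int[mu]_(t in `]l, +oo[) `|K t| + `|G eps / r eps| * - q l.
  move=> el xl; have l0 : 0 < l by exact: lt_le_trans el.
  apply/ler_addgt0Pl => e e0.
  have ub0 : 0 < `|G l / r l| + 1 by rewrite ltr_wpDl.
  have [M HM] := q_small _ (divr_gt0 e0 ub0).
  pose h := Num.max M l; have lh : l <= h by rewrite le_max lexx orbT.
  have h0 := lt_le_trans l0 lh.
  have qh : - q h <= e / (`|G l / r l| + 1) by apply: HM => //; rewrite le_max lexx.
  have mono (t1 t2 : R) : eps <= t1 -> t1 <= t2 -> s * (G t1 / r t1) <= s * (G t2 / r t2).
    move=> t1e t12; apply: ratio_monotone => //; first exact: lt_le_trans t1e.
    move: sD; apply: filterS; first exact: (ae_filter_ringOfSetsType mu).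
    by move=> t H /andP[p1 p2]; apply: H; rewrite (le_trans t1e).
  have key := @ratio_scaled_le phi hphi (fun x x0 => ltW (phi_gt0 x0)) l h `|G l / r l| `|G eps / r eps| l0 lh (normr_ge0 _) (normr_ge0 _).
  have {}key : `|G l / r l| * (q h - q l) <= 2 * \int[mu]_(t in `[l, h]) `|K t| + `|G eps / r eps| * (q h - q l).
    apply: key => t /andP[lt_ th]; rewrite addrC.
    by apply: (between s1); apply: mono.
  have IK : \int[mu]_(t in `[l, h]) `|K t| <= \int[mu]_(t in `]l, +oo[) `|K t|.
    have iJl : mu.-integrable `]l, +oo[ (EFin \o (fun t => `|K t|)).
      apply: integrableS nKJ => //.
      by apply: subset_itvr; rewrite bnd_simp.
    have sub : `]l, h]%classic `<=` `]l, +oo[%classic by apply: subset_itvl; rewrite bnd_simp.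
    have ilh : mu.-integrable `]l, h] (EFin \o (fun t => `|K t|)) by apply: integrableS iJl.
    rewrite -(@Rintegral_itv_obnd_cbnd _ l (BRight h))//.
    rewrite /Rintegral fine_le//.
    - exact: integrable_fin_num.
    - exact: integrable_fin_num.
    - by apply: ge0_subset_integral => //; have /integrableP[] := iJl.
  have el' : `|G l / r l| * - q h <= e.
    have := qh; rewrite ler_pdivlMr// mulrC; apply: le_trans.
    by rewrite ler_wpM2r// ?lerDl// oppr_ge0 q_le0.
  have k0 : 0 <= `|G eps / r eps| * - q h by rewrite mulr_ge0// oppr_ge0 q_le0.
  move: key IK el' k0; rewrite !mulrBr !mulrN.
  set i1 := \int[mu]_(t in `[l, h]) _; set i2 := \int[mu]_(t in `]l, +oo[) _.
  set t1 := `|G l / r l| * q h; set t2 := `|G l / r l| * q l.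
  set t3 := `|G eps / r eps| * q h; set t4 := `|G eps / r eps| * q l.
  by lra.
have JI n : J `\` I n = `]a n, +oo[%classic.
  apply/seteqP; split => t; rewrite /J /I /= !in_itv/= !andbT.
    by case=> ->/= /negP; rewrite -ltNge.
  by move=> ta; rewrite (lt_trans (ax n) ta)/= leNgt ta.
have Tn := @exhaustion_remainder _ _ _ mu J I mJ mI I_nd IJ J_cover _ nKJ.
pose e n := - (G (a n) * z (a n)).
have e_cvg : e n @[n --> \oo] --> 0.
  apply/cvgrPdist_le => ep ep0.
  have ub0 : 0 < `|G eps / r eps| + 1 by rewrite ltr_wpDl.
  have [dl Hdl] := q_small _ (divr_gt0 ep0 (mulr_gt0 (ltr0n _ 2) ub0)).
  have ep4 : 0 < ep / 4 by rewrite divr_gt0.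
  move/cvgrPdist_le : Tn => /(_ _ ep4) Tn.
  have aeps := a_big eps; have adl := a_big dl.
  near=> n.
  have a1 : eps <= a n by near: n.
  have a2 : dl <= a n by near: n.
  have Tn1 : `|0 - \int[mu]_(t in J `\` I n) `|K t| | <= ep / 4 by near: n.
  rewrite sub0r normrN JI in Tn1.
  have H1 := ratio_le (a n) a1 (ltW (ax n)).
  have qa : - q (a n) <= ep / (2 * (`|G eps / r eps| + 1)) by apply: Hdl.
  have H2 : `|G eps / r eps| * - q (a n) <= ep / 2.
    have := qa; rewrite ler_pdivlMr ?mulr_gt0// => H3.
    have : (`|G eps / r eps| + 1) * - q (a n) <= ep / 2 by rewrite ler_pdivlMr//; move: H3; set u := q (a n); set v := `|G eps / r eps|; lra.
    by apply: le_trans; rewrite ler_wpM2r ?lerDl// oppr_ge0 q_le0.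
  rewrite sub0r normrN (_ : e n = G (a n) / r (a n) * - q (a n)); last by rewrite /e /z; ring.
  rewrite normrM (ger0_norm (_ : 0 <= - q (a n))); last by rewrite oppr_ge0 q_le0.
  have := ler_norm (\int[mu]_(t in `]a n, +oo[) `|K t|).
  move: H1 H2 Tn1; set i2 := \int[mu]_(t in `]a n, +oo[) _.
  set t1 := `|_ / _| * _; set t3 := `|_ / _| * _; set t4 := `|i2|.
  by lra.
have bp n : mu.-integrable (I n) (EFin \o (fun t => D t * z t)) /\
    \int[mu]_(t in I n) (D t * z t) = G (a n) * z (a n) - G x * z x - 2 * \int[mu]_(t in I n) K t.
  have [i1 E1] := @D_op_by_parts phi hphi x (a n) x0 (ax n).
  have i2 : mu.-integrable (I n) (EFin \o (fun t => D t * z t)).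
    by apply: (lebesgue_integrableS _ (mI n) _ i1) => //; apply: subset_itvr; rewrite bnd_simp.
  have i3 : mu.-integrable (I n) (EFin \o K) by exact: (lebesgue_integrableS mJ (mI n) (IJ n) KJ).
  by split=> //; rewrite /I !Rintegral_itv_obnd_cbnd.
have ik : mu.-integrable J (EFin \o (fun t => - 2 * K t)) by exact: (lebesgue_integrableZl (- 2) mJ KJ).
have nIK n : mu.-integrable (I n) (EFin \o K) by exact: (lebesgue_integrableS mJ (mI n) (IJ n) KJ).
(* [phi'] is negative, so the integrand has the sign opposite to that of [D]. *)
have s1' : `|- s| = 1 by rewrite normrN.
have kE n : \int[mu]_(t in I n) (- 2 * K t) = - 2 * \int[mu]_(t in I n) K t by exact: lebesgue_RintegralZl (mI n) (nIK n).
have [||iF FE] := @exhaustion_by_parts _ _ _ mu J I mJ mI I_nd IJ J_cover (fun t => D t * z t) (fun t => - 2 * K t) (- (G x * z x)) (- s) e n0 (fun n => (bp n).1) ik _ e_cvg s1' _.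
- by move=> n; rewrite (bp n).2 kE /e; ring.
- move: sD; apply: filterS; first exact: (ae_filter_ringOfSetsType mu).
  move=> t H; rewrite /J /I /= !in_itv/= !andbT => xt; rewrite xt/= => /negP; rewrite -ltNge => ta.
  rewrite mulrA mulNr mulNr -mulrN mulr_ge0//; last first.
    by rewrite -mulNr mulr_ge0 ?oppr_ge0 ?q_le0 ?invr_ge0 ?ltW ?r_gt0// (lt_trans x0).
  by apply: H; rewrite (le_trans _ (ltW ta))//; exact: Hn0 (leqnn n0).
split; first exact: iF.
by move: FE; rewrite (lebesgue_RintegralZl _ mJ KJ) mulNr.
Unshelve. all: by end_near. Qed.

End boundary.

Section green_split.
Context {R : realType}.
Variables (u v kap f : R -> R) (y : R).
Local Notation mu := (@lebesgue_measure R).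
Hypotheses (y_gt0 : 0 < y) (u_ge0 : forall s : R, 0 < s -> 0 <= u s)
  (v_ge0 : forall s : R, 0 < s -> 0 <= v s) (kap_ge0 : forall s : R, 0 < s -> 0 <= kap s)
  (iv : mu.-integrable `]0, y] (EFin \o (fun s => f s * (v s * kap s))))
  (iu : mu.-integrable `]y, +oo[ (EFin \o (fun s => f s * (u s * kap s)))).
Let green s := (if s <= y then u y * v s else v y * u s) * kap s.

Lemma green_integral_finite :
  (\int[mu]_(s in `]0%R, +oo[) (`|f s| * green s)%:E < +oo)%E /\
  (\int[mu]_(s in `]0%R, +oo[) (f s * green s)%:E =
    (u y * \int[mu]_(s in `]0, y]) (f s * (v s * kap s)) +
    v y * \int[mu]_(s in `]y, +oo[) (f s * (u s * kap s)))%:E)%E.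
Proof.
have [ig E] := green_integral y_gt0 iv iu; rewrite -/green in ig E.
have m0 : measurable (`]0, +oo[%classic : set R) by exact: measurable_itv.
split; last by rewrite -E /Rintegral fineK//; exact: integrable_fin_num.
have /integrableP[_] := ig; rewrite (_ : (\int[mu]_(x in _) _ = \int[mu]_(s in `]0%R, +oo[) (`|f s| * green s)%:E)%E)//.
apply: eq_integral => s; rewrite inE/= in_itv/= andbT => s0.
have g0 : 0 <= green s.
  by rewrite /green mulr_ge0 ?kap_ge0//; case: ifP => _; rewrite mulr_ge0 ?u_ge0 ?v_ge0.
by rewrite normrM (ger0_norm g0).
Qed.

End green_split.

Section integral_endpoint.
Context {R : realType}.
Variables (K : R -> R) (x : R).
Local Notation mu := (@lebesgue_measure R).
Hypotheses (x_gt0 : 0 < x) (cK : forall y : R, 0 < y -> {for y, continuous K}).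

Let h0 : 0 < x / 2. Proof. by rewrite divr_gt0. Qed.
Let hx : x / 2 < x. Proof. by move: x_gt0; lra. Qed.
Let near_half : \forall y \near x, x / 2 < y. Proof. exact: lt_nbhsr. Qed.

(** Near [x] the integral is a constant plus the integral from [x / 2], whose integrand is
    continuous; the behaviour at 0 enters only through the constant. *)
Lemma is_derive_integral_from0 : (forall y : R, 0 < y -> mu.-integrable `]0, y] (EFin \o K)) ->
  is_derive x (1 : R) (fun y : R => \int[mu]_(s in `]0, y]) K s) (K x).
Proof.
move=> iK; have d1 := is_derive_pos_integral h0 hx cK.
have d2 : is_derive x (1 : R) (fun=> \int[mu]_(s in `]0, x / 2]) K s) 0 by exact: is_derive_cst.
have := is_deriveD d2 d1; rewrite add0r; apply: near_eq_is_derive.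
move: near_half; apply: filterS => y xy; have y0 := lt_trans h0 xy.
have e : \int[mu]_(s in `]0, y]) K s - \int[mu]_(s in `]0, x / 2]) K s = \int[mu]_(s in `[x / 2, y]) K s.
  rewrite (Rintegral_itvB (iK y y0)) ?bnd_simp ?(ltW h0) ?(ltW xy)//.
  apply: Rintegral_itv_obnd_cbnd; apply: (lebesgue_integrableS _ _ _ (iK y y0)) => //.
  by apply: subset_itvr; rewrite bnd_simp ltW.
by apply: (addIr (- \int[mu]_(s in `]0, x / 2]) K s)); rewrite e /= addrAC subrr add0r.
Qed.

Lemma is_derive_integral_to_infty : (forall y : R, 0 < y -> mu.-integrable `]y, +oo[ (EFin \o K)) ->
  is_derive x (1 : R) (fun y : R => \int[mu]_(s in `]y, +oo[) K s) (- K x).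
Proof.
move=> iK; have d1 := is_derive_pos_integral h0 hx cK.
have d2 : is_derive x (1 : R) (fun=> \int[mu]_(s in `]x / 2, +oo[) K s) 0 by exact: is_derive_cst.
have := is_deriveB d2 d1; rewrite sub0r; apply: near_eq_is_derive.
move: near_half; apply: filterS => y xy; have y0 := lt_trans h0 xy.
have ixy : mu.-integrable `]x / 2, y] (EFin \o K).
  by apply: (lebesgue_integrableS _ _ _ (iK _ h0)) => //; exact: subset_itvl.
have e : \int[mu]_(s in `]x / 2, +oo[) K s - \int[mu]_(s in `]x / 2, y]) K s = \int[mu]_(s in `]y, +oo[) K s.
  by rewrite (Rintegral_itvB (iK _ h0)) ?bnd_simp// ltW.
by rewrite -e /=; congr (_ - _); rewrite Rintegral_itv_obnd_cbnd.
Qed.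

End integral_endpoint.

Section resolvent_derivative.
Context {R : realType} {d : measure_display} {Omega : measurableType d}.
Variables (P : probability Omega R) (F : R -> set (set Omega)) (W : R -> Omega -> R).
Variables (b sigma r : R -> R) (X Y : R -> R -> Omega -> R) (r0 c eps : R) (phi psi G : R -> R).
Hypotheses (hF : usual_filtration P F) (hW : brownian_motion P F W)
  (cb : C1_pos b) (cs : C1_pos sigma) (s_gt0 : forall x : R, 0 < x -> 0 < sigma x ^+ 2)
  (hX : forall x : R, 0 < x -> nonexplosive_sde_solution P F W b sigma x (X x))
  (r0_gt0 : 0 < r0) (cr : C1_pos r) (r0r : forall x : R, 0 < x -> r0 <= r x)
  (hY : forall x : R, 0 < x -> nonexplosive_sde_solution P F W (drift_mu b sigma r) sigma x (Y x))
  (r0rho : forall x : R, 0 < x -> r0 <= rate_rho b r x)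
  (c_gt0 : 0 < c) (hpp : fundamental_pair b sigma r c phi psi) (hG : abs_continuous_pos G).
Variable p : R -> R.
Hypotheses (p_gt0 : forall x : R, 0 < p x)
  (dp : forall x : R, 0 < x -> is_derive x (1 : R) p (- 2 * (b x / sigma x ^+ 2) * p x)).
Local Notation mu := (@lebesgue_measure R).
Local Notation D := (D_op r G).
Local Notation C := (wronskian_constant c phi psi p).
Local Notation phi2 := (ode_second b sigma r phi).
Local Notation psi2 := (ode_second b sigma r psi).

Let r_gt0 (x : R) : 0 < x -> 0 < r x. Proof. by move=> x0; exact: lt_le_trans (r0r x0). Qed.
Let hphi : ode_solution b sigma r phi. Proof. by case: hpp => -[]. Qed.
Let hpsi : ode_solution b sigma r psi. Proof. by case: hpp => -[]. Qed.
Let phi_gt0 (x : R) : 0 < x -> 0 < phi x. Proof. by move=> x0; case: hpp => _ [+ _ _ _ _] => /(_ x x0)[]. Qed.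
Let phi1_lt0 (x : R) : 0 < x -> derive1 phi x < 0. Proof. by move=> x0; case: hpp => _ [+ _ _ _ _] => /(_ x x0)[]. Qed.
Let psi_gt0 (x : R) : 0 < x -> 0 < psi x. Proof. by move=> x0; case: hpp => _ [_ + _ _ _] => /(_ x x0)[]. Qed.
Let psi1_gt0 (x : R) : 0 < x -> 0 < derive1 psi x. Proof. by move=> x0; case: hpp => _ [_ + _ _ _] => /(_ x x0)[]. Qed.
Let C_gt0 : 0 < C. Proof. exact: (wronskian_constant_gt0 c_gt0 hpp p_gt0). Qed.
Let m s := (sigma s ^+ 2 * p s)^-1.
Let m_gt0 (x : R) : 0 < x -> 0 < m x. Proof. by move=> x0; rewrite invr_gt0 mulr_gt0// s_gt0. Qed.
Let cC (f : R -> R) (x : R) : C1_pos f -> 0 < x -> {for x, continuous f}. Proof. by move=> hf x0; exact: C1_pos_continuous. Qed.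
Let cG (x : R) : 0 < x -> {for x, continuous G}. Proof. exact: abs_continuous_pos_continuous. Qed.

Hypotheses (ipsi : forall x : R, 0 < x -> mu.-integrable `]0, x] (EFin \o (fun s => G s * (psi s / (sigma s ^+ 2 * p s)))))
  (iphi : forall x : R, 0 < x -> mu.-integrable `]x, +oo[ (EFin \o (fun s => G s * (phi s / (sigma s ^+ 2 * p s))))).
Let A x := \int[mu]_(s in `]0, x]) (G s * (psi s / (sigma s ^+ 2 * p s))).
Let B x := \int[mu]_(s in `]x, +oo[) (G s * (phi s / (sigma s ^+ 2 * p s))).

Lemma resolvent_X (x : R) : 0 < x ->
  resolvent P r G (X x) = (2 / C * (phi x * A x + psi x * B x))%:E.
Proof.
move=> x0.
have mG : measurable_fun (`]0, +oo[%classic : set R) G.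
  apply: open_continuous_measurable_fun; first exact: interval_open.
  by move=> y; rewrite inE/= in_itv/= andbT; exact: cG.
pose kap s := 2 / speed_wronskian phi (derive1 phi) psi (derive1 psi) sigma s.
(* By [wronskianE] the Wronskian is [C * p], so the Green weight is a constant multiple of the speed
   density. *)
have kapE s : 0 < s -> kap s = 2 / C / (sigma s ^+ 2 * p s).
  move=> s0; rewrite /kap /speed_wronskian (wronskianE s_gt0 c_gt0 hpp p_gt0 dp s0).
  have ss := gt_eqF (s_gt0 s0); rewrite sqrf_eq0 in ss.
  by field; rewrite ss (gt_eqF (p_gt0 s)) (gt_eqF C_gt0).
have kap0 s : 0 < s -> 0 <= kap s.
  by move=> s0; rewrite kapE//; apply/ltW/mulr_gt0; [exact: divr_gt0|exact: m_gt0].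
have e1 s : s \in `]0, x]%classic -> 2 / C * (G s * (psi s / (sigma s ^+ 2 * p s))) = G s * (psi s * kap s).
  by rewrite inE/= in_itv/= => /andP[s0 _]; rewrite kapE//; ring.
have e2 s : s \in `]x, +oo[%classic -> 2 / C * (G s * (phi s / (sigma s ^+ 2 * p s))) = G s * (phi s * kap s).
  by rewrite inE/= in_itv/= andbT => xs; rewrite kapE ?(lt_trans x0)//; ring.
have m1 : measurable (`]0, x]%classic : set R) by exact: measurable_itv.
have m2 : measurable (`]x, +oo[%classic : set R) by exact: measurable_itv.
have iv : mu.-integrable `]0, x] (EFin \o (fun s => G s * (psi s * kap s))).
  by have := lebesgue_integrableZl (2 / C) m1 (ipsi x0); apply: eq_integrable => // s sI; rewrite /= e1.
have iu : mu.-integrable `]x, +oo[ (EFin \o (fun s => G s * (phi s * kap s))).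
  by have := lebesgue_integrableZl (2 / C) m2 (iphi x0); apply: eq_integrable => // s sI; rewrite /= e2.
have [fin E] := green_integral_finite x0 (fun s s0 => ltW (phi_gt0 s0)) (fun s s0 => ltW (psi_gt0 s0)) kap0 iv iu.
have [_ key] := @resolvent_green _ _ _ P F W hF hW (X x) x b sigma r r0 x0 r0_gt0
  (fun y y0 => cC cb y0) (fun y y0 => cC cs y0) s_gt0 (fun y y0 => cC cr y0) r0r (hX x0)
  phi (derive1 phi) phi2 psi (derive1 psi) psi2
  (fun y y0 => ode_is_derive hphi y0) (fun y y0 => ode_is_derive2 s_gt0 hphi y0)
  (fun y y0 => is_derive_continuous (ode_is_derive3 cb cs s_gt0 cr r0_gt0 r0r hphi y0))
  (fun y y0 => ode_is_derive hpsi y0) (fun y y0 => ode_is_derive2 s_gt0 hpsi y0)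
  (fun y y0 => is_derive_continuous (ode_is_derive3 cb cs s_gt0 cr r0_gt0 r0r hpsi y0))
  (fun y y0 => ltW (phi_gt0 y0)) (fun y y0 => ltW (psi_gt0 y0))
  (fun y y0 => ltW (phi1_lt0 y0)) (fun y y0 => ltW (psi1_gt0 y0))
  (fun y y0 => eq_ind_r (fun z => 0 < z) (mulr_gt0 C_gt0 (p_gt0 y)) (wronskianE s_gt0 c_gt0 hpp p_gt0 dp y0))
  (fun y y0 => ode_second_eq b r s_gt0 phi y0) (fun y y0 => ode_second_eq b r s_gt0 psi y0) G mG.
have [_ ->] := key fin; rewrite E; congr (_%:E).
have E1 : \int[mu]_(s in `]0, x]) (G s * (psi s * kap s)) = 2 / C * A x.
  by rewrite -(lebesgue_RintegralZl _ m1 (ipsi x0)); apply/esym/eq_Rintegral.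
have E2 : \int[mu]_(s in `]x, +oo[) (G s * (phi s * kap s)) = 2 / C * B x.
  by rewrite -(lebesgue_RintegralZl _ m2 (iphi x0)); apply/esym/eq_Rintegral.
by rewrite E1 E2; ring.
Qed.

(** The contributions of [A'] and [B'] cancel, since [phi A' = - psi B']. Continuity of [G] suffices
    for this. *)
Lemma is_derive_resolvent_X (x : R) : 0 < x ->
  is_derive x (1 : R) (fun y => fine (resolvent P r G (X y)))
    (2 / C * (derive1 phi x * A x + derive1 psi x * B x)).
Proof.
move=> x0.
have cK w : ode_solution b sigma r w -> forall y : R, 0 < y -> {for y, continuous (fun s => G s * (w s / (sigma s ^+ 2 * p s)))}.
  move=> hw y y0; apply: cvgM; first exact: cG.
  apply: cvgM; first exact: is_derive_continuous (ode_is_derive hw y0).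
  apply: cvgV; first by rewrite mulf_neq0 ?(gt_eqF (p_gt0 y)) ?(gt_eqF (s_gt0 y0)).
  apply: cvgM; last exact: is_derive_continuous (dp y0).
  by apply: (@continuous_comp _ _ _ sigma (fun z => z ^+ 2)); [exact: cC|exact: exprn_continuous].
have dA := is_derive_integral_from0 x0 (cK _ hpsi) ipsi.
have dB := is_derive_integral_to_infty x0 (cK _ hphi) iphi.
rewrite -/A -/B in dA dB.
have dsum := is_deriveD (is_deriveM (ode_is_derive hphi x0) dA) (is_deriveM (ode_is_derive hpsi x0) dB).
have dC := is_deriveZ (2 / C) dsum.
apply: (@near_eq_is_derive _ _ _ ((2 / C) *: (phi * A + psi * B))).
  have : \forall y \near x, 0 < y by exact: lt_nbhsr.
  by apply: filterS => y y0; rewrite resolvent_X.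
apply: (is_derive_eq dC); rewrite /GRing.scale/=.
by rewrite [X in _ = X]/=; ring.
Qed.

Variable s0 sy : R.
Hypotheses (eps_gt0 : 0 < eps) (s01 : `|s0| = 1) (sy1 : `|sy| = 1)
  (sD0 : {ae mu, forall t : R, 0 < t <= eps -> 0 <= s0 * D t})
  (sDy : {ae mu, forall t : R, eps^-1 <= t -> 0 <= sy * D t}).

(** On each of the compact intervals exhausting the half-line [D / r] is integrable, in particular
    measurable, and [r] is continuous. *)
Lemma D_op_measurable : measurable_fun (`]0, +oo[%classic : set R) D.
Proof.
pose I n := `[n.+2%:R^-1, n.+1%:R]%classic : set R.
have lt_n n : n.+2%:R^-1 < n.+1%:R :> R.
  rewrite (@lt_le_trans _ _ 1)//; last by rewrite ler1n.
  by rewrite invf_lt1// ltr1n.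
apply: (@exhaustion_measurable _ _ _ _ I).
- by move=> n; exact: measurable_itv.
- move=> n t; rewrite /I /= !in_itv/= andbT => /andP[+ _]; apply: lt_le_trans.
  by rewrite invr_gt0.
- move=> t; rewrite /= in_itv/= andbT => t0.
  have : \forall n \near \oo, I n t.
    near=> n; rewrite /I /= in_itv/=; apply/andP; split.
      rewrite -[leRHS]invrK lef_pV2 ?posrE ?invr_gt0//.
      have tn : t^-1 <= n%:R by near: n; exact: nbhs_infty_ger.
      by rewrite (le_trans tn)// ler_nat; exact: leqW.
    have tn : t <= n%:R by near: n; exact: nbhs_infty_ger.
    by rewrite (le_trans tn)// ler_nat.
  by case=> n _ H; exists n; apply: H => /=.
- move=> n; have n0 : 0 < n.+2%:R^-1 :> R by rewrite invr_gt0.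
  have [iD _] := D_op_ratio cr r0_gt0 r0r hG n0 (lt_n n).
  have /integrableP[/measurable_EFinP mD _] := iD.
  have mr : measurable_fun (I n) r.
    apply: subspace_continuous_measurable_fun; first exact: measurable_itv.
    by apply: continuous_pos_within => // y y0; exact: cC.
  apply: (@eq_measurable_fun _ _ _ _ _ (fun t => D t / r t * r t)); last exact: measurable_funM.
  move=> t; rewrite inE /I/= in_itv/= => /andP[nt _].
  by rewrite divfK// gt_eqF// r_gt0// (lt_le_trans n0).
Unshelve. all: by end_near. Qed.

(** [resolvent_green] applies to the pair [- phi'], [psi']: its monotonicity is given by
    [phi_second_ge0] and [psi_second_ge0], the positivity of its Wronskian by [wronskian_second],
    and integrability against the kernels by the two boundary lemmas. *)
Lemma resolvent_Y (x : R) : 0 < x ->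
  [/\ mu.-integrable `]0, x] (EFin \o (fun s => D s * (derive1 psi s / p s / r s))),
      mu.-integrable `]x, +oo[ (EFin \o (fun s => D s * (derive1 phi s / p s / r s))),
      resolvent_well_defined P (rate_rho b r) D (Y x) &
      resolvent P (rate_rho b r) D (Y x) = (2 / C * (derive1 phi x * A x + derive1 psi x * B x))%:E].
Proof.
move=> x0.
have [iL EL] := left_boundary cs s_gt0 cr r0_gt0 r0r c_gt0 hpp p_gt0 dp hG s01 eps_gt0 sD0 x0 (ipsi x0).
have epsV : 0 < eps^-1 by rewrite invr_gt0.
have [iR ER] := right_boundary cs s_gt0 cr r0_gt0 r0r c_gt0 hpp p_gt0 dp hG sy1 epsV sDy x0 (iphi x0).
pose kap s := 2 / speed_wronskian (fun t => - derive1 phi t) (fun t => - phi2 t) (derive1 psi) psi2 sigma s.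
have wE s : 0 < s -> - derive1 phi s * psi2 s - - phi2 s * derive1 psi s = 2 * r s * p s * C / sigma s ^+ 2.
  exact: (wronskian_second s_gt0 r0_gt0 r0r c_gt0 hpp p_gt0 dp).
have kapE s : 0 < s -> kap s = C^-1 / p s / r s.
  move=> t0; rewrite /kap /speed_wronskian wE//.
  have ss := gt_eqF (s_gt0 t0); rewrite sqrf_eq0 in ss.
  by field; rewrite ss (gt_eqF (p_gt0 s)) (gt_eqF C_gt0) (gt_eqF (r_gt0 t0)).
have kap0 s : 0 < s -> 0 <= kap s.
  move=> t0; rewrite kapE//; apply/ltW/divr_gt0; last exact: r_gt0.
  by apply: divr_gt0 => //; rewrite invr_gt0.
have e1 s : s \in `]0, x]%classic -> C^-1 * (D s * (derive1 psi s / p s / r s)) = D s * (derive1 psi s * kap s).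
  by rewrite inE/= in_itv/= => /andP[t0 _]; rewrite kapE//; ring.
have e2 s : s \in `]x, +oo[%classic -> - C^-1 * (D s * (derive1 phi s / p s / r s)) = D s * (- derive1 phi s * kap s).
  by rewrite inE/= in_itv/= andbT => xs; rewrite kapE ?(lt_trans x0)//; ring.
have m1 : measurable (`]0, x]%classic : set R) by exact: measurable_itv.
have m2 : measurable (`]x, +oo[%classic : set R) by exact: measurable_itv.
have iv : mu.-integrable `]0, x] (EFin \o (fun s => D s * (derive1 psi s * kap s))).
  by have := lebesgue_integrableZl C^-1 m1 iL; apply: eq_integrable => // s sI; rewrite /= e1.
have iu : mu.-integrable `]x, +oo[ (EFin \o (fun s => D s * (- derive1 phi s * kap s))).
  by have := lebesgue_integrableZl (- C^-1) m2 iR; apply: eq_integrable => // s sI; rewrite /= e2.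
have u0 (y : R) : 0 < y -> 0 <= - derive1 phi y by move=> y0; rewrite oppr_ge0 ltW// phi1_lt0.
have u1 (y : R) : 0 < y -> - phi2 y <= 0.
  by move=> y0; rewrite oppr_le0; exact: (phi_second_ge0 cb s_gt0 cr r0_gt0 r0r r0rho hpp p_gt0 dp).
have v1 (y : R) : 0 < y -> 0 <= psi2 y.
  by move=> y0; exact: (psi_second_ge0 cb s_gt0 cr r0_gt0 r0r r0rho c_gt0 hpp p_gt0 dp).
have w0 (y : R) : 0 < y -> 0 < - derive1 phi y * psi2 y - - phi2 y * derive1 psi y.
  move=> y0; rewrite wE//; apply: divr_gt0; last exact: s_gt0.
  by apply: mulr_gt0 => //; apply: mulr_gt0 => //; apply: mulr_gt0 => //; exact: r_gt0.
have odeu (y : R) : 0 < y -> 2^-1 * sigma y ^+ 2 * - ode_third b sigma r phi y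
    + drift_mu b sigma r y * - phi2 y - rate_rho b r y * - derive1 phi y = 0.
  move=> y0; rewrite -[RHS]oppr0 -(ode_third_eq b r s_gt0 phi y0); ring.
have [fin E] := green_integral_finite x0 u0 (fun s s0 => ltW (psi1_gt0 s0)) kap0 iv iu.
have [_ key] := @resolvent_green _ _ _ P F W hF hW (Y x) x (drift_mu b sigma r) sigma (rate_rho b r) r0 x0 r0_gt0
  (fun y y0 => drift_mu_continuous cb cs cr r0_gt0 r0r y0) (fun y y0 => cC cs y0) s_gt0
  (fun y y0 => rate_rho_continuous cb cr r0_gt0 r0r y0) r0rho (hY x0)
  (fun t => - derive1 phi t) (fun t => - phi2 t) (fun t => - ode_third b sigma r phi t)
  (derive1 psi) psi2 (ode_third b sigma r psi)
  (fun y y0 => is_deriveN (ode_is_derive2 s_gt0 hphi y0))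
  (fun y y0 => is_deriveN (ode_is_derive3 cb cs s_gt0 cr r0_gt0 r0r hphi y0))
  (fun y y0 => cvgN (ode_third_continuous cb cs s_gt0 cr r0_gt0 r0r hphi y0))
  (fun y y0 => ode_is_derive2 s_gt0 hpsi y0)
  (fun y y0 => ode_is_derive3 cb cs s_gt0 cr r0_gt0 r0r hpsi y0)
  (fun y y0 => ode_third_continuous cb cs s_gt0 cr r0_gt0 r0r hpsi y0)
  u0 (fun y y0 => ltW (psi1_gt0 y0)) u1 v1 w0 odeu
  (fun y y0 => ode_third_eq b r s_gt0 psi y0) D D_op_measurable.
have [wd RE] := key fin; split => //; rewrite RE E; congr (_%:E).
have E1 : \int[mu]_(s in `]0, x]) (D s * (derive1 psi s * kap s)) = C^-1 * (G x * (derive1 psi x / p x / r x) - 2 * A x).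
  by rewrite /A -EL -(lebesgue_RintegralZl _ m1 iL); apply/esym/eq_Rintegral.
have E2 : \int[mu]_(s in `]x, +oo[) (D s * (- derive1 phi s * kap s)) = - C^-1 * (- (G x * (derive1 phi x / p x / r x)) - 2 * B x).
  by rewrite /B -ER -(lebesgue_RintegralZl _ m2 iR); apply/esym/eq_Rintegral.
(* The boundary terms at [x] coming from the left and from the right are opposite, as both equal
   [G phi' psi' / (C p r)] up to sign; the integrals [A] and [B] remain. *)
by rewrite E1 E2; field; rewrite (gt_eqF (p_gt0 x)) (gt_eqF C_gt0) (gt_eqF (r_gt0 x0)).
Qed.

End resolvent_derivative.

(** [D_op r G] is determined up to a null set only, hence sign conditions almost everywhere. [X y]
    and [Y y] are the solutions started at [y], and [is_derive] asserts the existence of the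
    derivative together with its value. *)
Theorem proposition4 (R : realType) (d : measure_display)
  (Omega : measurableType d) (P : probability Omega R)
  (F : R -> set (set Omega)) (W : R -> Omega -> R)
  (b sigma r : R -> R) (X Y : R -> R -> Omega -> R) (r0 c eps : R)
  (phi psi G : R -> R)
  (hF : usual_filtration P F) (hW : brownian_motion P F W)
  (hi : [/\ C1_pos b, C1_pos sigma, locally_lipschitz_pos (derive1 sigma)
          & forall x, 0 < x -> 0 < sigma x ^+ 2])
  (hii : forall x, 0 < x -> nonexplosive_sde_solution P F W b sigma x (X x))
  (r0_gt0 : 0 < r0)
  (hiii : [/\ C1_pos r, locally_lipschitz_pos (derive1 r)
            & forall x, 0 < x -> r0 <= r x])
  (hiv : forall x, 0 < x ->
     nonexplosive_sde_solution P F W (drift_mu b sigma r) sigma x (Y x))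
  (hv : forall x, 0 < x -> r0 <= rate_rho b r x)
  (c_gt0 : 0 < c) (hphipsi : fundamental_pair b sigma r c phi psi)
  (hG : abs_continuous_pos G)
  (hGint : forall x, 0 < x ->
     (resolvent P r (fun y => `|G y|%R) (X x) < +oo)%E /\
     (\int[lebesgue_measure]_(s in `]0%R, x[)
        (`|G s| * psi s / (sigma s ^+ 2 * scale_density b sigma c s))%:E +
      \int[lebesgue_measure]_(s in `]x, +oo[)
        (`|G s| * phi s / (sigma s ^+ 2 * scale_density b sigma c s))%:E
      < +oo)%E)
  (eps_gt0 : 0 < eps)
  (hsign0 :
     {ae lebesgue_measure, forall s : R, 0 < s <= eps -> D_op r G s <= 0} \/
     {ae lebesgue_measure, forall s : R, 0 < s <= eps -> 0 <= D_op r G s})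
  (hsigny :
     {ae lebesgue_measure, forall s : R, eps^-1 <= s -> D_op r G s <= 0} \/
     {ae lebesgue_measure, forall s : R, eps^-1 <= s -> 0 <= D_op r G s}) :
  forall x, 0 < x ->
    [/\ (\int[lebesgue_measure]_(s in `]0%R, x[)
           (`|D_op r G s| * derive1 psi s / (r s * scale_density b sigma c s))%:E +
         \int[lebesgue_measure]_(s in `]x, +oo[)
           (`|D_op r G s| * (- derive1 phi s)
              / (r s * scale_density b sigma c s))%:E
         < +oo)%E,
        resolvent_well_defined P (rate_rho b r) (D_op r G) (Y x),
        resolvent P (rate_rho b r) (D_op r G) (Y x) \is a fin_num
      & is_derive x (1 : R) (fun y => fine (resolvent P r G (X y)))
          (fine (resolvent P (rate_rho b r) (D_op r G) (Y x)))].
Proof.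
move=> x x0; have [cb cs _ s_gt0] := hi; have [cr _ r0r] := hiii.
have p_gt0 (y : R) : 0 < scale_density b sigma c y by exact: scale_density_gt0.
have dp (y : R) : 0 < y -> is_derive y (1 : R) (scale_density b sigma c)
    (- 2 * (b y / sigma y ^+ 2) * scale_density b sigma c y).
  move=> y0; apply: is_derive_scale_density => // z z0; exact: C1_pos_continuous.
move: hGint p_gt0 dp; set p := scale_density b sigma c => {}hGint p_gt0 dp.
have r_gt0 (y : R) : 0 < y -> 0 < r y by move=> y0; exact: lt_le_trans (r0r y y0).
have hphi : ode_solution b sigma r phi by case: hphipsi => -[].
have hpsi : ode_solution b sigma r psi by case: hphipsi => -[].
have phi_sign (y : R) : 0 < y -> 0 < phi y /\ derive1 phi y < 0 by case: hphipsi => _ [+ _ _ _ _]; exact.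
have psi_sign (y : R) : 0 < y -> 0 < psi y /\ 0 < derive1 psi y by case: hphipsi => _ [_ + _ _ _]; exact.
have phi_ge0 (y : R) : 0 < y -> 0 <= phi y by move=> /phi_sign[/ltW].
have psi_ge0 (y : R) : 0 < y -> 0 <= psi y by move=> /psi_sign[/ltW].
have sub1 (y : R) : `]0, y[%classic `<=` `]0, +oo[%classic by exact: subset_itvl.
have sub2 (y : R) : 0 < y -> `]y, +oo[%classic `<=` `]0, +oo[%classic.
  by move=> y0; apply: subset_itvr; rewrite bnd_simp ltW.
have pos_int (w : R -> R) (J : set R) : (forall y : R, 0 < y -> 0 <= w y) -> J `<=` `]0, +oo[%classic ->
    (0 <= \int[lebesgue_measure]_(s in J) (`|G s| * w s / (sigma s ^+ 2 * p s))%:E)%E.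
  move=> w0 J0; apply: integral_ge0 => s /J0; rewrite /= in_itv/= andbT => sp; rewrite lee_fin.
  apply: divr_ge0; first by rewrite mulr_ge0// w0.
  by apply: mulr_ge0; [exact/ltW/s_gt0|exact/ltW/p_gt0].
have ipsi (y : R) : 0 < y ->
    lebesgue_measure.-integrable `]0, y] (EFin \o (fun s => G s * (psi s / (sigma s ^+ 2 * p s)))).
  (* The hypothesis concerns intervals open on the right; taken at [y + 1], it covers ]0, y]. *)
  move=> y0; have y1 : 0 < y + 1 by rewrite addr_gt0.
  have fin1 := le_lt_trans (leeDl _ (pos_int _ _ phi_ge0 (sub2 _ y1))) (hGint _ y1).2.
  have m1 : measurable (`]0, y + 1[%classic : set R) by exact: measurable_itv.
  apply: (lebesgue_integrableS m1 _ _ (speed_integrable cs s_gt0 p_gt0 dp hG hpsi psi_ge0 m1 (sub1 _) fin1)).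
    exact: measurable_itv.
  by apply: subset_itvl; rewrite bnd_simp ltrDl.
have iphi (y : R) : 0 < y ->
    lebesgue_measure.-integrable `]y, +oo[ (EFin \o (fun s => G s * (phi s / (sigma s ^+ 2 * p s)))).
  move=> y0; have fin2 := le_lt_trans (leeDr _ (pos_int _ _ psi_ge0 (sub1 y))) (hGint _ y0).2.
  by apply: (speed_integrable cs s_gt0 p_gt0 dp hG hphi phi_ge0 _ (sub2 _ y0) fin2); exact: measurable_itv.
(* The two alternatives become one statement with a factor [e] equal to 1 or - 1, the form used by
   the boundary lemmas. *)
have sign (Q : R -> Prop) : {ae lebesgue_measure, forall s : R, Q s -> D_op r G s <= 0} \/
    {ae lebesgue_measure, forall s : R, Q s -> 0 <= D_op r G s} ->
    exists2 e : R, `|e| = 1 & {ae lebesgue_measure, forall s : R, Q s -> 0 <= e * D_op r G s}.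
  case=> H; [exists (- 1); first by rewrite normrN1|exists 1; first by rewrite normr1].
    move: H; apply: filterS; first exact: (ae_filter_ringOfSetsType lebesgue_measure).
    by move=> s H /H Ds; rewrite mulN1r oppr_ge0.
  move: H; apply: filterS; first exact: (ae_filter_ringOfSetsType lebesgue_measure).
  by move=> s H /H Ds; rewrite mul1r.
have [s0 s01 sD0] := sign (fun s => 0 < s <= eps) hsign0.
have [sy sy1 sDy] := sign (fun s => eps^-1 <= s) hsigny.
have [iL iR wd RE] := resolvent_Y hF hW cb cs s_gt0 r0_gt0 cr r0r hiv hv c_gt0 hphipsi hG
  p_gt0 dp ipsi iphi eps_gt0 s01 sy1 sD0 sDy x0.
split=> //; last 2 first.
- by rewrite RE.
- rewrite RE; exact: (is_derive_resolvent_X hF hW cb cs s_gt0 hii r0_gt0 cr r0r c_gt0 hphipsi hG p_gt0 dp ipsi iphi x0).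
apply: lte_add_pinfty.
  have m1 : measurable (`]0, x[%classic : set R) by exact: measurable_itv.
  have : lebesgue_measure.-integrable `]0, x[ (EFin \o (fun s => D_op r G s * (derive1 psi s / p s / r s))).
    apply: (lebesgue_integrableS _ m1 _ iL); first exact: measurable_itv.
    by apply: subset_itvl; rewrite bnd_simp.
  move=> /integrableP[_]; apply: le_lt_trans; rewrite le_eqVlt; apply/orP; left; apply/eqP.
  apply: eq_integral => s; rewrite inE/= in_itv/= => /andP[sp _]; congr (_%:E).
  have z0 : 0 <= derive1 psi s / p s / r s.
    by apply/ltW/divr_gt0; [apply/divr_gt0; [case: (psi_sign s sp)|exact: p_gt0]|exact: r_gt0].
  by rewrite [RHS]normrM (ger0_norm z0) invfM; ring.
have m1 : measurable (`]x, +oo[%classic : set R) by exact: measurable_itv.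
move: iR => /integrableP[_]; apply: le_lt_trans; rewrite le_eqVlt; apply/orP; left; apply/eqP.
apply: eq_integral => s; rewrite inE/= in_itv/= andbT => xs; congr (_%:E); have sp := lt_trans x0 xs.
have z0 : derive1 phi s / p s / r s <= 0.
  have [_ d0] := phi_sign s sp.
  by apply: mulr_le0_ge0; [apply: mulr_le0_ge0; [exact: ltW|rewrite invr_ge0 ltW]|rewrite invr_ge0 ltW// r_gt0].
by rewrite [RHS]normrM (ler0_norm z0) invfM; ring.
Qed.
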